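(* Let $N\ge 1$ be an integer and $N<p<\infty$. Let $a\in L^\infty(\mathbb{R}^N)$ with $a_-=\operatorname{ess\,inf}_{\mathbb{R}^N} a>0$, let $h\in L^1(\mathbb{R}^N)$ with $h\ge 0$, $h\not\equiv 0$, and let $g\in C(\mathbb{R})$ with $g\ge 0$ and $g\not\equiv 0$ in $[0,+\infty)$. Put $G(t)=\int_0^t g(\xi)\,d\xi$. Fix $x_0\in\mathbb{R}^N$ and $R>0$ such that $\int_{B(x_0,\frac R2)}h(x)\,dx>0$. Assume that $$\lim_{t\to0^+}\frac{G(t)}{t^p}=\lim_{t\to+\infty}\frac{G(t)}{t^p}=0.$$ Then, for each $\lambda>\lambda^*$, where $$\lambda^*=\frac32\,\frac{1}{p\,k_a^p\,\|h\|_1\,\tilde K_R}\,\inf_{d>0}\frac{d^p}{G(d)},$$ the problem $$-\Delta_p u+a(x)|u|^{p-2}u=\lambda h(x)g(u)\ \text{ in }\mathbb{R}^N,\qquad u\in W^{1,p}(\mathbb{R}^N),\ u\ge 0,$$ admits at least three (distinct) nonnegative weak solutions.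
   Context: $\Delta_p u=\operatorname{div}(|\nabla u|^{p-2}\nabla u)$. $B(x_0,\rho)$ is the ball of $\mathbb{R}^N$ with centre $x_0$ and radius $\rho$; $\|h\|_1$ is the $L^1(\mathbb{R}^N)$ norm. A weak solution of the problem is a function $u\in W^{1,p}(\mathbb{R}^N)$, $u\ge 0$, such that $$\int_{\mathbb{R}^N}\left(|\nabla u|^{p-2}\nabla u\cdot\nabla v+a(x)|u|^{p-2}uv\right)dx=\lambda\int_{\mathbb{R}^N}h(x)g(u)\,v\,dx\quad\text{for all }v\in W^{1,p}(\mathbb{R}^N).$$ Constants: $$k_a=\left(\frac1{a_-}\right)^{\frac{p-N}{p^2}}2^{\frac{p-1}{p}}\left(\frac{\Gamma(1+\frac N2)}{\pi^{N/2}}\right)^{\frac1p}\frac{1}{N^{\frac{N}{p^2}}}\left(\frac{p-1}{p-N}\right)^{\frac{N(p-1)}{p^2}},$$ $$K_R=\frac{1}{k_a^p}\,\frac{\Gamma(1+\frac N2)}{\pi^{N/2}}\left(\frac{R^{p-N}}{2^p-2^{p-N}+R^p\|a\|_\infty}\right),\qquad \tilde K_R=K_R\,\frac{\int_{B(x_0,\frac R2)}h(x)\,dx}{\|h\|_1},$$ where $\Gamma$ is the Gamma function. The condition on $g$ is read as: $g(t)\ge 0$ for all $t\ge 0$, and $g$ is not identically zero on $[0,+\infty)$. Convention: $\frac{d^p}{G(d)}=+\infty$ if $G(d)=0$. *)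

(* Defs.v *)
From HB Require Import structures.
From mathcomp Require Import all_boot all_order all_algebra.
From mathcomp Require Import all_classical all_reals all_analysis. 
From mathcomp Require Import ess_sup_inf.
Set Implicit Arguments.
Unset Strict Implicit.
Unset Printing Implicit Defensive.
Import Order.TTheory GRing.Theory Num.Theory.
Import numFieldNormedType.Exports.
Local Open Scope classical_set_scope.
Local Open Scope ring_scope.

Definition rV_display : measure_display -> measure_display.
Proof. exact. Qed.

Section rV_measurable.
Context {R : realType} {n : nat}.

Let coord (i : 'I_n) (x : 'rV[R]_n) : measurableTypeR R := x ord0 i.

Let rV_measurable : set (set 'rV[R]_n) := g_sigma_preimage coord.

Let rV_measurable0 : rV_measurable set0.
Proof. exact: sigma_algebra0. Qed.

Let rV_measurableC A : rV_measurable A -> rV_measurable (~` A).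
Proof. exact: sigma_algebraC. Qed.

Let rV_measurable_bigcup (F : (set 'rV[R]_n)^nat) :
  (forall i, rV_measurable (F i)) -> rV_measurable (\bigcup_i F i).
Proof. exact: sigma_algebra_bigcup. Qed.

(* The Borel sets of R^n, as the product sigma-algebra. *)
HB.instance Definition _ := @isMeasurable.Build (rV_display R.-ocitv)
  'rV[R]_n rV_measurable rV_measurable0 rV_measurableC rV_measurable_bigcup.

Lemma measurable_coord (i : 'I_n) :
  measurable_fun [set: 'rV[R]_n] (fun x : 'rV[R]_n => x ord0 i : measurableTypeR R).
Proof.
move=> _ Y mY; rewrite setTI; apply: sub_sigma_algebra => /=.
rewrite -bigcup_seq/=; exists i => /=; first by rewrite mem_index_enum.
by exists Y => //; rewrite setTI.
Qed.

Lemma measurable_fun_rV d (T : measurableType d) (f : T -> 'rV[R]_n) :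
  (forall i, measurable_fun [set: T] (fun x => f x ord0 i : measurableTypeR R)) ->
  measurable_fun [set: T] f.
Proof.
move=> mf _ Y mY; rewrite setTI.
have := mY; rewrite /measurable/= => /(_ [set A | measurable (f @^-1` A)]); apply.
split; last first.
  move=> A; rewrite -bigcup_seq/= => -[i _ [B mB <-]]; rewrite setTI/=.
  have := mf i measurableT B mB; rewrite setTI.
  by rewrite /coord.
split => /=.
- by rewrite preimage_set0.
- by move=> A mA; rewrite setTD preimage_setC; exact: measurableC.
- by move=> F mF; rewrite preimage_bigcup; exact: bigcup_measurable.
Qed.

End rV_measurable.

Section lebesgue_rV_step.
Context {R : realType} {n : nat}.
Local Open Scope ereal_scope.

Definition rV_cons (z : measurableTypeR R * 'rV[R]_n) : 'rV[R]_n.+1 :=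
  row_mx (const_mx (z.1 : R) : 'rV[R]_1) z.2.

Definition rV_uncons (x : 'rV[R]_n.+1) : measurableTypeR R * 'rV[R]_n :=
  (x ord0 ord0, \row_i x ord0 (lift ord0 i)).

Lemma rV_cons0 z : rV_cons z ord0 ord0 = z.1.
Proof.
have -> : ord0 = lshift n (ord0 : 'I_1) by exact/val_inj.
exact: etrans (row_mxEl _ _ _ _) (mxE _ _ _ _).
Qed.

Lemma rV_consS z i : rV_cons z ord0 (lift ord0 i) = z.2 ord0 i.
Proof.
have -> : lift ord0 i = rshift 1 i by exact/val_inj.
exact: row_mxEr.
Qed.

Lemma rV_consK : cancel rV_cons rV_uncons.
Proof.
move=> [t y]; rewrite /rV_uncons rV_cons0/=; congr (_, _).
by apply/rowP => i; rewrite mxE rV_consS.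
Qed.

Lemma measurable_rV_cons : measurable_fun setT rV_cons.
Proof.
apply: measurable_fun_rV => i.
case: (unliftP ord0 i) => [j|] ->.
- under eq_fun do rewrite rV_consS.
  by apply: (measurableT_comp (measurable_coord j)); exact: measurable_snd.
- under eq_fun do rewrite rV_cons0.
  exact: measurable_fst.
Qed.

Lemma measurable_rV_uncons : measurable_fun setT rV_uncons.
Proof.
apply/measurable_fun_pairP; split; first exact: measurable_coord.
apply: measurable_fun_rV => i.
rewrite /comp/=; under eq_fun do rewrite mxE.
exact: measurable_coord.
Qed.

Variable m : {sigma_finite_measure set 'rV[R]_n -> \bar R}.

Definition rV_product : set 'rV[R]_n.+1 -> \bar R :=
  pushforward (lebesgue_measure \x m) rV_cons.

Let rV_product0 : rV_product set0 = 0.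
Proof. by rewrite /rV_product /pushforward preimage_set0 measure0. Qed.

Let rV_product_ge0 A : 0 <= rV_product A.
Proof. by rewrite /rV_product /pushforward measure_ge0. Qed.

Let rV_product_sigma_additive : semi_sigma_additive rV_product.
Proof.
move=> F mF tF mUF; rewrite /rV_product /pushforward preimage_bigcup.
have mc (A : set 'rV[R]_n.+1) : measurable A -> measurable (rV_cons @^-1` A).
  by move=> mA; rewrite -[X in measurable X]setTI; exact: measurable_rV_cons.
apply: measure_semi_sigma_additive.
- by move=> k; exact: mc.
- apply/trivIsetP => /= i j _ _ ij; rewrite -preimage_setI.
  by move/trivIsetP : tF => /(_ _ _ _ _ ij) ->//; rewrite preimage_set0.
- by rewrite -preimage_bigcup; exact: mc.
Qed.

HB.instance Definition _ := isMeasure.Build _ _ _ rV_product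
  rV_product0 rV_product_ge0 rV_product_sigma_additive.

Let rV_product_sigma_finite : sigma_finite setT rV_product.
Proof.
have [F TF Foo] : sigma_finite setT (lebesgue_measure \x m).
  have /sigma_finiteP[A [TA ndA Aoo]] := sigma_finiteT (@lebesgue_measure R).
  have /sigma_finiteP[B [TB ndB Boo]] := sigma_finiteT m.
  exists (fun k => A k `*` B k).
    rewrite -setXTT TA TB predeqE => -[x y]; split.
      move=> [/= [i _ Aix] [j _ Bjy]]; exists (maxn i j) => //; split.
      - by move: x Aix; exact/subsetPset/ndA/leq_maxl.
      - by move: y Bjy; exact/subsetPset/ndB/leq_maxr.
    by move=> [k _ []/= ? ?]; split; exists k.
  move=> k; have [mA Akoo] := Aoo k; have [mB Bkoo] := Boo k.
  split; first exact: measurableX.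
  by rewrite product_measure1E// lte_mul_pinfty// ge0_fin_numE.
exists (fun k => rV_uncons @^-1` F k).
  by rewrite -preimage_bigcup -TF preimage_setT.
move=> k; have [mFk Fkoo] := Foo k; split.
  by rewrite -[X in measurable X]setTI; exact: measurable_rV_uncons.
rewrite /rV_product /pushforward -comp_preimage.
rewrite (_ : rV_uncons \o rV_cons = id) ?preimage_id//.
by apply/funext => z; exact: rV_consK.
Qed.

HB.instance Definition _ :=
  Measure_isSigmaFinite.Build _ _ _ rV_product rV_product_sigma_finite.

End lebesgue_rV_step.

(* Lebesgue measure on R^n; R^0 is a point of mass 1. *)
Fixpoint lebesgue_rV (R : realType) (n : nat) :
    {sigma_finite_measure set 'rV[R]_n -> \bar R} :=
  if n is n'.+1 then rV_product (lebesgue_rV R n')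
  else dirac (0 : 'rV[R]_0).

Lemma lebesgue_rV_box (R : realType) (n : nat)
    (A : 'I_n -> set (measurableTypeR R)) :
  (forall i, measurable (A i)) ->
  lebesgue_rV R n [set x | forall i, A i (x ord0 i)] =
  (\big[*%E/1]_(i < n) lebesgue_measure (A i))%E.
Proof.
elim: n A => [|n IH] A mA.
  rewrite big_ord0 /= diracE mem_set//.
  by move=> -[].
rewrite big_ord_recl -IH//= /rV_product/= /pushforward.
have mB : measurable [set y : 'rV[R]_n | forall i, A (lift ord0 i) (y ord0 i)].
  have -> : [set y : 'rV[R]_n | forall i, A (lift ord0 i) (y ord0 i)] =
      \bigcap_(i in [set: 'I_n])
        ((fun x : 'rV[R]_n => x ord0 i : measurableTypeR R) @^-1` A (lift ord0 i)).
    by apply/seteqP; split => x /= H i *; exact: H.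
  apply: fin_bigcap_measurable => // i _.
  by rewrite -[X in measurable X]setTI; exact: measurable_coord.
rewrite -product_measure1E//.
congr (_ _); apply/seteqP; split => -[t y]/=.
- move=> H; split; first by have := H ord0; rewrite rV_cons0.
  by move=> i; have := H (lift ord0 i); rewrite rV_consS.
- move=> [At Ay] i; case: (unliftP ord0 i) => [j|] ->.
  + by rewrite rV_consS; exact: Ay.
  + by rewrite rV_cons0.
Qed.

Section euclidean.
Context {R : realType} {n : nat}.
Implicit Types u v : 'rV[R]_n.

(* The norm `|u| and the balls of the library on 'rV[R]_n come from the sup
   norm; the p-Laplacian and B(x0, r) need the Euclidean ones. *)
Definition dotp u v : R := \sum_(i < n) u ord0 i * v ord0 i.
Definition enorm u : R := Num.sqrt (dotp u u).
Definition eball (x0 : 'rV[R]_n) (r : R) : set 'rV[R]_n :=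
  [set x | enorm (x - x0) < r].

End euclidean.

Section sobolev.
Context {R : realType} {n : nat}.
Notation mu := (lebesgue_rV R n).
Implicit Types (u phi : 'rV[R]_n -> R) (Du : 'rV[R]_n -> 'rV[R]_n) (p : R).

Definition partial (i : 'I_n) phi : 'rV[R]_n -> R :=
  fun x => 'D_(delta_mx ord0 i) phi x.

(* C^infinity: every iterated partial derivative is differentiable. *)
Definition smooth phi : Prop :=
  forall (s : seq 'I_n) (x : 'rV[R]_n), differentiable (foldr partial phi s) x.

Definition test_function phi : Prop :=
  smooth phi /\ compact (closure [set x | phi x != 0]).

Definition weak_gradient u Du : Prop :=
  forall (i : 'I_n) phi, test_function phi ->
    \int[mu]_x (u x * partial i phi x) = - \int[mu]_x (Du x ord0 i * phi x).

(* u is in W^{1,p}(R^n), and Du is (a representative of) its gradient. *)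
Definition sobolev_grad p u Du : Prop :=
  [/\ u \in Lfun mu p%:E,
      forall i : 'I_n, (fun x => Du x ord0 i) \in Lfun mu p%:E &
      weak_gradient u Du].

(* Functions here are representatives of classes modulo a.e. equality, so
   u >= 0 is meant a.e. *)
Definition weak_solution p (a h : 'rV[R]_n -> R) (g : R -> R) (lambda : R) u
    : Prop :=
  {ae mu, forall x, 0 <= u x} /\
  exists2 Du, sobolev_grad p u Du &
    forall v Dv, sobolev_grad p v Dv ->
      \int[mu]_x (enorm (Du x) `^ (p - 2) * dotp (Du x) (Dv x)
                  + a x * `|u x| `^ (p - 2) * u x * v x)
      = lambda * \int[mu]_x (h x * g (u x) * v x).

End sobolev.

Definition Gamma {R : realType} (x : R) : R :=
  \int[lebesgue_measure]_(t in `]0, +oo[) (t `^ (x - 1) * expR (- t)).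

Section constants.
Context {R : realType} {N : nat}.
Notation mu := (lebesgue_rV R N).
Implicit Types (p r : R) (a h : 'rV[R]_N -> R) (g : R -> R).

Definition a_minus a : R := fine (ess_inf mu (EFin \o a)).
Definition norm_infty a : R := fine (Lnorm mu +oo (EFin \o a)).
Definition norm1 h : R := fine (Lnorm mu 1 (EFin \o h)).

(* Gamma(1 + N/2) / pi^(N/2), the inverse of the volume of the unit ball. *)
Definition gamma_pi : R := Gamma (1 + N%:R / 2) / pi `^ (N%:R / 2).

Definition k_a p a : R :=
  (1 / a_minus a) `^ ((p - N%:R) / p ^+ 2) * 2 `^ ((p - 1) / p)
  * gamma_pi `^ (1 / p) * (1 / N%:R `^ (N%:R / p ^+ 2))
  * ((p - 1) / (p - N%:R)) `^ (N%:R * (p - 1) / p ^+ 2).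

Definition K_R p a r : R :=
  1 / k_a p a `^ p * gamma_pi
  * (r `^ (p - N%:R) / (2 `^ p - 2 `^ (p - N%:R) + r `^ p * norm_infty a)).

Definition Ktilde_R p a h (x0 : 'rV[R]_N) r : R :=
  K_R p a r * ((\int[mu]_(x in eball x0 (r / 2)) h x) / norm1 h).

(* G, used for t >= 0 only. *)
Definition primitive g (t : R) : R :=
  \int[lebesgue_measure]_(s in `[0, t]) g s.

(* d^p / G(d), equal to +oo if G(d) = 0. *)
Definition pow_ratio p g (d : R) : \bar R :=
  if primitive g d == 0 then +oo%E else (d `^ p / primitive g d)%:E.

Definition lambda_star p a h g (x0 : 'rV[R]_N) r : \bar R :=
  let c := 3 / 2 * (1 / (p * k_a p a `^ p * norm1 h * Ktilde_R p a h x0 r)) in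
  let m := ereal_inf [set pow_ratio p g d | d in [set d : R | 0 < d]] in
  (c%:E * m)%E.

End constants.

(* Main.v *)
(* Write [E u] for the energy [int |Du|^p + a |u|^p].  The weak solutions are
   the critical points of [J u = E u / p - lambda * int h G(u+)], and
   [u] is critical when it minimizes [w |-> E w / p - L u w], where
   [L u w = lambda * int h g(u+) w].  Since [p > N], Morrey's inequality makes
   [L] a compact map, and [G] being [o(t^p)] at 0 and at infinity makes 0 a
   strict local minimum of [J] and [J] coercive.  If [lambda > lambda*], a tent
   function around [x0] has negative [J], which gives a solution with [J < 0],
   and a mountain pass between 0 and the tent gives one with [J > 0]; the third
   solution is 0, and the three differ because their values of [J] do.

   The mountain pass is discrete: [u] is moved towards the minimizer [T u] of
   [w |-> E w / p - L u w], with a cutoff near the critical points.  Each step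
   decreases [J], and uniform convexity of [E] makes [T] continuous and
   Palais-Smale sequences compact.

   Morrey's inequality and almost everywhere compactness come from comparing
   the averages of [u] over dyadic cells.  The chain rule for [u+] is obtained
   from difference quotients and the convexity of [s |-> max s 0]. *)
From HB Require Import structures.
Require Import Defs.
From mathcomp Require Import all_boot all_order all_algebra.
From mathcomp Require Import all_classical all_reals all_analysis.
From mathcomp Require Import measurable_realfun ess_sup_inf.
From mathcomp Require Import ring lra.
Set Implicit Arguments.
Unset Strict Implicit.
Unset Printing Implicit Defensive.
Import Order.TTheory GRing.Theory Num.Theory.
Import numFieldNormedType.Exports.
Local Open Scope classical_set_scope.
Local Open Scope ring_scope.

(** The exponent $p$ may lie on either side of 2 and $h$ is merely integrable, so a gradient flow
    would first need a regularization. Weak limits are avoided too: minimizing sequences are Cauchy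
    by uniform convexity, and compactness of [L] is a Cauchy property of functionals. For a bounded
    sequence it rests on two facts: a uniform bound almost everywhere, which lets functions be
    paired with $h\in L^1$, and a subsequence converging almost everywhere. Points of the space are
    pairs (function, gradient) of representatives, so [N] is a seminorm. Energies still separate
    solutions, because at a critical point the energy is determined by the function alone. The
    condition on $G$ at 0 also forces $g(0)=0$: hence 0 is a solution and $g$ extends continuously
    by 0 to negative arguments, which makes critical points nonnegative. *)

Section real_sequences.
Variable R : realType.
Implicit Types (f : nat -> R) (p : R).

Lemma cvg0_leP f : (forall n, 0 <= f n) ->
  (f @ \oo --> (0 : R)) <-> (forall e, 0 < e -> \forall n \near \oo, f n <= e).
Proof.
move=> f0; split=> [/cvgrPdist_le fl e /fl|H].
  by apply: filterS => n; rewrite sub0r normrN ger0_norm.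
by apply/cvgrPdist_le => e /H; apply: filterS => n; rewrite sub0r normrN ger0_norm.
Qed.

Lemma cvg_subseq (f : nat -> R) (l : R) (phi : nat -> nat) :
  (forall n, (n <= phi n)%N) -> f @ \oo --> l -> (f \o phi) @ \oo --> l.
Proof.
move=> phin fl; apply: cvg_comp fl.
move=> A [k _ kA]; exists k => // n /= kn; apply: kA => /=.
exact: leq_trans (phin n).
Qed.

Lemma powR_superlinear p (M : R) : 1 < p ->
  exists2 Y, 0 < Y & forall y, Y <= y -> M * y <= y `^ p.
Proof.
move=> p1; set M' := Num.max M 1.
have M'0 : 0 < M' by rewrite lt_max ltr01 orbT.
exists (M' `^ (p - 1)^-1); first by rewrite powR_gt0.
move=> y Yy; have y0 : 0 < y by rewrite (lt_le_trans _ Yy)// powR_gt0.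
have -> : p = (p - 1) + 1 by rewrite subrK.
rewrite powRD; last by apply/implyP => _; rewrite gt_eqF.
rewrite powRr1 ?(ltW y0)//; apply: ler_wpM2r; first exact: ltW.
apply: (@le_trans _ _ M'); first by rewrite le_max lexx.
rewrite -[leLHS](@powRr1 _ M') ?(ltW M'0)// -[X in M' `^ X](@mulVf _ (p - 1)); last first.
  by rewrite gt_eqF// subr_gt0.
rewrite powRrM; apply: ge0_ler_powR => //; rewrite ?nnegrE ?powR_ge0//.
  by rewrite subr_ge0 ltW.
exact: ltW.
Qed.

(** Differentiability of the power settles a positive limit; at the limit 0 the sequence is
    eventually below $e^{1/p}$, which is enough. *)
Lemma cvg_powR (p : R) (f : nat -> R) (l : R) : 0 < p -> (forall n, 0 <= f n) ->
  f @ \oo --> l -> (fun n => f n `^ p) @ \oo --> l `^ p.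
Proof.
move=> p0 f0 fl.
have l0 : 0 <= l.
  by apply: (@closed_cvg _ _ \oo eventually_filter f (fun x => 0 <= x)) fl;
    [exact: closed_ge|exact: nearW].
have [l00|ln0] := eqVneq l 0.
  rewrite l00 powR0 ?gt_eqF//; apply/cvg0_leP => [n|e e0]; first exact: powR_ge0.
  have := fl; rewrite l00 => /(cvg0_leP f0) /(_ (e `^ p^-1)).
  rewrite powR_gt0// => /(_ isT); apply: filterS => n fn.
  rewrite -[leRHS](@powRr1 _ e) ?(ltW e0)// -(mulVf (lt0r_neq0 p0)) powRrM.
  by apply: ge0_ler_powR; rewrite ?nnegrE ?powR_ge0// ltW.
have lp : 0 < l by rewrite lt_neqAle eq_sym ln0.
apply: (@continuous_cvg _ _ _ _ _ _ (fun x => x `^ p)) => //.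
have : derivable (fun x : R => x `^ p) l 1 by apply: derivable_powR; rewrite in_itv/= lp.
by move/derivable1_diffP/differentiable_continuous.
Qed.

Lemma seq_continuous (f : R -> R) :
  (forall (t : R) (u : nat -> R), u @ \oo --> t -> f \o u @ \oo --> f t) ->
  continuous f.
Proof.
move=> H t; apply/cvgrPdist_le => e e0; apply: contrapT => nH.
have : forall n : nat, exists x : R, `|t - x| <= n.+1%:R^-1 /\ e < `|f t - f x|.
  move=> n; apply: contrapT => nx; apply: nH.
  have : \forall x \near t, `|t - x| <= n.+1%:R^-1.
    have /cvgrPdist_le : x @[x --> t] --> t by exact: cvg_id.
    by apply; rewrite invr_gt0.
  apply: filterS => x tx; rewrite leNgt; apply/negP => fx.
  by apply: nx; exists x.
move=> /choice[u uP].
have ut : u @ \oo --> t.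
  apply/cvgrPdist_le => d d0; near=> n.
  apply: le_trans (uP n).1 _; near: n.
  have /cvg0_leP := @cvg_harmonic R; apply => // n.
  by rewrite /harmonic/= invr_ge0.
have /cvgrPdist_le/(_ e e0)[n _ /(_ n (leqnn n))] := H t u ut.
by rewrite leNgt (uP n).2.
Unshelve. all: by end_near. Qed.

End real_sequences.

(** * Critical points by discrete descent *)

Section three_critical_points.
Variables (R : realType) (X : lmodType R) (N : X -> R) (p : R).
Hypothesis p_gt1 : 1 < p.
Hypothesis N_ge0 : forall x, 0 <= N x.
Hypothesis N_triangle : forall x y, N (x + y) <= N x + N y.
Hypothesis NZ : forall c x, N (c *: x) = `|c| * N x.
(** The defect in the midpoint convexity of $N^p$. A linear term leaves a midpoint gap unchanged, so
    this one quantity serves all the functionals $N^p/p-l$. *)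
Definition convexity_gap x y : R :=
  (N x `^ p + N y `^ p) / 2 - N (2^-1 *: (x + y)) `^ p.
(** Homogeneous of degree $p$, so that a pointwise inequality of this form can be integrated. For
    $p\ge 2$ Clarkson's inequality gives it even with [e = 0]; for $p<2$ the gap can be quadratic in
    a small distance, and an error term is unavoidable. *)
Hypothesis N_uniformly_convex : forall e, 0 < e -> exists2 C, 0 < C &
  forall x y, N (x - y) `^ p <=
    C * convexity_gap x y + e * (N x `^ p + N y `^ p).
Hypothesis N_complete : forall u : nat -> X,
  (forall e, 0 < e -> exists n0, forall m n, (n0 <= m)%N -> (n0 <= n)%N ->
     N (u m - u n) <= e) ->
  exists x, (fun n => N (u n - x)) @ \oo --> (0 : R).

Let p_gt0 : 0 < p. Proof. exact: lt_trans p_gt1. Qed.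
Let pn0 : p != 0. Proof. by rewrite gt_eqF. Qed.

Lemma N0 : N 0 = 0.
Proof. by have := NZ 0 0; rewrite scale0r normr0 mul0r. Qed.

Lemma NN x : N (- x) = N x.
Proof. by rewrite -scaleN1r NZ normrN1 mul1r. Qed.

Lemma N_distC x y : N (x - y) = N (y - x).
Proof. by rewrite -opprB NN. Qed.

Lemma N_dist x y : `|N x - N y| <= N (x - y).
Proof.
rewrite ler_norml; apply/andP; split.
  have := N_triangle (y - x) x; rewrite subrK N_distC; lra.
have := N_triangle (x - y) y; rewrite subrK; lra.
Qed.

Definition seq_cvg (u : nat -> X) x := (fun n => N (u n - x)) @ \oo --> (0 : R).

Lemma seq_cvg_N u x : seq_cvg u x -> (fun n => N (u n)) @ \oo --> N x.
Proof.
move=> /(cvg0_leP (fun n => N_ge0 _)) ux; apply/cvgrPdist_le => e /ux.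
by apply: filterS => n; apply: le_trans; rewrite distrC N_dist.
Qed.

Lemma seq_cvg_le (u : nat -> X) x (f : nat -> R) : f @ \oo --> (0 : R) ->
  (forall n, N (u n - x) <= f n) -> seq_cvg u x.
Proof.
move=> f0 uf; apply: (squeeze_cvgr _ (cvg_cst 0) f0).
by apply: nearW => n; rewrite N_ge0 uf.
Qed.

Lemma seq_cvgD u v x y : seq_cvg u x -> seq_cvg v y ->
  seq_cvg (fun n => u n + v n) (x + y).
Proof.
move=> ux vy; apply: (@seq_cvg_le _ _ (fun n => N (u n - x) + N (v n - y))).
  by rewrite -[X in _ --> X]addr0; exact: cvgD.
by move=> n; rewrite opprD addrACA; exact: N_triangle.
Qed.

Lemma seq_cvgZ (a : nat -> R) (b : R) u x : a @ \oo --> b -> seq_cvg u x ->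
  seq_cvg (fun n => a n *: u n) (b *: x).
Proof.
move=> ab ux; apply: (@seq_cvg_le _ _
    (fun n => `|a n| * N (u n - x) + `|a n - b| * N x)).
  have -> : (0 : R) = `|b| * 0 + 0 * N x by rewrite mulr0 mul0r addr0.
  apply: cvgD; first by apply: cvgM => //; exact: cvg_norm.
  apply: cvgM; last exact: cvg_cst.
  rewrite -(normr0 R) -(subrr b); apply: cvg_norm; apply: cvgB => //.
  exact: cvg_cst.
move=> n; rewrite -2!NZ; apply: le_trans (N_triangle _ _).
by rewrite scalerBr scalerBl addrA subrK.
Qed.

Lemma seq_cvg_cst x : seq_cvg (fun=> x) x.
Proof. by apply: (@seq_cvg_le _ _ (fun=> 0)); [exact: cvg_cst|move=> n; rewrite subrr N0]. Qed.

Lemma seq_cvgB u v x y : seq_cvg u x -> seq_cvg v y ->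
  seq_cvg (fun n => u n - v n) (x - y).
Proof.
move=> ux vy; apply: seq_cvgD => //.
have : seq_cvg (fun n => -1 *: v n) (-1 *: y) by apply: seq_cvgZ => //; exact: cvg_cst.
by rewrite /seq_cvg; under eq_fun do rewrite !scaleN1r.
Qed.

Lemma N_convex (s : R) x y : 0 <= s -> s <= 1 ->
  N ((1 - s) *: x + s *: y) `^ p <= (1 - s) * N x `^ p + s * N y `^ p.
Proof.
move=> s0 s1; have s1' : 0 <= 1 - s by rewrite subr_ge0.
apply: (@le_trans _ _ (((1 - s) * N x + s * N y) `^ p)).
  apply: ge0_ler_powR; rewrite ?nnegrE ?N_ge0 ?addr_ge0 ?mulr_ge0 ?(ltW p_gt0)//.
  by apply: le_trans (N_triangle _ _) _; rewrite !NZ !ger0_norm.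
have H := @convex_powR _ _ (ltW p_gt1) (Itv01 s0 s1) (N y) (N x).
have := H; rewrite !inE/= !in_itv/= !N_ge0/= => /(_ isT isT).
rewrite !convRE/= => HH.
by rewrite addrC [leRHS]addrC.
Qed.

Lemma convexity_gap_ge0 x y : 0 <= convexity_gap x y.
Proof.
have := @N_convex 2^-1 x y _ _; rewrite invr_ge0 ler0n invf_le1// ler1n => /(_ isT isT).
have -> : 1 - 2^-1 = 2^-1 :> R by lra.
rewrite -scalerDr /convexity_gap; lra.
Qed.

(** The error coefficient [e'] is fixed first, so that on the ball of radius [B] the error term
    costs at most half of $e^p$; the size [d] of the gap then pays for the other half. *)
Lemma small_gap (B e : R) : 0 < e -> exists2 d, 0 < d &
  forall x y, N x <= B -> N y <= B -> convexity_gap x y <= d -> N (x - y) <= e.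
Proof.
move=> e0; have [B0|B0] := ltP B 0.
  by exists 1 => // x y; rewrite leNgt (lt_le_trans B0)// N_ge0.
have ep : 0 < e `^ p by rewrite powR_gt0.
have Bp : 0 <= B `^ p by rewrite powR_ge0.
pose e' := e `^ p / (4 * (B `^ p + 1)).
have e'0 : 0 < e' by rewrite divr_gt0// mulr_gt0// ltr_wpDl.
have [C C0 HC] := N_uniformly_convex e'0.
exists (e `^ p / (2 * C)); first by rewrite divr_gt0// mulr_gt0.
move=> x y xB yB gd.
rewrite leNgt; apply/negP => eN.
have : e `^ p < N (x - y) `^ p.
  by apply: gt0_ltr_powR; rewrite ?nnegrE ?N_ge0 ?(ltW e0).
apply/negP; rewrite -leNgt; apply: le_trans (HC x y) _.
have xp : N x `^ p <= B `^ p by apply: ge0_ler_powR; rewrite ?nnegrE ?N_ge0 ?(ltW p_gt0).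
have yp : N y `^ p <= B `^ p by apply: ge0_ler_powR; rewrite ?nnegrE ?N_ge0 ?(ltW p_gt0).
have h1 : C * convexity_gap x y <= e `^ p / 2.
  apply: le_trans (ler_wpM2l (ltW C0) gd) _.
  by rewrite le_eqVlt; apply/orP; left; apply/eqP; field; rewrite gt_eqF.
have h2 : e' * (N x `^ p + N y `^ p) <= e' * (2 * (B `^ p + 1)).
  by apply: ler_wpM2l; [exact: ltW|lra].
have h3 : e' * (2 * (B `^ p + 1)) = e `^ p / 2.
  by rewrite /e'; field; rewrite gt_eqF// ltr_wpDl.
lra.
Qed.

Definition linear_functional (l : X -> R) :=
  forall a x y, l (a *: x + y) = a * l x + l y.
Definition bounded_functional (M : R) (l : X -> R) := forall x, `|l x| <= M * N x.

Section linear_functional_facts.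
Variable l : X -> R.
Hypothesis llin : linear_functional l.
Lemma lf0 : l 0 = 0.
Proof. have := llin 1 0 0; rewrite scaler0 addr0; lra. Qed.
Lemma lfD x y : l (x + y) = l x + l y.
Proof. by have := llin 1 x y; rewrite scale1r mul1r. Qed.
Lemma lfZ a x : l (a *: x) = a * l x.
Proof. by have := llin a x 0; rewrite !addr0 lf0 addr0. Qed.
Lemma lfN x : l (- x) = - l x.
Proof. by rewrite -scaleN1r lfZ mulN1r. Qed.
Lemma lfB x y : l (x - y) = l x - l y.
Proof. by rewrite lfD lfN. Qed.
End linear_functional_facts.

Definition tilted (l : X -> R) w : R := N w `^ p / p - l w.

Lemma bounded_of_growth (M c : R) : exists2 B, 0 < B &
  forall w, N w `^ p / p - M * N w <= c -> N w <= B.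
Proof.
have [Y Y0 HY] := powR_superlinear (p * (M + 1)) p_gt1.
exists (Num.max Y c); first by rewrite lt_max Y0.
move=> w wc; rewrite le_max; have [//|/ltW Yw /=] := leP (N w) Y.
have := HY _ Yw; rewrite -mulrA mulrC -ler_pdivlMr//; lra.
Qed.

Lemma tilted_bounded (M c : R) : exists2 B, 0 < B &
  forall l w, bounded_functional M l -> tilted l w <= c -> N w <= B.
Proof.
have [B B0 HB] := bounded_of_growth M c; exists B => // l w lM lw.
apply: HB; apply: le_trans lw; rewrite /tilted lerB//.
exact: le_trans (ler_norm _) (lM w).
Qed.

(** The linear parts cancel, so two near-minimizers of any tilted functional have a small convexity
    gap. *)
Lemma tilted_gap l x y : linear_functional l ->
  (tilted l x + tilted l y) / 2 - tilted l (2^-1 *: (x + y)) = convexity_gap x y / p.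
Proof.
by move=> llin; rewrite /tilted (lfZ llin) (lfD llin) /convexity_gap; field.
Qed.

Lemma tilted_convex l (s : R) x y : linear_functional l -> 0 <= s -> s <= 1 ->
  tilted l ((1 - s) *: x + s *: y) <= (1 - s) * tilted l x + s * tilted l y.
Proof.
move=> llin s0 s1; rewrite /tilted (lfD llin) !(lfZ llin).
have := N_convex x y s0 s1; rewrite -(ler_pM2r (_ : 0 < p^-1)) ?invr_gt0//; lra.
Qed.

Lemma tilted_cvg l M u x : linear_functional l -> bounded_functional M l ->
  seq_cvg u x -> (fun n => tilted l (u n)) @ \oo --> tilted l x.
Proof.
move=> llin lM ux; apply: cvgB.
  apply: cvgM; last exact: cvg_cst.
  by apply: cvg_powR => //; exact: seq_cvg_N.
apply/cvgrPdist_le => e e0.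
have : (fun n => M * N (u n - x)) @ \oo --> (0 : R).
  by rewrite -[X in _ --> X](mulr0 M); apply: cvgM => //; exact: cvg_cst.
move/cvgrPdist_le => /(_ e e0); apply: filterS => n.
rewrite sub0r normrN; apply: le_trans.
by rewrite distrC -lfB// (le_trans (lM _))// ler_norm.
Qed.

(** Uniform convexity replaces weak compactness: the value at the midpoint of two near-minimizers is
    at least the infimum, so their gap is small, and a minimizing sequence is Cauchy. *)
Lemma tilted_minimizer l M : linear_functional l -> bounded_functional M l ->
  exists w, forall v, tilted l w <= tilted l v.
Proof.
move=> llin lM.
have [Y Y0 HY] := powR_superlinear (p * M) p_gt1.
have lb v : - (`|M| * Y) <= tilted l v.
  have lv : l v <= M * N v by exact: le_trans (ler_norm _) (lM v).
  have Mv : M * N v <= `|M| * N v by rewrite ler_wpM2r// ler_norm.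
  have Np : 0 <= N v `^ p / p by rewrite divr_ge0 ?powR_ge0// ltW.
  have MY : 0 <= `|M| * Y by rewrite mulr_ge0// ltW.
  have [/HY|vY] := leP Y (N v).
    rewrite -mulrA mulrC -ler_pdivlMr// /tilted; lra.
  have : `|M| * N v <= `|M| * Y by rewrite ler_wpM2l// ltW.
  rewrite /tilted; lra.
pose A := range (tilted l).
have hA : has_inf A.
  split; first by exists (tilted l 0), 0.
  by exists (- (`|M| * Y)) => _ [v _ <-].
have infP n : exists w, tilted l w < inf A + n.+1%:R^-1.
  by have [_ [w _ <-] ?] := @inf_adherent _ A n.+1%:R^-1 (ltac:(by rewrite invr_gt0)) hA; exists w.
have /choice[w wP] := infP.
have wlb v : inf A <= tilted l v by apply: ge_inf; [exact: hA.2|exists v].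
have [B B0 HB] := tilted_bounded M (inf A + 1).
have wB n : N (w n) <= B.
  apply: (HB l) => //; apply: ltW; apply: lt_le_trans (wP n) _.
  by rewrite lerD2l invf_le1// ler1n.
have [x wx] : exists x, seq_cvg w x.
  apply: N_complete => e e0; have [d d0 Hd] := small_gap B e0.
  have /cvg0_leP := @cvg_harmonic R.
  move=> /(_ (fun n => (ltac:(by rewrite /harmonic/= invr_ge0))) (d / p)).
  rewrite divr_gt0// => /(_ isT)[n0 _ hn0]; exists n0 => m n mn0 nn0.
  apply: Hd => //; rewrite -[leLHS](divfK pn0) -(tilted_gap _ _ llin) -ler_pdivlMr//.
  have avg (tm tn t i a b c : R) : a <= c -> b <= c -> i <= t -> tn < i + a ->
      tm < i + b -> (tm + tn) / 2 - t <= c by move=> *; lra.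
  exact: avg (hn0 n nn0) (hn0 m mn0) (wlb _) (wP n) (wP m).
exists x => v; apply: le_trans (wlb v).
have : (fun n => inf A + n.+1%:R^-1) @ \oo --> inf A + 0.
  by apply: cvgD; [exact: cvg_cst|exact: cvg_harmonic].
rewrite addr0 => Hc; apply: ler_cvg_to (tilted_cvg llin lM wx) Hc _.
by apply: nearW => n; exact: ltW.
Qed.

Variables (L : X -> X -> R) (Psi : X -> R) (e : X).
Hypothesis L_linear : forall u, linear_functional (L u).
Hypothesis L_bounded : forall B, exists2 M, 0 < M &
  forall u, N u <= B -> bounded_functional M (L u).
Hypothesis L_continuous : forall (w : nat -> X) u, seq_cvg w u ->
  forall d, 0 < d -> \forall n \near \oo, bounded_functional d (fun v => L (w n) v - L u v).
(** Only the functionals are required to be Cauchy along the subsequence; the points [w (phi n)]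
    need not have a limit of any kind. *)
Hypothesis L_compact : forall (w : nat -> X) B, (forall n, N (w n) <= B) ->
  exists2 phi : nat -> nat, (forall n, (n <= phi n)%N) &
  forall d, 0 < d -> exists n0, forall m n, (n0 <= m)%N -> (n0 <= n)%N ->
    bounded_functional d (fun v => L (w (phi m)) v - L (w (phi n)) v).
Hypothesis L0 : forall v, L 0 v = 0.
Hypothesis Psi_ge0 : forall u, 0 <= Psi u.
(** [L] is the derivative of [Psi]. The radius [r] depends on [u] through the bound [B] only, which
    allows one step size on a whole sublevel set of the energy. *)
Hypothesis Psi_derivable : forall B d, 0 < d -> exists2 r, 0 < r &
  forall u v, N u <= B -> N v <= r -> `|Psi (u + v) - Psi u - L u v| <= d * N v.
(** The coefficient is half of the one in the energy: the other half makes the energy coercive here,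
    and in [Psi_small] positive on small spheres. *)
Hypothesis Psi_growth : exists C, forall u, Psi u <= N u `^ p / (2 * p) + C.
Hypothesis Psi_small : exists2 r, 0 < r &
  forall u, N u <= r -> Psi u <= N u `^ p / (2 * p).

Definition energy u : R := N u `^ p / p - Psi u.
Hypothesis energy_e : energy e < 0.

Definition critical u := forall w, tilted (L u) u <= tilted (L u) w.

Lemma L_boundedE u : exists M, bounded_functional M (L u).
Proof. by have [M _ HM] := L_bounded (N u); exists M; exact: HM. Qed.

Lemma solution_exists u : exists w, forall v, tilted (L u) w <= tilted (L u) v.
Proof. by have [M HM] := L_boundedE u; exact: tilted_minimizer HM. Qed.

Definition solution u : X := projT1 (cid (solution_exists u)).

Lemma solutionP u v : tilted (L u) (solution u) <= tilted (L u) v.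
Proof. by rewrite /solution; case: cid. Qed.

(** Plays the role of the size of the derivative of the energy: it is nonnegative, continuous, and
    zero exactly at the critical points. *)
Definition defect u := tilted (L u) u - tilted (L u) (solution u).

Lemma defect_ge0 u : 0 <= defect u.
Proof. by rewrite subr_ge0 solutionP. Qed.

(** The midpoint of [w] and [solution u] cannot beat the minimizer, so the excess of [w] over the
    minimum controls the gap. *)
Lemma gap_le_tilted u w :
  2 / p * convexity_gap w (solution u) <= tilted (L u) w - tilted (L u) (solution u).
Proof.
have := tilted_gap w (solution u) (L_linear u).
have := solutionP u (2^-1 *: (w + solution u)).
rewrite -mulrA [p^-1 * _]mulrC; lra.
Qed.

Lemma solution_bounded B : exists2 B', 0 < B' & forall u, N u <= B -> N (solution u) <= B'.
Proof.
have [M M0 HM] := L_bounded B; have [B' B'0 HB'] := tilted_bounded M 0.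
exists B' => // u uB; apply: (HB' (L u)); first exact: HM.
apply: le_trans (solutionP u 0) _.
by rewrite /tilted N0 powR0// mul0r lf0// subr0.
Qed.

(** Each solution is inserted into the minimum problem of the other. In the sum of the two excesses
    the powers of [N] cancel, and only [L u - L u'] at the difference of the solutions remains. *)
Lemma solution_close B d : 0 < d -> exists2 r, 0 < r & forall u u', N u <= B -> N u' <= B ->
  bounded_functional r (fun v => L u v - L u' v) -> N (solution u - solution u') <= d.
Proof.
move=> d0; have [B' B'0 HB'] := solution_bounded B.
have [r r0 Hr] := small_gap B' d0.
exists (r / (p * B')); first by rewrite divr_gt0// mulr_gt0.
move=> u u' uB u'B Luu'; apply: Hr; [exact: HB'|exact: HB'|].
set w := solution u; set w' := solution u'.
have h1 := gap_le_tilted u w'; have h2 := gap_le_tilted u' w.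
rewrite -/w in h1; rewrite -/w' in h2.
have gapC : convexity_gap w' w = convexity_gap w w'.
  by rewrite /convexity_gap [w' + w]addrC [N w' `^ p + _]addrC.
have h3 : tilted (L u) w' - tilted (L u) w + (tilted (L u') w - tilted (L u') w') =
    L u (w - w') - L u' (w - w').
  by rewrite /tilted !lfB//; ring.
have h4 : L u (w - w') - L u' (w - w') <= r / (p * B') * N (w - w').
  exact: le_trans (ler_norm _) (Luu' _).
have h5 : N (w - w') <= 2 * B'.
  have := N_triangle w (- w'); rewrite NN; have := HB' _ uB; have := HB' _ u'B.
  by rewrite -/w -/w'; lra.
have h6 : r / (p * B') * N (w - w') <= r / (p * B') * (2 * B').
  by apply: ler_wpM2l h5; rewrite divr_ge0 ?ltW// mulr_gt0.
have h7 : r / (p * B') * (2 * B') = 2 / p * r by field; rewrite pn0 gt_eqF.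
have p2 : 0 < 2 / p by rewrite divr_gt0.
rewrite -(ler_pM2l p2); have := convexity_gap_ge0 w w'; rewrite gapC in h1.
have : 0 <= 2 / p * convexity_gap w w' by rewrite mulr_ge0 ?convexity_gap_ge0// ltW.
lra.
Qed.

Lemma cvg_bounded (f : nat -> R) (l : R) : f @ \oo --> l -> exists B, forall n, f n <= B.
Proof.
move=> fl; have /cvg_seq_bounded[M [_ HM]] : cvgn f by apply/cvg_ex; exists l.
by exists (M + 1) => n; apply: le_trans (ler_norm _) (HM (M + 1) _ n _) => //; rewrite ltrDl.
Qed.

Lemma seq_cvg_solution w u : seq_cvg w u -> seq_cvg (solution \o w) (solution u).
Proof.
move=> wu; have [B HB] := cvg_bounded (seq_cvg_N wu).
have [B' HB'] : exists B', forall n, N (w n) <= B' /\ N u <= B'.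
  exists (Num.max B (N u)) => n; split; last by rewrite le_max lexx orbT.
  by rewrite le_max HB.
apply/(cvg0_leP (fun n => N_ge0 _)) => d d0.
have [r r0 Hr] := solution_close B' d0.
have := L_continuous wu r0; apply: filterS => n; apply: Hr; [exact: (HB' n).1|exact: (HB' n).2].
Qed.

Lemma cvg_tilted w u v x : seq_cvg w u -> seq_cvg v x ->
  (fun n => tilted (L (w n)) (v n)) @ \oo --> tilted (L u) x.
Proof.
move=> wu vx; have [M HM] := L_boundedE u.
have -> : (fun n => tilted (L (w n)) (v n)) =
    (fun n => tilted (L u) (v n) - (L (w n) (v n) - L u (v n))).
  by apply/funext => n; rewrite /tilted; ring.
rewrite -[X in _ --> X]subr0; apply: cvgB; first exact: tilted_cvg HM vx.
have [B HB] := cvg_bounded (seq_cvg_N vx).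
apply/cvgrPdist_le => d d0.
have B1 : 0 < `|B| + 1 by rewrite ltr_wpDl.
have := L_continuous wu (divr_gt0 d0 B1); apply: filterS => n H.
rewrite sub0r normrN; apply: le_trans (H (v n)) _.
rewrite mulrAC ler_pdivrMr// ler_wpM2l ?(ltW d0)//.
have := HB n; have := ler_norm B; lra.
Qed.

Lemma cvg_defect w u : seq_cvg w u -> (fun n => defect (w n)) @ \oo --> defect u.
Proof.
move=> wu; apply: cvgB; first exact: cvg_tilted.
by apply: cvg_tilted => //; exact: seq_cvg_solution.
Qed.

Lemma cvg_energy w u : seq_cvg w u -> (fun n => energy (w n)) @ \oo --> energy u.
Proof.
move=> wu; apply: cvgB.
  apply: cvgM; last exact: cvg_cst.
  by apply: cvg_powR => //; exact: seq_cvg_N.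
have [M HM] := L_boundedE u.
have M1 : 0 < `|M| + 1 by rewrite ltr_wpDl.
have [r r0 Hr] := Psi_derivable (N u) (@ltr01 R).
have w0 := wu; move/(cvg0_leP (fun n => N_ge0 _)) in w0.
apply/cvgrPdist_le => d d0.
have d1 : 0 < d / (`|M| + 1) by rewrite divr_gt0.
have h1 := w0 _ r0; have h2 := w0 _ d1.
apply: filterS2 h1 h2 => n h1 h2.
have := Hr u (w n - u) (lexx _) h1; rewrite (addrC u) subrK => h3.
have h4 := HM (w n - u).
have h5 : M * N (w n - u) <= `|M| * N (w n - u) by rewrite ler_wpM2r// ler_norm.
rewrite distrC; have -> : Psi (w n) - Psi u = (Psi (w n) - Psi u - L u (w n - u)) + L u (w n - u).
  by rewrite subrK.
apply: le_trans (ler_normD _ _) _.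
move: h2; rewrite ler_pdivlMr//; lra.
Qed.

(* A Palais-Smale sequence subconverges because [solution] is compact and
   [u - solution u] is controlled by the defect. *)
Lemma critical_limit (v : nat -> X) B : (forall n, N (v n) <= B) ->
  (fun n => defect (v n)) @ \oo --> (0 : R) ->
  exists phi w, [/\ forall n, (n <= phi n)%N, critical w & seq_cvg (v \o phi) w].
Proof.
move=> vB dv; have [phi phin Hphi] := L_compact vB.
have [B' B'0 HB'] := solution_bounded B.
have [w Tw] : exists w, seq_cvg (solution \o v \o phi) w.
  apply: N_complete => d d0; have [r r0 Hr] := solution_close B d0.
  have [n0 Hn0] := Hphi _ r0; exists n0 => m n mn nn; apply: Hr => //.
  exact: Hn0.
have vT : (fun n => N (v n - solution (v n))) @ \oo --> (0 : R).
  apply/(cvg0_leP (fun n => N_ge0 _)) => d d0.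
  have [r r0 Hr] := small_gap (Num.max B B') d0.
  have r1 : 0 < 2 / p * r by rewrite !mulr_gt0// invr_gt0.
  have := dv => /(cvg0_leP (fun n => defect_ge0 _)) /(_ _ r1); apply: filterS => n dn.
  apply: Hr; rewrite ?le_max ?vB ?HB' ?orbT//.
  rewrite -(ler_pM2l (_ : 0 < 2 / p)) ?divr_gt0//.
  exact: le_trans (gap_le_tilted (v n) (v n)) dn.
have vw : seq_cvg (v \o phi) w.
  have h1 := cvg_subseq phin vT.
  apply: (@seq_cvg_le _ _ (fun n => N (v (phi n) - solution (v (phi n))) +
     N (solution (v (phi n)) - w))).
    by rewrite -[X in _ --> X]addr0; exact: cvgD.
  by move=> n; rewrite -[X in N X <= _](subrKA (solution (v (phi n)))); exact: N_triangle.
exists phi, w; split => // z.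
have d0 : defect w = 0.
  have := cvg_defect vw => H; apply/esym; apply: (cvg_unique (@Rhausdorff R) _ H).
  exact: cvg_subseq phin dv.
apply: le_trans (solutionP w z).
by rewrite -subr_le0 -/(defect w) d0.
Qed.

(** This is $(s-k)^+/(|s|+k)$: zero up to [k] and at least 1/3 from [2 * k] on. The absolute value
    in the denominator keeps it continuous on the whole line. *)
Definition cutoff (k s : R) : R := (`|s - k| + (s - k)) / (2 * (`|s| + k)).

Lemma cutoff_bounds k s : 0 < k -> 0 <= s ->
  [/\ 0 <= cutoff k s, cutoff k s <= 1, cutoff k s * (s - k) >= 0 &
      2 * k <= s -> 3^-1 <= cutoff k s].
Proof.
move=> k0 s0; rewrite /cutoff [`|s|]ger0_norm//.
have den : 0 < 2 * (s + k) by rewrite mulr_gt0// ltr_wpDl.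
have n0 : 0 <= `|s - k| + (s - k) by have := ler_norm (- (s - k)); rewrite normrN; lra.
have n1 : `|s - k| + (s - k) <= 2 * (s + k).
  have : `|s - k| <= s + k by rewrite ler_norml; apply/andP; split; lra.
  lra.
split.
- by rewrite divr_ge0// ltW.
- by rewrite ler_pdivrMr// mul1r.
- have [sk|/ltW sk] := leP k s.
    by rewrite mulr_ge0 ?subr_ge0// divr_ge0// ltW.
  by rewrite ler0_norm ?subr_le0// addNr !mul0r.
- by move=> ks; rewrite ler_pdivlMr// ger0_norm; lra.
Qed.

Lemma cutoff_lt k s : 0 < k -> s <= k -> cutoff k s = 0.
Proof. by move=> k0 sk; rewrite /cutoff ler0_norm ?subr_le0// addNr mul0r. Qed.

Lemma cvg_cutoff k (f : nat -> R) l : 0 < k -> f @ \oo --> l ->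
  (fun n => cutoff k (f n)) @ \oo --> cutoff k l.
Proof.
move=> k0 fl; have fk : (fun n => f n - k) @ \oo --> l - k by apply: cvgB => //; exact: cvg_cst.
apply: cvgM; first by apply: cvgD => //; exact: cvg_norm.
apply: cvgV; first by rewrite gt_eqF// mulr_gt0// ltr_wpDl.
apply: cvgM; first exact: cvg_cst.
by apply: cvgD; [exact: cvg_norm|exact: cvg_cst].
Qed.

Definition step k d u := u - (d * cutoff k (defect u)) *: (u - solution u).

Lemma seq_cvg_step k d w u : 0 < k -> seq_cvg w u -> seq_cvg (step k d \o w) (step k d u).
Proof.
move=> k0 wu; apply: seq_cvgB => //; apply: seq_cvgZ.
  apply: cvgM; first exact: cvg_cst.
  by apply: cvg_cutoff => //; exact: cvg_defect.
by apply: seq_cvgB => //; exact: seq_cvg_solution.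
Qed.

Lemma energy_bounded c : exists2 B, 0 < B & forall u, energy u <= c -> N u <= B.
Proof.
have [C HC] := Psi_growth; have [B B0 HB] := bounded_of_growth 0 (2 * (c + C)).
exists B => // u uc; apply: HB; rewrite mul0r subr0.
have := HC u; move: uc; rewrite /energy; set y := N u `^ p.
have -> : y / (2 * p) = (y / p) / 2 by field.
lra.
Qed.

Lemma energy_lower : exists C, forall u, - C <= energy u.
Proof.
have [C HC] := Psi_growth; exists C => u.
have := HC u; rewrite /energy.
have : 0 <= N u `^ p / p by rewrite divr_ge0 ?powR_ge0// ltW.
have -> : N u `^ p / (2 * p) = (N u `^ p / p) / 2 by field.
lra.
Qed.

(** By convexity, a move of length [s] along the segment to [solution u] lowers the tilted
    functional by at least [s * defect u], which is at least [s * k] where the cutoff is positive.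
    The tolerance [k / (2 * (B + B'))] makes the linearization error of [Psi] at most half of that
    gain. *)
Lemma step_descent c k : 0 < k -> exists2 d, 0 < d &
  forall u, energy u <= c ->
    energy (step k d u) <= energy u - d * cutoff k (defect u) * (k / 2).
Proof.
move=> k0; have [B B0 HB] := energy_bounded c.
have [B' B'0 HB'] := solution_bounded B.
have BB : 0 < B + B' by rewrite addr_gt0.
have k2 : 0 < k / (2 * (B + B')) by rewrite divr_gt0// mulr_gt0.
have [r r0 Hr] := Psi_derivable B k2.
(* The bound 1 keeps the new point on the segment; the other bound keeps the displacement within the
   radius where the linearization of [Psi] is valid. *)
pose d := Num.min 1 (r / (B + B')).
have d0 : 0 < d by rewrite lt_min ltr01 divr_gt0.
have d1 : d <= 1 by rewrite ge_min lexx.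
have dr : d * (B + B') <= r by rewrite -ler_pdivlMr// ge_min lexx orbT.
exists d => // u uc; have uB := HB _ uc.
have [c0 c1 ck _] := cutoff_bounds k0 (defect_ge0 u).
set s := d * cutoff k (defect u).
have s0 : 0 <= s by rewrite mulr_ge0// ltW.
have sd : s <= d by rewrite ler_piMr// ltW.
have s1 : s <= 1 by rewrite (le_trans sd).
set z := - (s *: (u - solution u)).
have stepE : step k d u = u + z by [].
have NzE : N z <= s * (B + B').
  rewrite /z NN NZ ger0_norm//; apply: ler_wpM2l => //.
  apply: le_trans (N_triangle _ _) _; rewrite NN lerD//; exact: HB'.
have Nzr : N z <= r.
  apply: le_trans NzE _; apply: le_trans dr; apply: ler_wpM2r => //; exact: ltW.
have conv : u + z = (1 - s) *: u + s *: solution u.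
  by rewrite /z scalerBr opprB scalerBl scale1r addrCA addrC -addrA [- _ + _]addrC.
have := tilted_convex u (solution u) (L_linear u) s0 s1.
rewrite -conv => h1.
have h2 := Hr u z uB Nzr.
have h3 : k / (2 * (B + B')) * N z <= s * (k / 2).
  apply: le_trans (ler_wpM2l (ltW k2) NzE) _.
  by rewrite le_eqVlt; apply/orP; left; apply/eqP; field; rewrite gt_eqF.
have h4 := ler_norm (- (Psi (u + z) - Psi u - L u z)); rewrite normrN in h4.
have h5 : s * k <= s * defect u.
  rewrite -subr_ge0 -mulrBr /s -mulrA mulr_ge0 ?(ltW d0)//.
have h6 : L u (u + z) = L u u + L u z by rewrite lfD.
rewrite stepE /energy; move: h1 h5; rewrite /defect /tilted h6; lra.
Qed.

(** The 6 combines the cutoff value 1/3, valid while the defect is at least [2 * k], with the factor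
    1/2 of the descent estimate. *)
Lemma iter_step_descent c k d u : 0 < k -> 0 < d -> energy u <= c ->
  (forall u, energy u <= c ->
    energy (step k d u) <= energy u - d * cutoff k (defect u) * (k / 2)) ->
  forall n, energy (iter n (step k d) u) <= energy u /\
    ((forall j, (j < n)%N -> 2 * k <= defect (iter j (step k d) u)) ->
    energy (iter n (step k d) u) <= energy u - n%:R * (d * k / 6)).
Proof.
move=> k0 d0 uc H; elim=> [|n [IH1 IH2]] /=; first by rewrite lexx mul0r subr0.
have := H _ (le_trans IH1 uc); set w := iter n _ u => Hw.
have [c0 _ _ c3] := cutoff_bounds k0 (defect_ge0 w).
have dk : 0 < d * k by rewrite mulr_gt0.
split.
  apply: le_trans Hw _; rewrite -[leRHS]subr0 lerB//.
  by apply: mulr_ge0; [apply: mulr_ge0 => //; exact: ltW|rewrite divr_ge0// ltW].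
move=> Hj; have H1 := IH2 (fun j jn => Hj j (ltnW jn)).
have := c3 (Hj n (leqnn _)) => c3'; apply: le_trans Hw _.
have : d * k / 2 * 3^-1 <= d * k / 2 * cutoff k (defect w).
  by apply: ler_wpM2l => //; rewrite ltW// divr_gt0.
move: H1; rewrite -/w -(natr1 n); lra.
Qed.

(* While the defect is at least [2 * k], each step lowers the energy by a fixed
   amount, which the lower bound of the energy allows only boundedly often. *)
Lemma near_critical c k : 0 < k -> exists d n, forall u, energy u <= c ->
  energy (iter n (step k d) u) <= energy u /\
  exists j, [/\ defect (iter j (step k d) u) < 2 * k,
    energy (iter n (step k d) u) <= energy (iter j (step k d) u) &
    energy (iter j (step k d) u) <= energy u].
Proof.
move=> k0; have [d d0 Hd] := step_descent c k0; have [C HC] := energy_lower.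
have dk : 0 < d * k / 6 by rewrite divr_gt0// mulr_gt0.
pose n := (Num.truncn ((c + C) / (d * k / 6))).+1.
have nP : c + C < n%:R * (d * k / 6).
  by rewrite -ltr_pdivrMr//; exact: truncnS_gt.
exists d, n => u uc; have H := iter_step_descent k0 d0 uc Hd.
split; first exact: (H n).1.
have [j [jn jk]] : exists j, (j < n)%N /\ defect (iter j (step k d) u) < 2 * k.
  apply: contrapT => nj; have := (H n).2.
  have Hj j : (j < n)%N -> 2 * k <= defect (iter j (step k d) u).
    by move=> jn; rewrite leNgt; apply/negP => jk; apply: nj; exists j.
  move=> /(_ Hj); have := HC (iter n (step k d) u); lra.
exists j; split => //; last exact: (H j).1.
rewrite -(subnK (ltnW jn)) iterD.
have jc : energy (iter j (step k d) u) <= c by exact: le_trans (H j).1 uc.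
exact: (iter_step_descent k0 d0 jc Hd (n - j)).1.
Qed.

(** Points whose defects tend to 0 form a Palais-Smale sequence, and continuity of the energy
    carries both bounds to the limit. *)
Lemma critical_of_levels (a c : R) :
  (forall k, 0 < k -> exists v, [/\ defect v < 2 * k, a <= energy v & energy v <= c]) ->
  exists2 w, critical w & a <= energy w <= c.
Proof.
move=> H; have H' n : exists v, [/\ defect v < 2 * (n.+1%:R^-1), a <= energy v & energy v <= c].
  by apply: H; rewrite invr_gt0.
have /choice[v vP] := H'.
have [B B0 HB] := energy_bounded c.
have vB n : N (v n) <= B by apply: HB; have [] := vP n.
have dv : (fun n => defect (v n)) @ \oo --> (0 : R).
  have h : (fun n => 2 * n.+1%:R^-1) @ \oo --> (0 : R).
    rewrite -[X in _ --> X](mulr0 2); apply: cvgM; [exact: cvg_cst|exact: cvg_harmonic].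
  apply: (squeeze_cvgr _ (cvg_cst 0) h); apply: nearW => n.
  by rewrite defect_ge0/= ltW//; have [] := vP n.
have [phi [w [_ wc vw]]] := critical_limit vB dv; exists w => //.
have Ew := cvg_energy vw.
apply/andP; split.
  apply: ler_cvg_to (cvg_cst a) Ew _; apply: nearW => n; have [] := vP (phi n); by [].
apply: ler_cvg_to Ew (cvg_cst c) _; apply: nearW => n; have [] := vP (phi n); by [].
Qed.

(** Descent from [e] never exceeds [energy e], so the limit has negative energy as well. *)
Lemma negative_critical_point : exists2 w, critical w & energy w < 0.
Proof.
have [C HC] := energy_lower.
have [|w wc /andP[_ we]] := @critical_of_levels (- C) (energy e).
  move=> k k0; have [d [n H]] := near_critical (energy e) k0.
  by have [_ [j [h1 h2 h3]]] := H e (lexx _); exists (iter j (step k d) e).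
by exists w => //; exact: le_lt_trans energy_e.
Qed.

(** Since [L 0] vanishes, 0 is critical and the cutoff freezes it: the deformed path still starts at
    0. *)
Lemma step0 k d : 0 < k -> step k d 0 = 0.
Proof.
move=> k0; rewrite /step cutoff_lt ?mulr0 ?scale0r ?subr0//.
apply: le_trans (ltW k0); rewrite /defect subr_le0.
rewrite /tilted !L0 N0 powR0// mul0r !subr0.
by rewrite divr_ge0 ?powR_ge0 ?ltW.
Qed.

(** The energy is nonnegative on the ball of radius [r] and at least [a] on its boundary. After [n]
    steps the end of the segment still has negative energy and so lies outside this ball. Where the
    deformed segment meets the sphere, the energy after all the steps is at least [a], hence so is
    the energy of the intermediate point of small defect. *)
Lemma positive_critical_point : exists2 w, critical w & 0 < energy w.
Proof.
have [r r0 Hr] := Psi_small.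
pose a := r `^ p / (2 * p).
have a0 : 0 < a by rewrite divr_gt0 ?powR_gt0// mulr_gt0.
have Er u : N u = r -> a <= energy u.
  move=> ur; have := Hr u; rewrite ur lexx => /(_ isT); rewrite /energy ur /a.
  have -> : r `^ p / (2 * p) = (r `^ p / p) / 2 by field.
  lra.
have Er0 u : N u <= r -> 0 <= energy u.
  move=> ur; have := Hr u ur; rewrite /energy.
  have -> : N u `^ p / (2 * p) = (N u `^ p / p) / 2 by field.
  have : 0 <= N u `^ p / p by rewrite divr_ge0 ?powR_ge0// ltW.
  lra.
pose c := N e `^ p / p.
have Ec t : 0 <= t -> t <= 1 -> energy (t *: e) <= c.
  move=> t0 t1; rewrite /energy /c; have := Psi_ge0 (t *: e).
  suff : N (t *: e) `^ p / p <= N e `^ p / p by lra.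
  rewrite ler_pM2r ?invr_gt0//; apply: ge0_ler_powR; rewrite ?nnegrE ?N_ge0 ?(ltW p_gt0)//.
  by rewrite NZ ger0_norm// ler_piMl.
have [|w wc /andP[we _]] := @critical_of_levels a c; last first.
  by exists w => //; exact: lt_le_trans we.
move=> k k0; have [d [n H]] := near_critical c k0.
pose f t := N (iter n (step k d) (t *: e)).
have fc : continuous f.
  apply: seq_continuous => t u ut.
  have : seq_cvg (fun m => u m *: e) (t *: e).
    by apply: seq_cvgZ => //; exact: seq_cvg_cst.
  rewrite /f => h; have : seq_cvg (iter n (step k d) \o (fun m => u m *: e)) (iter n (step k d) (t *: e)).
    by elim: n {H f} => [//|j IH] /=; apply: (seq_cvg_step _ k0 IH).
  exact: seq_cvg_N.
have f0 : f 0 = 0.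
  by rewrite /f scale0r; elim: (n) => [|j IH] /=; rewrite ?N0// -[RHS]IH -[in RHS](step0 d k0) -iterSr.
have f1 : r <= f 1.
  rewrite leNgt; apply/negP => /ltW /Er0.
  have [+ _] := H (1 *: e) (Ec 1 ler01 (lexx 1)); rewrite scale1r; have := energy_e; lra.
(* The deformed segment crosses the sphere of radius [r], where the energy is at least [a]. *)
have [||t] := @IVT _ f 0 1 r ler01.
- exact: continuous_subspaceT.
- by rewrite f0 ge_min le_max (ltW r0) f1 orbT.
rewrite in_itv/= => /andP[t0 t1] /Er fa.
have [_ [j [h1 h2 h3]]] := H _ (Ec t t0 t1).
exists (iter j (step k d) (t *: e)); split => //; first exact: le_trans h2.
exact: le_trans h3 (Ec t t0 t1).
Qed.

End three_critical_points.

(** * Integrals and Lebesgue measure *)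

Section real_integrals.
Context d (T : measurableType d) (R : realType).
Variable mu : {measure set T -> \bar R}.
Implicit Types (f g h : T -> R) (p q : R).

Definition itg f := mu.-integrable [set: T] (EFin \o f).

Lemma itgM f : itg f -> measurable_fun setT f.
Proof. by move=> /measurable_int/measurable_EFinP. Qed.

Lemma itgD f g : itg f -> itg g -> itg (fun x => f x + g x).
Proof. by move=> fi gi; exact: (integrableD measurableT fi gi). Qed.

Lemma itgZ (c : R) f : itg f -> itg (fun x => c * f x).
Proof. by move=> fi; exact: (integrableZl measurableT c fi). Qed.

Lemma itgB f g : itg f -> itg g -> itg (fun x => f x - g x).
Proof. by move=> fi gi; exact: (integrableB measurableT fi gi). Qed.

Lemma itg_norm f : itg f -> itg (fun x => `|f x|).
Proof. exact: integrable_norm. Qed.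

Lemma itg_le_ae f g : measurable_fun setT f -> itg g ->
  {ae mu, forall x, `|f x| <= g x} -> itg f.
Proof.
move=> mf gi fg; apply/integrableP; split; first exact/measurable_EFinP.
have /integrableP[_] := gi; apply: le_lt_trans; apply: ae_ge0_le_integral => //.
- by apply: measurableT_comp => //; exact/measurable_EFinP.
- by apply: measurableT_comp => //; apply/measurable_EFinP; exact: itgM.
- by apply: filterS fg => x fgx _ /=; rewrite lee_fin (le_trans fgx)// ler_norm.
Qed.

Lemma itg_le f g : measurable_fun setT f -> itg g -> (forall x, `|f x| <= g x) -> itg f.
Proof. by move=> mf gi fg; apply: (itg_le_ae mf gi); exact: aeW. Qed.

Lemma IntD f g : itg f -> itg g ->
  \int[mu]_x (f x + g x) = \int[mu]_x f x + \int[mu]_x g x.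
Proof. by move=> fi gi; rewrite RintegralD. Qed.

Lemma IntB f g : itg f -> itg g ->
  \int[mu]_x (f x - g x) = \int[mu]_x f x - \int[mu]_x g x.
Proof. by move=> fi gi; rewrite RintegralB. Qed.

Lemma IntZ (c : R) f : itg f -> \int[mu]_x (c * f x) = c * \int[mu]_x f x.
Proof. by move=> fi; rewrite RintegralZl. Qed.

Lemma IntE f : itg f -> (\int[mu]_x f x)%:E = (\int[mu]_x (f x)%:E)%E.
Proof. by move=> fi; rewrite fineK//; exact: integrable_fin_num. Qed.

Lemma Int_le_ae f g : itg f -> itg g -> {ae mu, forall x, f x <= g x} ->
  \int[mu]_x f x <= \int[mu]_x g x.
Proof.
move=> fi gi fg; rewrite -subr_ge0 -IntB//.
have mfg : measurable_fun setT (fun x => g x - f x) by exact: itgM (itgB gi fi).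
have -> : \int[mu]_x (g x - f x) = \int[mu]_x `|g x - f x|.
  congr fine; apply: ae_eq_integral => //.
  - exact/measurable_EFinP.
  - by apply/measurable_EFinP; exact: measurableT_comp.
  - by apply: filterS fg => x fgx _; rewrite ger0_norm// subr_ge0.
by apply: Rintegral_ge0.
Qed.

Lemma Int_le f g : itg f -> itg g -> (forall x, f x <= g x) ->
  \int[mu]_x f x <= \int[mu]_x g x.
Proof. by move=> fi gi fg; apply: Int_le_ae => //; exact: aeW. Qed.

Lemma Int_ae f g : measurable_fun setT f -> measurable_fun setT g ->
  {ae mu, forall x, f x = g x} -> \int[mu]_x f x = \int[mu]_x g x.
Proof.
move=> mf mg fg; congr fine; apply: ae_eq_integral => //; try exact/measurable_EFinP.
by apply: filterS fg => x fgx _; rewrite fgx.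
Qed.

Lemma Int_norm f : itg f -> `|\int[mu]_x f x| <= \int[mu]_x `|f x|.
Proof. by move=> fi; exact: le_normr_Rintegral. Qed.

Lemma Int_norm_le f g : itg f -> itg g -> {ae mu, forall x, `|f x| <= g x} ->
  `|\int[mu]_x f x| <= \int[mu]_x g x.
Proof.
move=> fi gi fg; apply: le_trans (Int_norm fi) _.
by apply: Int_le_ae => //; exact: itg_norm.
Qed.

Lemma dct (f_ : nat -> T -> R) f g : (forall n, measurable_fun setT (f_ n)) ->
  measurable_fun setT f -> {ae mu, forall x, (f_ ^~ x) @ \oo --> f x} ->
  itg g -> {ae mu, forall x n, `|f_ n x| <= g x} ->
  [/\ itg f, (fun n => \int[mu]_x f_ n x) @ \oo --> \int[mu]_x f x &
   (fun n => \int[mu]_x `|f_ n x - f x|) @ \oo --> (0 : R)].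
Proof.
move=> mf_ mf ff gi fg.
have [] := @dominated_convergence _ _ _ mu setT measurableT
  (fun n => EFin \o f_ n) (EFin \o f) (EFin \o g)
  (fun n => (measurable_EFinP _ _).2 (mf_ n))
  ((measurable_EFinP _ _).2 mf) _ gi _.
- by apply: filterS ff => x fx _; apply: cvg_comp fx _; exact: cvg_id.
- by apply: filterS fg => x fgx n _ /=; rewrite lee_fin.
move=> fi h1 h2.
have f_i n : itg (f_ n).
  apply: (itg_le_ae (mf_ n) gi); by apply: filterS fg => x.
split => //.
- by apply: fine_cvg; rewrite IntE.
- by apply: fine_cvg; exact: h1.
Qed.

Lemma fatou_bounded (f_ : nat -> T -> R) f (C : R) : (forall n, itg (f_ n)) ->
  (forall n x, 0 <= f_ n x) -> measurable_fun setT f -> (forall x, 0 <= f x) ->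
  {ae mu, forall x, (f_ ^~ x) @ \oo --> f x} ->
  (\forall n \near \oo, \int[mu]_x f_ n x <= C) ->
  itg f /\ \int[mu]_x f x <= C.
Proof.
move=> fi f0 mf f00 ff fC.
have H : (\int[mu]_x (f x)%:E <= C%:E)%E.
  have -> : (\int[mu]_x (f x)%:E = \int[mu]_x (limn_einf (fun n => (f_ n x)%:E)))%E.
    apply: ae_eq_integral => //; first exact/measurable_EFinP.
      apply: measurableT_comp => //; apply: measurable_fun_limn_esup => n.
      by apply: measurableT_comp => //; apply/measurable_EFinP; exact: itgM.
    apply: filterS ff => x fx _; apply/esym.
    have fxE : (fun n => (f_ n x)%:E) @ \oo --> (f x)%:E by exact: cvg_comp fx _.
    by rewrite is_cvg_limn_einfE; [exact/cvg_lim|apply/cvg_ex; exists (f x)%:E].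
  apply: le_trans (@fatou _ _ _ mu setT measurableT (fun n => EFin \o f_ n) _ _) _.
  - by move=> n; apply/measurable_EFinP; exact: itgM.
  - by move=> n x _; rewrite lee_fin.
  have [n0 _ Hn0] := fC.
  rewrite limn_einf_lim; apply: lime_le; first exact: is_cvg_einfs.
  near=> n; apply: (@le_trans _ _ (\int[mu]_x (f_ n x)%:E)%E).
    by apply: ereal_inf_lbound; exists n => /=.
  rewrite -IntE//= lee_fin; near: n; exact: fC.
have fi' : itg f.
  apply/integrableP; split; first exact/measurable_EFinP.
  apply: le_lt_trans (ltry C).
  by under eq_integral => x _ do rewrite /= ger0_norm//.
by split => //; rewrite -lee_fin IntE.
Unshelve. all: by end_near. Qed.

(** The sum of the series is integrable by monotone convergence, hence finite almost everywhere, and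
    it dominates each of its terms. *)
Lemma series_integral_ae_bounded (f_ : nat -> T -> R) (C : R) :
  (forall n, itg (f_ n)) -> (forall n x, 0 <= f_ n x) ->
  (forall n, \sum_(k < n) \int[mu]_x f_ k x <= C) ->
  {ae mu, forall x, exists B, forall n, f_ n x <= B}.
Proof.
move=> fi f0 fC; pose S := fun x => (\sum_(k <oo) (f_ k x)%:E)%E.
have mS : measurable_fun [set: T] S.
  apply: ge0_emeasurable_sum => [k x _ _|k _]; first by rewrite lee_fin.
  by apply/measurable_EFinP; exact: itgM.
have S0 x : (0 <= S x)%E by apply: nneseries_ge0 => k _ _; rewrite lee_fin.
have Si : mu.-integrable setT S.
  apply/integrableP; split => //.
  under eq_integral => x _ do rewrite gee0_abs//.
  rewrite integral_nneseries//; last 2 first.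
  - by move=> n; apply/measurable_EFinP; exact: itgM.
  - by move=> n x _; rewrite lee_fin.
  apply: le_lt_trans (ltry C); apply: lime_le.
    apply: is_cvg_nneseries => n _ _; apply: integral_ge0 => x _; by rewrite lee_fin.
  apply: nearW => n; rewrite big_mkord.
  under eq_bigr => k _ do rewrite -IntE//.
  by rewrite sumEFin lee_fin.
have := integrable_ae measurableT Si; apply: filterS => x /(_ I) Sfin.
exists (fine (S x)) => n; rewrite -lee_fin fineK//.
rewrite /S (nneseries_split 0 n.+1)//; last by move=> k _; rewrite lee_fin.
rewrite add0n big_mkord big_ord_recr/=.
rewrite -addeA; apply: le_trans; last first.
  apply: leeDr; apply: sume_ge0 => k _; by rewrite lee_fin.
apply: leeDl; apply: nneseries_ge0 => k _ _; by rewrite lee_fin.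
Qed.

End real_integrals.

(** * The spaces $L^p$: Hölder's inequality and completeness *)

Section Lp_spaces.
Context d (T : measurableType d) (R : realType).
Variable mu : {measure set T -> \bar R}.
Implicit Types (f g h : T -> R) (p q : R).

Definition Lp p f := measurable_fun [set: T] f /\ itg mu (fun x => `|f x| `^ p).

Lemma measurable_powR_comp f p : measurable_fun [set: T] f ->
  measurable_fun [set: T] (fun x => f x `^ p).
Proof. by move=> mf; apply: (measurableT_comp (measurable_powR _)). Qed.

Lemma measurable_norm_powR f p : measurable_fun [set: T] f ->
  measurable_fun [set: T] (fun x => `|f x| `^ p).
Proof. by move=> mf; apply: measurable_powR_comp; exact: measurableT_comp. Qed.

Lemma Lfun_LpP p f : 1 <= p -> (f \in Lfun mu p%:E) <-> Lp p f.
Proof.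
move=> p1; have p0 : 0 < p by exact: lt_le_trans p1.
split=> [fL|[mf fi]].
  split; last exact: Lfun_integrable.
  by move: fL; rewrite inE => /andP[/[!inE]].
rewrite inE; apply/andP; split; rewrite inE//=.
rewrite /finite_norm unlock /=.
apply: poweR_lty.
have /integrableP[_] := fi; apply: le_lt_trans.
rewrite le_eqVlt; apply/orP; left; apply/eqP; apply: eq_integral => x _ /=.
by rewrite (@ger0_norm _ (`|f x| `^ p)) ?powR_ge0.
Qed.

Lemma powR_le_mono p (x y : R) : 0 < p -> 0 <= x -> x <= y -> x `^ p <= y `^ p.
Proof.
move=> p0 x0 xy; apply: ge0_ler_powR => //; rewrite ?nnegrE//; first exact: ltW.
exact: le_trans xy.
Qed.

Lemma powR_add_le p (x y : R) : 0 < p ->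
  `|x + y| `^ p <= 2 `^ p * (`|x| `^ p + `|y| `^ p).
Proof.
move=> p0; apply: (@le_trans _ _ ((2 * Num.max `|x| `|y|) `^ p)).
  apply: powR_le_mono => //; apply: le_trans (ler_normD _ _) _.
  by rewrite mulr_natl mulr2n lerD// le_max lexx ?orbT.
rewrite powRM ?le_max ?normr_ge0// ler_wpM2l ?powR_ge0//.
by rewrite /Num.max; case: ifP => _; rewrite ?lerDl ?lerDr powR_ge0.
Qed.

Lemma LpD p f g : 0 < p -> Lp p f -> Lp p g -> Lp p (fun x => f x + g x).
Proof.
move=> p0 [mf fi] [mg gi]; have mfg : measurable_fun [set: T] (fun x => f x + g x).
  exact: measurable_funD.
split => //; apply: (itg_le (g := fun x => 2 `^ p * (`|f x| `^ p + `|g x| `^ p))).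
- exact: measurable_norm_powR.
- by apply: itgZ; exact: itgD.
- by move=> x; rewrite ger0_norm ?powR_ge0// powR_add_le.
Qed.

Lemma LpZ p (c : R) f : Lp p f -> Lp p (fun x => c * f x).
Proof.
move=> [mf fi]; split; first exact: measurable_funM.
have -> : (fun x => `|c * f x| `^ p) = (fun x => `|c| `^ p * `|f x| `^ p).
  by apply/funext => x; rewrite normrM powRM.
exact: itgZ.
Qed.

Lemma LpN p f : Lp p f -> Lp p (fun x => - f x).
Proof. by move=> /(LpZ (-1)); under eq_fun do rewrite mulN1r. Qed.

Lemma LpB p f g : 0 < p -> Lp p f -> Lp p g -> Lp p (fun x => f x - g x).
Proof. by move=> p0 fp gp; apply: LpD => //; exact: LpN. Qed.

Lemma Lp_le p f g : 0 < p -> measurable_fun [set: T] f -> Lp p g ->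
  {ae mu, forall x, `|f x| <= `|g x|} -> Lp p f.
Proof.
move=> p0 mf [mg gi] fg; split => //.
apply: (itg_le_ae _ gi); first exact: measurable_norm_powR.
by apply: filterS fg => x fgx; rewrite ger0_norm ?powR_ge0// powR_le_mono.
Qed.

Lemma Int_hoelder p q f g : 0 < p -> 0 < q -> p^-1 + q^-1 = 1 ->
  Lp p f -> Lp q g -> itg mu (fun x => f x * g x) /\
  \int[mu]_x `|f x * g x| <=
    (\int[mu]_x `|f x| `^ p) `^ p^-1 * (\int[mu]_x `|g x| `^ q) `^ q^-1.
Proof.
move=> p0 q0 pq [mf fi] [mg gi].
have H := hoelder mu mf mg p0 q0 pq.
have E r h : itg mu (fun x => `|h x| `^ r) ->
    'N[mu]_r%:E[EFin \o h]%E = ((\int[mu]_x `|h x| `^ r) `^ r^-1)%:E.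
  by move=> hi; rewrite unlock /= -poweR_EFin IntE.
rewrite Lnorm1 (E _ _ fi) (E _ _ gi) -EFinM in H.
have mfg : measurable_fun [set: T] (fun x => f x * g x) by exact: measurable_funM.
have fgi : itg mu (fun x => f x * g x).
  apply/integrableP; split; first exact/measurable_EFinP.
  exact: le_lt_trans H (ltry _).
split => //; rewrite -lee_fin IntE//; last exact: itg_norm.
Qed.

(** The Riesz-Fischer argument: a rapidly Cauchy subsequence converges almost everywhere, and
    Fatou's lemma turns the Cauchy estimate into an estimate of the distance to the limit. *)
Lemma Lp_complete p (f : nat -> T -> R) : 1 <= p -> (forall n, Lp p (f n)) ->
  (forall e, 0 < e -> exists n0, forall m n, (n0 <= m)%N -> (n0 <= n)%N ->
    \int[mu]_x `|f m x - f n x| `^ p <= e) ->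
  exists2 g, Lp p g & (fun n => \int[mu]_x `|f n x - g x| `^ p) @ \oo --> (0 : R).
Proof.
move=> p1 fL fC; have p0 : 0 < p by exact: lt_le_trans p1.
(* Even after multiplication by $2^{kp}$ the integrals of $|g_k|^p$ are summable, so at almost every
   point $|g_k|$ is at most a constant times $2^{-k}$. *)
pose e k : R := 2^-1 ^+ k / 2 `^ (k%:R * p).
have /choice[c cP] : forall k, exists n0, forall m n, (n0 <= m)%N -> (n0 <= n)%N ->
    \int[mu]_x `|f m x - f n x| `^ p <= e k.
  by move=> k; apply: fC; rewrite divr_gt0 ?powR_gt0// exprn_gt0// invr_gt0.
(* Summing the thresholds makes [phi] nondecreasing and at least [c k]; the added [k] makes it
   unbounded. *)
pose phi k := (\sum_(j < k.+1) c j + k)%N.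
have phic k : (c k <= phi k)%N by rewrite /phi big_ord_recr/= -addnA addnCA leq_addr.
have phiS k : (phi k <= phi k.+1)%N.
  by rewrite /phi [in leqRHS]big_ord_recr/= leq_add// leq_addr.
have phik k : (k <= phi k)%N by exact: leq_addl.
pose g k x := f (phi k.+1) x - f (phi k) x.
have gL k : Lp p (g k) by exact: LpB.
have gI k : \int[mu]_x `|g k x| `^ p <= e k.
  by apply: cP => //; apply: leq_trans (phiS k).
have ae_g : {ae mu, forall x, exists B, forall k, 2 `^ (k%:R * p) * `|g k x| `^ p <= B}.
  apply: (@series_integral_ae_bounded _ _ _ _ _ 2).
  - by move=> k; apply: itgZ; exact: (gL k).2.
  - by move=> k x; rewrite mulr_ge0 ?powR_ge0.
  move=> n; apply: (@le_trans _ _ (\sum_(k < n) 2^-1 ^+ k)).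
    apply: ler_sum => k _; rewrite IntZ; last exact: (gL k).2.
    apply: le_trans (ler_wpM2l _ (gI k)) _; first exact: powR_ge0.
    by rewrite /e mulrCA divff ?mulr1// gt_eqF// powR_gt0.
  rewrite -(big_mkord xpredT (fun k => 2^-1 ^+ k)).
  have := @geometric_le_lim R n 1 2^-1; rewrite /series/=.
  under eq_bigr do rewrite mul1r.
  move=> /(_ ler01); rewrite invr_gt0 ltr0n => /(_ isT).
  rewrite ger0_norm ?invr_ge0// invf_lt1// ltr1n => /(_ isT) /le_trans; apply.
  by rewrite (_ : (1 - 2^-1 : R) = 2^-1) ?invrK ?mul1r ?lexx//; lra.
have ae_cvg : {ae mu, forall x, cvgn (fun k => f (phi k) x)}.
  apply: filterS ae_g => x [B HB].
  have gB k : `|g k x| <= (`|B| `^ p^-1) * 2^-1 ^+ k.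
    have h : (2 ^+ k * `|g k x|) `^ p <= `|B|.
      rewrite powRM ?exprn_ge0// -powR_mulrn// -powRrM.
      exact: le_trans (HB k) (ler_norm _).
    have : 2 ^+ k * `|g k x| <= `|B| `^ p^-1.
      rewrite -[leLHS](@powRr1 _ (2 ^+ k * `|g k x|)) ?mulr_ge0 ?exprn_ge0//.
      rewrite -[X in _ `^ X <= _](mulfV (lt0r_neq0 p0)) powRrM.
      by apply: powR_le_mono h; rewrite ?invr_gt0 ?powR_ge0.
    by rewrite -ler_pdivlMl ?exprn_gt0// -exprVn mulrC.
  have : cvgn (series (fun k => g k x)).
    apply: normed_cvg; apply: (@series_le_cvg _ _ (geometric (`|B| `^ p^-1) 2^-1)).
    - by move=> n; exact: normr_ge0.
    - by move=> n; rewrite /geometric/= mulr_ge0 ?powR_ge0 ?exprn_ge0 ?invr_ge0.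
    - exact: gB.
    - by apply: is_cvg_geometric_series; rewrite ger0_norm ?invr_ge0// invf_lt1// ltr1n.
  have -> : series (fun k => g k x) = (fun n => f (phi n) x - f (phi 0) x).
    by apply/funext => n; rewrite /series/= telescope_sumr.
  move=> h; have -> : (fun k => f (phi k) x) = (fun k => (f (phi k) x - f (phi 0) x) + f (phi 0) x).
    by apply/funext => k; rewrite subrK.
  by apply: is_cvgD => //; exact: is_cvg_cst.
(* An upper limit is measurable as a total function and agrees with the limit wherever the latter
   exists. *)
pose F x := fine (limn_esup (fun k => (f (phi k) x)%:E)).
have mF : measurable_fun [set: T] F.
  apply: measurableT_comp => //; apply: measurable_fun_limn_esup => k.
  by apply/measurable_EFinP; exact: (fL _).1.
have fF : {ae mu, forall x, (fun k => f (phi k) x) @ \oo --> F x}.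
  apply: filterS ae_cvg => x /cvg_ex[l fl].
  rewrite /F is_cvg_limn_esupE; last by apply/cvg_ex; exists l%:E; exact: cvg_comp fl _.
  have -> : limn (fun k => (f (phi k) x)%:E) = l%:E.
    by apply/cvg_lim => //; exact: cvg_comp fl _.
  by [].
have key eps : 0 < eps -> exists n0, forall n, (n0 <= n)%N ->
    Lp p (fun x => f n x - F x) /\ \int[mu]_x `|f n x - F x| `^ p <= eps.
  move=> e0; have [n0 Hn0] := fC _ e0; exists n0 => n nn0.
  have mfF : measurable_fun [set: T] (fun x => f n x - F x).
    by apply: measurable_funB => //; exact: (fL n).1.
  have := @fatou_bounded _ _ _ mu (fun k x => `|f n x - f (phi k) x| `^ p)
    (fun x => `|f n x - F x| `^ p) eps.
  case.
  - by move=> k; have [] : Lp p (fun x => f n x - f (phi k) x) by exact: LpB.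
  - by move=> k x; exact: powR_ge0.
  - exact: measurable_norm_powR.
  - by move=> x; exact: powR_ge0.
  - apply: filterS fF => x fFx; apply: cvg_powR => //.
    by apply: cvg_norm; apply: cvgB => //; exact: cvg_cst.
  - by exists n0 => // k /= n0k; apply: Hn0 => //; exact: leq_trans (phik k).
  by move=> h1 h2.
exists F.
  have [n0 /(_ n0 (leqnn _))[h _]] := key 1 ltr01.
  have -> : F = (fun x => f n0 x - (f n0 x - F x)) by apply/funext => x; ring.
  exact: LpB.
apply/cvg0_leP => [n|eps e0]; first by apply: Rintegral_ge0 => x _; exact: powR_ge0.
by have [n0 H] := key _ e0; exists n0 => // n /= /H[].
Qed.

End Lp_spaces.

(** * Dyadic cells and the Borel sets they generate *)

Section dyadic_cells.
Variables (R : realType) (n : nat).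
Notation mu := (lebesgue_rV R n).
Implicit Types (x y : 'rV[R]_n) (k : 'I_n -> nat) (m : {ffun 'I_n -> int}).

(** The level [k] depends on the coordinate because cells will be halved in one direction at a time.
    Indices are finite functions, so that unions of cells can be enumerated. *)
Definition cell_index k x : {ffun 'I_n -> int} :=
  [ffun i => Num.floor (2 ^+ k i * x ord0 i)].

Definition cell k m : set 'rV[R]_n := [set x | cell_index k x = m].

Definition cell_volume k : R := \prod_(i < n) (2 ^+ k i)^-1.

Lemma cell_volume_gt0 k : 0 < cell_volume k.
Proof. by apply: prodr_gt0 => i _; rewrite invr_gt0 exprn_gt0. Qed.

Lemma cell_itv k m : cell k m = [set x | forall i,
  x ord0 i \in `[(m i)%:~R / 2 ^+ k i, ((m i)%:~R + 1) / 2 ^+ k i[ ].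
Proof.
have p2 i : 0 < 2 ^+ k i :> R by rewrite exprn_gt0.
apply/seteqP; split=> x /=.
  move=> <- i; rewrite ffunE in_itv/= ler_pdivrMr// ltr_pdivlMr//.
  by rewrite mulrC floor_le_tmp/= -intrD1 floorD1_gt.
move=> H; apply/ffunP => i; rewrite ffunE; have := H i.
rewrite in_itv/= ler_pdivrMr// ltr_pdivlMr// mulrC => /andP[h1 h2].
by apply/eqP; rewrite floor_eq h1/= intrD.
Qed.

Lemma measurable_cell k m : measurable (cell k m).
Proof.
rewrite cell_itv.
rewrite [X in measurable X](_ : _ = \bigcap_(i in [set: 'I_n]) ((fun x : 'rV[R]_n => x ord0 i : measurableTypeR R) @^-1`
     `[(m i)%:~R / 2 ^+ k i, ((m i)%:~R + 1) / 2 ^+ k i[%classic)); last first.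
  by apply/seteqP; split => x /= H i *; exact: H.
apply: fin_bigcap_measurable => // i _.
by rewrite -[X in measurable X]setTI; exact: measurable_coord.
Qed.

Lemma measure_cell k m : mu (cell k m) = (cell_volume k)%:E.
Proof.
rewrite cell_itv.
rewrite (lebesgue_rV_box (A := fun i => `[(m i)%:~R / 2 ^+ k i, ((m i)%:~R + 1) / 2 ^+ k i[%classic)).
  rewrite /cell_volume -prodEFin; apply: eq_bigr => i _.
  have p2 : 0 < 2 ^+ k i :> R by rewrite exprn_gt0.
  rewrite lebesgue_measure_itv/= lte_fin ltr_pM2r ?invr_gt0// ltrDl ltr01.
  by rewrite -EFinB -mulrBl addrAC subrr add0r mul1r.
by move=> i.
Qed.

(** $\lfloor c\rfloor$ is the integer quotient of $\lfloor 2c\rfloor$ by 2; hence the index of a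
    point at a fine level determines its index at coarser levels. *)
Lemma floor_half (a b : R) : Num.floor (2 * a) = Num.floor (2 * b) ->
  Num.floor a = Num.floor b.
Proof.
suff H (c : R) : Num.floor c = (Num.floor (2 * c) %/ 2)%Z by move=> ab; rewrite H ab -H.
set j := Num.floor (2 * c).
have jc : j%:~R <= 2 * c by exact: floor_le_tmp.
have cj : 2 * c < (j + 1)%:~R by exact: floorD1_gt.
apply/eqP; rewrite floor_eq.
have jE := divz_eq j 2.
have r0 : (0 <= j %% 2)%Z by rewrite modz_ge0.
have r1 : (j %% 2 < 2)%Z by rewrite (ltz_pmod j).
set q := (j %/ 2)%Z in jE *; set r := (j %% 2)%Z in jE r0 r1.
have jq : (q * 2 <= j)%R by rewrite jE lerDl.
have jq1 : (j + 1 <= (q + 1) * 2)%R by rewrite mulrDl jE -addrA lerD2l mul1r lezD1.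
move: jq; rewrite -(ler_int R) intrM => jq.
move: jq1; rewrite -(ler_int R) [X in _ <= X -> _]intrM => jq1.
apply/andP; split; lra.
Qed.

Lemma cell_index_mono k k' x y : (forall i, (k i <= k' i)%N) ->
  cell_index k' x = cell_index k' y -> cell_index k x = cell_index k y.
Proof.
move=> kk' /ffunP H; apply/ffunP => i; have := H i; rewrite !ffunE.
rewrite -(subnK (kk' i)); elim: (k' i - k i)%N => [//|j IH].
by rewrite addSn !exprS -!mulrA => /floor_half; exact: IH.
Qed.

Lemma countable_bigcup_cells (G : set_system 'rV[R]_n) k (P : set {ffun 'I_n -> int}) :
  sigma_algebra setT G -> (forall m, G (cell k m)) ->
  G (\bigcup_(m in P) cell k m).
Proof.
move=> [G0 GC GU] Gc.
have -> : \bigcup_(m in P) cell k m = \bigcup_j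
    (if unpickle j is Some m then (if m \in P then cell k m else set0) else set0).
  apply/seteqP; split => x.
    by move=> [m Pm xm]; exists (pickle m) => //; rewrite pickleK mem_set.
  move=> [j _]; case: (unpickle j) => [m|//]; case: ifPn => // /set_mem Pm xm.
  by exists m.
apply: GU => j; case: (unpickle j) => [m|//]; by case: ifPn.
Qed.

(** The empty set is adjoined to obtain a family stable under intersection, as uniqueness of
    measures and Dynkin induction require. *)
Definition dyadic_cells : set_system 'rV[R]_n :=
  [set A | A = set0 \/ exists (k : nat) m, A = cell (fun=> k) m].

Lemma small_cell x (e : R) : 0 < e -> exists k : nat, forall y,
  cell_index (fun=> k) y = cell_index (fun=> k) x -> forall i, `|x ord0 i - y ord0 i| < e.
Proof.
move=> e0; have [k ke] : exists k : nat, 2^-1 ^+ k < e.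
  have := @cvg_geometric R 1 2^-1; rewrite ger0_norm ?invr_ge0// invf_lt1// ltr1n.
  move=> /(_ isT) /cvgrPdist_lt /(_ e e0)[k _ /(_ k (leqnn k))].
  rewrite sub0r normrN /geometric/= mul1r ger0_norm ?exprn_ge0 ?invr_ge0// => ke.
  by exists k.
exists k => y yx i.
have p2 : 0 < 2 ^+ k :> R by rewrite exprn_gt0.
apply: le_lt_trans ke; rewrite exprVn -(ler_pM2l p2) mulfV ?gt_eqF//.
rewrite -[X in X * _](ger0_norm (ltW p2)) -normrM mulrBr ltW//.
move/ffunP: yx => /(_ i); rewrite !ffunE => yx.
have := floor_le_tmp (2 ^+ k * x ord0 i); have := floorD1_gt (2 ^+ k * x ord0 i).
have := floor_le_tmp (2 ^+ k * y ord0 i); have := floorD1_gt (2 ^+ k * y ord0 i).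
rewrite yx intrD => *; rewrite ltr_norml; apply/andP; split; lra.
Qed.

(** An open set is the countable union of the dyadic cells it contains. The arbitrary [G] allows the
    use both for the generated sigma-algebra and for the product one. *)
Lemma dyadic_generation (A : set 'rV[R]_n) (G : set_system 'rV[R]_n) :
  sigma_algebra setT G -> dyadic_cells `<=` G ->
  (forall x, A x -> exists2 e, 0 < e & forall y, (forall i, `|x ord0 i - y ord0 i| < e) -> A y) ->
  G A.
Proof.
move=> sG dG Ao.
have -> : A = \bigcup_k \bigcup_(m in [set m | cell (fun=> k) m `<=` A]) cell (fun=> k) m.
  apply/seteqP; split => x.
    move=> Ax; have [e e0 He] := Ao x Ax; have [k Hk] := small_cell x e0.
    exists k => //; exists (cell_index (fun=> k) x) => //= y /= /Hk; exact: He.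
  by move=> [k _ [m /= mA xm]]; exact: mA.
have [_ _ GU] := sG; apply: GU => k.
by apply: countable_bigcup_cells => // m; apply: dG; right; exists k, m.
Qed.

Lemma dyadic_measurable : measurable = <<s dyadic_cells >> :> set_system 'rV[R]_n.
Proof.
apply/seteqP; split; last first.
  apply: smallest_sub; first exact: sigma_algebra_measurable.
  by move=> A [->|[k [m ->]]]; [exact: measurable0|exact: measurable_cell].
rewrite /measurable/=; apply: smallest_sub; first exact: smallest_sigma_algebra.
move=> A; rewrite -bigcup_seq/= => -[i _ [B mB <-]]; rewrite setTI.
pose T0 := g_sigma_algebraType dyadic_cells.
have mi : measurable_fun [set: T0] (fun x : T0 => (x : 'rV[R]_n) ord0 i : measurableTypeR R).
  move=> _; apply: (measurability _ (RGenInftyO.measurableE R)) => // _ [_ [c ->] <-].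
  rewrite setTI; apply: dyadic_generation.
  - exact: smallest_sigma_algebra.
  - exact: sub_sigma_algebra.
  - move=> x /=; rewrite in_itv/= => xc; exists (c - x ord0 i); first by rewrite subr_gt0.
    move=> y /(_ i); rewrite in_itv/= distrC ltr_norml => /andP[_]; lra.
by have := mi measurableT B mB; rewrite setTI.
Qed.

Lemma open_rV_measurable (U : set 'rV[R]_n) : open U -> measurable U.
Proof.
move=> oU; apply: dyadic_generation.
- exact: sigma_algebra_measurable.
- by move=> A [->|[k [m ->]]]; [exact: measurable0|exact: measurable_cell].
move=> x Ux; have /nbhs_ballP[e /= e0 He] : nbhs x U by exact: open_nbhs_nbhs.
by exists e => // y xy; apply: He; split => // i j; rewrite (ord1 i); exact: xy.
Qed.

Lemma continuous_rV_measurable (f : 'rV[R]_n -> R) : continuous f ->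
  measurable_fun [set: 'rV[R]_n] f.
Proof.
move=> cf _; apply: (measurability _ (RGenOpens.measurableE R)) => // _ [_ [a [b ->]] <-].
rewrite setTI; apply: open_rV_measurable.
by move/continuousP: cf; apply; exact: interval_open.
Qed.

Lemma dyadic_cells_setI : setI_closed dyadic_cells.
Proof.
move=> A B [->|[k [m ->]]]; first by rewrite set0I; left.
move=> [->|[k' [m' ->]]]; first by rewrite setI0; left.
wlog kk' : k m k' m' / (k <= k')%N.
  by move=> H; case: (leqP k k') => [|/ltnW] /H; [|rewrite setIC]; exact.
have [[x [xm xm']]|H] := pselect (exists x, cell (fun=> k) m x /\ cell (fun=> k') m' x).
  right; exists k', m'; apply/seteqP; split => y; first by case.
  move=> ym'; split => //; rewrite /cell/= -[RHS]xm.
  by apply: (@cell_index_mono _ (fun=> k')) => //; exact: etrans ym' (esym xm').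
by left; apply/seteqP; split => // x [xm xm']; apply: H; exists x.
Qed.

Lemma measure_rV_unique (m1 m2 : {measure set 'rV[R]_n -> \bar R}) :
  (forall (k : nat) m, m1 (cell (fun=> k) m) = m2 (cell (fun=> k) m)) ->
  (forall m, (m1 (cell (fun=> 0%N) m) < +oo)%E) ->
  forall A, measurable A -> m1 A = m2 A.
Proof.
move=> H Hoo.
pose g j : set 'rV[R]_n := if unpickle j is Some m then cell (fun=> 0%N) m else set0.
apply: (measure_unique dyadic_cells g).
- exact: dyadic_measurable.
- exact: dyadic_cells_setI.
- by move=> j; rewrite /g; case: unpickle => [m|]; [right; exists 0%N, m|left].
- apply/seteqP; split => // x _; exists (pickle (cell_index (fun=> 0%N) x)) => //.
  by rewrite /g pickleK.
- by move=> A [->|[k [m ->]]]; rewrite ?measure0.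
- by move=> j; rewrite /g; case: unpickle => [m|] //; rewrite measure0.
Qed.

End dyadic_cells.

Section affine_change_of_variables.
Variables (R : realType) (n : nat).
Notation mu := (lebesgue_rV R n).
Implicit Types (t : 'rV[R]_n) (c : R).

Definition affine_rV c t (x : 'rV[R]_n) : 'rV[R]_n := c *: x + t.

Lemma measurable_affine_rV c t : measurable_fun [set: 'rV[R]_n] (affine_rV c t).
Proof.
apply: measurable_fun_rV => i.
have -> : (fun x => affine_rV c t x ord0 i) = (fun x : 'rV[R]_n => c * x ord0 i + t ord0 i).
  by apply/funext => x; rewrite /affine_rV !mxE.
apply: measurable_funD => //; apply: measurable_funM => //; exact: measurable_coord.
Qed.

Lemma measure_affine_cell c t (k : nat) (m : {ffun 'I_n -> int}) : 0 < c ->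
  mu (affine_rV c t @^-1` cell (fun=> k) m) = ((c ^- n)%:E * mu (cell (fun=> k) m))%E.
Proof.
move=> c0; have p2 : 0 < 2 ^+ k :> R by rewrite exprn_gt0.
pose lo i := ((m i)%:~R / 2 ^+ k - t ord0 i) / c.
pose hi i := (((m i)%:~R + 1) / 2 ^+ k - t ord0 i) / c.
have -> : affine_rV c t @^-1` cell (fun=> k) m =
    [set x | forall i, `[lo i, hi i[%classic (x ord0 i)].
  have E (x : 'rV[R]_n) i : (x ord0 i \in `[lo i, hi i[) = (affine_rV c t x ord0 i \in
      `[(m i)%:~R / 2 ^+ k, ((m i)%:~R + 1) / 2 ^+ k[).
    by rewrite !in_itv/= /lo /hi !mxE ler_pdivrMr// ltr_pdivlMr// lerBlDr ltrBrDr ![x ord0 i * c]mulrC.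
  by rewrite cell_itv; apply/seteqP; split => x /= H i; have := H i; rewrite /= E.
rewrite (lebesgue_rV_box (A := fun i => `[lo i, hi i[%classic)); last by move=> i.
rewrite measure_cell /cell_volume -EFinM.
have -> : (c ^- n * \prod_(i < n) (2 ^+ k)^-1 = \prod_(i < n) (c^-1 * (2 ^+ k)^-1))%R.
  by rewrite big_split/= !prodr_const card_ord !exprVn.
rewrite -prodEFin; apply: eq_bigr => i _.
rewrite lebesgue_measure_itv/= lte_fin /lo /hi ltr_pM2r ?invr_gt0// ltrBlDr subrK.
rewrite ltr_pM2r ?invr_gt0// ltrDl ltr01 -EFinB; congr EFin.
by field; rewrite !gt_eqF.
Qed.

Lemma measure_affine c t (A : set 'rV[R]_n) : 0 < c -> measurable A ->
  mu (affine_rV c t @^-1` A) = ((c ^- n)%:E * mu A)%E.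
Proof.
move=> c0 mA; have c00 : 0 <= c ^- n by rewrite invr_ge0 exprn_ge0// ltW.
apply: (@measure_rV_unique R n (pushforward mu (affine_rV c t))
  (mscale (NngNum c00) mu) _ _ A mA) => [|? k m|? m].
- exact: measurable_affine_rV.
- by have H := @measure_affine_cell c t k m c0; exact: H.
- have H := @measure_affine_cell c t 0 m c0; apply: le_lt_trans (_ : _ <= _)%E (ltry (c ^- n * @cell_volume R n (fun=> 0%N))).
  by rewrite EFinM -(@measure_cell R n _ m) -H.
Qed.

Lemma measure_translation t (A : set 'rV[R]_n) : measurable A ->
  mu [set x | A (x + t)] = mu A.
Proof.
move=> mA; have := @measure_affine 1 t A ltr01 mA.
rewrite expr1n invr1 mul1e => <-; congr (mu _).
by apply/seteqP; split => x; rewrite /preimage/= /affine_rV scale1r.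
Qed.

Lemma measurable_translation t : measurable_fun [set: 'rV[R]_n] (fun x => x + t).
Proof.
have := measurable_affine_rV 1 t; rewrite (_ : affine_rV 1 t = fun x => x + t)//.
by apply/funext => x; rewrite /affine_rV scale1r.
Qed.

Lemma itg_translation t (f : 'rV[R]_n -> R) : itg mu f -> itg mu (fun x => f (x + t)) /\
  \int[mu]_x f (x + t) = \int[mu]_x f x.
Proof.
move=> fi; have mt := measurable_translation t.
have mf := itgM fi.
have mft : measurable_fun [set: 'rV[R]_n] (fun x => f (x + t)) by exact: measurableT_comp mf mt.
have E (g : 'rV[R]_n -> \bar R) : measurable_fun [set: 'rV[R]_n] g -> (forall x, 0 <= g x)%E ->
    (\int[mu]_x g x = \int[mu]_x g (x + t)%R)%E.
  move=> mg g0; transitivity (\int[pushforward mu (fun x => (x + t)%R)]_x g x)%E.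
    by apply: eq_measure_integral => A mA _; rewrite -[LHS](measure_translation t).
  by rewrite ge0_integral_pushforward.
have ft : itg mu (fun x => f (x + t)).
  apply/integrableP; split; first exact/measurable_EFinP.
  have /integrableP[_] := fi; rewrite E//.
  by do 2 apply: measurableT_comp => //.
split => //; congr fine.
transitivity (\int[pushforward mu (fun x => (x + t)%R)]_x (f x)%:E)%E.
  by rewrite (integral_pushforward mt)//; exact/measurable_EFinP.
by apply: eq_measure_integral => A mA _; rewrite -[RHS](measure_translation t).
Qed.

End affine_change_of_variables.

Section euclidean_norm.
Variables (R : realType) (n : nat).
Implicit Types (x y z : 'rV[R]_n) (c : R).

Lemma dotpC x y : dotp x y = dotp y x.
Proof. by apply: eq_bigr => i _; rewrite mulrC. Qed.

Lemma dotpDl x y z : dotp (x + y) z = dotp x z + dotp y z.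
Proof. by rewrite /dotp -big_split; apply: eq_bigr => i _; rewrite mxE mulrDl. Qed.

Lemma dotpZl c x y : dotp (c *: x) y = c * dotp x y.
Proof. by rewrite /dotp mulr_sumr; apply: eq_bigr => i _; rewrite mxE mulrA. Qed.

Lemma dotpDr x y z : dotp z (x + y) = dotp z x + dotp z y.
Proof. by rewrite dotpC dotpDl !(dotpC z). Qed.

Lemma dotpZr c x y : dotp x (c *: y) = c * dotp x y.
Proof. by rewrite dotpC dotpZl dotpC. Qed.

Lemma dotp_ge0 x : 0 <= dotp x x.
Proof. by apply: sumr_ge0 => i _; rewrite -expr2 sqr_ge0. Qed.

Lemma enorm_ge0 x : 0 <= enorm x.
Proof. exact: sqrtr_ge0. Qed.

Lemma sqr_enorm x : enorm x ^+ 2 = dotp x x.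
Proof. by rewrite sqr_sqrtr ?dotp_ge0. Qed.

Lemma enormZ c x : enorm (c *: x) = `|c| * enorm x.
Proof.
by rewrite /enorm dotpZl dotpZr mulrA -expr2 sqrtrM ?sqr_ge0// sqrtr_sqr.
Qed.

Lemma enorm0 : enorm (0 : 'rV[R]_n) = 0.
Proof. by rewrite -(scale0r 0) enormZ normr0 mul0r. Qed.

Lemma enormN x : enorm (- x) = enorm x.
Proof. by rewrite -scaleN1r enormZ normrN1 mul1r. Qed.

Lemma cauchy_schwarz x y : `|dotp x y| <= enorm x * enorm y.
Proof.
rewrite -ler_sqr ?nnegrE ?mulr_ge0 ?enorm_ge0//.
rewrite exprMn !sqr_enorm real_normK ?num_real//.
have [y0|y0] := eqVneq (dotp y y) 0.
  have yi i : y ord0 i = 0.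
    have /eqP := y0; rewrite /dotp psumr_eq0; last by move=> j _; rewrite -expr2 sqr_ge0.
    by move=> /allP/(_ i); rewrite mem_index_enum => /(_ isT)/implyP/(_ isT); rewrite mulf_eq0 orbb => /eqP.
  have -> : dotp x y = 0 by apply: big1 => i _; rewrite yi mulr0.
  by rewrite expr0n/= mulr_ge0 ?dotp_ge0.
have yp : 0 < dotp y y by rewrite lt_neqAle eq_sym y0 dotp_ge0.
(* The square of this vector is [dotp y y] times the difference of the two sides. *)
have := dotp_ge0 (dotp y y *: x + (- dotp x y) *: y).
rewrite dotpDl !dotpDr !dotpZl !dotpZr (dotpC y x).
set a := dotp x x; set b := dotp x y; set c := dotp y y => H.
rewrite -(ler_pM2l yp) -/c; move: H; rewrite expr2; lra.
Qed.

Lemma dotp_enorm0 x y : enorm x = 0 -> dotp x y = 0.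
Proof.
move=> x0; apply/eqP; rewrite -normr_eq0 eq_le normr_ge0 andbT.
by apply: le_trans (cauchy_schwarz x y) _; rewrite x0 mul0r.
Qed.

Lemma enormD x y : enorm (x + y) <= enorm x + enorm y.
Proof.
rewrite -ler_sqr ?nnegrE ?addr_ge0 ?enorm_ge0// sqrrD !sqr_enorm.
rewrite dotpDl !dotpDr (dotpC y x).
have := cauchy_schwarz x y; have := ler_norm (dotp x y).
rewrite -mulr_natr; lra.
Qed.

Lemma coord_le_enorm x i : `|x ord0 i| <= enorm x.
Proof.
rewrite -ler_sqr ?nnegrE ?enorm_ge0// sqr_enorm real_normK ?num_real//.
rewrite /dotp (bigD1 i)//= -expr2 lerDl; apply: sumr_ge0 => j _.
by rewrite -expr2 sqr_ge0.
Qed.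

Lemma enorm_le_sum x : enorm x <= \sum_(i < n) `|x ord0 i|.
Proof.
rewrite -ler_sqr ?nnegrE ?enorm_ge0 ?sumr_ge0// sqr_enorm /dotp expr2 mulr_sumr.
apply: ler_sum => i _; rewrite -expr2 -real_normK ?num_real// expr2.
apply: ler_wpM2r => //; rewrite (bigD1 i)//= lerDl; exact: sumr_ge0.
Qed.

Lemma measurable_dotp d (T : measurableType d) (u v : T -> 'rV[R]_n) :
  (forall i, measurable_fun [set: T] (fun w => u w ord0 i)) ->
  (forall i, measurable_fun [set: T] (fun w => v w ord0 i)) ->
  measurable_fun [set: T] (fun w => dotp (u w) (v w)).
Proof.
move=> mu mv; apply: measurable_sum => i.
exact: measurable_funM (mu i) (mv i).
Qed.

Lemma measurable_enorm d (T : measurableType d) (u : T -> 'rV[R]_n) :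
  (forall i, measurable_fun [set: T] (fun w => u w ord0 i)) ->
  measurable_fun [set: T] (fun w => enorm (u w)).
Proof.
move=> mu; have -> : (fun w => enorm (u w)) = (fun w => dotp (u w) (u w) `^ 2^-1).
  by apply/funext => w; rewrite /enorm -powR12_sqrt// dotp_ge0.
by apply: measurable_powR_comp; exact: measurable_dotp.
Qed.

End euclidean_norm.

(** * The volume of the Euclidean ball *)

Section ball_volume.
Variable (R : realType).
Local Notation leb := (@lebesgue_measure R).

Lemma integral_expRN_tail (c : R) :
  (\int[leb]_(s in `]c, +oo[) (expR (- s))%:E = (expR (- c))%:E)%E.
Proof.
have mE : measurable_fun [set: R] (fun s : R => expR (- s)).
  by apply: measurableT_comp => //.
have dE (x : R) : derivable (fun s : R => expR (- s)) x 1.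
  by apply/derivable1_diffP; apply: differentiable_comp => //; apply/derivable1_diffP; exact: derivable_expR.
have ce : continuous (fun s : R => expR (- s)).
  by move=> s; apply: continuous_comp; [exact: opp_continuous|exact: continuous_expR].
rewrite integral_itv_obnd_cbnd; last first.
  by apply/measurable_EFinP; exact: measurable_funTS.
rewrite (@ge0_continuous_FTC2y _ _ (fun s => - expR (- s)) c 0).
- by rewrite EFinN oppeK add0e.
- by move=> x _; exact: expR_ge0.
- exact: continuous_subspaceT.
- by rewrite -oppr0; apply: cvgN; exact: cvgr_expR.
- by move=> x _; apply: derivableN.
- by apply: cvgN; apply: cvg_at_right_filter; exact: ce.
- move=> x _; rewrite derive1E.
  have D : is_derive x 1 (fun s : R => - expR (- s)) (- (expR (- x) * -1)).
    apply: is_deriveN; apply: (@is_derive1_comp _ expR -%R) => //.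
  by rewrite derive_val mulrN1 opprK.
Qed.

Lemma integral_rV_cons n (f : 'rV[R]_n.+1 -> \bar R) :
  measurable_fun [set: 'rV[R]_n.+1] f -> (forall x, 0 <= f x)%E ->
  (\int[lebesgue_rV R n.+1]_x f x =
   \int[leb]_t \int[lebesgue_rV R n]_y f (rV_cons (t, y)))%E.
Proof.
move=> mf f0.
have mc := @measurable_rV_cons R n.
transitivity (\int[leb \x lebesgue_rV R n]_z f (rV_cons z))%E.
  exact: (@ge0_integral_pushforward _ _ _ _ R rV_cons mc (leb \x lebesgue_rV R n)%E setT f measurableT mf (fun y _ => f0 y)).
rewrite fubini_tonelli1//.
exact: measurableT_comp mf mc.
Qed.

Lemma dotp_cons n (t : measurableTypeR R) (y : 'rV[R]_n) :
  dotp (rV_cons (t, y)) (rV_cons (t, y)) = t ^+ 2 + dotp y y.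
Proof.
rewrite /dotp big_ord_recl rV_cons0 -expr2; congr (_ + _).
by apply: eq_bigr => i _; rewrite rV_consS.
Qed.

Lemma measurable_dotp_id n : measurable_fun [set: 'rV[R]_n] (fun x => dotp x x).
Proof. by apply: measurable_dotp => i; exact: measurable_coord. Qed.

Lemma integral_gauss_rV n :
  (\int[lebesgue_rV R n]_x (expR (- dotp x x))%:E = (pi `^ (n%:R / 2))%:E)%E.
Proof.
have mE m : measurable_fun [set: 'rV[R]_m] (fun x => (expR (- dotp x x))%:E).
  apply/measurable_EFinP; apply: measurableT_comp => //.
  by apply: measurableT_comp => //; exact: measurable_dotp_id.
elim: n => [|n IH].
  rewrite integral_dirac; [|exact: measurableT|exact: (mE 0%N)].
  rewrite diracT mul1e mul0r powRr0.
  by rewrite /dotp big_ord0 oppr0 expR0.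
rewrite integral_rV_cons//.
under eq_integral => t _.
  under eq_integral => y _ do rewrite dotp_cons opprD expRD EFinM.
  rewrite ge0_integralZl//; last exact: (mE n).
  rewrite IH.
  over.
rewrite ge0_integralZr//; last 2 first.
- by apply/measurable_EFinP; exact: measurable_gauss_fun.
- by rewrite lee_fin powR_ge0.
rewrite [X in (X * _)%E](@integralT_gauss R) -EFinM; congr EFin.
rewrite -powR12_sqrt ?pi_ge0// -powRD; last by rewrite gt_eqF ?pi_gt0// implybT.
by congr (_ `^ _); rewrite -natr1; field.
Qed.

Variable n : nat.
Notation mu := (lebesgue_rV R n).

Lemma eball_sublevel (r : R) : 0 <= r ->
  eball (0 : 'rV[R]_n) r = [set x | dotp x x < r ^+ 2].
Proof.
by move=> r0; apply/seteqP; split => x; rewrite /eball/= subr0 -sqr_enorm ltr_sqr ?nnegrE ?enorm_ge0.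
Qed.

Lemma measurable_eball (x0 : 'rV[R]_n) r : measurable (eball x0 r).
Proof.
rewrite (_ : eball x0 r = [set: 'rV[R]_n] `&` (fun x => enorm (x - x0)) @^-1` `]-oo, r[%classic).
  apply: measurable_enorm => // i.
  have -> : (fun w : 'rV[R]_n => (w - x0) ord0 i) = (fun w => w ord0 i - x0 ord0 i).
    by apply/funext => w; rewrite !mxE.
  by apply: measurable_funB => //; exact: measurable_coord.
by rewrite setTI; apply/seteqP; split => x; rewrite /eball/= in_itv.
Qed.

Lemma measure_eball (x0 : 'rV[R]_n) (r : R) : 0 < r ->
  mu (eball x0 r) = ((r ^+ n)%:E * mu (eball 0 1))%E.
Proof.
move=> r0; have := @measure_affine R n r^-1 (- (r^-1 *: x0)) (eball 0 1).
rewrite invr_gt0 => /(_ r0 (measurable_eball _ _)); rewrite exprVn invrK => <-.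
congr (mu _); apply/seteqP; split => x; rewrite /eball/preimage/affine_rV/= subr0 -scalerBr enormZ
  gtr0_norm ?invr_gt0// mulrC ltr_pdivrMr// mul1r//.
Qed.

Lemma measure_eball1_gt0 : (0 < mu (eball 0 1))%E.
Proof.
have n1 : 0 < n.+1%:R^-1 :> R by rewrite invr_gt0.
have [k Hk] := @small_cell R n 0 n.+1%:R^-1 n1.
apply: (@lt_le_trans _ _ (mu (cell (fun=> k) (cell_index (fun=> k) 0)))).
  by rewrite measure_cell lte_fin cell_volume_gt0.
apply: le_measure; rewrite ?inE.
- exact: measurable_cell.
- exact: measurable_eball.
move=> y /= /Hk yk; rewrite /eball/= subr0; apply: le_lt_trans (enorm_le_sum y) _.
apply: (@le_lt_trans _ _ (\sum_(i < n) n.+1%:R^-1)).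
  by apply: ler_sum => i _; have := yk i; rewrite mxE sub0r normrN => /ltW.
by rewrite sumr_const card_ord -[_ *+ n]mulr_natl ltr_pdivrMr// mul1r ltr_nat.
Qed.

(** With $e^{-|x|^2}=\int_{|x|^2}^{\infty}e^{-s}\,ds$ and Tonelli's theorem, the inner integral
    becomes the volume of the ball of radius $\sqrt s$, that is $s^{n/2}$ times the volume of the
    unit ball. This replaces polar coordinates. *)
Lemma layer_cake_gauss : (\int[mu]_x (expR (- dotp x x))%:E =
  mu (eball 0 1) * \int[leb]_(s in `]0%R, +oo[) (s `^ (n%:R / 2) * expR (- s))%:E)%E.
Proof.
pose F (z : 'rV[R]_n * measurableTypeR R) : \bar R :=
  if dotp z.1 z.1 < z.2 then (expR (- (z.2 : R)))%:E else 0%E.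
have mF : measurable_fun [set: 'rV[R]_n * measurableTypeR R] F.
  apply: measurable_fun_ifT => //.
    apply: measurable_fun_ltr; last exact: measurable_snd.
    by apply: measurable_dotp => i; exact: (measurableT_comp (measurable_coord i) measurable_fst).
  apply/measurable_EFinP; apply: measurableT_comp => //.
  by apply: measurableT_comp => //; exact: measurable_snd.
have F0 z : (0 <= F z)%E by rewrite /F; case: ifP => // _; rewrite lee_fin expR_ge0.
transitivity (\int[mu]_x \int[leb]_s F (x, s))%E.
  apply: eq_integral => x _; rewrite -integral_expRN_tail integral_mkcond.
  apply: eq_integral => s _; rewrite /F/= patchE.
  by rewrite mem_setE in_itv/= andbT.
rewrite -fubini_tonelli1// fubini_tonelli2// /fubini_G.
rewrite -ge0_integralZl//; last 2 first.
- apply/measurable_EFinP; apply: measurable_funTS; apply: measurable_funM.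
    exact: measurable_powR.
  by apply: measurableT_comp.
- by move=> s _; rewrite lee_fin mulr_ge0 ?powR_ge0 ?expR_ge0.
rewrite [RHS]integral_mkcond; apply: eq_integral => s _; rewrite patchE.
rewrite mem_setE in_itv/= andbT; case: ifPn => [s0|]; last first.
  rewrite -leNgt => s0; apply: integral0_eq => x _; rewrite /F/= ifF//.
  by apply/negbTE; rewrite -leNgt (le_trans s0)// dotp_ge0.
have sE : [set x : 'rV[R]_n | dotp x x < s] = eball 0 (Num.sqrt s).
  by rewrite eball_sublevel ?sqrtr_ge0// sqr_sqrtr// ltW.
transitivity (\int[mu]_(x in [set x : 'rV[R]_n | (dotp x x < s)%R]) (expR (- s))%:E)%E.
  rewrite [RHS]integral_mkcond; apply: eq_integral => x _; rewrite /F patchE/=.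
  by rewrite mem_setE.
rewrite sE integral_cst; last exact: measurable_eball.
have sq0 : 0 < Num.sqrt s by rewrite sqrtr_gt0.
transitivity ((expR (- s))%:E * ((Num.sqrt s ^+ n)%:E * mu (eball 0 1)))%E.
  by congr (_ * _)%E; exact: measure_eball.
rewrite muleA muleC; congr (_ * _)%E.
rewrite -EFinM mulrC; congr (_ * _)%:E.
by rewrite -powR_mulrn ?sqrtr_ge0// -powR12_sqrt ?(ltW s0)// -powRrM mulrC.
Qed.

(** The Gaussian integral is finite and positive, so neither factor of the layer-cake product is 0
    or infinite. Hence [Gamma], defined through [fine], is the true value of its integral here, and
    the quotient gives the volume. *)
Lemma Gamma_half_dim : (0 < Gamma (1 + n%:R / 2 : R)) /\
  mu (eball 0 1) = (pi `^ (n%:R / 2) / Gamma (1 + n%:R / 2))%:E.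
Proof.
have := layer_cake_gauss; rewrite integral_gauss_rV => H.
set I := (\int[leb]_(s in _) _)%E in H.
have GI : Gamma (1 + n%:R / 2 : R) = fine I.
  by rewrite /Gamma addrC addKr.
have I0 : (0 <= I)%E.
  by apply: integral_ge0 => s _; rewrite lee_fin mulr_ge0 ?powR_ge0 ?expR_ge0.
have w0 := measure_eball1_gt0.
have piR : 0 < pi `^ (n%:R / 2) :> R by rewrite powR_gt0// pi_gt0.
have In0 : I != 0%E.
  by apply/eqP => I00; move: H; rewrite I00 mule0 => -[] H; move: piR; rewrite H ltxx.
have Ifin : I \is a fin_num.
  rewrite ge0_fin_numE// ltNge leye_eq; apply/negP => /eqP Iy.
  by move: H; rewrite Iy gt0_muley.
have Ip : 0 < fine I by rewrite fine_gt0// lt0e In0 I0 -ge0_fin_numE.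
have wfin : mu (eball 0 1) \is a fin_num.
  rewrite ge0_fin_numE ?measure_ge0// ltNge leye_eq; apply/negP => /eqP wy.
  by move: H; rewrite wy gt0_mulye// lt0e In0.
rewrite GI; split => //.
rewrite -(fineK wfin); congr EFin.
move: H; rewrite -(fineK wfin) -(fineK Ifin) -EFinM => -[->].
by rewrite mulfK// gt_eqF.
Qed.

Lemma gamma_pi_gt0 : 0 < @gamma_pi R n.
Proof. by rewrite divr_gt0 ?(Gamma_half_dim.1)// powR_gt0// pi_gt0. Qed.

Lemma measure_eballE (x0 : 'rV[R]_n) (r : R) : 0 < r ->
  mu (eball x0 r) = (r ^+ n / @gamma_pi R n)%:E.
Proof.
move=> r0; rewrite measure_eball// Gamma_half_dim.2 -EFinM; congr EFin.
by rewrite /gamma_pi invf_div.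
Qed.

End ball_volume.

(** * Test functions *)

Section smooth_functions_of_one_variable.
Variable R : realType.
Implicit Types (f g : R -> R) (S : set (R -> R)).

(** A set of functions stable under differentiation certifies that all its members are infinitely
    differentiable: a coinductive definition in which no iterated derivative has to be named. *)
Definition smooth_class S := forall g, S g ->
  exists2 g', S g' & forall x : R, is_derive x (1 : R) g (g' x).

Definition smooth1 f := exists2 S, smooth_class S & S f.

Lemma smooth1_derive f : smooth1 f ->
  exists2 f', smooth1 f' & forall x : R, is_derive x (1 : R) f (f' x).
Proof. by move=> [S SS Sf]; have [f' Sf' H] := SS f Sf; exists f' => //; exists S. Qed.

(** Leibniz' rule leaves the products but not their sums; this is the stable class in which a
    product of two smooth functions lives. *)
Inductive product_span S1 S2 : set (R -> R) :=
| product_span_mul f g : S1 f -> S2 g -> product_span S1 S2 (f * g)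
| product_span_add f g : product_span S1 S2 f -> product_span S1 S2 g ->
    product_span S1 S2 (f + g).

Lemma smooth1M f g : smooth1 f -> smooth1 g -> smooth1 (fun x => f x * g x).
Proof.
move=> [S1 SS1 S1f] [S2 SS2 S2g]; exists (product_span S1 S2); last exact: product_span_mul.
move=> h; elim=> {f g S1f S2g h} [f g S1f S2g|f g _ [f' Sf' ff'] _ [g' Sg' gg']].
  have [f' Sf' ff'] := SS1 f S1f; have [g' Sg' gg'] := SS2 g S2g.
  exists (f * g' + f' * g).
    by apply: product_span_add; exact: product_span_mul.
  move=> x; have H := is_deriveM (ff' x) (gg' x).
  by apply: is_derive_eq H _; rewrite [RHS]/= /GRing.scale/= [g x * _]mulrC.
exists (f' + g'); first exact: product_span_add.
by move=> x; have H := is_deriveD (ff' x) (gg' x).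
Qed.

Lemma smooth1_affine f (a b : R) : smooth1 f -> smooth1 (fun x => f (a * x + b)).
Proof.
move=> [S SS Sf].
exists [set h | exists g (c : R), S g /\ h = fun x => c * g (a * x + b)]; last first.
  by exists f, 1; split => //; apply/funext => x; rewrite mul1r.
move=> _ [g [c [Sg ->]]]; have [g' Sg' gg'] := SS g Sg.
exists (fun x => (c * a) * g' (a * x + b)).
  by exists g', (c * a).
move=> x.
have h1 : is_derive x (1 : R) (fun x => a * x + b) a.
  have H : is_derive x (1 : R) (a \*: (id : R -> R) + cst b) (a *: 1 + 0).
    by apply: is_deriveD; exact: is_deriveZ.
  by apply: is_derive_eq H _; rewrite addr0 /GRing.scale/= mulr1.
have h2 := @is_derive1_comp R g (fun x => a * x + b) x _ _ (gg' (a * x + b)) h1.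
have h3 := is_deriveZ c h2.
by apply: is_derive_eq h3 _; rewrite /GRing.scale/=; ring.
Qed.

Lemma smooth1_primitive f F : smooth1 f -> (forall x : R, is_derive x (1 : R) F (f x)) -> smooth1 F.
Proof.
move=> [S SS Sf] FF; exists (S `|` [set F]); last by right.
move=> g [/SS[g' Sg' gg']|->]; first by exists g' => //; left.
by exists f => //; left.
Qed.

Lemma smooth1B f g : smooth1 f -> smooth1 g -> smooth1 (fun x => f x - g x).
Proof.
move=> [S1 SS1 S1f] [S2 SS2 S2g].
exists [set h | exists f g, [/\ S1 f, S2 g & h = f - g]]; last by exists f, g.
move=> _ [f0 [g0 [S1f0 S2g0 ->]]].
have [f' Sf' ff'] := SS1 _ S1f0; have [g' Sg' gg'] := SS2 _ S2g0.
exists (f' - g'); first by exists f', g'.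
by move=> x; exact: is_deriveB (ff' x) (gg' x).
Qed.

Lemma smooth1_derivable f x : smooth1 f -> derivable f x 1.
Proof. by move=> /smooth1_derive[f' _ /(_ x)[]]. Qed.

Lemma smooth1_continuous f : smooth1 f -> continuous f.
Proof.
move=> sf x; apply/differentiable_continuous/derivable1_diffP.
exact: smooth1_derivable.
Qed.

(* The family t^-n exp(-1/t) is stable under differentiation, up to linear
   combinations, and vanishes to infinite order at 0. *)
Definition flat n (t : R) : R := if 0 < t then t^-1 ^+ n * expR (- t^-1) else 0.

(** For $s=1/t$ and $m=n+2$, the inequality $e^{s/m}\ge s/m$ raised to the power $m$ beats $s^n$ by
    two powers of $s$; the resulting $t^2$ makes the difference quotient at 0 tend to 0. *)
Lemma flat_le n (t : R) : 0 < t -> flat n t <= n.+2%:R ^+ n.+2 * t ^+ 2.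
Proof.
move=> t0; rewrite /flat t0; set s := t^-1.
have s0 : 0 < s by rewrite invr_gt0.
have m0 : 0 < n.+2%:R :> R by [].
have h : (s / n.+2%:R) ^+ n.+2 <= expR s.
  have -> : expR s = expR (s / n.+2%:R) ^+ n.+2.
    by rewrite -expRM_natl mulrC divfK// gt_eqF.
  rewrite lerXn2r ?nnegrE ?expR_ge0 ?divr_ge0 ?(ltW s0)//.
  by apply: le_trans (expR_ge1Dx _); rewrite lerDr.
rewrite expRN -(ler_pM2r (expR_gt0 s)) mulfVK ?gt_eqF ?expR_gt0//.
have -> : s ^+ n = (n.+2%:R ^+ n.+2 * t ^+ 2) * (s / n.+2%:R) ^+ n.+2.
  rewrite expr_div_n; set A := _ ^+ n.+2; have A0 : A != 0 by rewrite expf_neq0// gt_eqF.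
  transitivity (s ^+ n.+2 * t ^+ 2); last by field.
  by rewrite -addn2 exprD -mulrA -exprMn /s mulVf ?gt_eqF// expr1n mulr1.
by apply: ler_wpM2l h; rewrite mulr_ge0// exprn_ge0// ltW.
Qed.

Lemma flat_ge0 n t : 0 <= flat n t.
Proof.
by rewrite /flat; case: ifP => // t0; rewrite mulr_ge0 ?expR_ge0 ?exprn_ge0// invr_ge0 ltW.
Qed.

Lemma is_derive_flat n (t : R) : is_derive t (1 : R) (flat n) (flat n.+2 t - n%:R * flat n.+1 t).
Proof.
have [t0|t0|t0] := ltgtP 0 t.
- have h0 : is_derive t (1 : R) (fun s : R => s^-1) (- t ^- 2).
    have tn0 : (id t : R) != 0 by rewrite gt_eqF.
    split; first exact: (@derivableV _ _ id _ _ tn0 (@derivable_id _ _ _ _)).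
    by rewrite (@deriveV _ _ id)//= derive_id /GRing.scale/= mulr1.
  have h1 : is_derive t (1 : R) ((fun s : R => s^-1) ^+ n) ((n%:R * t^-1 ^+ n.-1) *: (- t ^- 2)).
    exact: is_deriveX.
  have h2 : is_derive t (1 : R) (fun s : R => - s^-1) (- - t ^- 2) by exact: is_deriveN.
  have h3 : is_derive t (1 : R) (fun s : R => expR (- s^-1)) (expR (- t^-1) * - - t ^- 2).
    exact: (@is_derive1_comp _ expR (fun s : R => - s^-1)).
  have H := is_deriveM h1 h3.
  have E : {near t, ((fun s : R => s^-1) ^+ n * (fun s : R => expR (- s^-1))) =1 flat n}.
    near=> s; rewrite /flat; have -> : 0 < s.
      by near: s; exact: lt_nbhsr.
    by rewrite -[in RHS](_ : ((fun s : R => s^-1) ^+ n) s = s^-1 ^+ n)// fctE.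
  have [dH eH] := H; split.
    exact: (near_eq_derivable E dH).
  rewrite -(near_eq_derive _ E)// eH /GRing.scale/= opprK /flat t0.
  have -> : ((fun s : R => s^-1) ^+ n) t = t^-1 ^+ n by rewrite fctE.
  rewrite -(exprVn t 2); case: n {h1 H E dH eH} => [|m].
    by rewrite !mul0r !mulr0 addr0 subr0 expr0 mul1r mulrC.
  by rewrite /= !exprS; ring.
- have E : {near t, cst 0 =1 flat n}.
    near=> s; rewrite /flat ifF//; apply/negbTE; rewrite -leNgt ltW//.
    by near: s; exact: lt_nbhsl.
  have [dH eH] := @is_derive_cst R R^o R^o 0 t 1.
  have z k : flat k t = 0 by rewrite /flat ifF//; apply/negbTE; rewrite -leNgt ltW.
  split; first exact: (near_eq_derivable E dH).
  by rewrite -(near_eq_derive _ E)// eH !z mulr0 subr0.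
- rewrite -t0; have z k : flat k 0 = 0 by rewrite /flat ltxx.
  rewrite !z mulr0 subr0.
  have L : (fun h : R => h^-1 *: ((flat n \o shift 0) (h *: (1 : R)) - flat n 0)) @ 0^' --> (0 : R).
    apply/cvgrPdist_le => e e0; near=> h.
    rewrite sub0r normrN z subr0 /= addr0 /GRing.scale/= mulr1.
    have [h0|h0] := ltP 0 h; last by rewrite /flat ifF ?mulr0 ?normr0 ?(ltW e0)//; apply/negbTE; rewrite -leNgt.
    rewrite normrM ger0_norm ?invr_ge0 ?(ltW h0)// ger0_norm ?flat_ge0//.
    apply: le_trans (ler_wpM2l _ (flat_le n h0)) _; first by rewrite invr_ge0 ltW.
    rewrite mulrCA expr2 (mulrA h^-1) mulVf ?gt_eqF// mul1r.
    have C0 : 0 < n.+2%:R ^+ n.+2 :> R by rewrite exprn_gt0.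
    rewrite -ler_pdivlMl//; apply: le_trans (ler_norm _) _.
    near: h; apply: dnbhs0_le; by rewrite mulr_gt0// invr_gt0.
  split; first by apply/cvg_ex; exists 0.
  by apply/cvg_lim.
Unshelve. all: by end_near. Qed.

Inductive flat_span : set (R -> R) :=
| flat_span_flat n : flat_span (flat n)
| flat_span_scale (c : R) f : flat_span f -> flat_span (c \*: f)
| flat_span_sub f g : flat_span f -> flat_span g -> flat_span (f - g).

Lemma smooth1_flat n : smooth1 (flat n).
Proof.
exists flat_span; last exact: flat_span_flat.
move=> f; elim=> {f} [m|c f _ [f' Sf' ff']|f g _ [f' Sf' ff'] _ [g' Sg' gg']].
- exists (flat m.+2 - (m%:R : R) \*: flat m.+1).
    by apply: flat_span_sub; [|apply: flat_span_scale]; exact: flat_span_flat.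
  by move=> x; exact: is_derive_flat.
- exists (c \*: f'); first exact: flat_span_scale.
  by move=> x; exact: is_deriveZ.
- exists (f' - g'); first exact: flat_span_sub.
  by move=> x; exact: is_deriveB.
Qed.

(* Converges to the indicator of the half-open interval [a, b[. *)
Definition bump (a b : R) k (t : R) : R :=
  flat 0 (k.+1%:R ^+ 2 * t + (k.+1%:R - k.+1%:R ^+ 2 * a)) *
  flat 0 (- k.+1%:R * t + k.+1%:R * b).

Lemma smooth1_bump a b k : smooth1 (bump a b k).
Proof. by apply: smooth1M; apply: smooth1_affine; exact: smooth1_flat. Qed.

Lemma flat0_le1 t : flat 0 t <= 1.
Proof.
rewrite /flat; case: ifP => // t0; rewrite expr0 mul1r -expR0 ler_expR.
by rewrite oppr_le0 invr_ge0 ltW.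
Qed.

Lemma flat0_ge (t : R) : 0 < t -> 1 - t^-1 <= flat 0 t.
Proof. by move=> t0; rewrite /flat t0 expr0 mul1r; exact: expR_ge1Dx. Qed.

Lemma flat_eq0 n (t : R) : t <= 0 -> flat n t = 0.
Proof. by move=> t0; rewrite /flat ifF//; apply/negbTE; rewrite -leNgt. Qed.

Lemma bump_bounds a b k t : 0 <= bump a b k t <= 1.
Proof.
rewrite mulr_ge0 ?flat_ge0//= -[leRHS]mulr1.
by apply: ler_pM; rewrite ?flat_ge0 ?flat0_le1.
Qed.

Lemma bump_out a b k t : t <= a - 1 \/ b <= t -> bump a b k t = 0.
Proof.
have k0 : 0 < k.+1%:R :> R by [].
have k1 : 1 <= k.+1%:R :> R by rewrite ler1n.
move=> [ta|bt]; rewrite /bump.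
  rewrite [X in X * _]flat_eq0 ?mul0r//.
  have : k.+1%:R ^+ 2 * t <= k.+1%:R ^+ 2 * (a - 1) by rewrite ler_wpM2l// exprn_ge0.
  have : k.+1%:R * 1 <= k.+1%:R * k.+1%:R :> R by rewrite ler_wpM2l.
  rewrite -expr2; set m := k.+1%:R; lra.
rewrite [X in _ * X]flat_eq0 ?mulr0//.
by rewrite mulNr addrC -mulrBr pmulr_rle0// subr_le0.
Qed.

Lemma cvg_flat0 (c : nat -> R) d : 0 < d -> (forall k, k.+1%:R * d <= c k) ->
  (fun k => flat 0 (c k)) @ \oo --> (1 : R).
Proof.
move=> d0 kc.
have h : (fun k => 1 - k.+1%:R^-1 * d^-1) @ \oo --> (1 : R).
  rewrite -[X in _ --> X]subr0 -(mul0r d^-1); apply: cvgB; first exact: cvg_cst.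
  by apply: cvgM; [exact: cvg_harmonic|exact: cvg_cst].
apply: (@squeeze_cvgr _ _ _ _ (fun k => 1 - k.+1%:R^-1 * d^-1) (cst 1)) => //; last exact: cvg_cst.
apply: nearW => k.
have c0 : 0 < c k by apply: lt_le_trans (kc k); rewrite mulr_gt0.
rewrite flat0_le1 andbT; apply: le_trans (flat0_ge c0).
by rewrite lerB// -invfM lef_pV2 ?posrE// mulr_gt0.
Qed.

(** With $m=k+1$ the two arguments are $m^2(t-a)+m$ and $m(b-t)$. The first tends to infinity for
    $t\ge a$, the end point included, and is eventually nonpositive for $t<a$; the second vanishes
    at $t=b$. This yields the half-open interval. *)
Lemma cvg_bump a b t : (fun k => bump a b k t) @ \oo --> (\1_`[a, b[ t : R).
Proof.
rewrite indicE mem_setE in_itv/=.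
have [at_|ta] := leP a t; last first.
  have [k0 Hk] : exists k0, forall k, (k0 <= k)%N -> k.+1%:R ^+ 2 * t + (k.+1%:R - k.+1%:R ^+ 2 * a) <= 0.
    exists (Num.truncn ((a - t)^-1)) => k kk.
    have at0 : 0 < a - t by rewrite subr_gt0.
    have : (a - t)^-1 <= k.+1%:R.
      apply: (@le_trans _ _ (Num.truncn (a - t)^-1).+1%:R); last by rewrite ler_nat.
      exact/ltW/truncnS_gt.
    rewrite -[_^-1]mul1r ler_pdivrMr// => H.
    have : k.+1%:R * 1 <= k.+1%:R * (k.+1%:R * (a - t)) by rewrite ler_wpM2l.
    rewrite mulr1 mulrA -expr2 mulrBr; lra.
  apply: cvg_near_cst; exists k0 => // k /= /Hk H.
  by rewrite /bump flat_eq0// mul0r.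
have [tb|bt] := ltP t b; last first.
  apply: cvg_near_cst; apply: nearW => k; rewrite bump_out//; by right.
rewrite /= -[X in _ --> X]mulr1; apply: cvgM.
  apply: (@cvg_flat0 _ 1) => // k; rewrite mulr1 addrCA -mulrBr lerDl.
  by rewrite mulr_ge0 ?exprn_ge0// subr_ge0.
apply: (@cvg_flat0 _ (b - t)); first by rewrite subr_gt0.
by move=> k; rewrite mulrBr mulNr addrC.
Qed.

Local Notation leb := (@lebesgue_measure R).

(** For $a\le b$, the primitive of the indicator of $[a,b[$ that vanishes to the left of $a$. *)
Definition ramp (a b s : R) : R := Num.max 0 (Num.min s b - a).

Definition bump_primitive a b k (s : R) : R := \int[leb]_(x in `]-oo, s]) bump a b k x.

Lemma measurable_bump a b k : measurable_fun [set: R] (bump a b k).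
Proof. by apply: continuous_measurable_fun; apply: smooth1_continuous; exact: smooth1_bump. Qed.

Lemma lebesgue_itv (a b : R) (c d : bool) : a <= b ->
  leb [set` Interval (BSide c a) (BSide d b)] = (b - a)%:E.
Proof.
move=> ab; have H := @lebesgue_measure_itv R (Interval (BSide c a) (BSide d b)).
apply: (eq_trans H); rewrite /= lte_fin; case: ltP => // ba.
by have -> : a = b; [apply/eqP; rewrite eq_le ab ba|rewrite subrr].
Qed.

Lemma itg_itv (a b : R) (c : bool) (d : bool) : itg leb \1_[set` Interval (BSide c a) (BSide d b)].
Proof. exact: integrable_indic_itv. Qed.

Lemma itg_bump a b k : itg leb (bump a b k).
Proof.
apply: (@itg_le _ _ _ leb (bump a b k) \1_`[a - 1, b]); [exact: measurable_bump|exact: itg_itv|move=> x].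
have /andP[b0 b1] := bump_bounds a b k x.
rewrite ger0_norm// indicE mem_setE in_itv/=.
case: (boolP (_ && _)) => //; rewrite negb_and -!ltNge => /orP H.
by rewrite bump_out//; case: H => /ltW; [left|right].
Qed.

Lemma is_derive_bump_primitive a b k (s : R) :
  is_derive s (1 : R) (bump_primitive a b k) (bump a b k s).
Proof.
have [||||d1 d2] := @continuous_FTC1 R (bump a b k) -oo%O s (s + 1).
- by rewrite ltrDl.
- apply: integrableS (itg_bump a b k) => //.
- exact: ltNyr.
- by apply: smooth1_continuous; exact: smooth1_bump.
split; [exact: d1|rewrite -derive1E; exact: d2].
Qed.

Lemma smooth1_bump_primitive a b k : smooth1 (bump_primitive a b k).
Proof. exact: smooth1_primitive (smooth1_bump a b k) (is_derive_bump_primitive a b k). Qed.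

Lemma bump_primitiveE a b k s :
  bump_primitive a b k s = \int[leb]_x (\1_`]-oo, s] x * bump a b k x).
Proof.
rewrite /bump_primitive Rintegral_mkcond; apply: eq_Rintegral => x _.
by rewrite patchE indicE mem_setE; case: ifP => _; rewrite ?mul1r ?mul0r.
Qed.

Lemma itg_bump_cut a b k s : itg leb (fun x => \1_`]-oo, s] x * bump a b k x).
Proof.
apply: (itg_le _ (itg_bump a b k)) => [|x].
  by apply: measurable_funM => //; exact: measurable_bump.
have /andP[b0 b1] := bump_bounds a b k x.
by rewrite normrM [`|bump _ _ _ _|]ger0_norm// ler_piMl// indicE; case: (_ \in _); rewrite ?normr1 ?normr0.
Qed.

Lemma bump_primitive_bounds a b k s : a <= b -> 0 <= bump_primitive a b k s <= b - a + 1.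
Proof.
move=> ab; rewrite bump_primitiveE; apply/andP; split.
  apply: Rintegral_ge0 => x _; have /andP[b0 _] := bump_bounds a b k x.
  by rewrite mulr_ge0// indicE.
have -> : b - a + 1 = \int[leb]_x \1_`[a - 1, b] x.
  rewrite /Rintegral integral_indic// setIT.
  transitivity (fine (b - (a - 1))%:E); first by rewrite /= opprB addrA addrAC.
  by congr fine; apply/esym; apply: lebesgue_itv; rewrite lerBlDr (le_trans ab)// lerDl.
apply: Int_le; [exact: itg_bump_cut|exact: itg_itv|move=> x].
have /andP[b0 b1] := bump_bounds a b k x.
apply: (@le_trans _ _ (bump a b k x)).
  by rewrite ler_piMl// indicE; case: (_ \in _).
rewrite indicE mem_setE in_itv/=; case: (boolP (_ && _)) => //; rewrite negb_and -!ltNge => /orP H.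
by rewrite bump_out//; case: H => /ltW; [left|right].
Qed.

Lemma bump_primitive_left a b k s : s <= a - 1 -> bump_primitive a b k s = 0.
Proof.
move=> sa; rewrite bump_primitiveE; transitivity (\int[leb]_x (0 * (cst 0 x : R))); last first.
  rewrite IntZ ?mul0r//; exact: integrable0.
apply: eq_Rintegral => x _; rewrite mul0r indicE mem_setE in_itv/=.
have [xs|] := leP x s; last by rewrite mul0r.
by rewrite bump_out ?mulr0//; left; exact: le_trans sa.
Qed.

Lemma bump_primitive_right a b k s s' : b <= s -> b <= s' ->
  bump_primitive a b k s = bump_primitive a b k s'.
Proof.
move=> bs bs'; rewrite !bump_primitiveE; apply: eq_Rintegral => x _.
rewrite !indicE !mem_setE !in_itv/=; have [bx|xb] := leP b x.
  by rewrite bump_out ?mulr0//; right.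
by rewrite (le_trans (ltW xb) bs) (le_trans (ltW xb) bs').
Qed.

Lemma cvg_bump_primitive a b s : a <= b ->
  (fun k => bump_primitive a b k s) @ \oo --> ramp a b s.
Proof.
move=> ab.
have [] := @dct _ _ _ leb (fun k x => \1_`]-oo, s] x * bump a b k x)
  (fun x => \1_`]-oo, s] x * \1_`[a, b[ x) \1_`[a - 1, b].
- by move=> k; exact: itgM (itg_bump_cut a b k s).
- by apply: measurable_funM.
- by apply: aeW => x; apply: cvgM; [exact: cvg_cst|exact: cvg_bump].
- exact: itg_itv.
- apply: aeW => x k; have /andP[b0 b1] := bump_bounds a b k x.
  apply: (@le_trans _ _ (bump a b k x)).
    rewrite normrM [`|bump _ _ _ _|]ger0_norm// ler_piMl// indicE; case: (_ \in _); by rewrite ?normr1 ?normr0.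
  rewrite indicE mem_setE in_itv/=; case: (boolP (_ && _)) => //; rewrite negb_and -!ltNge => /orP H.
  by rewrite bump_out//; case: H => /ltW; [left|right].
move=> _ + _.
under eq_fun do rewrite -bump_primitiveE.
suff -> : \int[leb]_x (\1_`]-oo, s] x * \1_`[a, b[ x) = ramp a b s by [].
transitivity (\int[leb]_x \1_(`]-oo, s] `&` `[a, b[) x).
  by apply: eq_Rintegral => x _; rewrite indicI.
rewrite /Rintegral integral_indic//; last exact: measurableI.
rewrite setIT /ramp; have [sb|bs] := leP s b.
  have [sa|as_] := leP s a.
    rewrite max_l ?subr_le0//.
    rewrite -[RHS]/(fine 0%E); congr fine.
    apply: (@subset_measure0 _ _ _ leb _ [set a]) => //; last exact: lebesgue_measure_set1.
      exact: measurableI.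
    move=> x [/=]; rewrite !in_itv/= => xs /andP[ax _].
    by apply/eqP; rewrite eq_le ax (le_trans xs sa).
  rewrite max_r ?subr_ge0 1?ltW//.
  have [sb'|] := ltP s b; last first.
    move=> bs; have -> : s = b by apply/eqP; rewrite eq_le sb bs.
    have -> : `]-oo, b] `&` `[a, b[ = `[a, b[%classic.
      by apply/seteqP; split => x /=; rewrite !in_itv/=; [case|move=> /andP[-> /[dup] /ltW -> ->]].
    by apply: (congr1 fine (lebesgue_itv _ _ ab)).
  have -> : `]-oo, s] `&` `[a, b[ = `[a, s]%classic.
    apply/seteqP; split => x /=; rewrite !in_itv/=; first by move=> [-> /andP[->]].
    by move=> /andP[-> xs]; rewrite xs (le_lt_trans xs).
  by apply: (congr1 fine (lebesgue_itv _ _ _)); exact: ltW.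
have -> : `]-oo, s] `&` `[a, b[ = `[a, b[%classic.
  apply/seteqP; split => x /=; rewrite !in_itv/=; first by case.
  by move=> /andP[-> xb]; rewrite xb (ltW (lt_trans xb bs)).
by rewrite max_r ?subr_ge0//; apply: (congr1 fine (lebesgue_itv _ _ _)).
Qed.

End smooth_functions_of_one_variable.

(** * Tensor products of functions of one variable *)

Section tensor_products.
Variables (R : realType) (n : nat).
Implicit Types (f : 'I_n -> R -> R) (x : 'rV[R]_n) (i : 'I_n).

Definition tensor f x : R := \prod_(i < n) f i (x ord0 i).

Definition replace f i (h : R -> R) : 'I_n -> R -> R :=
  fun j => if j == i then h else f j.

Lemma tensor_replace f i h x :
  tensor (replace f i h) x = h (x ord0 i) * \prod_(j < n | j != i) f j (x ord0 j).
Proof.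
rewrite /tensor (bigD1 i)//= /replace eqxx; congr (_ * _).
by apply: eq_bigr => j /negbTE ->.
Qed.

Lemma tensorE f i x :
  tensor f x = f i (x ord0 i) * \prod_(j < n | j != i) f j (x ord0 j).
Proof. by rewrite /tensor (bigD1 i). Qed.

Lemma tensor_line f i x (h : R) : tensor f (h *: delta_mx ord0 i + x) =
  f i (h + x ord0 i) * \prod_(j < n | j != i) f j (x ord0 j).
Proof.
rewrite (tensorE _ i) !mxE !eqxx/= mulr1; congr (_ * _).
by apply: eq_bigr => j /negbTE ji; rewrite !mxE ji andbF mulr0 add0r.
Qed.

Lemma partial_tensor f i (f' : R -> R) : (forall t : R, is_derive t (1 : R) (f i) (f' t)) ->
  partial i (tensor f) = tensor (replace f i f').
Proof.
move=> ff'; apply/funext => x; rewrite tensor_replace.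
set C := \prod_(j < n | j != i) f j (x ord0 j).
have [d1 d2] := is_deriveZ C (ff' (x ord0 i)).
rewrite mulrC -[RHS]/(C *: f' (x ord0 i)) -d2 /partial /derive.
rewrite (_ : (fun h : R => h^-1 *: ((tensor f \o shift x) (h *: delta_mx ord0 i) - tensor f x)) =
  (fun h => h^-1 *: (((C \*: f i) \o shift (x ord0 i)) (h *: 1) - (C \*: f i) (x ord0 i))))//.
apply/funext => h /=.
by rewrite tensor_line (tensorE _ i) -/C /= [h *: 1]mulr1 /GRing.scale/= ![C * _]mulrC.
Qed.

Lemma differentiable_tensor f : (forall i (t : R), derivable (f i) t 1) ->
  forall x, differentiable (tensor f) x.
Proof.
move=> df x; rewrite /tensor.
elim: (index_enum _) => [|i s IH].
  rewrite (_ : (fun x : 'rV[R]_n => _) = cst 1); first exact: differentiable_cst.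
  by apply/funext => y; rewrite big_nil.
rewrite (_ : (fun x : 'rV[R]_n => _) = (fun x => f i (x ord0 i)) *
    (fun x => \prod_(j <- s) f j (x ord0 j))).
  apply: differentiableM => //; apply: (@differentiable_comp _ _ _ _ (fun x : 'rV[R]_n => x ord0 i) (f i)).
    exact: differentiable_coord.
  by apply/derivable1_diffP; exact: df.
by apply/funext => y; rewrite big_cons.
Qed.

Lemma smooth_tensor f : (forall i, smooth1 (f i)) -> smooth (tensor f).
Proof.
move=> sf s x.
have [g sg ->] : exists2 g, (forall i, smooth1 (g i)) & foldr partial (tensor f) s = tensor g.
  elim: s => [|i s [g sg /= ->]]; first by exists f.
  have [g' sg' gg'] := smooth1_derive (sg i).
  exists (replace g i g'); last exact: partial_tensor.
  by move=> j; rewrite /replace; case: ifP.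
by apply: differentiable_tensor => i t; exact: smooth1_derivable.
Qed.

Definition cbox (a b : 'I_n -> R) : set 'rV[R]_n :=
  [set x | forall i, x ord0 i \in `[a i, b i]].

Lemma compact_cbox a b : compact (cbox a b).
Proof. by apply: (@rV_compact _ _ (fun i => `[a i, b i]%classic)) => i; exact: segment_compact. Qed.

Lemma test_function_support (phi : 'rV[R]_n -> R) a b : smooth phi ->
  (forall x, phi x != 0 -> cbox a b x) -> test_function phi.
Proof.
move=> sphi H; split => //.
have cK := @compact_cbox a b.
have clK : closed (cbox a b) by apply: compact_closed => //; exact: norm_hausdorff.
apply: (subclosed_compact (@closed_closure _ _) cK).
have -> : cbox a b = closure (cbox a b) by exact/closure_id.
exact: closure_subset.
Qed.

Lemma tensor_out f x i : f i (x ord0 i) = 0 -> tensor f x = 0.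
Proof. by move=> fi0; rewrite (tensorE _ i) fi0 mul0r. Qed.

Lemma test_function_tensor f a b : (forall i, smooth1 (f i)) ->
  (forall i t, t \notin `[a i, b i] -> f i t = 0) -> test_function (tensor f).
Proof.
move=> sf fout; apply: (@test_function_support _ a b); first exact: smooth_tensor.
move=> x fx i; apply: contraNT fx => xi; apply/eqP.
by apply: (@tensor_out _ _ i); exact: fout.
Qed.

Lemma tensor_bound f a b (M : R) : 0 <= M -> (forall i t, `|f i t| <= M) ->
  (forall i t, t \notin `[a i, b i] -> f i t = 0) ->
  forall x, `|tensor f x| <= M ^+ n * \1_(cbox a b) x.
Proof.
move=> M0 fM fout x; rewrite indicE; case: (boolP (x \in cbox a b)) => [_|/negP xK].
  rewrite mulr1 /tensor normr_prod -[n in M ^+ n]card_ord -prodr_const.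
  by apply: ler_prod => i _; rewrite normr_ge0 fM.
have [i xi] : exists i, x ord0 i \notin `[a i, b i].
  apply: contrapT => H; apply: xK; rewrite inE => i.
  by apply: contrapT => /negP xi; apply: H; exists i.
by rewrite (@tensor_out _ _ i) ?fout// normr0 mulr0.
Qed.

Lemma cvg_tensor (f_ : nat -> 'I_n -> R -> R) f x :
  (forall i, (fun k => f_ k i (x ord0 i)) @ \oo --> f i (x ord0 i)) ->
  (fun k => tensor (f_ k) x) @ \oo --> tensor f x.
Proof.
move=> H; rewrite /tensor; elim: (index_enum _) => [|i s IH].
  by rewrite big_nil; under eq_fun do rewrite big_nil; exact: cvg_cst.
rewrite big_cons; under eq_fun do rewrite big_cons.
exact: cvgM.
Qed.

Lemma measurable_tensor f : (forall i, measurable_fun [set: R] (f i)) ->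
  measurable_fun [set: 'rV[R]_n] (tensor f).
Proof.
move=> mf; rewrite /tensor; apply: measurable_prod => i _.
exact: (measurableT_comp (mf i) (measurable_coord i)).
Qed.

Lemma measurable_cbox a b : measurable (cbox a b).
Proof.
rewrite [X in measurable X](_ : _ = \bigcap_(i in [set: 'I_n])
   ((fun x : 'rV[R]_n => x ord0 i : measurableTypeR R) @^-1` `[a i, b i]%classic)); last first.
  by apply/seteqP; split => x /= H i *; exact: H.
apply: fin_bigcap_measurable => // i _.
by rewrite -[X in measurable X]setTI; exact: measurable_coord.
Qed.

Lemma cbox_fin a b : (lebesgue_rV R n (cbox a b) < +oo)%E.
Proof.
rewrite (lebesgue_rV_box (A := fun i => `[a i, b i]%classic)); last by move=> i.
suff : (0 <= \big[*%E/1]_(i < n) lebesgue_measure `[a i, b i]%classic /\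
    \big[*%E/1]_(i < n) lebesgue_measure `[a i, b i]%classic < +oo)%E by case.
elim/big_rec: _ => [|i y _ [y0 yoo]]; first by rewrite lee_fin ltry.
split; first by apply: mule_ge0.
apply: lte_mul_pinfty => //.
  rewrite ge0_fin_numE//; rewrite lebesgue_measure_itv/=; case: ifP => _; by rewrite ?ltry.
Qed.

End tensor_products.

Section local_integrability.
Variables (R : realType) (n : nat).
Notation mu := (lebesgue_rV R n).
Implicit Types (u v phi : 'rV[R]_n -> R) (a b : 'I_n -> R) (p : R).

Definition locally_itg u := measurable_fun [set: 'rV[R]_n] u /\
  forall a b, itg mu (fun x => \1_(cbox a b) x * u x).

Lemma itg_cbox a b : itg mu \1_(cbox a b).
Proof.
apply/integrableP; split; first by apply/measurable_EFinP; apply: measurable_indic; exact: measurable_cbox.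
under eq_integral => x _ do rewrite /= ger0_norm//.
rewrite integral_indic//; last exact: measurable_cbox.
by rewrite setIT cbox_fin.
Qed.

Lemma le_1_powR p (y : R) : 1 <= p -> 0 <= y -> y <= 1 + y `^ p.
Proof.
move=> p1 y0; have [y1|/ltW y1] := leP y 1; first by rewrite (le_trans y1)// lerDl powR_ge0.
apply: (@le_trans _ _ (y `^ p)); last by rewrite lerDr.
by rewrite -[leLHS]powRr1//; apply: ler_powR.
Qed.

Lemma Lp_locally_itg p u : 1 <= p -> Lp mu p u -> locally_itg u.
Proof.
move=> p1 [mu_ ui]; split => // a b.
apply: (itg_le _ (itgD (itg_cbox a b) ui)) => [|x].
  by apply: measurable_funM => //; apply: measurable_indic; exact: measurable_cbox.
rewrite normrM indicE; case: (_ \in _); last by rewrite normr0 mul0r add0r powR_ge0.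
by rewrite normr1 mul1r le_1_powR.
Qed.

Lemma locally_itg_mul u phi a b (M : R) : locally_itg u ->
  measurable_fun [set: 'rV[R]_n] phi -> (forall x, `|phi x| <= M * \1_(cbox a b) x) ->
  itg mu (fun x => u x * phi x).
Proof.
move=> [mu_ ui] mphi bphi; apply: (itg_le _ (itgZ M (itg_norm (ui a b)))) => [|x].
  exact: measurable_funM.
rewrite normrM mulrC [X in _ <= _ * X]normrM [X in _ <= _ * (X * _)]ger0_norm ?indicE// mulrA.
by apply: ler_wpM2r; [|rewrite -indicE].
Qed.

Lemma dct_local u (phi_ : nat -> 'rV[R]_n -> R) phi a b (M : R) : locally_itg u ->
  (forall k, measurable_fun [set: 'rV[R]_n] (phi_ k)) ->
  measurable_fun [set: 'rV[R]_n] phi ->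
  {ae mu, forall x, (fun k => phi_ k x) @ \oo --> phi x} ->
  (forall k x, `|phi_ k x| <= M * \1_(cbox a b) x) ->
  itg mu (fun x => u x * phi x) /\
  (fun k => \int[mu]_x (u x * phi_ k x)) @ \oo --> \int[mu]_x (u x * phi x).
Proof.
move=> [mu_ ui] mphi_ mphi cphi bphi.
have [] := @dct _ _ _ mu (fun k x => u x * phi_ k x) (fun x => u x * phi x)
  (fun x => M * `|\1_(cbox a b) x * u x|).
- by move=> k; exact: measurable_funM.
- exact: measurable_funM.
- by apply: filterS cphi => x cx; apply: cvgM => //; exact: cvg_cst.
- by apply: itgZ; exact: itg_norm.
- apply: aeW => x k.
  rewrite normrM mulrC [X in _ <= _ * X]normrM [X in _ <= _ * (X * _)]ger0_norm ?indicE// mulrA.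
  by apply: ler_wpM2r; [|rewrite -indicE].
by [].
Qed.

Lemma locally_itgD u v : locally_itg u -> locally_itg v -> locally_itg (fun x => u x + v x).
Proof.
move=> [m1 u1] [m2 u2]; split; first exact: measurable_funD.
move=> a b; under eq_fun do rewrite mulrDr; exact: itgD.
Qed.

Lemma locally_itgZ (c : R) u : locally_itg u -> locally_itg (fun x => c * u x).
Proof.
move=> [m1 u1]; split; first exact: measurable_funM.
move=> a b; under eq_fun do rewrite mulrCA; exact: itgZ.
Qed.

End local_integrability.

(** * The weak gradient tested on boxes *)

Section shift_identity.
Variables (R : realType) (n : nat).
Notation mu := (lebesgue_rV R n).
Variables (u : 'rV[R]_n -> R) (Du : 'rV[R]_n -> 'rV[R]_n).
Hypothesis u_loc : locally_itg u.
Hypothesis Du_loc : forall i, locally_itg (fun x => Du x ord0 i).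
Hypothesis u_Du : weak_gradient u Du.

Definition box_factor (a b : 'I_n -> R) j : R -> R := \1_`[a j, b j[.

(** A trapezoid whose derivative is the indicator of $[a,b[$ minus its translate by $t$; unlike a
    single ramp it has bounded support. *)
Definition ramp_shift (a b t s : R) := ramp a b s - ramp a b (s - t).

Lemma measurable_ramp (a b : R) : measurable_fun [set: R] (ramp a b).
Proof.
apply: measurable_maxr; first exact: measurable_cst.
apply: measurable_funB; last exact: measurable_cst.
by apply: measurable_minr => //; exact: measurable_cst.
Qed.

Lemma measurable_shift (f : R -> R) (t : R) : measurable_fun [set: R] f ->
  measurable_fun [set: R] (fun s => f (s - t)).
Proof. by move=> mf; apply: measurableT_comp => //; exact: measurable_funB. Qed.

(** The definition of the weak gradient is applied to a product of bumps in which the factor [i] is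
    a smooth trapezoid. Its partial derivative is a bump of the box minus a bump of the translated
    box; dominated convergence then replaces bumps by indicators. *)
Lemma shift_identity (a b : 'I_n -> R) i (t : R) : (forall j, a j <= b j) -> 0 <= t ->
  \int[mu]_x (u x * tensor (box_factor a b) x) -
  \int[mu]_x (u x * tensor (replace (box_factor a b) i (fun s => box_factor a b i (s - t))) x) =
  - \int[mu]_x (Du x ord0 i * tensor (replace (box_factor a b) i (ramp_shift (a i) (b i) t)) x).
Proof.
move=> ab t0.
pose A j := a j - 1; pose B j := b j + t.
pose M := b i - a i + 1.
have M1 : 1 <= M by rewrite /M lerDr subr_ge0.
have M0 : 0 <= M by exact: le_trans M1.
pose f k j := bump (a j) (b j) k.
pose fs k := replace (f k) i (fun s => bump (a i) (b i) k (s - t)).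
(* Each primitive is constant to the right of [b i], so the difference with its translate has
   compact support. *)
pose psi k s := bump_primitive (a i) (b i) k s - bump_primitive (a i) (b i) k (s - t).
pose F k := replace (f k) i (psi k).
have out (s : R) j : s \notin `[A j, B j] -> s <= a j - 1 \/ b j + t <= s.
  by rewrite in_itv/= negb_and -!ltNge => /orP[|] /ltW; [left|right].
have fB k j s : `|f k j s| <= M.
  have /andP[h0 h1] := bump_bounds (a j) (b j) k s.
  by rewrite ger0_norm// (le_trans h1).
have fout k j s : s \notin `[A j, B j] -> f k j s = 0.
  move=> /out[h|h]; apply: bump_out; [by left|right].
  by apply: le_trans h; rewrite lerDl.
have fsB k j s : `|fs k j s| <= M.
  rewrite /fs /replace; case: ifP => // _.
  have /andP[h0 h1] := bump_bounds (a i) (b i) k (s - t).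
  by rewrite ger0_norm// (le_trans h1).
have fsout k j s : s \notin `[A j, B j] -> fs k j s = 0.
  rewrite /fs /replace; case: ifP => [/eqP ->|_]; last exact: fout.
  move=> /out[h|h]; apply: bump_out; [left|right].
    by apply: le_trans h; rewrite gerBl.
  by rewrite lerBrDr.
have psiB k s : `|psi k s| <= M.
  have /andP[h0 h1] := bump_primitive_bounds k s (ab i).
  have /andP[h2 h3] := bump_primitive_bounds k (s - t) (ab i).
  by rewrite ler_norml /psi /M; apply/andP; split; lra.
have FB k j s : `|F k j s| <= M by rewrite /F /replace; case: ifP.
have Fout k j s : s \notin `[A j, B j] -> F k j s = 0.
  rewrite /F /replace; case: ifP => [/eqP ->|_]; last exact: fout.
  move=> /out[h|h]; rewrite /psi.
    rewrite !bump_primitive_left ?subr0//; by apply: le_trans h; rewrite gerBl.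
  rewrite (@bump_primitive_right _ _ _ _ s (s - t)) ?subrr//.
    by apply: le_trans h; rewrite lerDl.
  by rewrite lerBrDr.
have sf k j : smooth1 (f k j) by exact: smooth1_bump.
have shiftE (h : R -> R) : (fun s => h (s - t)) = (fun s => h (1 * s + (- t))).
  by apply/funext => s; rewrite mul1r.
have sfs k j : smooth1 (fs k j).
  rewrite /fs /replace; case: ifP => // _; rewrite shiftE.
  by apply: smooth1_affine; exact: smooth1_bump.
have spsi k : smooth1 (psi k).
  apply: smooth1B; first exact: smooth1_bump_primitive.
  by rewrite shiftE; apply: smooth1_affine; exact: smooth1_bump_primitive.
have sF k j : smooth1 (F k j) by rewrite /F /replace; case: ifP.
have dpsi k (s : R) : is_derive s (1 : R) (psi k) (f k i s - bump (a i) (b i) k (s - t)).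
  apply: is_deriveB; first exact: is_derive_bump_primitive.
  have h1 : is_derive s (1 : R) (fun s => s - t) 1.
    have H : is_derive s (1 : R) ((id : R -> R) - cst t) (1 - 0) by exact: is_deriveB.
    by rewrite subr0 in H.
  have H := @is_derive1_comp R (bump_primitive (a i) (b i) k) (fun s => s - t) s _ _
    (is_derive_bump_primitive (a i) (b i) k (s - t)) h1.
  by rewrite mulr1 in H.
have key k : \int[mu]_x (u x * tensor (f k) x) - \int[mu]_x (u x * tensor (fs k) x) =
    - \int[mu]_x (Du x ord0 i * tensor (F k) x).
  have tF : test_function (tensor (F k)) by apply: (@test_function_tensor _ _ (F k) A B) => //; exact: Fout.
  rewrite -(u_Du i tF).
  have dF s : is_derive s (1 : R) (F k i) (f k i s - bump (a i) (b i) k (s - t)).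
    by rewrite /F /replace eqxx.
  rewrite (partial_tensor dF) -IntB.
  - apply: eq_Rintegral => x _; rewrite -mulrBr; congr (_ * _).
    rewrite (tensorE (f k) i) !tensor_replace -mulrBl; congr (_ * _).
    by apply: eq_bigr => j /negbTE ji; rewrite /F /replace ji.
  - apply: (locally_itg_mul u_loc _ (tensor_bound M0 (fB k) (fout k))).
    by apply: measurable_tensor => j; exact: measurable_bump.
  - apply: (locally_itg_mul u_loc _ (tensor_bound M0 (fsB k) (fsout k))).
    by apply: measurable_tensor => j; apply: continuous_measurable_fun; exact: smooth1_continuous.
have mbf j : measurable_fun [set: R] (box_factor a b j) by exact: measurable_indic.
have L1 : (fun k => \int[mu]_x (u x * tensor (f k) x)) @ \oo -->
    \int[mu]_x (u x * tensor (box_factor a b) x).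
  apply: (dct_local u_loc _ _ _ (fun k => tensor_bound M0 (fB k) (fout k))).2.
  - by move=> k; apply: measurable_tensor => j; exact: measurable_bump.
  - exact: measurable_tensor.
  - apply: aeW => x; apply: cvg_tensor => j; exact: cvg_bump.
have L2 : (fun k => \int[mu]_x (u x * tensor (fs k) x)) @ \oo -->
    \int[mu]_x (u x * tensor (replace (box_factor a b) i (fun s => box_factor a b i (s - t))) x).
  apply: (dct_local u_loc _ _ _ (fun k => tensor_bound M0 (fsB k) (fsout k))).2.
  - by move=> k; apply: measurable_tensor => j; apply: continuous_measurable_fun; exact: smooth1_continuous.
  - apply: measurable_tensor => j; rewrite /replace; case: ifP => // _; exact: measurable_shift.
  - apply: aeW => x; apply: cvg_tensor => j; rewrite /fs /replace; case: ifP => _; exact: cvg_bump.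
have L3 : (fun k => \int[mu]_x (Du x ord0 i * tensor (F k) x)) @ \oo -->
    \int[mu]_x (Du x ord0 i * tensor (replace (box_factor a b) i (ramp_shift (a i) (b i) t)) x).
  apply: (dct_local (Du_loc i) _ _ _ (fun k => tensor_bound M0 (FB k) (Fout k))).2.
  - by move=> k; apply: measurable_tensor => j; apply: continuous_measurable_fun; exact: smooth1_continuous.
  - apply: measurable_tensor => j; rewrite /replace; case: ifP => // _.
    apply: measurable_funB; first exact: measurable_ramp.
    by apply: measurable_shift; exact: measurable_ramp.
  - apply: aeW => x; apply: cvg_tensor => j; rewrite /F /replace; case: ifP => _; last exact: cvg_bump.
    by apply: cvgB; exact: cvg_bump_primitive.
have H1 := cvgB L1 L2; have H2 := cvgN L3.
set l1 := (X in X = _); set l2 := (X in _ = X).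
have H1' : (fun k => \int[mu]_x (u x * tensor (f k) x) - \int[mu]_x (u x * tensor (fs k) x)) @ \oo --> l1.
  exact: H1.
have H2' : (fun k => \int[mu]_x (u x * tensor (f k) x) - \int[mu]_x (u x * tensor (fs k) x)) @ \oo --> l2.
  by under eq_fun do rewrite key; exact: H2.
exact: (cvg_unique (@Rhausdorff R) H1' H2').
Qed.

End shift_identity.

(** * Dyadic averages, Morrey's inequality and compactness *)

Section cells_as_boxes.
Variables (R : realType) (n : nat).
Notation mu := (lebesgue_rV R n).
Implicit Types (k : 'I_n -> nat) (m : {ffun 'I_n -> int}) (i j : 'I_n).

Definition cell_lo k m j : R := (m j)%:~R / 2 ^+ k j.
Definition cell_hi k m j : R := ((m j)%:~R + 1) / 2 ^+ k j.

Lemma cell_lo_hi k m j : cell_lo k m j <= cell_hi k m j.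
Proof. by rewrite ler_pM2r ?invr_gt0 ?exprn_gt0// lerDl. Qed.

Lemma indic_cell k m x :
  \1_(cell k m) x = tensor (box_factor (cell_lo k m) (cell_hi k m)) x :> R.
Proof.
rewrite cell_itv indicE /tensor.
case: (boolP (x \in _)) => [/set_mem /= H|/negP H].
  by rewrite big1// => i _; rewrite /box_factor indicE mem_set//=; exact: H.
have [i xi] : exists i, x ord0 i \notin `[cell_lo k m i, cell_hi k m i[.
  apply: contrapT => nH; apply: H; rewrite inE /= => i.
  by apply: contrapT => /negP xi; apply: nH; exists i.
rewrite (bigD1 i)//= /box_factor indicE memNset ?mul0r//=.
exact/negP.
Qed.

Definition refine k i : 'I_n -> nat := fun j => (k j + (j == i))%N.
Definition left_child m i : {ffun 'I_n -> int} := [ffun j => if j == i then 2 * m i else m j].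
Definition right_child m i : {ffun 'I_n -> int} := [ffun j => if j == i then 2 * m i + 1 else m j].

Lemma cell_refine_ne k m i j : j != i -> (cell_lo (refine k i) (left_child m i) j = cell_lo k m j) /\
  (cell_hi (refine k i) (left_child m i) j = cell_hi k m j) /\
  (cell_lo (refine k i) (right_child m i) j = cell_lo k m j) /\
  (cell_hi (refine k i) (right_child m i) j = cell_hi k m j).
Proof. by move=> /negbTE ji; rewrite /cell_lo /cell_hi /refine !ffunE ji addn0. Qed.

Definition cell_half k i : R := (2 ^+ (k i).+1)^-1.

Lemma cell_half_gt0 k i : 0 < cell_half k i.
Proof. by rewrite invr_gt0 exprn_gt0. Qed.

Lemma cell_refine_eq k m i :
  [/\ cell_lo (refine k i) (left_child m i) i = cell_lo k m i,
      cell_hi (refine k i) (left_child m i) i = cell_lo k m i + cell_half k i,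
      cell_lo (refine k i) (right_child m i) i = cell_lo k m i + cell_half k i,
      cell_hi (refine k i) (right_child m i) i = cell_hi k m i &
      cell_hi k m i = cell_lo k m i + cell_half k i + cell_half k i].
Proof.
rewrite /cell_lo /cell_hi /refine /cell_half !ffunE !eqxx addn1 exprS.
rewrite intrD !intrM; have p2 : 2 ^+ k i != 0 :> R by rewrite expf_neq0.
by split; field.
Qed.

Lemma indic_split (a c b s : R) : a <= c -> c <= b ->
  \1_`[a, b[ s = \1_`[a, c[ s + \1_`[c, b[ s :> R.
Proof.
move=> ac cb; rewrite !indicE !mem_setE !in_itv/=.
have [as_|sa] := leP a s; have [sc|cs] := ltP s c; have [sb|bs] := ltP s b => //=.
- by rewrite addr0.
- by move: (lt_le_trans sc (le_trans cb bs)); rewrite ltxx.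
- by rewrite add0r.
- by rewrite addr0.
- by rewrite addr0.
- by rewrite addr0.
- by move: (lt_le_trans sa (le_trans ac cs)); rewrite ltxx.
- by rewrite addr0.
Qed.

Lemma indic_children k m i (x : 'rV[R]_n) : \1_(cell k m) x =
  \1_(cell (refine k i) (left_child m i)) x + \1_(cell (refine k i) (right_child m i)) x :> R.
Proof.
have [e1 e2 e3 e4 e5] := cell_refine_eq k m i.
have h := cell_half_gt0 k i.
rewrite !indic_cell !(tensorE _ i) /box_factor e1 e2 e3 e4.
rewrite (@indic_split _ (cell_lo k m i + cell_half k i)); last 2 first.
- by rewrite lerDl ltW.
- by rewrite e5 lerDl ltW.
rewrite mulrDl; congr (_ * _ + _ * _); apply: eq_bigr => j ji;
  have [f1 [f2 [f3 f4]]] := cell_refine_ne k m ji; by rewrite ?f1 ?f2 ?f3 ?f4.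
Qed.

Lemma refine_index k i (x : 'rV[R]_n) : let m := cell_index k x in
  cell_index (refine k i) x = left_child m i \/ cell_index (refine k i) x = right_child m i.
Proof.
move=> m; have := indic_children k m i x.
rewrite !indicE [in LHS]mem_set//.
case: (boolP (x \in cell (refine k i) (left_child m i))) => [/set_mem H _|_]; first by left.
case: (boolP (x \in cell (refine k i) (right_child m i))) => [/set_mem H _|_]; first by right.
by rewrite addr0 => /eqP; rewrite oner_eq0.
Qed.

Lemma cell_volume_refine k i : cell_volume R (refine k i) = cell_volume R k / 2.
Proof.
rewrite /cell_volume (bigD1 i)//= [in RHS](bigD1 i)//= /refine eqxx addn1 exprS invfM.
have -> : \prod_(j < n | j != i) (2 ^+ (k j + (j == i)))^-1 =
    \prod_(j < n | j != i) (2 ^+ k j)^-1 :> R.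
  by apply: eq_bigr => j /negbTE ->; rewrite addn0.
by ring.
Qed.

Lemma cell_sub_cbox k m x : \1_(cell k m) x <= \1_(cbox (cell_lo k m) (cell_hi k m)) x :> R.
Proof.
rewrite !indicE; case: (boolP (x \in cell k m)) => // /set_mem.
rewrite cell_itv /= => H; rewrite mem_set// => i; have := H i.
by rewrite !in_itv/= => /andP[-> /ltW].
Qed.

End cells_as_boxes.

Section ramps.
Variable R : realType.
Implicit Types a b s t : R.

Lemma ramp_left a b s : s <= a -> ramp a b s = 0.
Proof.
move=> sa; rewrite /ramp max_l// subr_le0 (le_trans _ sa)//.
by rewrite ge_min lexx.
Qed.

Lemma ramp_right a b s : a <= b -> b <= s -> ramp a b s = b - a.
Proof. by move=> ab bs; rewrite /ramp min_r// max_r// subr_ge0. Qed.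

Lemma ramp_shift_bounds a b t s : 0 <= t -> 0 <= ramp_shift a b t s <= t.
Proof.
move=> t0; rewrite /ramp_shift subr_ge0 lerBlDr; apply/andP; split.
  rewrite /ramp ge_max le_max lexx/= le_max lerB ?orbT// le_min !ge_min lexx orbT andbT.
  by rewrite gerBl t0.
rewrite /ramp ge_max addr_ge0 ?le_max ?lexx//=.
apply: (@le_trans _ _ (t + (Num.min (s - t) b - a))); last by rewrite lerD2l le_max lexx orbT.
by rewrite addrA lerB// addr_minr addrC subrK le_min !ge_min lexx/= lerDr t0 orbT.
Qed.

Lemma ramp_shift_out a b t s : 0 <= t -> a <= b -> s <= a \/ b + t <= s -> ramp_shift a b t s = 0.
Proof.
move=> t0 ab [sa|bs]; rewrite /ramp_shift.
  by rewrite !ramp_left ?subrr//; apply: le_trans sa; rewrite gerBl.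
rewrite !ramp_right ?subrr ?lerBrDr//.
by apply: le_trans bs; rewrite lerDl.
Qed.

End ramps.

Section cell_averages.
Variables (R : realType) (n : nat) (p : R).
Notation mu := (lebesgue_rV R n).
Hypothesis p_gt1 : 1 < p.
Implicit Types (k : 'I_n -> nat) (m : {ffun 'I_n -> int}) (i j : 'I_n) (f u : 'rV[R]_n -> R).

Let p_gt0 : 0 < p. Proof. exact: lt_trans p_gt1. Qed.

Definition norm_p f : R := (\int[mu]_x `|f x| `^ p) `^ p^-1.

Lemma norm_p_ge0 f : 0 <= norm_p f. Proof. exact: powR_ge0. Qed.

Definition cell_int f k m : R := \int[mu]_x (f x * \1_(cell k m) x).

Definition cell_avg f k (x : 'rV[R]_n) : R := cell_int f k (cell_index k x) / cell_volume R k.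

Lemma measurable_indic_cell k m : measurable_fun [set: 'rV[R]_n] (\1_(cell k m) : 'rV[R]_n -> R).
Proof. by apply: measurable_indic; exact: measurable_cell. Qed.

Lemma itg_cell f k m : locally_itg f -> itg mu (fun x => f x * \1_(cell k m) x).
Proof.
move=> lf; apply: (@locally_itg_mul R n f _ (cell_lo R k m) (cell_hi R k m) 1 lf).
  exact: measurable_indic_cell.
by move=> x; rewrite ger0_norm ?indicE// mul1r -!indicE cell_sub_cbox.
Qed.

Lemma itg_indic_cell k m : itg mu (\1_(cell k m) : 'rV[R]_n -> R).
Proof.
apply: (itg_le (measurable_indic_cell k m) (itg_cbox (cell_lo R k m) (cell_hi R k m))) => x.
by rewrite ger0_norm ?indicE// -!indicE cell_sub_cbox.
Qed.

Lemma int_indic_cell k m : \int[mu]_x \1_(cell k m) x = cell_volume R k.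
Proof.
rewrite /Rintegral integral_indic//; last exact: measurable_cell.
by rewrite setIT; exact: (congr1 fine (measure_cell R k m)).
Qed.

Lemma cell_int_children f k m i : locally_itg f ->
  cell_int f k m = cell_int f (refine k i) (left_child m i) + cell_int f (refine k i) (right_child m i).
Proof.
move=> lf; rewrite /cell_int -IntD; [|exact: itg_cell|exact: itg_cell].
by apply: eq_Rintegral => x _; rewrite -mulrDr -indic_children.
Qed.

Lemma cell_int_hoelder f k m : Lp mu p f ->
  \int[mu]_x `|f x * \1_(cell k m) x| <= norm_p f * cell_volume R k `^ (1 - p^-1).
Proof.
move=> fp; pose q := (1 - p^-1)^-1.
have pi0 : p^-1 < 1 by rewrite invf_lt1.
have q0 : 0 < q by rewrite invr_gt0 subr_gt0.
have E : (fun x : 'rV[R]_n => `|\1_(cell k m) x : R| `^ q) = (\1_(cell k m) : 'rV[R]_n -> R).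
  apply/funext => x; rewrite indicE; case: (_ \in _); first by rewrite normr1 powR1.
  by rewrite normr0 powR0// gt_eqF.
have Lq : Lp mu q (\1_(cell k m) : 'rV[R]_n -> R).
  split; first exact: measurable_indic_cell.
  by rewrite E; exact: itg_indic_cell.
have pq : p^-1 + q^-1 = 1 by rewrite invrK addrC subrK.
have [_] := Int_hoelder p_gt0 q0 pq fp Lq.
by rewrite E int_indic_cell invrK.
Qed.

(** The right half of the cell is the left half translated by its own width [t]. In the shift
    identity the trapezoid is then a triangle of height [t] supported in the whole cell, and
    Hölder's inequality finishes. *)
Lemma child_average_bound u (Du : 'rV[R]_n -> 'rV[R]_n) k m i :
  locally_itg u -> (forall j, Lp mu p (fun x => Du x ord0 j)) -> weak_gradient u Du ->
  `|cell_int u (refine k i) (left_child m i) - cell_int u (refine k i) (right_child m i)| <=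
  cell_half R k i * (norm_p (fun x => Du x ord0 i) * cell_volume R k `^ (1 - p^-1)).
Proof.
move=> lu Dp wu.
have lD j : locally_itg (fun x => Du x ord0 j) by exact: Lp_locally_itg (ltW p_gt1) (Dp j).
pose a := cell_lo R (refine k i) (left_child m i).
pose b := cell_hi R (refine k i) (left_child m i).
have ab j : a j <= b j by exact: cell_lo_hi.
pose t := cell_half R k i.
have t0 : 0 < t by exact: cell_half_gt0.
have [e1 e2 e3 e4 e5] := cell_refine_eq R k m i.
have := shift_identity lu lD wu i ab (ltW t0).
have E1 x : tensor (box_factor a b) x = \1_(cell (refine k i) (left_child m i)) x.
  by rewrite indic_cell.
have E2 x : tensor (replace (box_factor a b) i (fun s => box_factor a b i (s - t))) x =
    \1_(cell (refine k i) (right_child m i)) x.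
  rewrite indic_cell tensor_replace (tensorE _ i); congr (_ * _).
    rewrite /box_factor /a /b e1 e2 e3 e4 !indicE !mem_setE !in_itv/= lerBrDr ltrBlDr.
    by rewrite -/t e5.
  apply: eq_bigr => j ji; have [f1 [f2 [f3 f4]]] := cell_refine_ne R k m ji.
  by rewrite /box_factor /a /b f1 f2 f3 f4.
under eq_Rintegral do rewrite E1.
under [X in _ - X]eq_Rintegral do rewrite E2.
rewrite -!/(cell_int _ _ _) => ->; rewrite normrN.
set F := tensor _.
have FB x : `|F x| <= t * \1_(cell k m) x.
  rewrite /F tensor_replace indic_cell (tensorE _ i) normrM mulrA.
  have -> : \prod_(j < n | j != i) box_factor a b j (x ord0 j) =
      \prod_(j < n | j != i) box_factor (cell_lo R k m) (cell_hi R k m) j (x ord0 j).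
    apply: eq_bigr => j ji; have [f1 [f2 [f3 f4]]] := cell_refine_ne R k m ji.
    by rewrite /box_factor /a /b f1 f2.
  set C := \prod_(j < n | j != i) _.
  have C0 : 0 <= C by apply: prodr_ge0 => j _; rewrite /box_factor indicE.
  rewrite (ger0_norm C0); apply: ler_wpM2r => //.
  set s := x ord0 i; rewrite /ramp_shift /a /b e1 e2 -/t /box_factor.
  set lo := cell_lo R k m i; rewrite e5 -/lo -/t indicE mem_setE in_itv/=.
  have /andP[r0 r1] := ramp_shift_bounds lo (lo + t) s (ltW t0).
  have out := @ramp_shift_out _ lo (lo + t) t s (ltW t0); rewrite lerDl (ltW t0) in out.
  rewrite -/(ramp_shift _ _ _ _) ger0_norm//.
  have [losl|/ltW slo] := leP lo s; have [sh|hs] := ltP s (lo + t + t) => /=; rewrite ?mulr1//.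
  - by rewrite out ?mulr0//; right.
  - by rewrite out ?mulr0//; left.
  - by rewrite out ?mulr0//; left.
have mF : measurable_fun [set: 'rV[R]_n] F.
  apply: measurable_tensor => j; rewrite /replace; case: ifP => // _.
    by apply: measurable_funB; [exact: measurable_ramp|apply: measurable_shift; exact: measurable_ramp].
  exact: measurable_indic.
have ii : itg mu (fun x => Du x ord0 i * \1_(cell k m) x) by exact: itg_cell.
have H : itg mu (fun x => t * `|Du x ord0 i * \1_(cell k m) x|).
  by apply: itgZ; exact: itg_norm.
have le1 x : `|Du x ord0 i * F x| <= t * `|Du x ord0 i * \1_(cell k m) x|.
  rewrite !normrM mulrCA; apply: ler_wpM2l => //.
  by apply: le_trans (FB x) _; rewrite [`|\1_ _ _|]ger0_norm ?indicE.
have iF : itg mu (fun x => Du x ord0 i * F x).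
  by apply: (itg_le _ H le1); apply: measurable_funM => //; exact: (lD i).1.
apply: le_trans (Int_norm_le iF H _) _; first exact: aeW.
rewrite IntZ; last exact: itg_norm.
by apply: ler_wpM2l; [exact: ltW|exact: cell_int_hoelder].
Qed.

End cell_averages.

Section functions_determined_by_cells.
Variables (R : realType) (n : nat).
Notation mu := (lebesgue_rV R n).
Implicit Types (f : 'rV[R]_n -> R) (m : {ffun 'I_n -> int}).

(** Dynkin induction shows that the integral over every measurable set vanishes; the vanishing total
    integral serves the passage to complements. *)
Lemma itg_zero_of_cells f : itg mu f ->
  (forall (k : nat) m, \int[mu]_x (f x * \1_(cell (fun=> k) m) x) = 0) ->
  \int[mu]_x f x = 0 ->
  {ae mu, forall x, f x = 0}.
Proof.
move=> fi f0 fT.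
have E A : measurable A -> (\int[mu]_(x in A) (f x)%:E = (\int[mu]_x (f x * \1_A x))%:E)%E.
  move=> mA; rewrite IntE; last first.
    apply: (itg_le _ (itg_norm fi)) => [|x].
      by apply: measurable_funM; [exact: (itgM fi)|exact: measurable_indic].
    rewrite normrM ler_piMr// indicE; case: (_ \in _); by rewrite ?normr1 ?normr0.
  rewrite [LHS]integral_mkcond; apply: eq_integral => x _; rewrite patchE indicE.
  by case: (_ \in _); rewrite ?mulr1 ?mulr0.
have key A : measurable A -> (\int[mu]_(x in A) (f x)%:E = 0)%E.
  move=> mA; apply: (@dynkin_induction _ _ (@dyadic_cells R n)
    (fun A => \int[mu]_(x in A) (f x)%:E = 0)%E).
  - exact: dyadic_measurable.
  - exact: dyadic_cells_setI.
  - by rewrite -IntE// fT.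
  - move=> B [->|[k [m ->]]]; first by rewrite integral_set0.
    by rewrite E ?f0//; exact: measurable_cell.
  - move=> B mB B0.
    have mf : measurable_fun [set: 'rV[R]_n] (EFin \o f) by apply/measurable_EFinP; exact: (itgM fi).
    have := @integral_setU _ _ _ mu B (~` B) (EFin \o f) mB (measurableC mB).
    rewrite setUv => /(_ mf); rewrite disj_set2E setICr eqxx => /(_ isT).
    by rewrite [X in (_ = X + _)%E -> _]B0 add0e -IntE// fT => <-.
  - move=> F mF tF F0; rewrite integral_bigcup//; last first.
      by apply: integrableS fi => //; exact: bigcup_measurable.
    by rewrite eseries0.
  - by rewrite -dyadic_measurable.
have := @integral_ae_eq _ _ _ mu setT measurableT (cst 0%E) (EFin \o f) fi (@measurable_cst _ _ _ _ _ _).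
have H B : B `<=` setT -> measurable B ->
    (\int[mu]_(x in B) (EFin \o f) x = \int[mu]_(x in B) cst 0 x)%E.
  by move=> _ mB; rewrite integral0 key.
by move=> /(_ H); apply: filterS => x /(_ I) [].
Qed.

(** Cut to one cell of level 0 the function becomes integrable, and its integral over another cell
    is the integral of [f] over an intersection, which is a cell or empty. Countably many such cells
    cover the space. *)
Lemma zero_of_cells f : locally_itg f ->
  (forall (k : nat) m, \int[mu]_x (f x * \1_(cell (fun=> k) m) x) = 0) ->
  {ae mu, forall x, f x = 0}.
Proof.
move=> lf f0.
have H (m : {ffun 'I_n -> int}) : {ae mu, forall x, f x * \1_(cell (fun=> 0%N) m) x = 0}.
  apply: itg_zero_of_cells; [exact: itg_cell| |exact: f0].
  move=> k m'.
  have EI (x : 'rV[R]_n) : f x * \1_(cell (fun=> 0%N) m) x * \1_(cell (fun=> k) m') x =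
      f x * \1_(cell (fun=> 0%N) m `&` cell (fun=> k) m') x by rewrite -mulrA indicI.
  under eq_Rintegral do rewrite EI.
  have [->|[k' [m'' ->]]] := @dyadic_cells_setI R n _ _
     (or_intror (ex_intro _ 0%N (ex_intro _ m erefl)))
     (or_intror (ex_intro _ k (ex_intro _ m' erefl))).
    under eq_Rintegral do rewrite indic0 mulr0.
    by rewrite /Rintegral integral0.
  exact: f0.
have : {ae mu, forall x, forall j : nat, if unpickle j is Some m then
    f x * \1_(cell (fun=> 0%N) m) x = 0 else True}.
  by apply: ae_foralln => j; case: (unpickle j) => [m|]; [exact: H|exact: aeW].
apply: filterS => x /(_ (pickle (cell_index (fun=> 0%N) x))); rewrite pickleK.
by rewrite indicE mem_set// mulr1.
Qed.

End functions_determined_by_cells.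

Lemma geometric_cvg (R : realType) (a : nat -> R) (c q : R) : 0 <= c -> 0 < q -> q < 1 ->
  (forall k, `|a k.+1 - a k| <= c * q ^+ k) ->
  exists2 l, a @ \oo --> l & forall k, `|l - a k| <= c * q ^+ k / (1 - q).
Proof.
move=> c0 q0 q1 H; have q1' : 0 < 1 - q by rewrite subr_gt0.
have tail k d : `|a (k + d)%N - a k| <= c * q ^+ k / (1 - q).
  apply: (@le_trans _ _ (c * q ^+ k * (1 - q ^+ d) / (1 - q))); last first.
    rewrite ler_pM2r ?invr_gt0// ler_piMr ?mulr_ge0 ?exprn_ge0 ?(ltW q0)//.
    by rewrite gerBl exprn_ge0// ltW.
  elim: d => [|d IH]; first by rewrite addn0 subrr normr0 expr0 subrr mulr0 mul0r.
  rewrite addnS -(subrKA (a (k + d)%N)); apply: le_trans (ler_normD _ _) _.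
  apply: le_trans (lerD (H _) IH) _; rewrite le_eqVlt; apply/orP; left; apply/eqP.
  by rewrite exprD exprS; field; rewrite gt_eqF.
have [l al] : exists l : R, a @ \oo --> l.
  have : cvgn (series (fun k => a k.+1 - a k)).
    apply: normed_cvg; apply: (@series_le_cvg _ _ (geometric c q)).
    - by move=> k; exact: normr_ge0.
    - by move=> k; rewrite /geometric/= mulr_ge0 ?exprn_ge0 ?(ltW q0).
    - exact: H.
    - by apply: is_cvg_geometric_series; rewrite ger0_norm ?(ltW q0).
  have -> : series (fun k => a k.+1 - a k) = (fun k => a k - a 0%N).
    by apply/funext => k; rewrite /series/= telescope_sumr.
  move=> /cvg_ex[l al]; exists (l + a 0%N).
  have : (fun k => a k - a 0%N + a 0%N) @ \oo --> l + a 0%N.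
    by apply: cvgD => //; exact: cvg_cst.
  have E : (fun k => a k - a 0%N + a 0%N) = a by apply/funext => k; rewrite subrK.
  by rewrite E.
exists l => // k.
have h : (fun d => `|a (d + k)%N - a k|) @ \oo --> `|l - a k|.
  apply: cvg_norm; apply: cvgB; last exact: cvg_cst.
  by rewrite cvg_shiftn.
apply: (@ler_cvg_to _ _ _ _ _ _ _ _ h (cvg_cst (c * q ^+ k / (1 - q)))).
by apply: nearW => d; rewrite addnC tail.
Qed.

(** * Morrey's inequality through dyadic averages *)

Section morrey.
Variables (R : realType) (n : nat) (p : R).
Notation mu := (lebesgue_rV R n).
Hypothesis p_gt1 : 1 < p.
Hypothesis p_gtn : n%:R < p.
Implicit Types (i j : 'I_n) (u : 'rV[R]_n -> R) (Du : 'rV[R]_n -> 'rV[R]_n).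

Let p_gt0 : 0 < p. Proof. exact: lt_trans p_gt1. Qed.

Definition sobolev u Du := [/\ Lp mu p u, forall i, Lp mu p (fun x => Du x ord0 i) & weak_gradient u Du].

(** The levels between the cubes of level [k] and those of level [k + 1]: the first [j] coordinates
    have already been halved. *)
Definition chain k (j : nat) : 'I_n -> nat := fun i => (k + (i < j))%N.

Lemma chain0 k : chain k 0 = fun=> k.
Proof. by apply/funext => i; rewrite /chain ltn0 addn0. Qed.

Lemma chainn k : chain k n = fun=> k.+1.
Proof. by apply/funext => i; rewrite /chain ltn_ord addn1. Qed.

Lemma refine_chain k i : refine (chain k i) i = chain k i.+1.
Proof.
apply/funext => j; rewrite /refine /chain -addnA ltnS [(j <= i)%N]leq_eqVlt.
rewrite -val_eqE; case: eqP => [->|_]; first by rewrite ltnn.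
by rewrite orFb addn0.
Qed.

Definition grad_norm Du : R := \sum_(i < n) norm_p p (fun x => Du x ord0 i).

(** The factor gained per level: a side of length $2^{-m}$ times the power $-1/p$ of the volume
    $2^{-mn}$ is [rate ^+ m]. It is below 1 exactly when $p>n$. *)
Definition rate : R := 2 `^ (n%:R / p - 1).

Lemma rate_gt0 : 0 < rate. Proof. by rewrite powR_gt0. Qed.

Lemma rate_lt1 : rate < 1.
Proof.
rewrite /rate /powR pnatr_eq0/= -[X in _ < X]expR0 ltr_expR pmulr_llt0 ?ln_gt0 ?ltr1n//.
by rewrite subr_lt0 ltr_pdivrMr ?mul1r.
Qed.

(** A child has half the volume $V$ of its parent, so the two averages differ by $(I_0-I_1)/V$ up to
    sign. The bound on the halves, with width $2^{-(k+1)}$ and $V\ge 2^{-(k+1)n}$, gives the power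
    of [rate]. *)
Lemma chain_step u Du k i x : sobolev u Du ->
  `|cell_avg u (chain k i.+1) x - cell_avg u (chain k i) x| <=
  norm_p p (fun x => Du x ord0 i) * rate ^+ k.+1.
Proof.
move=> [up Dp wu]; rewrite -refine_chain; set K := chain k i.
have lu : locally_itg u by exact: Lp_locally_itg (ltW p_gt1) up.
set m := cell_index K x; set V := cell_volume R K.
have V0 : 0 < V by exact: cell_volume_gt0.
have ch := child_average_bound p_gt1 K m i lu Dp wu.
set I0 := cell_int u (refine K i) (left_child m i) in ch.
set I1 := cell_int u (refine K i) (right_child m i) in ch.
have D : `|cell_avg u (refine K i) x - cell_avg u K x| = `|I0 - I1| / V.
  rewrite /cell_avg cell_volume_refine -/V -/m (cell_int_children K m i lu) -/I0 -/I1.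
  have -> : forall y : R, `|y| / V = `|y / V|.
    by move=> y; rewrite normrM [`|V^-1|]ger0_norm// invr_ge0 ltW.
  have [->|->] := refine_index K i x; rewrite -/m -/I0 -/I1; last rewrite -normrN;
    congr `|_|; field; by rewrite gt_eqF.
rewrite D ler_pdivrMr//; apply: le_trans ch _.
rewrite mulrCA -mulrA; apply: ler_wpM2l; first exact: norm_p_ge0.
rewrite powRB; last by rewrite (gt_eqF V0) implybT.
rewrite powRr1 ?(ltW V0)//.
rewrite mulrCA [X in _ <= X]mulrC; apply: ler_wpM2l; first exact: ltW.
have hE : cell_half R K i = 2 `^ (- k.+1%:R).
  by rewrite /cell_half /K /chain ltnn addn0 powRN powR_mulrn.
have VE : (V `^ p^-1)^-1 <= 2 `^ (k.+1%:R * (n%:R / p)).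
  have hV : (2 `^ (- k.+1%:R)) ^+ n <= V.
    rewrite /V /cell_volume -[n in leLHS]card_ord -prodr_const.
    apply: ler_prod => j _; rewrite powR_ge0/= powRN powR_mulrn//.
    rewrite lef_pV2 ?posrE ?exprn_gt0// ler_eXn2l ?ltr1n// /K /chain.
    by apply: leq_trans (leq_add (leqnn k) (leq_b1 _)) _; rewrite addn1.
  apply: (@le_trans _ _ (((2 `^ (- k.+1%:R)) ^+ n) `^ p^-1)^-1).
    rewrite lef_pV2 ?posrE ?powR_gt0 ?exprn_gt0 ?powR_gt0//.
    by apply: ge0_ler_powR; rewrite ?nnegrE ?invr_ge0 ?(ltW p_gt0) ?exprn_ge0 ?(ltW V0) ?powR_ge0.
  rewrite -powR_mulrn ?powR_ge0// -!powRrM -powRN.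
  by rewrite le_eqVlt; apply/orP; left; apply/eqP; congr (_ `^ _); field; rewrite gt_eqF.
rewrite hE; apply: le_trans (ler_wpM2l (powR_ge0 _ _) VE) _.
rewrite -powRD; last by rewrite pnatr_eq0 implybT.
rewrite /rate -powR_mulrn ?powR_ge0// -powRrM.
rewrite le_eqVlt; apply/orP; left; apply/eqP; congr (_ `^ _); ring.
Qed.

Lemma level_step u Du k x : sobolev u Du ->
  `|cell_avg u (fun=> k.+1) x - cell_avg u (fun=> k) x| <= grad_norm Du * rate * rate ^+ k.
Proof.
move=> su; rewrite -chainn -chain0 -mulrA -exprS /grad_norm mulr_suml.
have -> : cell_avg u (chain k n) x - cell_avg u (chain k 0) x =
    \sum_(0 <= j < n) (cell_avg u (chain k j.+1) x - cell_avg u (chain k j) x).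
  by rewrite telescope_sumr.
rewrite big_mkord; apply: le_trans (ler_norm_sum _ _ _) _.
by apply: ler_sum => i _; exact: chain_step.
Qed.

Lemma grad_norm_ge0 Du : 0 <= grad_norm Du.
Proof. by apply: sumr_ge0 => i _; exact: norm_p_ge0. Qed.

Lemma cell_int_coarsen (f g : 'rV[R]_n -> R) (k : nat) : locally_itg f -> locally_itg g ->
  (forall m, cell_int f (fun=> k.+1) m = cell_int g (fun=> k.+1) m) ->
  forall m, cell_int f (fun=> k) m = cell_int g (fun=> k) m.
Proof.
move=> lf lg; rewrite -chainn -(chain0 k).
move=> H; have coarsen (d : nat) : (d <= n)%N ->
    (forall m, cell_int f (chain k d) m = cell_int g (chain k d) m) ->
    forall m, cell_int f (chain k 0) m = cell_int g (chain k 0) m.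
  elim: d => [_ H0 m|d IH jn Hj]; first exact: H0.
  apply: (IH (ltnW jn)) => m.
  pose i := Ordinal jn.
  have E : refine (chain k d) i = chain k d.+1 := refine_chain k i.
  by rewrite (cell_int_children (chain k d) m i lf) (cell_int_children (chain k d) m i lg) E !Hj.
exact: (coarsen n (leqnn n) H).
Qed.

Lemma measurable_cell_avg u (k : nat) : measurable_fun [set: 'rV[R]_n] (cell_avg u (fun=> k)).
Proof.
move=> _ B mB; rewrite setTI.
pose F (m : {ffun 'I_n -> int}) := cell_int u (fun=> k) m / @cell_volume R n (fun=> k).
have -> : cell_avg u (fun=> k) @^-1` B = \bigcup_(m in [set m | B (F m)]) cell (fun=> k) m.
  apply/seteqP; split => x /=; first by move=> Bx; exists (cell_index (fun=> k) x).
  by move=> [m /= Bm xm]; rewrite /cell_avg xm.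
apply: countable_bigcup_cells; first exact: sigma_algebra_measurable.
by move=> m; exact: measurable_cell.
Qed.

Lemma cell_avg0_bound u x : Lp mu p u -> `|cell_avg u (fun=> 0%N) x| <= norm_p p u.
Proof.
move=> up.
have V1 : @cell_volume R n (fun=> 0%N) = 1.
  by rewrite /cell_volume big1// => i _; rewrite expr0 invr1.
rewrite /cell_avg V1 divr1 /cell_int.
have ii : itg mu (fun y => u y * \1_(cell (fun=> 0%N) (cell_index (fun=> 0%N) x)) y).
  by apply: itg_cell; exact: Lp_locally_itg (ltW p_gt1) up.
apply: le_trans (Int_norm ii) _; apply: le_trans (cell_int_hoelder p_gt1 _ _ up) _.
by rewrite V1 powR1 mulr1.
Qed.

(* The dyadic averages converge uniformly; the limit equals [u] almost
   everywhere because both have the same integral over every dyadic cell. *)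
Lemma cell_avg_uniform u Du : sobolev u Du ->
  {ae mu, forall x, forall k,
    `|u x - cell_avg u (fun=> k) x| <= grad_norm Du * rate * rate ^+ k / (1 - rate)}.
Proof.
move=> su; have [up Dp wu] := su.
have lu : locally_itg u by exact: Lp_locally_itg (ltW p_gt1) up.
have G0 : 0 <= grad_norm Du * rate by rewrite mulr_ge0 ?grad_norm_ge0 ?(ltW rate_gt0).
have /choice[v vP] : forall x, exists l, (fun k => cell_avg u (fun=> k) x) @ \oo --> l /\
    forall k, `|l - cell_avg u (fun=> k) x| <= grad_norm Du * rate * rate ^+ k / (1 - rate).
  move=> x; have [l h1 h2] := geometric_cvg G0 rate_gt0 rate_lt1 (fun k => level_step k x su).
  by exists l.
have mA k := measurable_cell_avg u k.
have mv : measurable_fun [set: 'rV[R]_n] v.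
  by apply: (measurable_fun_cvg mA) => x _; exact: (vP x).1.
pose C := norm_p p u + grad_norm Du * rate / (1 - rate).
have q1 : 0 < 1 - rate by rewrite subr_gt0 rate_lt1.
have C0 : 0 <= C by rewrite addr_ge0 ?norm_p_ge0// divr_ge0 ?(ltW q1).
have vC x : `|v x| <= C.
  have := (vP x).2 0%N; rewrite expr0 mulr1 => h.
  rewrite -[v x](subrK (cell_avg u (fun=> 0%N) x)); apply: le_trans (ler_normD _ _) _.
  by rewrite addrC lerD// cell_avg0_bound.
pose C2 := C + grad_norm Du * rate / (1 - rate).
have AC k x : `|cell_avg u (fun=> k) x| <= C2.
  have h := (vP x).2 k; rewrite distrC in h.
  rewrite -[cell_avg _ _ _](subrK (v x)); apply: le_trans (ler_normD _ _) _.
  rewrite addrC lerD//; apply: le_trans h _; rewrite ler_pM2r ?invr_gt0//.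
  by rewrite ler_piMr// exprn_ile1 ?(ltW rate_gt0) ?(ltW rate_lt1).
have lbd (f : 'rV[R]_n -> R) (M : R) : measurable_fun [set: 'rV[R]_n] f ->
    (forall x, `|f x| <= M) -> locally_itg f.
  move=> mf fM; split => // a b; apply: (itg_le _ (itgZ M (itg_cbox a b))) => [|x].
    by apply: measurable_funM => //; apply: measurable_indic; exact: measurable_cbox.
  by rewrite normrM mulrC [X in _ * X]ger0_norm ?indicE//; apply: ler_wpM2r.
have lv := lbd _ _ mv vC; have lA k := lbd _ _ (mA k) (AC k).
(* For [d = 0] the average is constant on the cell. A finer average has the correct integrals over
   finer cells, and these add up to the integral over the coarse one. *)
have same d k m :
    cell_int (cell_avg u (fun=> (d + k)%N)) (fun=> k) m = cell_int u (fun=> k) m.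
  elim: d k m => [|d IH] k m.
    rewrite add0n {1}/cell_int.
    transitivity (\int[mu]_x (cell_int u (fun=> k) m / @cell_volume R n (fun=> k) * \1_(cell (fun=> k) m) x)).
      apply: eq_Rintegral => x _; rewrite indicE.
      by case: (boolP (_ \in _)) => [/set_mem xm|_]; rewrite ?mulr0// /cell_avg xm.
    rewrite IntZ; last exact: itg_indic_cell.
    by rewrite int_indic_cell divfK// gt_eqF// cell_volume_gt0.
  by apply: cell_int_coarsen => // m'; rewrite addSnnS.
have vu k m : cell_int v (fun=> k) m = cell_int u (fun=> k) m.
  have [|||||_ H _] := @dct _ _ _ mu
    (fun d x => cell_avg u (fun=> (d + k)%N) x * \1_(cell (fun=> k) m) x)
    (fun x => v x * \1_(cell (fun=> k) m) x) (fun x => C2 * \1_(cell (fun=> k) m) x).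
  - by move=> d; apply: measurable_funM => //; exact: measurable_indic_cell.
  - by apply: measurable_funM => //; exact: measurable_indic_cell.
  - apply: aeW => x; apply: cvgM; last exact: cvg_cst.
    have := (vP x).1; rewrite -(cvg_shiftn k); exact.
  - by apply: itgZ; exact: itg_indic_cell.
  - apply: aeW => x d; rewrite normrM [X in _ * X]ger0_norm ?indicE//.
    by apply: ler_wpM2r.
  have : (fun=> cell_int u (fun=> k) m) @ \oo --> cell_int v (fun=> k) m.
    by move: H; under eq_fun do rewrite -/(cell_int _ _ _) same.
  by move=> H'; apply: (cvg_unique (@Rhausdorff R) H'); exact: cvg_cst.
have : {ae mu, forall x, u x + -1 * v x = 0}.
  apply: zero_of_cells; first by apply: locally_itgD => //; exact: locally_itgZ.
  move=> k m; have -> : (fun x => (u x + -1 * v x) * \1_(cell (fun=> k) m) x) =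
    (fun x => u x * \1_(cell (fun=> k) m) x - v x * \1_(cell (fun=> k) m) x).
    by apply/funext => x; ring.
  rewrite IntB; [|exact: itg_cell|exact: itg_cell].
  by rewrite -!/(cell_int _ _ _) vu subrr.
apply: filterS => x uv k; have -> : u x = v x by move: uv; lra.
exact: (vP x).2.
Qed.

Definition sup_const : R := 1 + rate / (1 - rate).

Lemma sup_const_ge1 : 1 <= sup_const.
Proof. by rewrite /sup_const lerDl divr_ge0 ?(ltW rate_gt0)// subr_ge0 ltW// rate_lt1. Qed.

Lemma sup_bound u Du : sobolev u Du ->
  {ae mu, forall x, `|u x| <= sup_const * (norm_p p u + grad_norm Du)}.
Proof.
move=> su; have := cell_avg_uniform su; apply: filterS => x /(_ 0%N).
rewrite expr0 mulr1 => h; have [up _ _] := su; have h0 := cell_avg0_bound x up.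
rewrite -[u x](subrK (cell_avg u (fun=> 0%N) x)); apply: le_trans (ler_normD _ _) _.
have c0 : 0 <= rate / (1 - rate) by rewrite divr_ge0 ?(ltW rate_gt0)// subr_ge0 ltW// rate_lt1.
have := mulr_ge0 c0 (norm_p_ge0 p u); have := grad_norm_ge0 Du.
move: h h0; rewrite /sup_const -mulrA; lra.
Qed.

End morrey.

(** * Compactness almost everywhere *)

Section diagonal_subsequence.
Variable R : realType.

Lemma ultra_bounded_cvg (G : set_system nat) (a : nat -> R) (M : R) : UltraFilter G ->
  (forall n, `|a n| <= M) -> exists l : R, a @ G --> l.
Proof.
move=> UG aM; have PG : ProperFilter G by exact: ultra_proper.
have [p [_ clp]] : `[- M, M]%classic `&` cluster (a @ G) !=set0.
  apply: (@segment_compact R (- M) M (a @ G)).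
  by apply: (@filterE _ G) => d /=; rewrite in_itv/= -ler_norml aM.
exists p => U /= Up; have [//|Gc] := in_ultra_setVsetC (a @^-1` U) UG.
have [y [/= ny Uy]] : (~` U) `&` U !=set0.
  by apply: clp => //; exact: Gc.
by [].
Qed.

(** An ultrafilter finer than the tails makes all the bounded sequences converge at once, without
    nested extractions. The index [phi n] is then taken beyond [n] and such that the first [n + 1]
    sequences are within $1/(n+1)$ of their limits. *)
Lemma diagonal_subsequence (a : nat -> nat -> R) : (forall j, exists M, forall n, `|a j n| <= M) ->
  exists2 phi : nat -> nat, (forall n, (n <= phi n)%N) &
  forall j, exists l : R, (fun n => a j (phi n)) @ \oo --> l.
Proof.
move=> /choice[M aM].
have [G [UG GF]] := @ultraFilterLemma nat \oo eventually_filter.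
have PG : ProperFilter G by exact: ultra_proper.
have /choice[l al] : forall j, exists l : R, a j @ G --> l.
  by move=> j; exact: ultra_bounded_cvg (aM j).
have /choice[phi Hphi] : forall n, exists m, (n <= m)%N /\
    forall j : 'I_n.+1, `|l j - a j m| <= n.+1%:R^-1.
  move=> n; have : G ([set m | (n <= m)%N] `&`
      [set m | forall j : 'I_n.+1, `|l j - a j m| <= n.+1%:R^-1]).
    apply: filterI; first by apply: GF; exists n.
    apply: filter_forall => j; move: (al j) => /cvgrPdist_le; apply.
    by rewrite invr_gt0.
  by move=> /filter_ex[m [h1 h2]]; exists m.
exists phi => [n|j]; first exact: (Hphi n).1.
exists (l j); apply/cvgrPdist_le => e e0.
have /cvg0_leP := @cvg_harmonic R; move=> H.
have : \forall n \near \oo, (harmonic n : R) <= e.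
  by apply: H => // n; rewrite /harmonic/= invr_ge0.
move=> [n0 _ Hn0]; exists (maxn n0 j) => // n /=; rewrite geq_max => /andP[n0n jn].
have jn' : (j < n.+1)%N by [].
exact: le_trans ((Hphi n).2 (Ordinal jn')) (Hn0 n n0n).
Qed.

End diagonal_subsequence.

Section compactness.
Variables (R : realType) (n : nat) (p : R).
Notation mu := (lebesgue_rV R n).
Hypothesis p_gt1 : 1 < p.
Hypothesis p_gtn : n%:R < p.

(** There are countably many cell averages and each is bounded along the sequence, so a diagonal
    subsequence makes all of them converge. Every [u d] is within the same geometric error of its
    averages of level [k], so the values at almost every point are Cauchy. *)
Lemma sobolev_ae_compact (u : nat -> 'rV[R]_n -> R) (Du : nat -> 'rV[R]_n -> 'rV[R]_n) (B : R) :
  (forall k, sobolev p (u k) (Du k)) ->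
  (forall k, norm_p p (u k) + grad_norm p (Du k) <= B) ->
  exists2 phi : nat -> nat, (forall k, (k <= phi k)%N) &
  {ae mu, forall x, cvgn (fun k => u (phi k) x)}.
Proof.
move=> su uB.
pose I : countType := (nat * {ffun 'I_n -> int})%type.
pose a (j : nat) (d : nat) := if (unpickle j : option I) is Some (k, m) then
  cell_int (u d) (fun=> k) m / @cell_volume R n (fun=> k) else 0.
have [|phi phik Hphi] := @diagonal_subsequence R a.
  move=> j; rewrite /a; case: (unpickle j) => [[k m]|]; last first.
    by exists 0 => d; rewrite normr0.
  set V := cell_volume _ _; have V0 : 0 < V by exact: cell_volume_gt0.
  exists (B * V `^ (1 - p^-1) / V) => d.
  rewrite normrM [X in _ * X]ger0_norm ?invr_ge0 ?(ltW V0)// ler_pM2r ?invr_gt0//.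
  have [up _ _] := su d.
  have ii : itg mu (fun y => u d y * \1_(cell (fun=> k) m) y).
    by apply: itg_cell; exact: Lp_locally_itg (ltW p_gt1) up.
  apply: le_trans (Int_norm ii) _; apply: le_trans (cell_int_hoelder p_gt1 _ _ up) _.
  apply: ler_wpM2r; first exact: powR_ge0.
  by apply: le_trans (uB d); rewrite lerDl grad_norm_ge0.
exists phi => //.
have r0 := @rate_gt0 R n p; have r1 : rate n p < 1 by exact: rate_lt1.
have q1 : 0 < 1 - rate n p by rewrite subr_gt0.
have B0 : 0 <= B.
  by apply: le_trans (uB 0%N); rewrite addr_ge0 ?norm_p_ge0 ?grad_norm_ge0.
have : {ae mu, forall x, forall d k, `|u d x - cell_avg (u d) (fun=> k) x| <=
    grad_norm p (Du d) * rate n p * rate n p ^+ k / (1 - rate n p)}.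
  by apply: ae_foralln => d; exact: cell_avg_uniform.
apply: filterS => x Hx.
have Hx' d k : `|u d x - cell_avg (u d) (fun=> k) x| <= B * rate n p ^+ k / (1 - rate n p).
  apply: le_trans (Hx d k) _; rewrite ler_pM2r ?invr_gt0// ler_pM2r ?exprn_gt0//.
  apply: (@le_trans _ _ (grad_norm p (Du d))); first by rewrite ler_piMr ?grad_norm_ge0 ?ltW.
  by apply: le_trans (uB d); rewrite lerDr norm_p_ge0.
have avg_cvg k : exists l : R, (fun d => cell_avg (u (phi d)) (fun=> k) x) @ \oo --> l.
  have := Hphi (pickle ((k, cell_index (fun=> k) x) : I)).
  by rewrite /a pickleK.
apply/cauchy_cvgP/cauchy_exP => e e0.
have [k Hk] : exists k, B * rate n p ^+ k / (1 - rate n p) < e / 2.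
  have h : (fun k => B * rate n p ^+ k / (1 - rate n p)) @ \oo --> (0 : R).
    have -> : (0 : R) = B * 0 / (1 - rate n p) by rewrite mulr0 mul0r.
    apply: cvgM; last exact: cvg_cst.
    apply: cvgM; first exact: cvg_cst.
    by apply: cvg_expr; rewrite ger0_norm ?(ltW r0).
  have := h => /cvgrPdist_lt /(_ (e / 2)); rewrite divr_gt0// => /(_ isT)[k _ /(_ k (leqnn k))].
  by rewrite sub0r normrN => /(le_lt_trans (ler_norm _)); exists k.
have [l al] := avg_cvg k; exists l.
have := al => /cvgrPdist_lt /(_ (e / 2)); rewrite divr_gt0// => /(_ isT).
apply: filterS => d /= hd; rewrite -ball_normE/=.
rewrite -(subrKA (cell_avg (u (phi d)) (fun=> k) x)); apply: le_lt_trans (ler_normD _ _) _.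
have := Hx' (phi d) k; rewrite distrC => h2.
by rewrite [e]splitr ltrD//; exact: le_lt_trans Hk.
Qed.

End compactness.

Section test_functions_are_bounded.
Variables (R : realType) (n : nat).
Notation mu := (lebesgue_rV R n).
Implicit Types (phi f : 'rV[R]_n -> R) (K : set 'rV[R]_n).

Definition bounded_in_cbox f := exists a b M,
  0 <= M /\ forall x, `|f x| <= M * \1_(cbox a b) x.

Lemma compact_sub_cbox K : compact K -> exists a b, K `<=` @cbox R n a b.
Proof.
move=> cK.
have /choice[M HM] : forall i : 'I_n, exists M : R, forall x, K x -> `|x ord0 i| <= M.
  move=> i; have : compact ((fun x : 'rV[R]_n => x ord0 i) @` K).
    apply: continuous_compact => //; apply: continuous_subspaceT.
    exact: coord_continuous.
  move=> /compact_bounded[M0 [_ HM]]; exists (M0 + 1) => x Kx.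
  by apply: (HM (M0 + 1)); [rewrite ltrDl|exists x].
exists (fun i => - M i), M => x Kx i.
by rewrite in_itv/= -ler_norml HM.
Qed.

Lemma continuous_bounded_in_cbox f K : continuous f -> compact K ->
  (forall x, ~ K x -> f x = 0) -> bounded_in_cbox f.
Proof.
move=> cf cK f0.
have [a [b Kab]] := compact_sub_cbox cK.
have : compact (f @` K) by apply: continuous_compact => //; apply: continuous_subspaceT.
move=> /compact_bounded[M0 [_ HM]]; exists a, b, (`|M0| + 1); split; first by rewrite addr_ge0.
move=> x; rewrite indicE; have [Kx|nKx] := pselect (K x); last first.
  by rewrite f0// normr0 mulr_ge0// addr_ge0.
rewrite mem_set ?mulr1; last exact: Kab.
by apply: (HM (`|M0| + 1)); [apply: le_lt_trans (ler_norm _) _; rewrite ltrDl|exists x].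
Qed.

Lemma test_function_continuous phi : test_function phi -> continuous phi.
Proof. by move=> [sphi _] x; exact: differentiable_continuous (sphi [::] x). Qed.

Lemma test_function_bounded phi : test_function phi -> bounded_in_cbox phi.
Proof.
move=> tphi; apply: continuous_bounded_in_cbox tphi.2 _.
  exact: test_function_continuous.
move=> x nx; apply/eqP; apply: contrapT => /negP phix; apply: nx.
exact: subset_closure.
Qed.

Lemma partial_continuous i phi : test_function phi -> continuous (partial i phi).
Proof. by move=> [sphi _] x; exact: differentiable_continuous (sphi [:: i] x). Qed.

Lemma partial_bounded i phi : test_function phi -> bounded_in_cbox (partial i phi).
Proof.
move=> tphi; apply: continuous_bounded_in_cbox tphi.2 _.
  exact: partial_continuous.
move=> x nx; rewrite /partial.
have -> : 'D_(delta_mx ord0 i) phi x = 'D_(delta_mx ord0 i) (cst 0) x.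
  apply: near_eq_derive.
  have oC : open (~` closure [set x | phi x != 0]) by apply: closed_openC; exact: closed_closure.
  have : nbhs x (~` closure [set x | phi x != 0]) by apply: open_nbhs_nbhs.
  apply: filterS => y ny /=; apply/eqP; apply: contrapT => /negP phiy; apply: ny.
  exact: subset_closure.
exact: derive_cst.
Qed.

Lemma bounded_in_cbox_Lp q f : 0 < q -> measurable_fun [set: 'rV[R]_n] f ->
  bounded_in_cbox f -> Lp mu q f.
Proof.
move=> q0 mf [a [b [M [M0 fM]]]]; split => //.
apply: (itg_le _ (itgZ (M `^ q) (itg_cbox a b))) => [|x].
  exact: measurable_norm_powR.
rewrite ger0_norm ?powR_ge0//; have := fM x; rewrite indicE.
case: (_ \in _) => /= h.
  by rewrite mulr1; apply: powR_le_mono => //; rewrite mulr1 in h.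
by move: h; rewrite mulr0 => h; rewrite (_ : `|f x| = 0) ?powR0 ?gt_eqF ?mulr0//; apply/eqP; rewrite eq_le h normr_ge0.
Qed.

End test_functions_are_bounded.

(** * Linear combinations and limits of weak gradients *)

Section weak_gradients.
Variables (R : realType) (n : nat) (p : R).
Notation mu := (lebesgue_rV R n).
Hypothesis p_gt1 : 1 < p.
Implicit Types (u v phi : 'rV[R]_n -> R) (Du Dv : 'rV[R]_n -> 'rV[R]_n).

Let p_gt0 : 0 < p. Proof. exact: lt_trans p_gt1. Qed.
Definition dual_exponent : R := p / (p - 1).
Local Notation q := dual_exponent.
Lemma dual_exponent_gt0 : 0 < q.
Proof. by rewrite divr_gt0 ?p_gt0// subr_gt0. Qed.
Lemma dual_exponentV : p^-1 + q^-1 = 1.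
Proof. by rewrite /q invf_div; field; rewrite !gt_eqF ?subr_gt0. Qed.

Lemma itg_mul_Lp u phi : Lp mu p u -> Lp mu q phi -> itg mu (fun x => u x * phi x).
Proof. by move=> up phiq; have [] := Int_hoelder p_gt0 dual_exponent_gt0 dual_exponentV up phiq. Qed.

Lemma Int_mul_Lp_le u phi : Lp mu p u -> Lp mu q phi ->
  `|\int[mu]_x (u x * phi x)| <= norm_p p u * norm_p q phi.
Proof.
move=> up phiq; have [h1 h2] := Int_hoelder p_gt0 dual_exponent_gt0 dual_exponentV up phiq.
exact: le_trans (Int_norm h1) h2.
Qed.

Lemma Int_mul_Lp_cvg (u_ : nat -> 'rV[R]_n -> R) u phi : (forall k, Lp mu p (u_ k)) ->
  Lp mu p u -> Lp mu q phi ->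
  (fun k => \int[mu]_x `|u_ k x - u x| `^ p) @ \oo --> (0 : R) ->
  (fun k => \int[mu]_x (u_ k x * phi x)) @ \oo --> \int[mu]_x (u x * phi x).
Proof.
move=> ukp up phiq h; apply/cvgrPdist_le => e e0.
have h2 : (fun k => norm_p p (fun x => u_ k x - u x) * norm_p q phi) @ \oo --> (0 : R).
  rewrite -(mul0r (norm_p q phi)); apply: cvgM; last exact: cvg_cst.
  rewrite -(@powR0 _ p^-1) ?invr_eq0 ?gt_eqF//; apply: cvg_powR h; first by rewrite invr_gt0.
  by move=> k; apply: Rintegral_ge0 => x _; exact: powR_ge0.
have := h2 => /cvgrPdist_le /(_ e e0); apply: filterS => k.
rewrite sub0r normrN => /(le_trans (ler_norm _)) hk.
rewrite distrC -IntB; [|exact: itg_mul_Lp|exact: itg_mul_Lp].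
under eq_Rintegral do rewrite -mulrBl.
by apply: le_trans hk; apply: Int_mul_Lp_le => //; exact: LpB.
Qed.

Lemma test_Lp r phi : 0 < r -> test_function phi -> Lp mu r phi.
Proof.
move=> r0 tphi; apply: bounded_in_cbox_Lp => //; last exact: test_function_bounded.
by apply: continuous_rV_measurable; exact: test_function_continuous.
Qed.

Lemma partial_Lp r i phi : 0 < r -> test_function phi -> Lp mu r (partial i phi).
Proof.
move=> r0 tphi; apply: bounded_in_cbox_Lp => //; last exact: partial_bounded.
by apply: continuous_rV_measurable; exact: partial_continuous.
Qed.

(** For a fixed test function both sides of the defining identity are continuous in $L^p$, since the
    test function and its partial derivatives lie in the dual space. *)
Lemma weak_gradient_limit (u_ : nat -> 'rV[R]_n -> R) (Du_ : nat -> 'rV[R]_n -> 'rV[R]_n) u Du :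
  (forall k, sobolev p (u_ k) (Du_ k)) -> Lp mu p u -> (forall i, Lp mu p (fun x => Du x ord0 i)) ->
  (fun k => \int[mu]_x `|u_ k x - u x| `^ p) @ \oo --> (0 : R) ->
  (forall i, (fun k => \int[mu]_x `|Du_ k x ord0 i - Du x ord0 i| `^ p) @ \oo --> (0 : R)) ->
  sobolev p u Du.
Proof.
move=> su up Dup ul Dul; split => // i phi tphi.
have h1 := Int_mul_Lp_cvg (fun k => let: And3 h _ _ := su k in h) up
  (partial_Lp i dual_exponent_gt0 tphi) ul.
have h2 := Int_mul_Lp_cvg (fun k => let: And3 _ h _ := su k in h i) (Dup i)
  (test_Lp dual_exponent_gt0 tphi) (Dul i).
have := h1; have -> : (fun k => \int[mu]_x (u_ k x * partial i phi x)) =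
    (fun k => - \int[mu]_x (Du_ k x ord0 i * phi x)).
  by apply/funext => k; have [_ _ ->] := su k.
move=> h1'; apply: (cvg_unique (@Rhausdorff R) h1'); exact: cvgN.
Qed.

Lemma sobolevD u Du v Dv : sobolev p u Du -> sobolev p v Dv ->
  sobolev p (fun x => u x + v x) (fun x => Du x + Dv x).
Proof.
move=> [up Dup wu] [vp Dvp wv]; split; first exact: LpD.
  move=> i; under eq_fun do rewrite mxE; exact: LpD.
move=> i phi tphi.
have P := partial_Lp i dual_exponent_gt0 tphi; have T := test_Lp dual_exponent_gt0 tphi.
under eq_Rintegral do rewrite mulrDl.
under [in RHS]eq_Rintegral do rewrite mxE mulrDl.
rewrite IntD ?wu ?wv//; [|exact: itg_mul_Lp|exact: itg_mul_Lp].
by rewrite IntD ?opprD//; exact: itg_mul_Lp.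
Qed.

Lemma sobolevZ (c : R) u Du : sobolev p u Du ->
  sobolev p (fun x => c * u x) (fun x => c *: Du x).
Proof.
move=> [up Dup wu]; split; first exact: LpZ.
  move=> i; under eq_fun do rewrite mxE; exact: LpZ.
move=> i phi tphi.
have P := partial_Lp i dual_exponent_gt0 tphi; have T := test_Lp dual_exponent_gt0 tphi.
under eq_Rintegral do rewrite -mulrA.
under [in RHS]eq_Rintegral do rewrite mxE -mulrA.
rewrite IntZ ?wu//; [|exact: itg_mul_Lp].
by rewrite IntZ ?mulrN//; exact: itg_mul_Lp.
Qed.

Lemma Lp0 r : 0 < r -> Lp mu r (fun=> 0 : R).
Proof.
move=> r0; split; first exact: measurable_cst.
have -> : (fun x : 'rV[R]_n => `|(0 : R)| `^ r) = cst 0 by apply/funext => x; rewrite normr0 powR0 ?gt_eqF.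
exact: integrable0.
Qed.

Lemma sobolev0 : sobolev p (fun _ : 'rV[R]_n => 0 : R) (fun=> 0).
Proof.
split; first exact: Lp0.
  move=> i; under eq_fun do rewrite mxE; exact: Lp0.
move=> i phi _; under eq_Rintegral do rewrite mul0r.
by under [in RHS]eq_Rintegral do rewrite mxE mul0r; rewrite /Rintegral integral0 oppr0.
Qed.

End weak_gradients.

(** * Difference quotients and the positive part *)

Section test_function_algebra.
Variables (R : realType) (n : nat).
Implicit Types (f g phi : 'rV[R]_n -> R) (s : seq 'I_n) (i : 'I_n) (c : R) (t : 'rV[R]_n).

Lemma foldr_partialD f g s : smooth f -> smooth g ->
  foldr partial (fun x => f x + g x) s = (fun x => foldr partial f s x + foldr partial g s x).
Proof.
move=> sf sg; elim: s => [//|i s IH] /=; rewrite IH; apply/funext => x.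
rewrite /partial; have df : derivable (foldr partial f s) x (delta_mx ord0 i).
  exact: diff_derivable (sf s x).
have dg : derivable (foldr partial g s) x (delta_mx ord0 i).
  exact: diff_derivable (sg s x).
exact: (deriveD df dg).
Qed.

Lemma foldr_partialZ c f s : smooth f ->
  foldr partial (fun x => c * f x) s = (fun x => c * foldr partial f s x).
Proof.
move=> sf; elim: s => [//|i s IH] /=; rewrite IH; apply/funext => x.
rewrite /partial; have df : derivable (foldr partial f s) x (delta_mx ord0 i).
  exact: diff_derivable (sf s x).
exact: (deriveZ c df).
Qed.

Lemma foldr_partial_translation f t s :
  foldr partial (fun x => f (x + t)) s = (fun x => foldr partial f s (x + t)).
Proof.
elim: s => [//|i s IH] /=; rewrite IH; apply/funext => x.
rewrite /partial /derive; congr (lim (_ @ 0^')).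
by apply/funext => h /=; rewrite addrA.
Qed.

Lemma smoothD f g : smooth f -> smooth g -> smooth (fun x => f x + g x).
Proof. by move=> sf sg s x; rewrite foldr_partialD//; exact: differentiableD. Qed.

Lemma smoothZ c f : smooth f -> smooth (fun x => c * f x).
Proof. by move=> sf s x; rewrite foldr_partialZ//; exact: differentiableZ. Qed.

Lemma smooth_translation f t : smooth f -> smooth (fun x => f (x + t)).
Proof.
move=> sf s x; rewrite foldr_partial_translation.
apply: (@differentiable_comp _ _ _ _ (fun x => x + t) (foldr partial f s)) => //.
Qed.

Lemma test_function_cbox phi : test_function phi ->
  exists a b, forall x, phi x != 0 -> @cbox R n a b x.
Proof.
move=> [_ cK]; have [a [b Kab]] := compact_sub_cbox cK; exists a, b => x px.
by apply: Kab; exact: subset_closure.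
Qed.

Lemma test_functionD f g : test_function f -> test_function g ->
  test_function (fun x => f x + g x).
Proof.
move=> tf tg; have [a [b fab]] := test_function_cbox tf.
have [c [d gcd]] := test_function_cbox tg.
apply: (@test_function_support _ _ _ (fun j => Num.min (a j) (c j)) (fun j => Num.max (b j) (d j))).
  by apply: smoothD; [exact: tf.1|exact: tg.1].
move=> x fgx j; rewrite in_itv/= ge_min le_max.
have [fx0|/fab/(_ j)] := eqVneq (f x) 0; last by rewrite in_itv/= => /andP[-> ->].
have /gcd/(_ j) : g x != 0 by move: fgx; rewrite fx0 add0r.
by rewrite in_itv/= => /andP[-> ->]; rewrite !orbT.
Qed.

Lemma test_functionZ c f : test_function f -> test_function (fun x => c * f x).
Proof.
move=> tf; have [a [b fab]] := test_function_cbox tf.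
apply: (@test_function_support _ _ _ a b); first by apply: smoothZ; exact: tf.1.
by move=> x cfx; apply: fab; move: cfx; rewrite mulf_eq0 negb_or => /andP[].
Qed.

Lemma test_function_translation t f : test_function f -> test_function (fun x => f (x + t)).
Proof.
move=> tf; have [a [b fab]] := test_function_cbox tf.
apply: (@test_function_support _ _ _ (fun j => a j - t ord0 j) (fun j => b j - t ord0 j)).
  by apply: smooth_translation; exact: tf.1.
by move=> x /fab H j; have := H j; rewrite !in_itv/= mxE lerBlDr lerBrDr.
Qed.

Lemma test_function0 : test_function (fun _ : 'rV[R]_n => 0 : R).
Proof.
apply: (@test_function_support _ _ _ (fun=> 0) (fun=> 0)); last by move=> x; rewrite eqxx.
move=> s x; have -> : foldr partial (fun _ : 'rV[R]_n => 0 : R) s = cst 0.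
  elim: s => [//|i s IH] /=; rewrite IH; apply/funext => y; exact: derive_cst.
exact: differentiable_cst.
Qed.

Lemma flat0_ge_cst (t : R) : 1 <= t -> expR (-1) <= flat 0 t.
Proof.
move=> t1; have t0 : 0 < t by exact: lt_le_trans t1.
by rewrite /flat t0 expr0 mul1r ler_expR lerN2 invf_le1.
Qed.

Lemma test_function_dominating (a b : 'I_n -> R) :
  exists chi : 'rV[R]_n -> R, [/\ test_function chi, forall x, 0 <= chi x &
    forall x, cbox a b x -> 1 <= chi x].
Proof.
(* At index 0, with the right end moved by 1, both arguments of [flat] are at least 1 on
   $[a_j,b_j]$, so each factor is at least $e^{-2}$ there. *)
pose f j := bump (a j) (b j + 1) 0.
pose c : R := expR (-1) * expR (-1).
have c0 : 0 < c by rewrite mulr_gt0 ?expR_gt0.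
exists (fun x => (c ^+ n)^-1 * tensor f x); split.
- apply: test_functionZ; apply: (@test_function_tensor _ _ f (fun j => a j - 1) (fun j => b j + 1)).
    by move=> j; exact: smooth1_bump.
  move=> j s; rewrite in_itv/= negb_and -!ltNge => sn; apply: bump_out.
  by move: sn => /orP[|] /ltW; [left|right].
- move=> x; rewrite mulr_ge0 ?invr_ge0 ?exprn_ge0 ?(ltW c0)//.
  by apply: prodr_ge0 => j _; have /andP[] := bump_bounds (a j) (b j + 1) 0 (x ord0 j).
- move=> x xab; rewrite mulrC ler_pdivlMr ?exprn_gt0// mul1r.
  rewrite -[n in leLHS]card_ord -prodr_const; apply: ler_prod => j _.
  rewrite (ltW c0)/=; have := xab j; rewrite in_itv/= => /andP[h1 h2].
  by apply: ler_pM; rewrite ?expR_ge0// flat0_ge_cst// ?mulN1r; lra.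
Qed.

(** Adding a large multiple of a dominating test function makes [phi] nonnegative. The inequalities
    behind the chain rule for the positive part are available for nonnegative test functions, and
    this extends their consequence to all. *)
Lemma test_function_split phi : test_function phi -> exists phi1 phi2 : 'rV[R]_n -> R,
  [/\ test_function phi1 /\ test_function phi2, forall x, 0 <= phi1 x, forall x, 0 <= phi2 x &
    phi = (fun x => phi1 x - phi2 x)].
Proof.
move=> tphi; have [a [b [M [M0 phiM]]]] := test_function_bounded tphi.
have [chi [tchi chi0 chi1]] := test_function_dominating a b.
exists (fun x => phi x + M * chi x), (fun x => M * chi x); split.
- by split; [apply: test_functionD => //|]; exact: test_functionZ.
- move=> x; have := phiM x; rewrite indicE; have [xab|nx] := pselect (cbox a b x).
    rewrite mem_set// mulr1 => h; have h2 : M <= M * chi x by rewrite ler_peMr// chi1.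
    by move: h; rewrite ler_norml => /andP[+ _]; lra.
  rewrite memNset// mulr0 => h; have /eqP -> : phi x == 0 by rewrite -normr_eq0 eq_le h normr_ge0.
  by rewrite add0r mulr_ge0.
- by move=> x; rewrite mulr_ge0.
- by apply/funext => x; rewrite addrK.
Qed.

End test_function_algebra.

(** * Density of test functions in $L^q$ *)

Section density.
Variables (R : realType) (n : nat) (q : R).
Notation mu := (lebesgue_rV R n).
Hypothesis q_gt1 : 1 < q.
Implicit Types (f g z phi : 'rV[R]_n -> R).

Let q_gt0 : 0 < q. Proof. exact: lt_trans q_gt1. Qed.

Lemma norm_pE f : Lp mu q f -> 'N[mu]_q%:E[EFin \o f]%E = (norm_p q f)%:E.
Proof. by move=> [_ fi]; rewrite unlock /= /norm_p -poweR_EFin IntE. Qed.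

Lemma norm_pD f g : Lp mu q f -> Lp mu q g ->
  norm_p q (fun x => f x + g x) <= norm_p q f + norm_p q g.
Proof.
move=> fq gq; have := minkowski_EFin mu fq.1 gq.1 (ltW q_gt1).
by rewrite norm_pE ?norm_pE// -?EFinD ?lee_fin//; exact: LpD.
Qed.

Lemma norm_pZ c f : Lp mu q f -> norm_p q (fun x => c * f x) = `|c| * norm_p q f.
Proof.
move=> [_ fi]; rewrite /norm_p; under eq_Rintegral do rewrite normrM powRM//.
rewrite IntZ// powRM ?powR_ge0//; last by apply: Rintegral_ge0 => x _; exact: powR_ge0.
by rewrite -powRrM mulfV ?gt_eqF// powRr1.
Qed.

Lemma norm_p_le (d : R) f : 0 <= d -> Lp mu q f -> \int[mu]_x `|f x| `^ q <= d `^ q -> norm_p q f <= d.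
Proof.
move=> d0 fq h; rewrite /norm_p -[leRHS](@powRr1 _ d)// -(mulfV (lt0r_neq0 q_gt0)) powRrM.
apply: powR_le_mono => //; first by rewrite invr_gt0.
by apply: Rintegral_ge0 => x _; exact: powR_ge0.
Qed.

Lemma norm_p_mono f g : Lp mu q f -> Lp mu q g -> (forall x, `|f x| <= `|g x|) ->
  norm_p q f <= norm_p q g.
Proof.
move=> fq gq fg; apply: powR_le_mono; rewrite ?invr_gt0//.
  by apply: Rintegral_ge0 => x _; exact: powR_ge0.
by apply: Int_le; [exact: fq.2|exact: gq.2|move=> x; exact: powR_le_mono].
Qed.

Definition approximable z := Lp mu q z /\
  forall d : R, 0 < d -> exists2 phi, test_function phi & norm_p q (fun x => z x - phi x) <= d.

Lemma approximable_test phi : test_function phi -> approximable phi.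
Proof.
move=> tphi; split; first exact: test_Lp.
move=> d d0; exists phi => //; apply: norm_p_le; first exact: ltW.
  by under eq_fun do rewrite subrr; exact: Lp0.
under eq_Rintegral do rewrite subrr normr0 powR0 ?gt_eqF//.
by rewrite /Rintegral integral0 powR_ge0.
Qed.

Lemma approximableD f g : approximable f -> approximable g -> approximable (fun x => f x + g x).
Proof.
move=> [fq fa] [gq ga]; split; first exact: LpD.
move=> d d0; have d2 : 0 < d / 2 by rewrite divr_gt0.
have [p1 t1 h1] := fa _ d2; have [p2 t2 h2] := ga _ d2.
exists (fun x => p1 x + p2 x); first exact: test_functionD.
have -> : (fun x => f x + g x - (p1 x + p2 x)) = (fun x => (f x - p1 x) + (g x - p2 x)).
  by apply/funext => x; rewrite opprD addrACA.
have f1 : Lp mu q (fun x => f x - p1 x) by apply: LpB => //; exact: test_Lp.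
have g1 : Lp mu q (fun x => g x - p2 x) by apply: LpB => //; exact: test_Lp.
by rewrite [d]splitr; apply: le_trans (norm_pD f1 g1) (lerD h1 h2).
Qed.

Lemma approximableZ c f : approximable f -> approximable (fun x => c * f x).
Proof.
move=> [fq fa]; split; first exact: LpZ.
move=> d d0; have d2 : 0 < d / (`|c| + 1) by rewrite divr_gt0// ltr_wpDl.
have [p1 t1 h1] := fa _ d2.
exists (fun x => c * p1 x); first exact: test_functionZ.
under eq_fun do rewrite -mulrBr.
rewrite norm_pZ; last by apply: LpB => //; exact: test_Lp.
apply: le_trans (ler_wpM2l (normr_ge0 c) h1) _.
by rewrite mulrCA ler_piMr ?(ltW d0)// ler_pdivrMr ?ltr_wpDl// mul1r lerDl.
Qed.

Lemma approximableB f g : approximable f -> approximable g -> approximable (fun x => f x - g x).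
Proof.
move=> fa ga; have := approximableD fa (approximableZ (-1) ga).
by under eq_fun do rewrite mulN1r.
Qed.

Lemma approximable_closed z : Lp mu q z ->
  (forall d : R, 0 < d -> exists2 z', approximable z' & norm_p q (fun x => z x - z' x) <= d) ->
  approximable z.
Proof.
move=> zq H; split => // d d0; have d2 : 0 < d / 2 by rewrite divr_gt0.
have [z' [z'q za] h1] := H _ d2; have [p t h2] := za _ d2; exists p => //.
have -> : (fun x => z x - p x) = (fun x => (z x - z' x) + (z' x - p x)).
  by apply/funext => x; rewrite subrKA.
have f1 : Lp mu q (fun x => z x - z' x) by exact: LpB.
have g1 : Lp mu q (fun x => z' x - p x) by apply: LpB => //; exact: test_Lp.
by rewrite [d]splitr; apply: le_trans (norm_pD f1 g1) (lerD h1 h2).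
Qed.

Lemma approximable_limit z (z_ : nat -> 'rV[R]_n -> R) (a b : 'I_n -> R) (M : R) :
  measurable_fun [set: 'rV[R]_n] z -> (forall k, approximable (z_ k)) ->
  (forall x, (fun k => z_ k x) @ \oo --> z x) ->
  (forall k x, `|z_ k x| <= M * \1_(cbox a b) x) -> approximable z.
Proof.
move=> mz za zl zM.
have zM' x : `|z x| <= M * \1_(cbox a b) x.
  have h : (fun k => `|z_ k x|) @ \oo --> `|z x| by exact: cvg_norm.
  apply: (@ler_cvg_to _ _ _ _ _ _ _ _ h (cvg_cst (M * \1_(cbox a b) x))).
  by apply: nearW => k.
have M0 : forall x, 0 <= M * \1_(cbox a b) x by move=> x; exact: le_trans (normr_ge0 _) (zM' x).
have zq : Lp mu q z.
  apply: bounded_in_cbox_Lp => //; exists a, b, `|M|; split => // x.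
  by apply: le_trans (zM' x) _; rewrite ler_wpM2r ?indicE// ler_norm.
apply: approximable_closed => // d d0.
have [|||||_ _ H] := @dct _ _ _ mu (fun k x => `|z x - z_ k x| `^ q) (fun=> 0)
  (fun x => (2 * `|M|) `^ q * \1_(cbox a b) x).
- by move=> k; apply: measurable_norm_powR; apply: measurable_funB => //; exact: (za k).1.1.
- exact: measurable_cst.
- apply: aeW => x; rewrite -[X in _ --> X](@powR0 _ q) ?gt_eqF//; apply: cvg_powR => //.
  rewrite -(normr0 R) -(subrr (z x)); apply: cvg_norm; apply: cvgB => //; exact: cvg_cst.
- by apply: itgZ; exact: itg_cbox.
- apply: aeW => x k; rewrite ger0_norm ?powR_ge0//.
  have h1 := zM' x; have h2 := zM k x; move: h1 h2; rewrite indicE; case: (_ \in _) => /=.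
    rewrite !mulr1 => h1 h2; apply: powR_le_mono => //; apply: le_trans (ler_normB _ _) _.
    by have := ler_norm M; lra.
  rewrite !mulr0 => h1 h2; have -> : `|z x - z_ k x| = 0.
    apply/eqP; rewrite eq_le normr_ge0 andbT; apply: le_trans (ler_normB _ _) _; lra.
  by rewrite powR0 ?gt_eqF.
have h : (fun k => \int[mu]_x `|z x - z_ k x| `^ q) @ \oo --> (0 : R).
  by move: H; under eq_fun do under eq_Rintegral do rewrite subr0 ger0_norm ?powR_ge0//.
have dq : 0 < d `^ q by rewrite powR_gt0.
have := h => /cvgrPdist_le /(_ _ dq) [k _ /(_ k (leqnn k))].
rewrite /= sub0r normrN => /(le_trans (ler_norm _)) hk; exists (z_ k) => //.
apply: norm_p_le => //; first exact: ltW.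
by apply: LpB => //; exact: (za k).1.
Qed.

(** Two boxes at once, because a dyadic cell will be intersected with a fixed bounded box. *)
Lemma approximable_box (a b c d : 'I_n -> R) :
  approximable (fun x => tensor (box_factor a b) x * tensor (box_factor c d) x).
Proof.
pose f k j s := bump (a j) (b j) k s * bump (c j) (d j) k s.
have fout k j t : t \notin `[a j - 1, b j] -> f k j t = 0.
  rewrite in_itv/= negb_and -!ltNge => sn; rewrite /f bump_out ?mul0r//.
  by move: sn => /orP[|] /ltW; [left|right].
have fB k j t : `|f k j t| <= 1.
  have /andP[h1 h2] := bump_bounds (a j) (b j) k t.
  have /andP[h3 h4] := bump_bounds (c j) (d j) k t.
  rewrite /f ger0_norm; last by rewrite mulr_ge0.
  by rewrite -[leRHS]mulr1 ler_pM.
apply: (@approximable_limit _ (fun k => tensor (f k)) (fun j => a j - 1) b (1 ^+ n)).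
- apply: measurable_funM; apply: measurable_tensor => j; exact: measurable_indic.
- move=> k; apply: approximable_test; apply: (@test_function_tensor _ _ (f k) (fun j => a j - 1) b).
    by move=> j; apply: smooth1M; exact: smooth1_bump.
  exact: fout.
- move=> x; rewrite /tensor -big_split/=.
  apply: (@cvg_tensor _ _ f (fun j s => box_factor a b j s * box_factor c d j s)) => j.
  by apply: cvgM; exact: cvg_bump.
- by move=> k x; exact: (tensor_bound ler01 (fB k) (fout k)).
Qed.

(** Dynkin induction on [A]. Everything is cut by one fixed box, so that complements and countable
    unions stay in $L^q$ with a common bounded support. *)
Lemma approximable_indic (a b : 'I_n -> R) (A : set 'rV[R]_n) : measurable A ->
  approximable (fun x => \1_A x * tensor (box_factor a b) x).
Proof.
pose K := tensor (box_factor a b).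
have K01 x : 0 <= K x <= 1.
  apply/andP; split; first by apply: prodr_ge0 => j _; rewrite /box_factor indicE.
  by apply: prodr_ile1 => j _; rewrite /box_factor indicE; case: (_ \in _); rewrite ?lexx ?ler01.
have KB x : K x <= 1 * \1_(cbox a b) x.
  have /andP[K0 K1] := K01 x; rewrite mul1r indicE; have [xab|nx] := pselect (cbox a b x).
    by rewrite mem_set.
  rewrite memNset//; have : exists j, x ord0 j \notin `[a j, b j].
    by apply: contrapT => h; apply: nx => j; apply: contrapT => /negP hj; apply: h; exists j.
  move=> [j hj]; rewrite /K (@tensor_out _ _ _ x j)// /box_factor indicE memNset//=.
  by move: hj; rewrite !in_itv/= => /negP hj /andP[h1 h2]; apply: hj; rewrite h1 ltW.
have mK : measurable_fun [set: 'rV[R]_n] K by apply: measurable_tensor => j; exact: measurable_indic.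
have aK : approximable K.
  have := approximable_box a b a b; congr approximable; apply/funext => x.
  rewrite /K /tensor -big_split/=; apply: eq_bigr => j _; rewrite /box_factor indicE.
  by case: (_ \in _); rewrite ?mulr1 ?mulr0.
move=> mA; apply: (@dynkin_induction _ _ (@dyadic_cells R n)
    (fun A => approximable (fun x => \1_A x * tensor (box_factor a b) x))).
- exact: dyadic_measurable.
- exact: dyadic_cells_setI.
- by under eq_fun do rewrite indicT mul1r.
- move=> B [->|[k [m ->]]].
    under eq_fun do rewrite indic0 mul0r; apply: approximable_test; exact: test_function0.
  by under eq_fun do rewrite indic_cell; exact: approximable_box.
- move=> B mB aB; have := approximableB aK aB; congr approximable; apply/funext => x.
  rewrite !indicE in_setC; case: (_ \in _); rewrite ?mul1r ?mul0r ?subrr ?subr0//.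
- move=> F mF tF aF.
  apply: (@approximable_limit _ (fun k x => \sum_(j < k) (\1_(F j) x * K x)) a b 1).
  + by apply: measurable_funM => //; apply: measurable_indic; exact: bigcup_measurable.
  + elim=> [|k IH].
      under eq_fun do rewrite big_ord0; apply: approximable_test; exact: test_function0.
    have -> : (fun x => \sum_(j < k.+1) (\1_(F j) x * K x)) =
        (fun x => \sum_(j < k) (\1_(F j) x * K x) + \1_(F k) x * K x).
      by apply/funext => x; rewrite big_ord_recr.
    exact: (approximableD IH (aF k)).
  + move=> x; have [[j _ Fjx]|nx] := pselect ((\bigcup_k F k) x).
      rewrite indicE mem_set ?mul1r//; last by exists j.
      apply: cvg_near_cst; exists j.+1 => // k /= jk.
      rewrite (bigD1 (Ordinal jk))//= indicE mem_set// mul1r big1 ?addr0// => l lj.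
      rewrite indicE memNset ?mul0r// => Flx; move: lj; rewrite -val_eqE/= => /eqP; apply.
      by apply: (tF _ _ I I); exists x.
    rewrite indicE memNset// mul0r; apply: cvg_near_cst.
    apply: nearW => k; rewrite big1// => l _; rewrite indicE memNset ?mul0r// => Flx.
    by apply: nx; exists l.
  + move=> k x; have /andP[K0 _] := K01 x; apply: le_trans (KB x).
    rewrite -mulr_suml normrM [X in _ * X]ger0_norm// ler_piMl//.
    have [[j [jk Fjx]]|nx] := pselect (exists j, (j < k)%N /\ F j x).
      rewrite (bigD1 (Ordinal jk))//= indicE mem_set// big1 ?addr0 ?normr1// => l lj.
      rewrite indicE memNset// => Flx; move: lj; rewrite -val_eqE/= => /eqP; apply.
      by apply: (tF _ _ I I); exists x.
    rewrite big1 ?normr0// => l _; rewrite indicE memNset// => Flx; apply: nx; exists l; split => //.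
- by rewrite -dyadic_measurable.
Qed.

(** One binary digit per step: subtracting [M / 2] on the set where [z] reaches that value leaves a
    remainder between 0 and [M / 2]. *)
Lemma approximable_nonneg (a b : 'I_n -> R) (k : nat) : forall (M : R) z, 0 <= M ->
  measurable_fun [set: 'rV[R]_n] z -> (forall x, 0 <= z x <= M * tensor (box_factor a b) x) ->
  exists2 z', approximable z' & forall x, 0 <= z x - z' x <= M / 2 ^+ k * tensor (box_factor a b) x.
Proof.
elim: k => [|k IH] M z M0 mz zM.
  exists (fun=> 0); first by apply: approximable_test; exact: test_function0.
  by move=> x; rewrite subr0 expr0 divr1.
pose K := tensor (box_factor a b).
have M2 : 0 <= M / 2 by rewrite divr_ge0.
pose A := [set x | M / 2 <= z x].
have mA : measurable A.
  by rewrite (_ : A = z @^-1` `[M / 2, +oo[); [rewrite -[X in measurable X]setTI; exact: mz|apply/seteqP; split => x; rewrite /A/= in_itv/= andbT].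
have [||w wa wM] := IH (M / 2) (fun x => z x - M / 2 * (\1_A x * K x)) M2.
- apply: measurable_funB => //; apply: measurable_funM => //; apply: measurable_funM.
    exact: measurable_indic.
  by apply: measurable_tensor => j; exact: measurable_indic.
- move=> x; have /andP[z0 z1] := zM x.
  have K01 : K x = 0 \/ K x = 1.
    rewrite /K /tensor; apply: (big_ind (fun y : R => y = 0 \/ y = 1)); first by right.
      by move=> y y' [->|->] [->|->]; rewrite ?mulr0 ?mul0r ?mulr1; [left|left|left|right].
    by move=> j _; rewrite /box_factor indicE; case: (_ \in _); [right|left].
  rewrite indicE; move: z1; rewrite -/K; have [xA|xA] := boolP (x \in A); case: K01 => ->; rewrite ?mulr0 ?mulr1 ?mul0r.
  + move=> ?; lra.
  + move: xA => /set_mem; rewrite /A/= => ? ?; lra.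
  + move=> ?; lra.
  + move: xA; rewrite notin_setE /A/= => /negP; rewrite -ltNge => ? ?; lra.
exists (fun x => w x + M / 2 * (\1_A x * K x)).
  by apply: (approximableD wa); apply: approximableZ; exact: (approximable_indic a b mA).
move=> x; have := wM x; have -> : M / 2 ^+ k.+1 = M / 2 / 2 ^+ k by rewrite exprS invfM mulrA.
by have -> : z x - (w x + M / 2 * (\1_A x * K x)) = z x - M / 2 * (\1_A x * K x) - w x by ring.
Qed.

Theorem bounded_approximable z : measurable_fun [set: 'rV[R]_n] z -> bounded_in_cbox z ->
  approximable z.
Proof.
move=> mz [a [b [M [M0 zM]]]].
pose K := tensor (box_factor a (fun j => b j + 1)).
have K1 x : cbox a b x -> K x = 1.
  move=> xab; rewrite /K /tensor big1// => j _; rewrite /box_factor indicE mem_set//=.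
  by have := xab j; rewrite !in_itv/= => /andP[-> h]; rewrite (le_lt_trans h)// ltrDl.
have K0 x : 0 <= K x by apply: prodr_ge0 => j _; rewrite /box_factor indicE.
have mK : measurable_fun [set: 'rV[R]_n] K by apply: measurable_tensor => j; exact: measurable_indic.
have zK x : `|z x| <= M * K x.
  apply: le_trans (zM x) _; rewrite indicE; have [xab|nx] := pselect (cbox a b x).
    by rewrite mem_set// K1.
  by rewrite memNset// mulr0 mulr_ge0.
have KL : Lp mu q K.
  by have [] := @approximable_indic a (fun j => b j + 1) setT measurableT; under eq_fun do rewrite indicT mul1r.
have nonneg f : measurable_fun [set: 'rV[R]_n] f -> (forall x, 0 <= f x <= M * K x) -> approximable f.
  move=> mf fM; apply: approximable_closed.
    apply: (Lp_le _ mf (LpZ M KL)) => //; apply: aeW => x; have /andP[f0 f1] := fM x.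
    by rewrite !ger0_norm// mulr_ge0.
  move=> d d0.
  have h : (fun k => M * norm_p q K * (2^-1 ^+ k)) @ \oo --> (0 : R).
    rewrite -(mulr0 (M * norm_p q K)); apply: cvgM; first exact: cvg_cst.
    by apply: cvg_expr; rewrite ger0_norm ?invr_ge0// invf_lt1// ltr1n.
  have := h => /cvgrPdist_le /(_ _ d0) [k _ /(_ k (leqnn k))].
  rewrite /= sub0r normrN => /(le_trans (ler_norm _)) hk.
  have [g ga gM] := approximable_nonneg k M0 mf fM; exists g => //.
  have E : M * norm_p q K * 2^-1 ^+ k = norm_p q (fun x => M / 2 ^+ k * K x).
    by rewrite norm_pZ// ger0_norm ?divr_ge0// exprVn mulrAC.
  apply: le_trans hk; rewrite E; apply: norm_p_mono; [|exact: LpZ|].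
    apply: LpB => //; last exact: ga.1.
    apply: (Lp_le _ mf (LpZ M KL)) => //; apply: aeW => x; have /andP[f0 f1] := fM x.
    by rewrite !ger0_norm// mulr_ge0.
  move=> x; have /andP[f0 f1] := gM x.
  by rewrite ger0_norm// ger0_norm// mulr_ge0// divr_ge0.
have -> : z = (fun x => Num.max (z x) 0 - Num.max (- z x) 0).
  by apply/funext => x; rewrite /Num.max; do 2 case: ifP; lra.
apply: approximableB; apply: nonneg.
- exact: measurable_maxr.
- move=> x; rewrite le_max lexx orbT ge_max mulr_ge0// andbT.
  exact: le_trans (ler_norm _) (zK x).
- by apply: measurable_maxr => //; exact: measurableT_comp.
- move=> x; rewrite le_max lexx orbT ge_max mulr_ge0// andbT.
  by apply: le_trans (zK x); rewrite -normrN ler_norm.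
Qed.

End density.

Lemma lipschitz_of_derivative (R : realType) (G dG : R -> R) (C t : R) :
  (forall s : R, is_derive s (1 : R) G (dG s)) -> (forall s, `|dG s| <= C) ->
  `|G t - G 0| <= C * `|t|.
Proof.
move=> GD HC; have cG : continuous G.
  move=> s; apply: differentiable_continuous; apply/derivable1_diffP.
  by have [] := GD s.
have key a b : a <= b -> `|G b - G a| <= C * (b - a).
  move=> ab; have [|c _ ->] := @MVT_segment R G dG a b ab (fun x _ => GD x).
    exact: continuous_subspaceT.
  by rewrite normrM [X in _ * X]ger0_norm ?subr_ge0// ler_wpM2r ?subr_ge0.
have [t0|t0] := leP 0 t; first by rewrite (ger0_norm t0) -{2}(subr0 t) key.
by rewrite distrC (ltr0_norm t0) -(sub0r t) key// ltW.
Qed.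

Lemma distr_sum_le (R : realFieldType) (a b A B c : R) :
  `|- b - A| <= c / 2 -> `|B| <= c / 4 -> `|a| <= c / 4 -> `|- (a + b) - (B + A)| <= c.
Proof.
have -> : - (a + b) - (B + A) = (- b - A) + (- B) + (- a) by ring.
move=> hA hB ha; apply: le_trans (ler_normD _ _) _.
by apply: le_trans (lerD (ler_normD _ _) (lexx _)) _; rewrite !normrN; lra.
Qed.

(** * Shifts in a coordinate direction and their difference quotients *)

Section shifts.
Variables (R : realType) (n : nat) (i : 'I_n).
Notation mu := (lebesgue_rV R n).
Local Notation sh t := ((t : R) *: (delta_mx ord0 i : 'rV[R]_n)).
Implicit Types (u v f z phi : 'rV[R]_n -> R) (t : R).

Lemma shift_bound f (a b : 'I_n -> R) (M T : R) : (forall x, `|f x| <= M * \1_(cbox a b) x) ->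
  0 <= M -> forall t x, `|t| <= T -> `|f (x + sh t)| <= M * \1_(cbox (fun j => a j - T) (fun j => b j + T)) x.
Proof.
move=> fM M0 t x tT; apply: le_trans (fM _) _; apply: ler_wpM2l => //.
have T0 : 0 <= T by exact: le_trans tT.
rewrite !indicE; have [H|nH] := pselect (cbox a b (x + sh t)); last by rewrite (memNset nH).
rewrite !mem_set// => j; have := H j; rewrite !in_itv/= !mxE eqxx/=.
move: tT; rewrite ler_norml => /andP[h1 h2].
by case: (j == i); rewrite ?mulr1 ?mulr0 => /andP[h3 h4]; apply/andP; split; lra.
Qed.

Lemma measurable_shift_rV f t : measurable_fun [set: 'rV[R]_n] f ->
  measurable_fun [set: 'rV[R]_n] (fun x => f (x + sh t)).
Proof. by move=> mf; apply: measurableT_comp => //; exact: measurable_translation. Qed.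

Lemma bounded_shift f t : bounded_in_cbox f -> bounded_in_cbox (fun x => f (x + sh t)).
Proof.
move=> [a [b [M [M0 fM]]]]; exists (fun j => a j - `|t|), (fun j => b j + `|t|), M; split => //.
by move=> x; exact: (shift_bound fM M0).
Qed.

Lemma shift_Lp q f t : Lp mu q f -> Lp mu q (fun x => f (x + sh t)).
Proof.
move=> [mf fi]; split; first exact: measurable_shift_rV.
by have [] := itg_translation (sh t) fi.
Qed.

Lemma shift_norm_p q f t : Lp mu q f -> norm_p q (fun x => f (x + sh t)) = norm_p q f.
Proof. by move=> [mf fi]; rewrite /norm_p; have [_ ->] := itg_translation (sh t) fi. Qed.

Lemma locally_itg_bounded u f : locally_itg u -> measurable_fun [set: 'rV[R]_n] f ->
  bounded_in_cbox f -> itg mu (fun x => u x * f x).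
Proof. by move=> lu mf [a [b [M [_ fM]]]]; exact: (locally_itg_mul lu mf fM). Qed.

Lemma is_derive_shift phi x (s : R) : test_function phi ->
  is_derive s (1 : R) (fun t => phi (x + sh t)) (partial i phi (x + sh s)).
Proof.
move=> [sphi _]; have d : derivable phi (x + sh s) (delta_mx ord0 i).
  exact: diff_derivable (sphi [::] _).
have E (h : R) : phi (x + sh (h *: 1 + s)) = phi (h *: delta_mx ord0 i + (x + sh s)).
  by rewrite scalerDl addrCA; congr (phi (_ + _)); rewrite scaler1.
have E2 : (fun h : R => h^-1 *: (((fun t : R => phi (x + sh t)) \o shift s) (h *: 1) - phi (x + sh s))) =
    (fun h : R => h^-1 *: ((phi \o shift (x + sh s)) (h *: delta_mx ord0 i) - phi (x + sh s))).
  by apply/funext => h /=; rewrite E.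
by apply: DeriveDef; [rewrite /derivable E2|rewrite /partial /derive E2].
Qed.

Lemma is_derive_shift_integral u phi (s : R) : locally_itg u -> test_function phi ->
  is_derive s (1 : R) (fun t => \int[mu]_x (u x * phi (x + sh t)))
    (\int[mu]_x (u x * partial i phi (x + sh s))).
Proof.
move=> lu tphi; have bphi := test_function_bounded tphi.
have [a [b [M [M0 dM]]]] := partial_bounded i tphi.
have mphi : measurable_fun [set: 'rV[R]_n] phi.
  by apply: continuous_rV_measurable; exact: test_function_continuous.
pose T := `|s| + 1.
pose f (t : R) x := u x * phi (x + sh t).
have df (t : R) x : is_derive t (1 : R) (f ^~ x) (u x * partial i phi (x + sh t)).
  exact: is_deriveZ (is_derive_shift x t tphi).
have d1 t x : partial1of2 f t x = u x * partial i phi (x + sh t).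
  by rewrite partial1of2E; have [_ ->] := df t x.
have Is : `]s - 1, s + 1[%classic s by rewrite /= in_itv/=; apply/andP; split; lra.
have IT t : `]s - 1, s + 1[%classic t -> `|t| <= T.
  rewrite /= in_itv/= /T => /andP[h1 h2]; have := ler_norm s; have := ler_norm (- s).
  by rewrite normrN ler_norml => h3 h4; apply/andP; split; lra.
pose G x := M * `|\1_(cbox (fun j => a j - T) (fun j => b j + T)) x * u x|.
have H := @cvg_differentiation_under_integral R _ _ mu f setT measurableT s (s - 1) (s + 1) Is _ _ G _ _ _.
have : (fun h : R => h^-1 *: (\int[mu]_(y in [set: 'rV[R]_n]) f (h + s) y - \int[mu]_(y in [set: 'rV[R]_n]) f s y)) @ 0^' -->
   \int[mu]_(y in [set: 'rV[R]_n]) partial1of2 f s y.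
  apply: H.
  - move=> t It; apply: locally_itg_bounded => //; [exact: measurable_shift_rV|exact: bounded_shift].
  - by move=> t x _ _; have [] := df t x.
  - by move=> x; rewrite /G mulr_ge0.
  - by apply: itgZ; apply: itg_norm; exact: lu.2.
  - move=> t x It _; rewrite d1 normrM /G normrM mulrC mulrA.
    apply: ler_wpM2r => //; rewrite [X in _ <= _ * X]ger0_norm ?indicE//.
    by rewrite -indicE; apply: (shift_bound dM M0); exact: IT.
have -> : \int[mu]_(y in [set: 'rV[R]_n]) partial1of2 f s y = \int[mu]_x (u x * partial i phi (x + sh s)).
  by apply: eq_Rintegral => x _; exact: d1.
move=> {}H; apply: DeriveDef.
  apply/cvg_ex => /=; exists (\int[mu]_x (u x * partial i phi (x + sh s))).
  by under eq_fun do rewrite scaler1.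
by rewrite /derive; under eq_fun do rewrite /= scaler1; exact/cvg_lim.
Qed.

Definition null_sequence (t : nat -> R) := (forall k, t k != 0) /\ t @ \oo --> (0 : R).

Lemma test_quotient_cvg u phi (t : nat -> R) : locally_itg u -> test_function phi -> null_sequence t ->
  (fun k => (t k)^-1 * \int[mu]_x (u x * (phi (x + sh (t k)) - phi x))) @ \oo -->
  \int[mu]_x (u x * partial i phi x).
Proof.
move=> lu tphi tn; have bphi := test_function_bounded tphi.
have mphi : measurable_fun [set: 'rV[R]_n] phi.
  by apply: continuous_rV_measurable; exact: test_function_continuous.
have [/cvg_ex[l /= Hl] E] := is_derive_shift_integral 0 lu tphi.
have lE : l = \int[mu]_x (u x * partial i phi x).
  transitivity ('D_1 (fun t => \int[mu]_x (u x * phi (x + sh t))) (0 : R)).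
    by apply/esym/cvg_lim.
  by rewrite E; apply: eq_Rintegral => x _; rewrite scale0r addr0.
rewrite -lE; have /cvgr_dnbhsP/(_ _ tn) := Hl; apply: cvg_trans; apply: near_eq_cvg.
apply: nearW => k /=; rewrite scaler1 addr0 scale0r; congr (_ * _).
under [in X in _ - X]eq_Rintegral do rewrite addr0.
rewrite -IntB; [by apply: eq_Rintegral => x _; rewrite mulrBr| |exact: locally_itg_bounded].
by apply: locally_itg_bounded => //; [exact: measurable_shift_rV|exact: bounded_shift].
Qed.

End shifts.

Section difference_quotients.
Variables (R : realType) (n : nat) (p : R).
Notation mu := (lebesgue_rV R n).
Hypothesis p_gt1 : 1 < p.
Variables (u : 'rV[R]_n -> R) (Du : 'rV[R]_n -> 'rV[R]_n) (i : 'I_n).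
Hypothesis u_sobolev : sobolev p u Du.
Local Notation q := (dual_exponent p).
Local Notation sh t := ((t : R) *: (delta_mx ord0 i : 'rV[R]_n)).
Local Notation D := (fun x => Du x ord0 i).

Let p_gt0 : 0 < p. Proof. exact: lt_trans p_gt1. Qed.
Let q_gt0 : 0 < q. Proof. exact: dual_exponent_gt0. Qed.
Lemma dual_exponent_gt1 : 1 < q.
Proof. by rewrite /dual_exponent ltr_pdivlMr ?subr_gt0// mul1r gtrBl. Qed.

Let up : Lp mu p u. Proof. by have [] := u_sobolev. Qed.
Let Dp : Lp mu p D. Proof. by have [_ h _] := u_sobolev; exact: h. Qed.
Let u_loc : locally_itg u. Proof. exact: Lp_locally_itg (ltW p_gt1) up. Qed.

Definition increment t z := \int[mu]_x (u x * (z (x + sh t) - z x)).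

(** The derivative in $s$ of $\int u\,\phi(\cdot+se_i)$ is $-\int D_iu\,\phi(\cdot+se_i)$.
    Translations preserve the norm of $\phi$, so this derivative is bounded uniformly in $s$ and the
    mean value theorem applies. *)
Lemma increment_test t phi : test_function phi ->
  `|increment t phi| <= norm_p p D * norm_p q phi * `|t|.
Proof.
move=> tphi; have phiq : Lp mu q phi by exact: test_Lp.
have Lq s : Lp mu q (fun x => phi (x + sh s)) by exact: shift_Lp.
have -> : increment t phi = \int[mu]_x (u x * phi (x + sh t)) - \int[mu]_x (u x * phi (x + sh 0)).
  rewrite -IntB; [|exact: (itg_mul_Lp p_gt1 up (Lq t))|exact: (itg_mul_Lp p_gt1 up (Lq 0))].
  by apply: eq_Rintegral => x _; rewrite scale0r addr0 mulrBr.
apply: (@lipschitz_of_derivative R (fun s => \int[mu]_x (u x * phi (x + sh s)))) => s.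
  exact: is_derive_shift_integral.
have tshift : test_function (fun x => phi (x + sh s)) by exact: test_function_translation.
have [_ _ w] := u_sobolev; have := w i _ tshift.
have -> : partial i (fun x => phi (x + sh s)) = (fun x => partial i phi (x + sh s)).
  exact: (foldr_partial_translation phi (sh s) [:: i]).
move=> ->; rewrite normrN; apply: le_trans (Int_mul_Lp_le p_gt1 Dp (Lq s)) _.
by rewrite shift_norm_p.
Qed.

Lemma incrementB t z z' : Lp mu q z -> Lp mu q z' ->
  increment t (fun x => z x - z' x) = increment t z - increment t z'.
Proof.
move=> zq zq'; rewrite /increment -IntB.
- by apply: eq_Rintegral => x _; ring.
- exact: (itg_mul_Lp p_gt1 up (LpB q_gt0 (shift_Lp i t zq) zq)).
- exact: (itg_mul_Lp p_gt1 up (LpB q_gt0 (shift_Lp i t zq') zq')).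
Qed.

Lemma increment_crude t z : Lp mu q z -> `|increment t z| <= norm_p p u * (2 * norm_p q z).
Proof.
move=> zq; have zq' : Lp mu q (fun x => z (x + sh t)) by exact: shift_Lp.
apply: le_trans (Int_mul_Lp_le p_gt1 up (LpB q_gt0 zq' zq)) _.
apply: ler_wpM2l; first exact: norm_p_ge0.
have nz : Lp mu q (fun x => -1 * z x) by exact: LpZ.
have := norm_pD dual_exponent_gt1 zq' nz.
rewrite norm_pZ ?dual_exponent_gt1// normrN1 mul1r shift_norm_p//.
have -> : (fun x => z (x + sh t) + -1 * z x) = (fun x => z (x + sh t) - z x).
  by apply/funext => x; rewrite mulN1r.
by move=> h; apply: le_trans h _; rewrite mulrDl mul1r.
Qed.

(** For a fixed [t] the crude estimate, which has no factor [|t|], suffices for the approximation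
    error: that error tends to 0 while [t] does not move. *)
Lemma increment_bound t z : approximable q z ->
  `|increment t z| <= norm_p p D * norm_p q z * `|t|.
Proof.
move=> [zq za].
have key (d : R) : 0 < d -> `|increment t z| <= norm_p p D * norm_p q z * `|t| +
    (norm_p p D * `|t| + 2 * norm_p p u) * d.
  move=> d0; have [phi tphi hd] := za _ d0.
  have phiq : Lp mu q phi by exact: test_Lp.
  have zpq := LpB q_gt0 zq phiq.
  have -> : increment t z = increment t (fun x => z x - phi x) + increment t phi.
    by rewrite incrementB// subrK.
  apply: le_trans (ler_normD _ _) _.
  have h1 := increment_crude t zpq; have h2 := increment_test t tphi.
  have h3 : norm_p q phi <= norm_p q z + d.
    have := norm_pD dual_exponent_gt1 zq (LpZ (-1) zpq).
    have -> : (fun x => z x + -1 * (z x - phi x)) = phi by apply/funext => x; ring.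
    by rewrite norm_pZ ?dual_exponent_gt1// normrN1 mul1r => /le_trans; apply; rewrite lerD2l.
  have h4 : norm_p p D * norm_p q phi * `|t| <= norm_p p D * (norm_p q z + d) * `|t|.
    by apply: ler_wpM2r => //; apply: ler_wpM2l; first exact: norm_p_ge0.
  have h5 : norm_p p u * (2 * norm_p q (fun x => z x - phi x)) <= norm_p p u * (2 * d).
    by apply: ler_wpM2l; [exact: norm_p_ge0|rewrite ler_pM2l].
  apply: le_trans (lerD (le_trans h1 h5) (le_trans h2 h4)) _.
  move: (norm_p p u) (norm_p p D) (norm_p q z) `|t| {h1 h2 h3 h4 h5} => U P Z T.
  by rewrite le_eqVlt; apply/orP; left; apply/eqP; ring.
apply/ler_addgt0Pr => e e0; set K := norm_p p D * `|t| + 2 * norm_p p u in key.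
have K0 : 0 <= K by rewrite addr_ge0 ?mulr_ge0 ?norm_p_ge0.
apply: le_trans (key (e / (K + 1)) _) _; first by rewrite divr_gt0// ltr_wpDl.
by rewrite lerD2l mulrCA ler_piMr ?(ltW e0)// ler_pdivrMr ?ltr_wpDl// mul1r lerDl.
Qed.

(** Here [z] may jump, as the indicator of a positivity set does. The quotients are bounded in [z]
    for the $L^q$ norm uniformly in [t], so their convergence on test functions extends to the
    closure. *)
Theorem quotient_cvg (t : nat -> R) z : measurable_fun [set: 'rV[R]_n] z -> bounded_in_cbox z ->
  null_sequence t ->
  (fun k => (t k)^-1 * increment (t k) z) @ \oo --> - \int[mu]_x (Du x ord0 i * z x).
Proof.
move=> mz bz tn; have az := bounded_approximable dual_exponent_gt1 mz bz.
have [zq za] := az; apply/cvgrPdist_le => e e0.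
set K := norm_p p D; have K0 : 0 <= K by exact: norm_p_ge0.
(* [K] may vanish, hence [K + 1]. The two approximation errors then take [e / 4] each and leave
   [e / 2] for the quotient of the test function. *)
have d0 : 0 < e / (4 * (K + 1)) by rewrite divr_gt0// mulr_gt0// ltr_wpDl.
have [phi tphi hd] := za _ d0.
have phiq : Lp mu q phi by exact: test_Lp.
have zpq := LpB q_gt0 zq phiq.
have Kd : K * (e / (4 * (K + 1))) <= e / 4.
  have -> : K * (e / (4 * (K + 1))) = e / 4 * (K / (K + 1)).
    by move: (K) K0 => k k0; field; rewrite gt_eqF// ltr_wpDl.
  by rewrite ler_piMr ?divr_ge0 ?(ltW e0)// ler_pdivrMr ?ltr_wpDl// mul1r lerDl.
have [_ _ w] := u_sobolev; have := @test_quotient_cvg R n i u phi t u_loc tphi tn.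
rewrite (w i _ tphi) => /cvgrPdist_le /(_ (e / 2)).
rewrite divr_gt0// => /(_ isT); apply: filterS => k hk.
have t0 := tn.1 k.
have az' : approximable q (fun x => z x - phi x).
  exact: (approximableB dual_exponent_gt1 az (approximable_test dual_exponent_gt1 tphi)).
have h1 : `|(t k)^-1 * increment (t k) (fun x => z x - phi x)| <= e / 4.
  rewrite normrM normfV mulrC ler_pdivrMr ?normr_gt0//.
  apply: le_trans (increment_bound _ az') _; apply: ler_wpM2r => //.
  by apply: le_trans Kd; exact: ler_wpM2l.
have h2 : `|\int[mu]_x (Du x ord0 i * (z x - phi x))| <= e / 4.
  apply: le_trans (Int_mul_Lp_le p_gt1 Dp zpq) _.
  by apply: le_trans Kd; exact: ler_wpM2l.
have E1 : increment (t k) z = increment (t k) (fun x => z x - phi x) + increment (t k) phi.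
  by rewrite incrementB// subrK.
have E2 : \int[mu]_x (Du x ord0 i * z x) = \int[mu]_x (Du x ord0 i * (z x - phi x)) +
    \int[mu]_x (Du x ord0 i * phi x).
  rewrite -IntD; [by apply: eq_Rintegral => x _; rewrite -mulrDr subrK|exact: (itg_mul_Lp p_gt1 Dp zpq)|exact: (itg_mul_Lp p_gt1 Dp phiq)].
rewrite E1 E2 mulrDr.
exact: distr_sum_le hk h1 h2.
Qed.

End difference_quotients.

Section translated_quotients.
Variables (R : realType) (n : nat) (i : 'I_n).
Notation mu := (lebesgue_rV R n).
Local Notation sh t := ((t : R) *: (delta_mx ord0 i : 'rV[R]_n)).
Implicit Types (u v z phi : 'rV[R]_n -> R) (t : R).

(** Discrete integration by parts, from the translation invariance of the measure; the local
    integrability of [u] and the bounded support of [z] make the integrals finite. *)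
Lemma shift_adjoint u z t : locally_itg u -> measurable_fun [set: 'rV[R]_n] z ->
  bounded_in_cbox z ->
  itg mu (fun x => (u (x - sh t) - u x) * z x) /\
  \int[mu]_x (u x * (z (x + sh t) - z x)) = \int[mu]_x ((u (x - sh t) - u x) * z x).
Proof.
move=> lu mz bz.
have i1 : itg mu (fun x => u x * z (x + sh t)).
  by apply: locally_itg_bounded => //; [exact: measurable_shift_rV|exact: bounded_shift].
have i0 : itg mu (fun x => u x * z x) by exact: locally_itg_bounded.
have [] := itg_translation (- sh t) i1; under eq_fun do rewrite subrK.
move=> i2 E2.
have E3 : (fun x => (u (x - sh t) - u x) * z x) = (fun x => u (x - sh t) * z x - u x * z x).
  by apply/funext => x; rewrite mulrBl.
rewrite E3; split; first exact: (itgB i2 i0).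
rewrite (IntB i2 i0).
have -> : \int[mu]_x (u x * (z (x + sh t) - z x)) = \int[mu]_x (u x * z (x + sh t) - u x * z x).
  by apply: eq_Rintegral => x _; rewrite mulrBr.
by rewrite (IntB i1 i0) -E2; congr (_ - _).
Qed.

Lemma harmonic_null : @null_sequence R harmonic.
Proof. by split=> [k|]; [rewrite /harmonic/= invr_neq0|exact: cvg_harmonic]. Qed.

Lemma opp_harmonic_null : @null_sequence R (fun k => - harmonic k).
Proof.
split=> [k|]; first by rewrite /harmonic/= oppr_eq0 invr_neq0.
by rewrite -oppr0; apply: cvgN; exact: cvg_harmonic.
Qed.

End translated_quotients.

(** * The chain rule for the positive part *)

Section positive_part.
Variables (R : realType) (n : nat) (p : R).
Notation mu := (lebesgue_rV R n).
Hypothesis p_gt1 : 1 < p.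
Variables (u : 'rV[R]_n -> R) (Du : 'rV[R]_n -> 'rV[R]_n).
Hypothesis u_sobolev : sobolev p u Du.

Let p_gt0 : 0 < p. Proof. exact: lt_trans p_gt1. Qed.
Let up : Lp mu p u. Proof. by have [] := u_sobolev. Qed.
Let Dp i : Lp mu p (fun x => Du x ord0 i). Proof. by have [_ h _] := u_sobolev; exact: h. Qed.

Definition pos_part x : R := Num.max (u x) 0.
Definition pos_set : set 'rV[R]_n := [set x | 0 < u x].

Lemma measurable_pos_set : measurable pos_set.
Proof.
rewrite (_ : pos_set = u @^-1` `]0, +oo[).
  by rewrite -[X in measurable X]setTI; exact: up.1.
by apply/seteqP; split => x; rewrite /pos_set/= in_itv/= andbT.
Qed.

Lemma pos_part_Lp : Lp mu p pos_part.
Proof.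
apply: (Lp_le p_gt0 _ up); first by apply: measurable_maxr => //; exact: up.1.
apply: aeW => x; rewrite /pos_part /Num.max; case: ifP => // _.
by rewrite normr0.
Qed.

Lemma pos_part_convex x y : \1_pos_set x * (u y - u x) <= pos_part y - pos_part x.
Proof.
rewrite /pos_part indicE; have [ux|ux] := ltP 0 (u x).
  by rewrite mem_set// mul1r lerD2r le_max lexx.
rewrite memNset ?mul0r; last by rewrite /pos_set/= ltNge ux.
by rewrite subr0 le_max lexx orbT.
Qed.

(** After discrete integration by parts this is the subgradient inequality for the positive part,
    between the values of [u] at the shifted point and at [x], weighted by the nonnegative [phi]. *)
Lemma pos_part_quotient i phi (t : R) : test_function phi -> (forall x, 0 <= phi x) ->
  increment u i t (fun x => \1_pos_set x * phi x) <=
  \int[mu]_x (pos_part x * (phi (x + t *: delta_mx ord0 i) - phi x)).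
Proof.
move=> tphi phi0.
have mphi : measurable_fun [set: 'rV[R]_n] phi.
  by apply: continuous_rV_measurable; exact: test_function_continuous.
have bphi := test_function_bounded tphi.
have mz : measurable_fun [set: 'rV[R]_n] (fun x => \1_pos_set x * phi x).
  by apply: measurable_funM => //; apply: measurable_indic; exact: measurable_pos_set.
have bz : bounded_in_cbox (fun x => \1_pos_set x * phi x).
  have [a [b [M [M0 H]]]] := bphi; exists a, b, M; split => // x.
  apply: le_trans (H x); rewrite normrM ler_piMl// indicE.
  by case: (_ \in _); rewrite ?normr1 ?normr0.
have lu : locally_itg u by exact: Lp_locally_itg (ltW p_gt1) up.
have lv : locally_itg pos_part by exact: Lp_locally_itg (ltW p_gt1) pos_part_Lp.
rewrite /increment.
have [i1 ->] := shift_adjoint i t lu mz bz.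
have [i2 ->] := shift_adjoint i t lv mphi bphi.
apply: Int_le => // x; rewrite mulrCA mulrA; apply: ler_wpM2r => //.
exact: pos_part_convex.
Qed.

(** Division of the one-sided estimate by [t] keeps its direction for positive [t] and reverses it
    for negative [t]. The two limits coincide, so the inequalities combine into the equality. *)
Theorem sobolev_pos : sobolev p pos_part (fun x => \1_pos_set x *: Du x).
Proof.
have m1 : measurable_fun [set: 'rV[R]_n] (\1_pos_set : 'rV[R]_n -> R).
  by apply: measurable_indic; exact: measurable_pos_set.
have D1 i : Lp mu p (fun x => (\1_pos_set x *: Du x) ord0 i).
  under eq_fun do rewrite mxE.
  apply: (Lp_le p_gt0 _ (Dp i)); first by apply: measurable_funM => //; exact: (Dp i).1.
  apply: aeW => x; rewrite normrM ler_piMl// indicE.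
  by case: (_ \in _); rewrite ?normr1 ?normr0.
split => //; first exact: pos_part_Lp.
have key i phi : test_function phi -> (forall x, 0 <= phi x) ->
    \int[mu]_x (pos_part x * partial i phi x) =
    - \int[mu]_x (Du x ord0 i * (\1_pos_set x * phi x)).
  move=> tphi phi0.
  have mphi : measurable_fun [set: 'rV[R]_n] phi.
    by apply: continuous_rV_measurable; exact: test_function_continuous.
  have mz : measurable_fun [set: 'rV[R]_n] (fun x => \1_pos_set x * phi x).
    exact: measurable_funM.
  have bz : bounded_in_cbox (fun x => \1_pos_set x * phi x).
    have [a [b [M [M0 H]]]] := test_function_bounded tphi; exists a, b, M; split => // x.
    apply: le_trans (H x); rewrite normrM ler_piMl// indicE.
    by case: (_ \in _); rewrite ?normr1 ?normr0.
  have lv : locally_itg pos_part by exact: Lp_locally_itg (ltW p_gt1) pos_part_Lp.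
  apply/eqP; rewrite eq_le; apply/andP; split.
    have h1 := @test_quotient_cvg R n i _ _ _ lv tphi (@opp_harmonic_null R).
    have h2 := @quotient_cvg R n p p_gt1 u Du i u_sobolev _ _ mz bz (@opp_harmonic_null R).
    apply: ler_cvg_to h1 h2 _; apply: nearW => k; rewrite /=.
    rewrite ler_nM2l ?invr_lt0 ?oppr_lt0 ?invr_gt0//.
    exact: pos_part_quotient.
  have h1 := @test_quotient_cvg R n i _ _ _ lv tphi (@harmonic_null R).
  have h2 := @quotient_cvg R n p p_gt1 u Du i u_sobolev _ _ mz bz (@harmonic_null R).
  apply: ler_cvg_to h2 h1 _; apply: nearW => k; rewrite /=.
  rewrite ler_pM2l ?invr_gt0 ?invr_gt0//.
  exact: pos_part_quotient.
move=> i phi tphi.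
have [phi1 [phi2 [[t1 t2] p1 p2 E]]] := test_function_split tphi.
have q0 := dual_exponent_gt0 p_gt1.
have P1 := partial_Lp i q0 t1; have P2 := partial_Lp i q0 t2.
have T1 := test_Lp q0 t1; have T2 := test_Lp q0 t2.
have -> : \int[mu]_x (pos_part x * partial i phi x) =
    \int[mu]_x (pos_part x * partial i phi1 x) - \int[mu]_x (pos_part x * partial i phi2 x).
  rewrite -IntB; [|exact: (itg_mul_Lp p_gt1 pos_part_Lp P1)|exact: (itg_mul_Lp p_gt1 pos_part_Lp P2)].
  apply: eq_Rintegral => x _; rewrite -mulrBr; congr (_ * _).
  have -> : phi = (fun x => phi1 x + -1 * phi2 x) by rewrite E; apply/funext => y; rewrite mulN1r.
  have := @foldr_partialD R n phi1 (fun x => -1 * phi2 x) [:: i] t1.1 (smoothZ (-1) t2.1).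
  rewrite /= => ->; have := @foldr_partialZ R n (-1) phi2 [:: i] t2.1 => /= ->.
  by rewrite mulN1r.
rewrite (key i _ t1 p1) (key i _ t2 p2) -opprD; congr (- _).
have S r : test_function r -> \int[mu]_x (Du x ord0 i * (\1_pos_set x * r x)) =
    \int[mu]_x ((\1_pos_set x *: Du x) ord0 i * r x).
  by move=> _; apply: eq_Rintegral => x _; rewrite mxE mulrCA mulrA.
rewrite (S _ t1) (S _ t2) -IntB; [|exact: (itg_mul_Lp p_gt1 (D1 i) T1)|exact: (itg_mul_Lp p_gt1 (D1 i) T2)].
by apply: eq_Rintegral => x _; rewrite E mulrBr.
Qed.

End positive_part.

(** * Tent functions *)

Section clamp.
Variable R : realType.
Implicit Types s t : R.
Definition clamp s : R := Num.max 0 (Num.min 1 s).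
Lemma clamp_bounds s : 0 <= clamp s <= 1.
Proof. by rewrite /clamp le_max lexx/= ge_max ler01 ge_min lexx. Qed.
Lemma clampE s : clamp s = if s <= 0 then 0 else if 1 <= s then 1 else s.
Proof.
rewrite /clamp; have [s0|s0] := leP s 0; first by rewrite min_r ?max_l// (le_trans s0).
have [s1|s1] := leP 1 s; first by rewrite max_r.
by rewrite max_r// ltW.
Qed.
Lemma clamp_dist s t : `|clamp s - clamp t| <= `|s - t|.
Proof.
wlog st : s t / s <= t.
  by move=> H; have [/H//|/ltW/H] := leP s t; rewrite distrC (distrC t).
rewrite (distrC s) (distrC (clamp s)) [leRHS]ger0_norm ?subr_ge0// !clampE ler_norml.
by have [?|?] := leP s 0; have [?|?] := leP t 0; have [?|?] := leP 1 s; have [?|?] := leP 1 t;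
  apply/andP; split; lra.
Qed.
Lemma clamp_low s : s <= 0 -> clamp s = 0.
Proof. by rewrite clampE => ->. Qed.
Lemma clamp_high s : 1 <= s -> clamp s = 1.
Proof. by rewrite clampE => s1; rewrite s1; have [?|//] := leP s 0; lra. Qed.
Lemma clamp_mid s : 0 <= s -> s <= 1 -> clamp s = s.
Proof. by rewrite clampE => s0 s1; have [?|?] := leP s 0; have [?|?] := leP 1 s; lra. Qed.
Lemma affine_low (r q : R) : 0 < r -> r <= q -> 2 - 2 / r * q <= 0.
Proof.
move=> r0 rq; suff : 2 <= 2 / r * q by lra.
by rewrite -mulrA ler_peMr// mulrC ler_pdivlMr// mul1r.
Qed.
Lemma affine_high (r q : R) : 0 < r -> q <= r / 2 -> 1 <= 2 - 2 / r * q.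
Proof.
move=> r0 rq; suff : 2 / r * q <= 1 by lra.
by rewrite mulrAC ler_pdivrMr// mul1r; lra.
Qed.
Lemma affine_mid (r q : R) : 0 < r -> r / 2 <= q -> q <= r -> 0 <= 2 - 2 / r * q <= 1.
Proof.
move=> r0 rq qr; have : 2 / r * q <= 2 by rewrite mulrAC ler_pdivrMr//; lra.
have : 1 <= 2 / r * q by rewrite mulrAC ler_pdivlMr//; lra.
by move=> *; apply/andP; split; lra.
Qed.
End clamp.

Lemma indic_le1 (R : numDomainType) (T : Type) (A : set T) (x : T) : \1_A x <= 1 :> R.
Proof. by rewrite indicE; case: (_ \in _). Qed.

Section tent.
Variables (R : realType) (n : nat) (x0 : 'rV[R]_n) (r d : R).
Notation mu := (lebesgue_rV R n).
Hypotheses (r_gt0 : 0 < r) (d_gt0 : 0 < d).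
Local Notation rho x := (enorm (x - x0)).

(** The candidate of negative energy: height [d] on the ball of radius [r / 2], zero outside the
    ball of radius [r], and of slope [2 * d / r] on the annulus between them. *)
Definition tent x : R := d * clamp (2 - 2 / r * rho x).
Definition tent_gradient x : 'rV[R]_n :=
  if (r / 2 < rho x) && (rho x < r) then - (2 * d / r / rho x) *: (x - x0) else 0.

Lemma tent_bounds x : 0 <= tent x <= d.
Proof.
have /andP[c0 c1] := clamp_bounds (2 - 2 / r * rho x).
by rewrite mulr_ge0 ?(ltW d_gt0)//= ler_piMr// ltW.
Qed.

Lemma tent_inner x : rho x <= r / 2 -> tent x = d.
Proof. by move=> h; rewrite /tent clamp_high ?mulr1// affine_high. Qed.

Lemma tent_outer x : r <= rho x -> tent x = 0.
Proof. by move=> h; rewrite /tent clamp_low ?mulr0// affine_low. Qed.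

Lemma tent_middle x : r / 2 <= rho x -> rho x <= r -> tent x = d * (2 - 2 / r * rho x).
Proof. by move=> h1 h2; have /andP[? ?] := affine_mid r_gt0 h1 h2; rewrite /tent clamp_mid. Qed.

Lemma rho_dist x y : `|rho x - rho y| <= enorm (x - y).
Proof.
have key a b : rho a - rho b <= enorm (a - b).
  by have := enormD (a - b) (b - x0); rewrite addrA subrK; lra.
rewrite ler_norml; apply/andP; split; last exact: key.
by have := key y x; rewrite -(enormN (x - y)) opprB; lra.
Qed.

Lemma tent_lipschitz x y : `|tent x - tent y| <= 2 * d / r * enorm (x - y).
Proof.
rewrite /tent -mulrBr normrM ger0_norm ?(ltW d_gt0)//.
apply: le_trans (ler_wpM2l (ltW d_gt0) (clamp_dist _ _)) _.
have -> : 2 - 2 / r * rho x - (2 - 2 / r * rho y) = 2 / r * (rho y - rho x) by ring.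
have c0 : 0 <= 2 / r by rewrite divr_ge0 ?(ltW r_gt0).
rewrite normrM (ger0_norm c0) mulrA distrC (_ : d * (2 / r) = 2 * d / r); last by ring.
by apply: ler_wpM2l; [rewrite divr_ge0 ?mulr_ge0 ?ltW|exact: rho_dist].
Qed.

Lemma measurable_rho : measurable_fun [set: 'rV[R]_n] (fun x => rho x).
Proof.
apply: measurable_enorm => j; under eq_fun do rewrite !mxE.
by apply: measurable_funB => //; exact: measurable_coord.
Qed.

Lemma measurable_clamp : measurable_fun [set: R] (@clamp R).
Proof. by apply: measurable_maxr => //; exact: measurable_minr. Qed.

Lemma measurable_tent : measurable_fun [set: 'rV[R]_n] tent.
Proof.
apply: measurable_funM => //; apply: measurableT_comp; first exact: measurable_clamp.
by apply: measurable_funB => //; apply: measurable_funM => //; exact: measurable_rho.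
Qed.

Lemma measurable_annulus : measurable [set x | (r / 2 < rho x) && (rho x < r)].
Proof.
rewrite (_ : mkset _ = (fun x => rho x) @^-1` `]r / 2, r[).
  by rewrite -[X in measurable X]setTI; exact: measurable_rho.
by apply/seteqP; split => x; rewrite /= in_itv.
Qed.

Lemma tent_gradientE x : tent_gradient x =
  (\1_[set x | (r / 2 < rho x) && (rho x < r)] x * - (2 * d / r / rho x)) *: (x - x0).
Proof.
rewrite /tent_gradient indicE; case: ifPn => h; first by rewrite mem_set ?mul1r.
by rewrite memNset ?mul0r ?scale0r//=; apply/negP.
Qed.

Lemma measurable_tent_gradient i : measurable_fun [set: 'rV[R]_n] (fun x => tent_gradient x ord0 i).
Proof.
under eq_fun do rewrite tent_gradientE !mxE.
apply: measurable_funM; last by apply: measurable_funB => //; exact: measurable_coord.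
apply: measurable_funM; first by apply: measurable_indic; exact: measurable_annulus.
apply: measurableT_comp => //; apply: measurable_funM => //.
under eq_fun do rewrite -powR_inv1 ?enorm_ge0//.
by apply: measurable_powR_comp; exact: measurable_rho.
Qed.

Lemma enorm_tent_gradient x : enorm (tent_gradient x) =
  2 * d / r * \1_[set x | (r / 2 < rho x) && (rho x < r)] x.
Proof.
have c0 : 0 < 2 * d / r by rewrite divr_gt0// mulr_gt0.
rewrite /tent_gradient indicE; case: ifPn => h; last first.
  by rewrite memNset ?mulr0 ?enorm0//=; apply/negP.
have rx : 0 < rho x by move/andP: h => [h _]; apply: lt_trans h; rewrite divr_gt0.
rewrite mem_set// mulr1 enormZ normrN ger0_norm ?(divr_ge0 (ltW c0) (ltW rx))//.
by rewrite divfK ?mulr1// gt_eqF.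
Qed.

Lemma bounded_of_support (f : 'rV[R]_n -> R) (M : R) : 0 <= M -> (forall x, `|f x| <= M) ->
  (forall x, r <= rho x -> f x = 0) -> bounded_in_cbox f.
Proof.
move=> M0 fM fr; exists (fun j => x0 ord0 j - r), (fun j => x0 ord0 j + r), M; split => // x.
have [rx|rx] := leP r (rho x); first by rewrite fr// normr0 mulr_ge0// indicE.
rewrite indicE mem_set ?mulr1// => j; rewrite in_itv/=.
have := le_lt_trans (coord_le_enorm (x - x0) j) rx; rewrite !mxE ltr_norml => /andP[h1 h2].
by apply/andP; split; lra.
Qed.

Lemma bounded_tent : bounded_in_cbox tent.
Proof.
apply: (@bounded_of_support _ d); first exact: ltW; last exact: tent_outer.
by move=> x; have /andP[h0 h1] := tent_bounds x; rewrite ger0_norm.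
Qed.

Lemma bounded_tent_gradient i : bounded_in_cbox (fun x => tent_gradient x ord0 i).
Proof.
have c0 : 0 <= 2 * d / r by rewrite divr_ge0 ?mulr_ge0 ?ltW.
apply: (@bounded_of_support _ (2 * d / r)) => // x.
  apply: le_trans (coord_le_enorm _ _) _; rewrite enorm_tent_gradient ler_piMr//; exact: indic_le1.
by move=> rx; rewrite /tent_gradient (ltNge (rho x) r) rx andbF mxE.
Qed.

Lemma rho_shift_cvg i x (t : nat -> R) : t @ \oo --> (0 : R) ->
  (fun k => rho (x - t k *: delta_mx ord0 i)) @ \oo --> rho x.
Proof.
move=> t0; apply/cvgrPdist_le => e e0.
have := t0 => /cvgrPdist_le /(_ e e0); apply: filterS => k; rewrite sub0r normrN => tk.
apply: le_trans (rho_dist _ _) _; rewrite opprB addrC subrK enormZ.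
suff -> : enorm (delta_mx ord0 i : 'rV[R]_n) = 1 by rewrite mulr1.
rewrite /enorm /dotp (bigD1 i)//= big1 => [|j ji]; last by rewrite !mxE (negbTE ji) mulr0.
by rewrite !mxE !eqxx mulr1 addr0 sqrtr1.
Qed.

Lemma enorm_delta i : enorm (delta_mx ord0 i : 'rV[R]_n) = 1.
Proof.
rewrite /enorm /dotp (bigD1 i)//= big1 => [|j ji]; last by rewrite !mxE (negbTE ji) mulr0.
by rewrite !mxE !eqxx mulr1 addr0 sqrtr1.
Qed.

Lemma sqr_enorm_shift i (y : 'rV[R]_n) (t : R) :
  enorm (y - t *: delta_mx ord0 i) ^+ 2 - enorm y ^+ 2 = t * (- (2 * y ord0 i) + t).
Proof.
have De : dotp (delta_mx ord0 i) y = y ord0 i.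
  rewrite /dotp (bigD1 i)//= big1 => [|j ji]; last by rewrite !mxE (negbTE ji) mul0r.
  by rewrite !mxE !eqxx mul1r addr0.
have Dee : dotp (delta_mx ord0 i) (delta_mx ord0 i : 'rV[R]_n) = 1.
  by rewrite -sqr_enorm enorm_delta expr1n.
by rewrite !sqr_enorm -scaleNr dotpDl !dotpDr !dotpZl !dotpZr Dee (dotpC y (delta_mx _ _)) De; ring.
Qed.

(** The difference of the two norms is the difference of their squares, a polynomial in [t], divided
    by their sum. *)
Lemma rho_quotient_cvg i x (t : nat -> R) : 0 < rho x -> null_sequence t ->
  (fun k => (t k)^-1 * (rho (x - t k *: delta_mx ord0 i) - rho x)) @ \oo -->
  - ((x - x0) ord0 i / rho x).
Proof.
move=> rx [tn t0]; set y := x - x0 in rx *.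
have E k : (t k)^-1 * (rho (x - t k *: delta_mx ord0 i) - rho x) =
    (- (2 * y ord0 i) + t k) / (rho (x - t k *: delta_mx ord0 i) + rho x).
  set z := x - t k *: delta_mx ord0 i.
  have zx : 0 < rho z + rho x by rewrite ltr_wpDl// enorm_ge0.
  apply: (canRL (mulfK (lt0r_neq0 zx))); rewrite -mulrA -subr_sqr.
  have -> : z - x0 = y - t k *: delta_mx ord0 i by rewrite /z /y addrAC.
  rewrite -/y sqr_enorm_shift mulrA mulVf ?mul1r; [by []|exact: tn].
under eq_fun do rewrite E.
have -> : - (y ord0 i / rho x) = (- (2 * y ord0 i) + 0) / (rho x + rho x).
  move: (enorm y) (y ord0 i) rx => q c q0; field.
  by rewrite !gt_eqF ?addr_gt0.
apply: cvgM; first by apply: cvgD => //; exact: cvg_cst.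
apply: cvgV; first by rewrite gt_eqF// addr_gt0.
by apply: cvgD; [exact: rho_shift_cvg|exact: cvg_cst].
Qed.

Lemma tent_quotient_cvg i x (t : nat -> R) : rho x != r / 2 -> rho x != r -> null_sequence t ->
  (fun k => (t k)^-1 * (tent (x - t k *: delta_mx ord0 i) - tent x)) @ \oo -->
  - tent_gradient x ord0 i.
Proof.
move=> x2 x1 tn; have rc := @rho_shift_cvg i x t tn.2.
have near_lt (c : R) : rho x < c -> \forall k \near \oo, rho (x - t k *: delta_mx ord0 i) < c.
  by move=> xc; apply: (cvgr_lt (rho x) rc).
have near_gt (c : R) : c < rho x -> \forall k \near \oo, c < rho (x - t k *: delta_mx ord0 i).
  by move=> xc; apply: (cvgr_gt (rho x) rc).
have [h2|h2] := leP (rho x) (r / 2).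
  rewrite /tent_gradient ltNge h2 mxE oppr0; apply: cvg_near_cst.
  have := near_lt (r / 2); rewrite lt_neqAle x2 h2 => /(_ isT); apply: filterS => k hk.
  by rewrite !tent_inner ?subrr ?mulr0// ltW.
have [h1|h1] := leP r (rho x).
  rewrite /tent_gradient (ltNge (rho x) r) h1 andbF mxE oppr0; apply: cvg_near_cst.
  have := near_gt r; rewrite lt_neqAle eq_sym x1 h1 => /(_ isT); apply: filterS => k hk.
  by rewrite !tent_outer ?subrr ?mulr0// ltW.
have rx : 0 < rho x by apply: lt_trans h2; rewrite divr_gt0.
have := @rho_quotient_cvg i x t rx tn.
have -> : tent_gradient x ord0 i = - (2 * d / r / rho x) * (x - x0) ord0 i.
  by rewrite /tent_gradient h2 h1/= [LHS]mxE.
move=> H; have {}H : (fun k => - (2 * d / r) * ((t k)^-1 * (rho (x - t k *: delta_mx ord0 i) - rho x))) @ \oo -->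
   - (2 * d / r) * - ((x - x0) ord0 i / rho x).
  by apply: cvgM; [exact: cvg_cst|exact: H].
have -> : - (- (2 * d / r / rho x) * (x - x0) ord0 i) = - (2 * d / r) * - ((x - x0) ord0 i / rho x).
  by rewrite !mulNr mulrN !opprK mulrA [RHS]mulrAC.
apply: cvg_trans H; apply: near_eq_cvg.
have A := near_lt _ h1; have B := near_gt _ h2; near=> k.
rewrite tent_middle; [|by apply: ltW; near: k|by apply: ltW; near: k].
by rewrite tent_middle ?(ltW h1) ?(ltW h2)//; ring.
Unshelve. all: by end_near. Qed.

(** The sphere and its open ball are disjoint and lie in every slightly larger ball, whose volume
    tends to that of the ball. *)
Lemma sphere_null (s : R) : 0 < s -> mu [set x | rho x = s] = 0%E.
Proof.
move=> s0; have mS : measurable [set x | rho x = s].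
  rewrite (_ : mkset _ = (fun x => rho x) @^-1` [set s])//.
  by rewrite -[X in measurable X]setTI; exact: measurable_rho.
have g0 := @gamma_pi_gt0 R n.
have key k : (mu [set x | rho x = s] + (s ^+ n / @gamma_pi R n)%:E <=
    ((s + harmonic k) ^+ n / @gamma_pi R n)%:E)%E.
  have sk : 0 < s + harmonic k by rewrite addr_gt0// /harmonic/= invr_gt0.
  rewrite -(measure_eballE x0 s0) -(measure_eballE x0 sk) -measureU//; last 2 first.
  - exact: measurable_eball.
  - by apply/seteqP; split => x //= [e]; rewrite /eball/= e ltxx.
  apply: le_measure; rewrite ?inE.
  - by apply: measurableU => //; exact: measurable_eball.
  - exact: measurable_eball.
  - move=> x [/= e|]; rewrite /eball/= ?e; first by rewrite ltrDl /harmonic/= invr_gt0.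
    by move=> /lt_trans; apply; rewrite ltrDl /harmonic/= invr_gt0.
have fin : mu [set x | rho x = s] \is a fin_num.
  rewrite ge0_fin_numE//; apply: le_lt_trans (leeDl _ _) (le_lt_trans (key 0%N) (ltry _)).
  by rewrite lee_fin divr_ge0 ?exprn_ge0 ?(ltW s0) ?(ltW g0).
rewrite -(fineK fin); set m := fine _; have m0 : 0 <= m by rewrite fine_ge0.
congr EFin; apply/eqP; rewrite eq_le m0 andbT.
have h : (fun k => (s + harmonic k) ^+ n / @gamma_pi R n - s ^+ n / @gamma_pi R n) @ \oo --> (0 : R).
  rewrite -(subrr (s ^+ n / @gamma_pi R n)); apply: cvgB; last exact: cvg_cst.
  apply: cvgM; last exact: cvg_cst.
  apply: (@continuous_cvg _ _ _ _ _ _ (fun y : R => y ^+ n)); first exact: exprn_continuous.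
  by rewrite -[X in _ --> X]addr0; apply: cvgD; [exact: cvg_cst|exact: cvg_harmonic].
apply: ler_cvg_to (cvg_cst m) h _; apply: nearW => k.
by have := key k; rewrite -(fineK fin) -/m -EFinD lee_fin lerBrDr.
Qed.

(** The difference quotients are moved from the test function to the tent. There they converge off
    two spheres of measure zero and are bounded by the Lipschitz constant, so dominated convergence
    identifies the weak gradient. *)
Theorem sobolev_tent p : 1 < p -> sobolev p tent tent_gradient.
Proof.
move=> p1; have p0 : 0 < p by exact: lt_trans p1.
have Tp : Lp mu p tent by apply: bounded_in_cbox_Lp => //; [exact: measurable_tent|exact: bounded_tent].
have Gp i : Lp mu p (fun x => tent_gradient x ord0 i).
  by apply: bounded_in_cbox_Lp => //; [exact: measurable_tent_gradient|exact: bounded_tent_gradient].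
split => // i phi tphi.
have mphi : measurable_fun [set: 'rV[R]_n] phi.
  by apply: continuous_rV_measurable; exact: test_function_continuous.
have bphi := test_function_bounded tphi.
have lT : locally_itg tent by exact: Lp_locally_itg (ltW p1) Tp.
have tn := @harmonic_null R.
have h1 := @test_quotient_cvg R n i _ _ _ lT tphi tn.
have ae_off : {ae mu, forall x, rho x != r / 2 /\ rho x != r}.
  have N s : 0 < s -> {ae mu, forall x, rho x != s}.
    move=> s0; exists [set x | rho x = s]; split.
    - rewrite (_ : mkset _ = (fun x => rho x) @^-1` [set s])//.
      by rewrite -[X in measurable X]setTI; exact: measurable_rho.
    - exact: sphere_null.
    - by move=> x /= /negP; rewrite negbK => /eqP.
  have r2 : 0 < r / 2 by rewrite divr_gt0.
  by have := N _ r2; have := N _ r_gt0; apply: filterS2.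
have phi1 : itg mu phi.
  have [_] := test_Lp ltr01 tphi; have [a [b [M [M0 H]]]] := bphi => _.
  by apply: (itg_le mphi (itgZ M (itg_cbox a b))).
have [|||||_ h2 _] := @dct _ _ _ mu
    (fun k x => (harmonic k)^-1 * (tent (x - harmonic k *: delta_mx ord0 i) - tent x) * phi x)
    (fun x => - tent_gradient x ord0 i * phi x) (fun x => 2 * d / r * `|phi x|).
- move=> k; apply: measurable_funM => //; apply: measurable_funM => //; apply: measurable_funB.
    by apply: measurableT_comp; [exact: measurable_tent|exact: measurable_translation].
  exact: measurable_tent.
- apply: measurable_funM => //; apply: measurableT_comp => //; exact: measurable_tent_gradient.
- apply: filterS ae_off => x [x2 x1]; apply: cvgM; last exact: cvg_cst.
  exact: tent_quotient_cvg.
- by apply: itgZ; exact: itg_norm.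
- apply: aeW => x k; rewrite normrM; apply: ler_wpM2r => //.
  have k0 : 0 < harmonic k :> R by rewrite /harmonic/= invr_gt0.
  rewrite normrM normfV (ger0_norm (ltW k0)) mulrC ler_pdivrMr//.
  apply: le_trans (tent_lipschitz _ _) _.
  by rewrite addrAC subrr add0r enormN enormZ enorm_delta mulr1 (ger0_norm (ltW k0)).
have E k : (harmonic k)^-1 * \int[mu]_x (tent x * (phi (x + harmonic k *: delta_mx ord0 i) - phi x)) =
   \int[mu]_x ((harmonic k)^-1 * (tent (x - harmonic k *: delta_mx ord0 i) - tent x) * phi x).
  have [i1 ->] := shift_adjoint i (harmonic k) lT mphi bphi.
  by rewrite -IntZ//; apply: eq_Rintegral => x _; rewrite mulrA.
rewrite (_ : - _ = \int[mu]_x (- tent_gradient x ord0 i * phi x)).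
  apply: (cvg_unique (@Rhausdorff R) h1); apply: cvg_trans h2; apply: near_eq_cvg.
  by apply: nearW => k; rewrite E.
have iG : itg mu (fun x => tent_gradient x ord0 i * phi x).
  exact: (itg_mul_Lp p1 (Gp i) (test_Lp (dual_exponent_gt0 p1) tphi)).
rewrite -mulN1r -(IntZ _ iG); apply: eq_Rintegral => x _; ring.
Qed.

End tent.

(** * The energy and its uniform convexity *)

Section power_inequalities.
Variables (R : realType) (p : R).
Hypothesis p_gt1 : 1 < p.
Implicit Types x s m : R.

Let p_gt0 : 0 < p. Proof. exact: lt_trans p_gt1. Qed.

Lemma powR_tangent1 x : 0 <= x -> x != 1 -> 1 + p * (x - 1) < x `^ p.
Proof.
rewrite le_eqVlt => /predU1P[<- _|x0 x1].
  by rewrite powR0 ?gt_eqF// sub0r mulrN1; have := p_gt1; lra.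
have D (a b : R) : 0 < a -> a < b -> exists2 c, c \in `]a, b[%R & b `^ p - a `^ p = p * c `^ (p - 1) * (b - a).
  move=> a0 ab; have [| |c cab E] := @MVT R (fun y => y `^ p) (fun y => p * y `^ (p - 1)) a b ab.
  - by move=> y; rewrite in_itv/= => /andP[ay _]; apply: is_derive1_powR; exact: lt_trans ay.
  - apply: derivable_within_continuous => y; rewrite in_itv/= => /andP[ay _].
    by apply: derivable_powR; rewrite in_itv/= andbT; exact: lt_le_trans ay.
  - by exists c.
have p1 : 0 < p - 1 by rewrite subr_gt0.
have [xl|xg|xe] := ltgtP x 1; last by rewrite xe eqxx in x1.
  have [c] := D x 1 x0 xl; rewrite in_itv/= powR1 => /andP[xc c1] E.
  have c0 : 0 < c by exact: lt_trans xc.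
  have : c `^ (p - 1) < 1 `^ (p - 1) by apply: gt0_ltr_powR; rewrite ?nnegrE ?(ltW c0).
  rewrite powR1 => h; have : p * c `^ (p - 1) * (1 - x) < p * (1 - x).
    by rewrite ltr_pM2r ?subr_gt0// gtr_pMr.
  by rewrite -E; lra.
have [c] := D 1 x ltr01 xg; rewrite in_itv/= powR1 => /andP[xc c1] E.
have : 1 `^ (p - 1) < c `^ (p - 1).
  by apply: gt0_ltr_powR; rewrite ?nnegrE// ltW// (lt_trans _ xc).
rewrite powR1 => h; have : p * (x - 1) < p * c `^ (p - 1) * (x - 1).
  by rewrite ltr_pM2r ?subr_gt0// ltr_pMr.
by rewrite -E; lra.
Qed.

Lemma powR_predE x : 0 <= x -> x `^ (p - 1) * x = x `^ p.
Proof.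
rewrite le_eqVlt => /predU1P[<-|x0]; first by rewrite mulr0 powR0 ?gt_eqF.
rewrite -[X in _ * X = _](@powRr1 _ x) ?(ltW x0)// -powRD ?subrK//.
by rewrite gt_eqF// implybT.
Qed.

Lemma powR_tangent x s : 0 <= x -> 0 <= s -> s `^ p + p * s `^ (p - 1) * (x - s) <= x `^ p.
Proof.
move=> x0; rewrite le_eqVlt => /predU1P[<-|s0].
  by rewrite !powR0 ?gt_eqF ?subr_gt0// mulr0 mul0r addr0 powR_ge0.
have sp : 0 < s `^ p by rewrite powR_gt0.
have xs0 : 0 <= x / s by rewrite divr_ge0 ?(ltW s0).
have E : s `^ p + p * s `^ (p - 1) * (x - s) = (1 + p * (x / s - 1)) * s `^ p.
  rewrite -(powR_predE (ltW s0)); set w := s `^ (p - 1); field; exact: lt0r_neq0.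
have F : x `^ p = (x / s) `^ p * s `^ p by rewrite -powRM ?(ltW s0)// divfK// lt0r_neq0.
rewrite E F ler_pM2r//; have [->|/powR_tangent1-/(_ xs0)/ltW//] := eqVneq (x / s) 1.
by rewrite subrr mulr0 addr0 powR1.
Qed.

Lemma powR_midpoint_strict x s : 0 <= x -> 0 <= s -> x != s ->
  ((x + s) / 2) `^ p < (x `^ p + s `^ p) / 2.
Proof.
move=> x0 s0 xs; set c := (x + s) / 2.
have c0 : 0 < c.
  rewrite divr_gt0// lt_neqAle addr_ge0// andbT eq_sym paddr_eq0//.
  by apply: contra xs => /andP[/eqP-> /eqP->].
have H y : 0 <= y -> y != c -> c `^ p * (1 + p * (y / c - 1)) < y `^ p.
  move=> y0 yc; have yc0 : 0 <= y / c by rewrite divr_ge0 ?(ltW c0).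
  have -> : y `^ p = c `^ p * (y / c) `^ p by rewrite -powRM ?(ltW c0)// mulrC divfK// lt0r_neq0.
  rewrite ltr_pM2l ?powR_gt0//; apply: powR_tangent1 => //.
  by apply: contra yc => /eqP/divr1_eq ->.
have h1 : x != c by apply: contra xs => /eqP; rewrite /c => h; apply/eqP; lra.
have h2 : s != c by apply: contra xs => /eqP; rewrite /c => h; apply/eqP; lra.
have := H x x0 h1; have := H s s0 h2.
have : c `^ p * (1 + p * (x / c - 1)) + c `^ p * (1 + p * (s / c - 1)) = c `^ p * 2.
  have -> : s = c * 2 - x by rewrite /c; lra.
  by move: (c `^ p) => w; field; rewrite lt0r_neq0.
lra.
Qed.

Lemma powR_midpoint x s : 0 <= x -> 0 <= s -> ((x + s) / 2) `^ p <= (x `^ p + s `^ p) / 2.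
Proof.
move=> x0 s0; have [->|/(powR_midpoint_strict x0 s0)/ltW//] := eqVneq x s.
by rewrite -mulr2n -[s *+ 2]mulr_natr mulfK// -[X in _ <= X / _]mulr2n -[X in _ <= X / _]mulr_natr mulfK.
Qed.

Lemma sqr_powR x : 0 <= x -> (x ^+ 2) `^ (p / 2) = x `^ p.
Proof. by move=> x0; rewrite -powR_mulrn// -powRrM mulrCA mulfV// mulr1. Qed.

(* [x], [y] and [m] stand for the norms of two vectors and of their midpoint;
   by the parallelogram law the base of the power is the square of the norm
   of the difference. *)
Definition diff_power x y m : R := ((x - y) ^+ 2 + 4 * (((x + y) / 2) ^+ 2 - m ^+ 2)) `^ (p / 2).

Lemma diff_power_base_ge0 x y m : 0 <= m -> m <= (x + y) / 2 ->
  0 <= (x - y) ^+ 2 + 4 * (((x + y) / 2) ^+ 2 - m ^+ 2).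
Proof.
move=> m0 ms; apply: addr_ge0; first exact: sqr_ge0.
apply: mulr_ge0 => //; rewrite subr_ge0 ler_sqr ?nnegrE//; exact: le_trans ms.
Qed.

Lemma diff_powerZ c x y m : 0 <= c -> 0 <= m -> m <= (x + y) / 2 ->
  diff_power (c * x) (c * y) (c * m) = c `^ p * diff_power x y m.
Proof.
move=> c0 m0 ms; rewrite /diff_power -(sqr_powR c0) -powRM ?sqr_ge0 ?diff_power_base_ge0//.
by congr (_ `^ _); field.
Qed.

Lemma mid_gap_ge0 x y m : 0 <= x -> 0 <= y -> 0 <= m -> m <= (x + y) / 2 ->
  0 <= (x `^ p + y `^ p) / 2 - m `^ p.
Proof.
move=> x0 y0 m0 ms; rewrite subr_ge0; apply: le_trans (powR_midpoint x0 y0).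
exact: powR_le_mono.
Qed.

Lemma powR_lt1_le x : 0 <= x -> x `^ p <= 1 -> x <= 1.
Proof.
move=> x0; apply: contraTT; rewrite -!ltNge => x1.
have -> : 1 = 1 `^ p :> R by rewrite powR1.
by apply: gt0_ltr_powR; rewrite ?nnegrE.
Qed.

(** Compactness in $\mathbb R^3$, independent of the dimension of the vectors. Counterexamples for
    growing constants, normalized by $x^p+y^p=1$, subconverge to a triple with zero gap; strict
    convexity forces $x=y=m$ there, so [diff_power] vanishes, although it should stay at least
    [e]. *)
Lemma norms_uniform_convexity e : 0 < e -> exists2 C, 0 < C & forall x y m,
  0 <= x -> 0 <= y -> 0 <= m -> m <= (x + y) / 2 ->
  diff_power x y m <= C * ((x `^ p + y `^ p) / 2 - m `^ p) + e * (x `^ p + y `^ p).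
Proof.
move=> e0; apply: contrapT => nC.
have /choice[w wP] : forall k : nat, exists w : R * R * R,
   [/\ 0 <= w.1.1, 0 <= w.1.2, 0 <= w.2 /\ w.2 <= (w.1.1 + w.1.2) / 2,
      w.1.1 `^ p + w.1.2 `^ p = 1 &
      k.+1%:R * (1 / 2 - w.2 `^ p) + e < diff_power w.1.1 w.1.2 w.2].
  move=> k; apply: contrapT => nw; apply: nC; exists k.+1%:R; first by [].
  move=> x y m x0 y0 m0 ms; rewrite leNgt; apply/negP => H; apply: nw.
  set T := x `^ p + y `^ p in H.
  have gap0 := mid_gap_ge0 x0 y0 m0 ms.
  have T0 : 0 <= T by rewrite addr_ge0 ?powR_ge0.
  have Tp : 0 < T.
    rewrite lt_neqAle T0 andbT eq_sym; apply/negP => /eqP TE.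
    have : x = 0 /\ y = 0.
      move/eqP: TE; rewrite /T paddr_eq0 ?powR_ge0// !powR_eq0 (gt_eqF p_gt0) !andbT.
      by move=> /andP[/eqP -> /eqP ->].
    move=> [xe ye]; move: H gap0; rewrite TE mulr0 addr0 xe ye mul0r sub0r => H gap0.
    have m00 : m = 0 by apply/eqP; rewrite eq_le m0 andbT; move: ms; rewrite xe ye addr0 mul0r.
    move: H; rewrite m00 powR0 ?gt_eqF// oppr0 mulr0 /diff_power.
    by rewrite !(addr0, mul0r, subr0, expr0n, mulr0)/= powR0 ?ltxx// gt_eqF// divr_gt0.
  (* All the terms are homogeneous of degree [p], so scaling by $T^{-1/p}$ normalizes the
     counterexample without losing the strict inequality. *)
  pose c := T `^ (- p^-1); have c0 : 0 < c by rewrite powR_gt0.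
  have cp : c `^ p = T^-1.
    by rewrite /c -powRrM mulNr mulVf ?gt_eqF// powR_inv1.
  exists (c * x, c * y, c * m); split => /=.
  - by rewrite mulr_ge0 ?(ltW c0).
  - by rewrite mulr_ge0 ?(ltW c0).
  - split; first by rewrite mulr_ge0 ?(ltW c0).
    by rewrite -mulrDr -mulrA ler_pM2l.
  - by rewrite !powRM ?(ltW c0)// -mulrDr cp mulVf// gt_eqF.
  - rewrite diff_powerZ ?(ltW c0)// powRM ?(ltW c0)// cp.
    rewrite -(ltr_pM2l Tp) mulrA mulfV ?gt_eqF// !mul1r.
    apply: le_lt_trans H; rewrite le_eqVlt; apply/orP; left; apply/eqP.
    by move: (m `^ p) => mp; field; rewrite gt_eqF.
have bnd k : [/\ (w k).1.1 <= 1, (w k).1.2 <= 1 & (w k).2 <= 1].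
  have [a0 b0 [m0 ms] T1 _] := wP k.
  have a1 : (w k).1.1 <= 1.
    by apply: powR_lt1_le => //; have := powR_ge0 (w k).1.2 p; lra.
  have b1 : (w k).1.2 <= 1.
    by apply: powR_lt1_le => //; have := powR_ge0 (w k).1.1 p; lra.
  by split => //; lra.
pose s j k := if j is j'.+1 then if j' is _.+1 then (w k).2 else (w k).1.2 else (w k).1.1.
have [j|phi phik Hphi] := @diagonal_subsequence R s.
  exists 1 => k; have [a0 b0 [m0 _] _ _] := wP k; have [a1 b1 m1] := bnd k.
  by case: j => [|[|j]] /=; rewrite ger0_norm.
have [a Ha] := Hphi 0%N; have [b Hb] := Hphi 1%N; have [m Hm] := Hphi 2%N.
rewrite /s in Ha Hb Hm.
have lim0 (f : nat -> R) l : f @ \oo --> l -> (forall k, 0 <= f k) -> 0 <= l.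
  by move=> fl f0; apply: (ler_cvg_to (cvg_cst 0) fl); exact: nearW.
have a0 : 0 <= a by apply: lim0 Ha _ => k; have [] := wP (phi k).
have b0 : 0 <= b by apply: lim0 Hb _ => k; have [] := wP (phi k).
have m0 : 0 <= m by apply: lim0 Hm _ => k; have [_ _ []] := wP (phi k).
have Hs : (fun k => ((w (phi k)).1.1 + (w (phi k)).1.2) / 2) @ \oo --> (a + b) / 2.
  by apply: cvgM; [exact: cvgD|exact: cvg_cst].
have ms : m <= (a + b) / 2.
  by apply: (ler_cvg_to Hm Hs); apply: nearW => k; have [_ _ []] := wP (phi k).
have Hap : (fun k => (w (phi k)).1.1 `^ p) @ \oo --> a `^ p.
  by apply: cvg_powR => // k; have [] := wP (phi k).
have Hbp : (fun k => (w (phi k)).1.2 `^ p) @ \oo --> b `^ p.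
  by apply: cvg_powR => // k; have [] := wP (phi k).
have Hmp : (fun k => (w (phi k)).2 `^ p) @ \oo --> m `^ p.
  by apply: cvg_powR => // k; have [_ _ []] := wP (phi k).
have abT : a `^ p + b `^ p = 1.
  have h1 : (fun k => (w (phi k)).1.1 `^ p + (w (phi k)).1.2 `^ p) @ \oo --> a `^ p + b `^ p.
    exact: cvgD.
  have h2 : (fun k => (w (phi k)).1.1 `^ p + (w (phi k)).1.2 `^ p) @ \oo --> (1 : R).
    by apply: cvg_near_cst; apply: nearW => k; have [_ _ _ + _] := wP (phi k); exact.
  exact: (cvg_unique (@Rhausdorff R) h1 h2).
have Hd : (fun k => diff_power (w (phi k)).1.1 (w (phi k)).1.2 (w (phi k)).2) @ \oo --> diff_power a b m.
  apply: cvg_powR; first by rewrite divr_gt0.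
    by move=> k; have [_ _ [h1 h2] _ _] := wP (phi k); exact: diff_power_base_ge0.
  have Sq (f : nat -> R) (l : R) : f @ \oo --> l -> (fun k => f k ^+ 2) @ \oo --> l ^+ 2.
    by move=> fl; rewrite expr2; under eq_fun do rewrite expr2; exact: cvgM.
  apply: cvgD; first by apply: Sq; exact: cvgB.
  apply: cvgM; first exact: cvg_cst.
  by apply: cvgB; exact: Sq.
have dB k : diff_power (w k).1.1 (w k).1.2 (w k).2 <= 4 `^ (p / 2).
  have [x0 y0 [z0 zs] _ _] := wP k; have [x1 y1 z1] := bnd k.
  apply: powR_le_mono; [by rewrite divr_gt0|exact: diff_power_base_ge0|].
  (* The parallelogram form of the base, at most 4 because both norms are at most 1. *)
  have -> : ((w k).1.1 - (w k).1.2) ^+ 2 + 4 * ((((w k).1.1 + (w k).1.2) / 2) ^+ 2 - (w k).2 ^+ 2) =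
    2 * (w k).1.1 ^+ 2 + 2 * (w k).1.2 ^+ 2 - 4 * (w k).2 ^+ 2 by field.
  have := sqr_ge0 (w k).2; have : (w k).1.1 ^+ 2 <= 1 by rewrite exprn_ile1.
  have : (w k).1.2 ^+ 2 <= 1 by rewrite exprn_ile1.
  lra.
have gk k : 1 / 2 - (w k).2 `^ p <= 4 `^ (p / 2) * harmonic k.
  have [_ _ _ _ h] := wP k; have := le_trans (ltW h) (dB k) => h2.
  rewrite /harmonic/= ler_pdivlMr// mulrC; have := e0; lra.
have mp : 1 / 2 <= m `^ p.
  have h : (fun k => 1 / 2 - (w (phi k)).2 `^ p) @ \oo --> 1 / 2 - m `^ p.
    by apply: cvgB => //; exact: cvg_cst.
  have h2 : (fun k => 4 `^ (p / 2) * (harmonic k : R)) @ \oo --> 4 `^ (p / 2) * 0.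
    by apply: cvgM; [exact: cvg_cst|exact: cvg_harmonic].
  rewrite mulr0 in h2; rewrite -subr_le0; apply: (ler_cvg_to h (cvg_subseq phik h2)).
  by apply: nearW => k; exact: gk.
have ab : a = b.
  apply/eqP/negPn/negP => /(powR_midpoint_strict a0 b0); rewrite abT.
  by apply/negP; rewrite -leNgt; apply: le_trans mp _; exact: powR_le_mono.
have ma : m = a.
  apply/eqP; rewrite eq_le; apply/andP; split; first by move: ms; rewrite -ab; lra.
  rewrite leNgt; apply/negP => ma; have : m `^ p < a `^ p by apply: gt0_ltr_powR; rewrite ?nnegrE.
  by move: abT mp; rewrite -ab; lra.
have : e <= diff_power a b m.
  apply: (ler_cvg_to (cvg_cst e) Hd); apply: nearW => k.
  have [x0 y0 [z0 zs] T1 h] := wP (phi k); have := mid_gap_ge0 x0 y0 z0 zs; rewrite T1 => g0.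
  apply: le_trans (ltW h); rewrite lerDr mulr_ge0//.
rewrite ma -ab /diff_power subrr expr0n/= add0r.
have -> : (a + a) / 2 = a by lra.
by rewrite subrr mulr0 powR0 ?gt_eqF ?divr_gt0//; move: e0; lra.
Qed.

End power_inequalities.

Section vector_inequalities.
Variables (R : realType) (n : nat) (p : R).
Hypothesis p_gt1 : 1 < p.
Implicit Types (x y : 'rV[R]_n).

Let p_gt0 : 0 < p. Proof. exact: lt_trans p_gt1. Qed.

Lemma enorm_uniform_convexity e : 0 < e -> exists2 C, 0 < C & forall x y,
  enorm (x - y) `^ p <= C * ((enorm x `^ p + enorm y `^ p) / 2 - enorm (2^-1 *: (x + y)) `^ p) +
    e * (enorm x `^ p + enorm y `^ p).
Proof.
move=> /(norms_uniform_convexity p_gt1)[C C0 H]; exists C => // x y.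
apply: le_trans (H (enorm x) (enorm y) (enorm (2^-1 *: (x + y))) _ _ _ _); rewrite ?enorm_ge0//; last first.
  by rewrite enormZ ger0_norm ?invr_ge0// mulrC ler_pM2r ?invr_gt0// enormD.
rewrite -(sqr_powR p (enorm_ge0 (x - y))) /diff_power le_eqVlt; apply/orP; left; apply/eqP.
congr (_ `^ _); rewrite enormZ ger0_norm ?invr_ge0// !exprMn !sqr_enorm sqrrB sqrrD !sqr_enorm.
rewrite -scaleN1r !dotpDl !dotpDr !dotpZl !dotpZr (dotpC y x).
by field.
Qed.

Lemma abs_uniform_convexity e : 0 < e -> exists2 C, 0 < C & forall s t : R,
  `|s - t| `^ p <= C * ((`|s| `^ p + `|t| `^ p) / 2 - `|2^-1 * (s + t)| `^ p) +
    e * (`|s| `^ p + `|t| `^ p).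
Proof.
move=> /(norms_uniform_convexity p_gt1)[C C0 H]; exists C => // s t.
apply: le_trans (H `|s| `|t| `|2^-1 * (s + t)| _ _ _ _) => //; last first.
  by rewrite normrM ger0_norm ?invr_ge0// mulrC ler_pM2r ?invr_gt0// ler_normD.
rewrite -(sqr_powR p (normr_ge0 (s - t))) /diff_power le_eqVlt; apply/orP; left; apply/eqP.
congr (_ `^ _); rewrite sqrrB exprMn sqrrD !real_normK ?num_real//.
by field.
Qed.

(** Cauchy-Schwarz reduces it to the tangent of $t\mapsto t^p$ between the two norms. The case
    [y = 0] is separate, since the exponent [p - 2] may be negative. *)
Lemma enorm_tangent x y : enorm y `^ p + p * (enorm y `^ (p - 2) * dotp y (x - y)) <= enorm x `^ p.
Proof.
apply: le_trans (powR_tangent p_gt1 (enorm_ge0 x) (enorm_ge0 y)).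
rewrite lerD2l -mulrA ler_pM2l//.
have : 0 <= enorm y := enorm_ge0 y; rewrite le_eqVlt => /predU1P[y0|y0].
  suff -> : dotp y (x - y) = 0 by rewrite mulr0 -y0 powR0 ?mul0r// gt_eqF// subr_gt0.
  exact: dotp_enorm0 (esym y0).
have -> : enorm y `^ (p - 1) = enorm y `^ (p - 2) * enorm y.
  rewrite -[X in _ * X](@powRr1 _ (enorm y)) ?(ltW y0)// -powRD; last by rewrite (gt_eqF y0) implybT.
  by congr (_ `^ _); lra.
rewrite -mulrA ler_pM2l ?powR_gt0// -scaleN1r dotpDr dotpZr -sqr_enorm mulrBr -expr2 mulN1r.
by rewrite lerD2r; exact: le_trans (ler_norm _) (cauchy_schwarz _ _).
Qed.

End vector_inequalities.

(** * The Sobolev space and its energy norm *)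

Section sobolev_space.
Variables (R : realType) (n : nat) (p : R).
Notation mu := (lebesgue_rV R n).

(** Representatives of a function and of its gradient rather than classes, so that the vector
    operations are pointwise and hold by computation. The energy norm is only a seminorm on them. *)
Definition function_pair : Type := (('rV[R]_n -> R^o) * ('rV[R]_n -> 'rV[R]_n))%type.
HB.instance Definition _ := GRing.Lmodule.on function_pair.

(* [1 < p] is an argument so that the closure properties can be canonical. *)
Definition sobolev_pred of 1 < p : {pred function_pair} :=
  fun w => `[< sobolev p (w.1 : 'rV[R]_n -> R) w.2 >].

Variable p_gt1 : 1 < p.

Lemma sobolev_submod : submod_closed (sobolev_pred p_gt1).
Proof.
split; first by apply/asboolP; exact: sobolev0.
move=> c u v /asboolP su /asboolP sv; apply/asboolP => /=.
exact: (sobolevD p_gt1 (sobolevZ p_gt1 c su) sv).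
Qed.

HB.instance Definition _ := GRing.isSubmodClosed.Build R function_pair (sobolev_pred p_gt1) sobolev_submod.

Record sobolev_space := SobolevSpace { sobolev_val : function_pair; _ : sobolev_val \in sobolev_pred p_gt1 }.
HB.instance Definition _ := [isSub for sobolev_val].
HB.instance Definition _ := [Choice of sobolev_space by <:].
HB.instance Definition _ := [SubChoice_isSubLmodule of sobolev_space by <:].

End sobolev_space.

Section sobolev_elements.
Variables (R : realType) (n : nat) (p : R) (p_gt1 : 1 < p).
Notation mu := (lebesgue_rV R n).
Local Notation X := (sobolev_space n p_gt1).
Implicit Types (w v : X).

Definition fn w : 'rV[R]_n -> R := (sobolev_val w).1.
Definition gr w : 'rV[R]_n -> 'rV[R]_n := (sobolev_val w).2.

Lemma sobolevP w : sobolev p (fn w) (gr w).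
Proof. by case: w => w ws; apply/asboolP; exact: ws. Qed.

Definition mk_sobolev u Du (su : sobolev p u Du) : X :=
  @SobolevSpace R n p p_gt1 ((u : 'rV[R]_n -> R^o), Du) (introT (asboolP _) su).

Lemma fnD w v x : fn (w + v) x = fn w x + fn v x. Proof. by []. Qed.
Lemma grD w v x : gr (w + v) x = gr w x + gr v x. Proof. by []. Qed.
Lemma fnN w x : fn (- w) x = - fn w x. Proof. by []. Qed.
Lemma grN w x : gr (- w) x = - gr w x. Proof. by []. Qed.
Lemma fnB w v x : fn (w - v) x = fn w x - fn v x. Proof. by []. Qed.
Lemma grB w v x : gr (w - v) x = gr w x - gr v x. Proof. by []. Qed.
Lemma fnZ c w x : fn (c *: w) x = c * fn w x. Proof. by []. Qed.
Lemma grZ c w x : gr (c *: w) x = c *: gr w x. Proof. by []. Qed.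
Lemma fn0 x : fn (0 : X) x = 0. Proof. by []. Qed.

Lemma fn_Lp w : Lp mu p (fn w). Proof. by have [] := sobolevP w. Qed.
Lemma gr_Lp w i : Lp mu p (fun x => gr w x ord0 i). Proof. by have [_ h _] := sobolevP w; exact: h. Qed.

End sobolev_elements.

(* A nonnegative convex function, positively homogeneous of degree [p], is the
   [p]-th power of a seminorm. *)
Lemma convex_homogeneous_triangle (R : realType) (V : lmodType R) (p : R) (F : V -> R) :
  0 < p -> (forall x, 0 <= F x) -> (forall c x, F (c *: x) = `|c| `^ p * F x) ->
  (forall (s : R) x y, 0 <= s -> s <= 1 -> F ((1 - s) *: x + s *: y) <= (1 - s) * F x + s * F y) ->
  forall x y, F (x + y) `^ p^-1 <= F x `^ p^-1 + F y `^ p^-1.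
Proof.
move=> p0 F0 FZ Fc x y; have root_pow (s : R) : 0 <= s -> (s `^ p^-1) `^ p = s.
  by move=> s0; rewrite -powRrM mulVf ?gt_eqF// powRr1.
have pow_root (s : R) : 0 <= s -> (s `^ p) `^ p^-1 = s.
  by move=> s0; rewrite -powRrM mulfV ?gt_eqF// powRr1.
have key (al be : R) : F x `^ p^-1 < al -> F y `^ p^-1 < be -> F (x + y) `^ p^-1 <= al + be.
  move=> xa yb; have al0 : 0 < al by exact: le_lt_trans (powR_ge0 _ _) xa.
  have be0 : 0 < be by exact: le_lt_trans (powR_ge0 _ _) yb.
  have ab0 : 0 < al + be by rewrite addr_gt0.
  have small (c : R) z : 0 < c -> F z `^ p^-1 < c -> F (c^-1 *: z) <= 1.
    move=> c0 zc; rewrite FZ ger0_norm ?invr_ge0 ?(ltW c0)//.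
    have -> : c^-1 `^ p = (c `^ p)^-1 by rewrite -[c^-1]powR_inv1 ?(ltW c0)// -powRrM mulN1r powRN.
    rewrite mulrC ler_pdivrMr ?powR_gt0// mul1r -(root_pow (F z))//.
    by apply: powR_le_mono; rewrite ?powR_ge0// ltW.
  (* With this weight $(x+y)/(\alpha+\beta)$ is a convex combination of $x/\alpha$ and $y/\beta$, at
     both of which [F] is at most 1. *)
  pose s := be / (al + be).
  have s0 : 0 <= s by rewrite divr_ge0 ?(ltW be0) ?(ltW ab0).
  have s1 : s <= 1 by rewrite ler_pdivrMr// mul1r lerDr ltW.
  have E : (al + be)^-1 *: (x + y) = (1 - s) *: (al^-1 *: x) + s *: (be^-1 *: y).
    rewrite scalerDr !scalerA; congr (_ *: _ + _ *: _).
      by rewrite /s; field; rewrite !lt0r_neq0.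
    by rewrite /s; field; rewrite !lt0r_neq0.
  have h : F ((al + be)^-1 *: (x + y)) <= 1.
    rewrite E; apply: le_trans (Fc _ _ _ s0 s1) _.
    rewrite -[leRHS](subrK s); apply: lerD.
      by rewrite ler_piMr ?subr_ge0//; exact: small.
    by rewrite ler_piMr//; exact: small.
  have : F (x + y) <= (al + be) `^ p.
    have -> : x + y = (al + be) *: ((al + be)^-1 *: (x + y)).
      by rewrite scalerA mulfV ?scale1r// gt_eqF.
    by rewrite FZ (ger0_norm (ltW ab0)) ler_piMr// powR_ge0.
  move=> h2; rewrite -[leRHS](pow_root (al + be)) ?(ltW ab0)//.
  by apply: powR_le_mono; rewrite ?invr_gt0.
apply/ler_addgt0Pr => e e0.
have h := key (F x `^ p^-1 + e / 2) (F y `^ p^-1 + e / 2).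
by apply: le_trans (h _ _) _; rewrite ?ltrDl ?divr_gt0//; lra.
Qed.

Lemma sum_powR_le (R : realType) (n : nat) (p : R) (c : 'I_n -> R) : 0 < p -> (forall i, 0 <= c i) ->
  (\sum_i c i) `^ p <= n%:R `^ p * \sum_i c i `^ p.
Proof.
case: n c => [|n] c p0 c0; first by rewrite !big_ord0 powR0 ?gt_eqF// mulr0.
pose j := [arg max_(i > ord0) c i]%O.
have cj i : c i <= c j by rewrite /j; case: arg_maxP => // k _; exact.
have h : \sum_i c i <= n.+1%:R * c j.
  by rewrite -[n.+1 in leRHS]card_ord mulr_natl -sumr_const; apply: ler_sum.
apply: le_trans (powR_le_mono p0 (sumr_ge0 _ (fun i _ => c0 i)) h) _.
rewrite powRM//; apply: ler_wpM2l; first exact: powR_ge0.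
by rewrite (bigD1 j)//= lerDl sumr_ge0// => i _; exact: powR_ge0.
Qed.

Lemma convexity_gap_power (R : realType) (V : lmodType R) (N F : V -> R) (p C e : R) :
  (forall x, N x `^ p = F x) ->
  (forall x y, F (x - y) <= C * ((F x + F y) / 2 - F (2^-1 *: (x + y))) + e * (F x + F y)) ->
  forall x y, N (x - y) `^ p <= C * convexity_gap N p x y + e * (N x `^ p + N y `^ p).
Proof. by move=> NF H x y; rewrite /convexity_gap !NF. Qed.

Lemma cvg_sum (R : realType) (n : nat) (f : 'I_n -> nat -> R) (l : 'I_n -> R) :
  (forall i, f i @ \oo --> l i) -> (fun k => \sum_i f i k) @ \oo --> \sum_i l i.
Proof.
move=> fl; elim: (index_enum 'I_n) => [|i s IH].
  rewrite big_nil; under eq_fun do rewrite big_nil; exact: cvg_cst.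
by rewrite big_cons; under eq_fun do rewrite big_cons; apply: cvgD; [exact: fl|exact: IH].
Qed.

Section energy_norm.
Variables (R : realType) (n : nat) (p : R) (p_gt1 : 1 < p).
Notation mu := (lebesgue_rV R n).
Variables (a : 'rV[R]_n -> R) (a0 A : R).
Hypotheses (a_meas : measurable_fun [set: 'rV[R]_n] a) (a0_gt0 : 0 < a0).
Hypothesis a_bounds : forall x, a0 <= a x <= A.
Local Notation X := (sobolev_space n p_gt1).
Implicit Types (w v : X).

Let p_gt0 : 0 < p. Proof. exact: lt_trans p_gt1. Qed.
Let a_ge0 x : 0 <= a x. Proof. by have /andP[h _] := a_bounds x; exact: le_trans (ltW a0_gt0) h. Qed.

Definition energy_density w x : R := enorm (gr w x) `^ p + a x * `|fn w x| `^ p.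
Definition dirichlet w : R := \int[mu]_x energy_density w x.
Definition sob_norm w : R := dirichlet w `^ p^-1.

Lemma gr_enorm_Lp w : Lp mu p (fun x => enorm (gr w x)).
Proof.
have sum_Lp (s : seq 'I_n) : Lp mu p (fun x => \sum_(i <- s) `|gr w x ord0 i|).
  elim: s => [|i s IH]; first by under eq_fun do rewrite big_nil; exact: Lp0.
  under eq_fun do rewrite big_cons.
  apply: LpD => //; apply: (Lp_le p_gt0 _ (gr_Lp w i)).
    by apply: measurableT_comp => //; exact: (gr_Lp w i).1.
  by apply: aeW => x; rewrite normr_id.
apply: (Lp_le p_gt0 _ (sum_Lp (index_enum 'I_n))).
  by apply: measurable_enorm => i; exact: (gr_Lp w i).1.
apply: aeW => x; rewrite ger0_norm ?enorm_ge0// ger0_norm ?sumr_ge0//.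
exact: enorm_le_sum.
Qed.

Lemma itg_enorm w : itg mu (fun x => enorm (gr w x) `^ p).
Proof.
have [_] := gr_enorm_Lp w; congr itg; apply/funext => x.
by rewrite ger0_norm// enorm_ge0.
Qed.

Lemma itg_weighted w : itg mu (fun x => a x * `|fn w x| `^ p).
Proof.
have [mf fi] := fn_Lp w; apply: (itg_le _ (itgZ A fi)) => [|x].
  by apply: measurable_funM => //; exact: measurable_norm_powR.
rewrite ger0_norm; first by apply: ler_wpM2r; [exact: powR_ge0|have /andP[] := a_bounds x].
by apply: mulr_ge0; [exact: a_ge0|exact: powR_ge0].
Qed.

Lemma itg_energy w : itg mu (energy_density w).
Proof. exact: (itgD (itg_enorm w) (itg_weighted w)). Qed.

Lemma energy_density_ge0 w x : 0 <= energy_density w x.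
Proof. by rewrite addr_ge0 ?mulr_ge0 ?powR_ge0 ?a_ge0. Qed.

Lemma dirichlet_ge0 w : 0 <= dirichlet w.
Proof. by apply: Rintegral_ge0 => x _; exact: energy_density_ge0. Qed.

Lemma sob_norm_ge0 w : 0 <= sob_norm w. Proof. exact: powR_ge0. Qed.

Lemma sob_norm_powR w : sob_norm w `^ p = dirichlet w.
Proof. by rewrite /sob_norm -powRrM mulVf ?gt_eqF// powRr1// dirichlet_ge0. Qed.

Lemma dirichletZ c w : dirichlet (c *: w) = `|c| `^ p * dirichlet w.
Proof.
rewrite /dirichlet -(IntZ _ (itg_energy w)); apply: eq_Rintegral => x _.
rewrite /energy_density grZ fnZ enormZ normrM !powRM ?enorm_ge0//.
by rewrite mulrDr [in RHS]mulrCA.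
Qed.

Lemma sob_normZ c w : sob_norm (c *: w) = `|c| * sob_norm w.
Proof.
rewrite /sob_norm dirichletZ powRM ?powR_ge0 ?dirichlet_ge0//.
by rewrite -powRrM mulfV ?gt_eqF// powRr1.
Qed.

Lemma energy_density_convex (s : R) w v x : 0 <= s -> s <= 1 ->
  energy_density ((1 - s) *: w + s *: v) x <= (1 - s) * energy_density w x + s * energy_density v x.
Proof.
move=> s0 s1.
have h1 := @N_convex R 'rV[R]_n (@enorm R n) p p_gt1 (@enorm_ge0 R n) (@enormD R n) (@enormZ R n)
  s (gr w x) (gr v x) s0 s1.
have h2 := @N_convex R R^o Num.norm p p_gt1 (@normr_ge0 R R) (@ler_normD R R) (@normrM R)
  s (fn w x) (fn v x) s0 s1.
have h3 := ler_wpM2l (a_ge0 x) h2.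
rewrite /energy_density grD fnD !grZ !fnZ; apply: le_trans (lerD h1 h3) _.
by rewrite le_eqVlt; apply/orP; left; apply/eqP; ring.
Qed.

Lemma sob_norm_triangle w v : sob_norm (w + v) <= sob_norm w + sob_norm v.
Proof.
apply: convex_homogeneous_triangle => //.
- exact: dirichlet_ge0.
- exact: dirichletZ.
- move=> s {}w {}v s0 s1; rewrite /dirichlet -(IntZ (1 - s) (itg_energy w)) -(IntZ s (itg_energy v)).
  rewrite -(IntD (itgZ (1 - s) (itg_energy w)) (itgZ s (itg_energy v))).
  apply: Int_le => [||x]; first exact: itg_energy.
    exact: (itgD (itgZ (1 - s) (itg_energy w)) (itgZ s (itg_energy v))).
  exact: energy_density_convex.
Qed.

(** The gradient part and the weighted part satisfy the inequality pointwise with different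
    constants. Both can be enlarged to the maximum because each pointwise gap is nonnegative, and
    the sum is integrated. *)
Lemma dirichlet_uniformly_convex (e : R) : 0 < e -> exists2 C : R, 0 < C & forall w v,
  dirichlet (w - v) <= C * ((dirichlet w + dirichlet v) / 2 - dirichlet (2^-1 *: (w + v))) +
    e * (dirichlet w + dirichlet v).
Proof.
move=> e0; have [C1 C10 H1] := enorm_uniform_convexity n p_gt1 e0.
have [C2 C20 H2] := abs_uniform_convexity p_gt1 e0.
exists (Num.max C1 C2); first by rewrite lt_max C10.
move=> w v; set C := Num.max C1 C2.
have iw := itg_energy w; have iv := itg_energy v; have im := itg_energy (2^-1 *: (w + v)).
have ig := itgB (itgZ 2^-1 (itgD iw iv)) im.
have ir := itgD (itgZ C ig) (itgZ e (itgD iw iv)).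
have -> : C * ((dirichlet w + dirichlet v) / 2 - dirichlet (2^-1 *: (w + v))) +
    e * (dirichlet w + dirichlet v) =
  \int[mu]_x (C * (2^-1 * (energy_density w x + energy_density v x) - energy_density (2^-1 *: (w + v)) x)
     + e * (energy_density w x + energy_density v x)).
  rewrite (IntD (itgZ C ig) (itgZ e (itgD iw iv))) (IntZ _ ig) (IntZ _ (itgD iw iv)).
  by rewrite (IntB (itgZ 2^-1 (itgD iw iv)) im) (IntZ _ (itgD iw iv)) (IntD iw iv) [2^-1 * _]mulrC.
apply: Int_le => [||x]; [exact: itg_energy|exact: ir|].
have gap1 : 0 <= (enorm (gr w x) `^ p + enorm (gr v x) `^ p) / 2 - enorm (2^-1 *: (gr w x + gr v x)) `^ p.
  exact: (@convexity_gap_ge0 R 'rV[R]_n (@enorm R n) p p_gt1 (@enorm_ge0 R n) (@enormD R n) (@enormZ R n)).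
have gap2 : 0 <= (`|fn w x| `^ p + `|fn v x| `^ p) / 2 - `|2^-1 * (fn w x + fn v x)| `^ p.
  exact: (@convexity_gap_ge0 R R^o Num.norm p p_gt1 (@normr_ge0 R R) (@ler_normD R R) (@normrM R)).
have C1C : C1 <= C by rewrite le_max lexx.
have C2C : C2 <= C by rewrite le_max lexx orbT.
have h1 := le_trans (H1 (gr w x) (gr v x)) (lerD (ler_wpM2r gap1 C1C) (lexx _)).
have h2 := ler_wpM2l (a_ge0 x) (le_trans (H2 (fn w x) (fn v x)) (lerD (ler_wpM2r gap2 C2C) (lexx _))).
rewrite /energy_density grB fnB grZ fnZ grD fnD; apply: le_trans (lerD h1 h2) _.
by rewrite le_eqVlt; apply/orP; left; apply/eqP; field.
Qed.

Lemma sob_uniformly_convex (e : R) : 0 < e -> exists2 C : R, 0 < C & forall w v,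
  sob_norm (w - v) `^ p <= C * convexity_gap sob_norm p w v + e * (sob_norm w `^ p + sob_norm v `^ p).
Proof.
move=> /dirichlet_uniformly_convex[C C0 H]; exists C => //.
exact: (convexity_gap_power sob_norm_powR H).
Qed.

Lemma Int_fn_le w : \int[mu]_x `|fn w x| `^ p <= a0^-1 * dirichlet w.
Proof.
rewrite ler_pdivlMl//; rewrite -(IntZ a0 (fn_Lp w).2).
apply: Int_le => [||x]; [exact: (itgZ a0 (fn_Lp w).2)|exact: itg_energy|].
rewrite /energy_density; apply: (@le_trans _ _ (a x * `|fn w x| `^ p)).
  by apply: ler_wpM2r; [exact: powR_ge0|have /andP[] := a_bounds x].
by rewrite lerDr powR_ge0.
Qed.

Lemma Int_gr_le w i : \int[mu]_x `|gr w x ord0 i| `^ p <= dirichlet w.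
Proof.
apply: Int_le => [||x]; [exact: (gr_Lp w i).2|exact: itg_energy|].
rewrite /energy_density; apply: (@le_trans _ _ (enorm (gr w x) `^ p)).
  by apply: powR_le_mono => //; exact: coord_le_enorm.
by rewrite lerDl mulr_ge0 ?powR_ge0 ?a_ge0.
Qed.

Lemma dirichlet_le w : dirichlet w <=
  n%:R `^ p * \sum_i \int[mu]_x `|gr w x ord0 i| `^ p + A * \int[mu]_x `|fn w x| `^ p.
Proof.
rewrite /dirichlet /energy_density (IntD (itg_enorm w) (itg_weighted w)); apply: lerD.
  have isum (s : seq 'I_n) : itg mu (fun x => \sum_(i <- s) `|gr w x ord0 i| `^ p) /\
      \int[mu]_x (\sum_(i <- s) `|gr w x ord0 i| `^ p) = \sum_(i <- s) \int[mu]_x `|gr w x ord0 i| `^ p.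
    elim: s => [|i s [IH1 IH2]].
      have -> : (fun x => \sum_(i <- [::]) `|gr w x ord0 i| `^ p) = cst 0.
        by apply/funext => x; rewrite big_nil.
      by rewrite big_nil; split; [exact: integrable0|rewrite /Rintegral integral0].
    have -> : (fun x => \sum_(j <- i :: s) `|gr w x ord0 j| `^ p) =
        (fun x => `|gr w x ord0 i| `^ p + \sum_(j <- s) `|gr w x ord0 j| `^ p).
      by apply/funext => x; rewrite big_cons.
    by rewrite big_cons -IH2; split; [exact: (itgD (gr_Lp w i).2 IH1)|exact: (IntD (gr_Lp w i).2 IH1)].
  have [i1 E1] := isum (index_enum 'I_n).
  rewrite -E1 -(IntZ _ i1); apply: Int_le => [||x]; [exact: itg_enorm|exact: (itgZ _ i1)|].
  apply: le_trans (sum_powR_le p_gt0 (fun i => normr_ge0 (gr w x ord0 i))).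
  by apply: powR_le_mono => //; [exact: enorm_ge0|exact: enorm_le_sum].
rewrite -(IntZ A (fn_Lp w).2); apply: Int_le => [||x]; [exact: itg_weighted|exact: (itgZ A (fn_Lp w).2)|].
by apply: ler_wpM2r; [exact: powR_ge0|have /andP[] := a_bounds x].
Qed.

(** The energy controls the function and each partial derivative in $L^p$, where limits exist. The
    limits again form a function with its weak gradient, and [dirichlet_le] converts the
    componentwise convergence back into the energy norm. *)
Lemma sob_complete (w : nat -> X) :
  (forall e, 0 < e -> exists n0, forall k m, (n0 <= k)%N -> (n0 <= m)%N -> sob_norm (w k - w m) <= e) ->
  exists v, (fun k => sob_norm (w k - v)) @ \oo --> (0 : R).
Proof.
move=> cw.
have cE (e : R) : 0 < e -> exists n0, forall k m, (n0 <= k)%N -> (n0 <= m)%N -> dirichlet (w k - w m) <= e.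
  move=> e0; have e1 : 0 < e `^ p^-1 by rewrite powR_gt0.
  have [n0 H] := cw _ e1; exists n0 => k m kn mn; rewrite -sob_norm_powR.
  have -> : e = (e `^ p^-1) `^ p by rewrite -powRrM mulVf ?gt_eqF// powRr1// ltW.
  by apply: powR_le_mono => //; [exact: sob_norm_ge0|exact: H].
have [u uL ul] : exists2 u, Lp mu p u & (fun k => \int[mu]_x `|fn (w k) x - u x| `^ p) @ \oo --> (0 : R).
  apply: Lp_complete; [exact: ltW|by move=> k; exact: fn_Lp|].
  move=> e e0; have e1 : 0 < a0 * e by rewrite mulr_gt0.
  have [n0 H] := cE _ e1; exists n0 => k m kn mn.
  apply: le_trans (Int_fn_le (w k - w m)) _.
  by rewrite mulrC ler_pdivrMr// mulrC; exact: H.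
have /choice[D DP] : forall i : 'I_n, exists D : 'rV[R]_n -> R, Lp mu p D /\
    (fun k => \int[mu]_x `|gr (w k) x ord0 i - D x| `^ p) @ \oo --> (0 : R).
  move=> i; have [||D DL Dl] := @Lp_complete _ _ _ mu p (fun k x => gr (w k) x ord0 i) (ltW p_gt1).
  - by move=> k; exact: gr_Lp.
  - move=> e e0; have [n0 H] := cE _ e0; exists n0 => k m kn mn.
    apply: le_trans (H k m kn mn); apply: le_trans (Int_gr_le (w k - w m) i).
    by rewrite le_eqVlt; apply/orP; left; apply/eqP; apply: eq_Rintegral => x _; rewrite grB !mxE.
  - by exists D.
pose Du x : 'rV[R]_n := \row_i D i x.
have DuE i : (fun x => Du x ord0 i) = D i by apply/funext => x; rewrite mxE.
have su : sobolev p u Du.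
  have Dp i : Lp mu p (fun x => Du x ord0 i) by rewrite DuE; exact: (DP i).1.
  apply: (weak_gradient_limit p_gt1 (fun k => sobolevP (w k)) uL Dp ul) => i.
  apply: cvg_trans (DP i).2; apply: near_eq_cvg; apply: nearW => k.
  by apply: eq_Rintegral => x _; rewrite mxE.
exists (mk_sobolev p_gt1 su); set v := mk_sobolev p_gt1 su.
have h : (fun k => n%:R `^ p * \sum_i \int[mu]_x `|gr (w k - v) x ord0 i| `^ p + A * \int[mu]_x `|fn (w k - v) x| `^ p) @ \oo --> (0 : R).
  rewrite [X in _ --> X](_ : 0 = n%:R `^ p * \sum_(i < n) 0 + A * 0); last by rewrite big1// !mulr0 addr0.
  apply: cvgD; last by apply: cvgM; [exact: cvg_cst|exact: ul].
  apply: cvgM; first exact: cvg_cst.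
  apply: (@cvg_sum R n (fun i k => \int[mu]_x `|gr (w k - v) x ord0 i| `^ p) (fun=> 0)) => i.
  have := (DP i).2; apply: cvg_trans; apply: near_eq_cvg; apply: nearW => k.
  by apply: eq_Rintegral => x _; rewrite grB !mxE.
have h2 : (fun k => dirichlet (w k - v)) @ \oo --> (0 : R).
  apply: (squeeze_cvgr _ (cvg_cst 0) h); apply: nearW => k.
  by rewrite dirichlet_ge0 dirichlet_le.
have := @cvg_powR R p^-1 (fun k => dirichlet (w k - v)) 0.
rewrite powR0 ?invr_eq0 ?gt_eqF//; apply => //; first by rewrite invr_gt0.
by move=> k; exact: dirichlet_ge0.
Qed.

(** An embedding constant into bounded functions: [sup_const] from the dyadic estimate, $a_0^{-1/p}$
    for the norm of the function, and 1 for each of the [n] partial derivatives. *)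
Definition sup_norm_const : R := sup_const n p * (a0^-1 `^ p^-1 + n%:R).

Lemma sup_norm_const_ge0 : n%:R < p -> 0 <= sup_norm_const.
Proof.
move=> pn; apply: mulr_ge0; last by rewrite addr_ge0 ?powR_ge0.
exact: (le_trans ler01 (sup_const_ge1 p_gt1 pn)).
Qed.

Lemma sob_sup_parts w : norm_p p (fn w) + grad_norm p (gr w) <= (a0^-1 `^ p^-1 + n%:R) * sob_norm w.
Proof.
rewrite mulrDl; apply: lerD.
  rewrite /sob_norm -powRM ?invr_ge0 ?(ltW a0_gt0) ?dirichlet_ge0//.
  apply: powR_le_mono; rewrite ?invr_gt0//; last exact: Int_fn_le.
  by apply: Rintegral_ge0 => x _; exact: powR_ge0.
rewrite mulr_natl -[n in X in _ <= X]card_ord -sumr_const; apply: ler_sum => i _.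
apply: powR_le_mono; rewrite ?invr_gt0//; last exact: Int_gr_le.
by apply: Rintegral_ge0 => x _; exact: powR_ge0.
Qed.

Lemma sob_sup w : n%:R < p -> {ae mu, forall x, `|fn w x| <= sup_norm_const * sob_norm w}.
Proof.
move=> pn; have := sup_bound p_gt1 pn (sobolevP w); apply: filterS => x /le_trans; apply.
rewrite /sup_norm_const -mulrA; apply: ler_wpM2l; last exact: sob_sup_parts.
exact: (le_trans ler01 (sup_const_ge1 p_gt1 pn)).
Qed.

End energy_norm.

(** * The nonlinear term *)

Section antiderivatives.
Variable R : realType.
Notation leb := (@lebesgue_measure R).
Variable f : R -> R.
Hypothesis f_cont : continuous f.

(** Starting at [- T] makes the derivative at 0 two-sided, which an integral starting at 0 does not
    provide. *)
Definition antiderivative (T s : R) : R := \int[leb]_(t in `[- T, s]) f t.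

Lemma integrable_segment (b c : R) : leb.-integrable `[b, c] (EFin \o f).
Proof.
apply: (@continuous_compact_integrable R f); first exact: segment_compact.
exact: continuous_subspaceT.
Qed.

Lemma is_derive_antiderivative (T s : R) : - T < s -> is_derive s (1 : R) (antiderivative T) (f s).
Proof.
move=> Ts; have [|||d1 d2] := @continuous_FTC1_closed R f (- T) s (s + 1) _ _ Ts.
- by rewrite ltrDl.
- exact: integrable_segment.
- exact: f_cont.
by split; [exact: d1|rewrite -derive1E; exact: d2].
Qed.

Lemma antiderivativeB (T s t : R) : - T <= s -> s <= t ->
  antiderivative T t - antiderivative T s = \int[leb]_(x in `[s, t]) f x.
Proof.
move=> Ts st; rewrite /antiderivative Rintegral_itvB; first last.
- by rewrite bnd_simp.
- by rewrite bnd_simp.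
- exact: integrable_segment.
apply: Rintegral_itv_obnd_cbnd; apply: integrableS (integrable_segment s t) => //.
by apply: subset_itv; rewrite bnd_simp.
Qed.

End antiderivatives.

Section nonlinearity.
Variables (R : realType) (p : R) (g : R -> R).
Hypothesis p_gt1 : 1 < p.
Hypothesis g_cont : continuous g.
Hypothesis g_ge0 : forall t : R, 0 <= t -> 0 <= g t.
Hypothesis G_at0 : primitive g t / t `^ p @[t --> 0^'+] --> (0 : R).
Hypothesis G_atoo : primitive g t / t `^ p @[t --> +oo] --> (0 : R).

Let p_gt0 : 0 < p. Proof. exact: lt_trans p_gt1. Qed.

(** Agrees with [g] where the solutions take their values. Its nonnegativity on the whole line is
    what makes critical points nonnegative. *)
Definition g_pos (s : R) : R := g (Num.max s 0).
Definition G_pos (s : R) : R := primitive g (Num.max s 0).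

Lemma g_pos_cont : continuous g_pos.
Proof.
move=> s; have E : g_pos = g \o (fun s => (s + `|s|) / 2).
  apply/funext => x /=; congr (g _); have [x0|x0] := leP x 0.
    by rewrite ler0_norm//; lra.
  by rewrite gtr0_norm//; lra.
rewrite E; apply: (@continuous_comp _ _ _ (fun s : R => (s + `|s|) / 2)); last exact: g_cont.
apply: cvgM; last exact: cvg_cst.
by apply: cvgD; [exact: cvg_id|apply: cvg_norm; exact: cvg_id].
Qed.

Lemma g_pos_ge0 s : 0 <= g_pos s.
Proof. by apply: g_ge0; rewrite le_max lexx orbT. Qed.

Lemma primitiveE (T t : R) : 0 < T -> 0 <= t ->
  primitive g t = antiderivative g_pos T t - antiderivative g_pos T 0.
Proof.
move=> T0 t0; rewrite antiderivativeB//; [|exact: g_pos_cont|by rewrite oppr_le0 ltW].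
apply: eq_Rintegral => x; rewrite inE/= in_itv/= => /andP[x0 _].
by rewrite /g_pos max_l.
Qed.

(** [g 0] is the derivative of the primitive at 0, and $G(t)/t=(G(t)/t^p)\,t^{p-1}$ tends to 0
    because $p>1$. *)
Lemma g0 : g 0 = 0.
Proof.
have D := is_derive_antiderivative g_pos_cont (ltrN10 R : - 1 < (0 : R)).
have [/cvg_ex[l /= Hl] E] := D.
have lE : l = g 0.
  transitivity ('D_1 (antiderivative g_pos 1) (0 : R)); first by apply/esym/cvg_lim.
  by rewrite E /g_pos max_l.
have hpos k : 0 < harmonic k :> R by rewrite /harmonic/= invr_gt0.
have hn : (forall k, harmonic k != 0 :> R) /\ (@harmonic R) @ \oo --> (0 : R).
  by split=> [k|]; [rewrite gt_eqF|exact: cvg_harmonic].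
have h1 := (cvgr_dnbhsP _ _ _).1 Hl _ hn.
have h2 := (cvg_at_rightP _ _ _).1 G_at0 _ (conj hpos (@cvg_harmonic R)).
have h3 : (fun k => (harmonic k : R) `^ (p - 1)) @ \oo --> (0 : R).
  rewrite -[X in _ --> X](@powR0 _ (p - 1)) ?gt_eqF ?subr_gt0//.
  by apply: cvg_powR; [rewrite subr_gt0|move=> k; exact: ltW|exact: cvg_harmonic].
have h4 : (fun k => primitive g (harmonic k) / (harmonic k : R) `^ p * (harmonic k : R) `^ (p - 1)) @ \oo --> (0 : R).
  by rewrite -[X in _ --> X](mul0r 0); exact: cvgM.
rewrite -lE; apply: (cvg_unique (@Rhausdorff R) h1); apply: cvg_trans h4.
apply: near_eq_cvg; apply: nearW => k; cbv beta.
have hk := hpos k; move: (harmonic k : R) hk => h h0.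
rewrite scaler1 addr0 (primitiveE ltr01 (ltW h0)) -(powR_predE p_gt1 (ltW h0)).
have : 0 < h `^ (p - 1) by rewrite powR_gt0.
move: (h `^ (p - 1)) => w w0; rewrite -[_ *: _]/(_ * _).
by field; rewrite !gt_eqF.
Qed.

Lemma g_pos_le0 s : s <= 0 -> g_pos s = 0.
Proof. by move=> s0; rewrite /g_pos max_r// g0. Qed.

Lemma G_posE (T s : R) : 0 < T -> - T <= s ->
  G_pos s = antiderivative g_pos T s - antiderivative g_pos T 0.
Proof.
move=> T0 Ts; rewrite /G_pos; have [s0|s0] := leP 0 s; first exact: primitiveE.
rewrite (primitiveE T0 (lexx 0)) subrr; apply/esym/eqP.
rewrite subr_eq0 -subr_eq0 -opprB oppr_eq0 antiderivativeB ?(ltW s0)//; last exact: g_pos_cont.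
apply/eqP; transitivity (\int[lebesgue_measure]_(x in `[s, 0]) (cst 0 x : R)).
  by apply: eq_Rintegral => x; rewrite inE/= in_itv/= => /andP[_ x0]; exact: g_pos_le0.
by rewrite /Rintegral integral0.
Qed.

Lemma is_derive_G_pos s : is_derive s (1 : R) G_pos (g_pos s).
Proof.
pose T := `|s| + 1; have T0 : 0 < T by rewrite ltr_wpDl.
have Ts : - T < s by have := ler_norm (- s); rewrite normrN /T; lra.
have D : is_derive s (1 : R) (antiderivative g_pos T + cst (- antiderivative g_pos T 0)) (g_pos s + 0).
  by apply: is_deriveD; exact: (is_derive_antiderivative g_pos_cont Ts).
rewrite addr0 in D; have [d1 d2] := D.
have E : \forall x \near s, (antiderivative g_pos T + cst (- antiderivative g_pos T 0)) x = G_pos x.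
  have : \forall x \near s, - T < x by exact: lt_nbhsr.
  by apply: filterS => x Tx; rewrite (G_posE T0 (ltW Tx)).
split; last by rewrite -d2; apply/esym; exact: near_eq_derive.
by apply: near_eq_derivable d1.
Qed.

Lemma G_pos_cont : continuous G_pos.
Proof.
move=> s; apply: differentiable_continuous; apply/derivable1_diffP.
by have [] := is_derive_G_pos s.
Qed.

Lemma G_pos_ge0 s : 0 <= G_pos s.
Proof.
apply: Rintegral_ge0 => x; rewrite /= in_itv/= => /andP[x0 _]; exact: g_ge0.
Qed.

Lemma continuous_bounded (f : R -> R) (B : R) : continuous f -> exists2 M, 0 <= M &
  forall s, `|s| <= B -> `|f s| <= M.
Proof.
move=> fc; have : compact (f @` `[- B, B]).
  by apply: continuous_compact; [exact: continuous_subspaceT|exact: segment_compact].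
move=> /compact_bounded[M0 [_ HM]]; exists (`|M0| + 1); first by rewrite addr_ge0.
move=> s sB; apply: (HM (`|M0| + 1)); first by rewrite (le_lt_trans (ler_norm _))// ltrDl.
by exists s => //; rewrite /= in_itv/= -ler_norml.
Qed.

(** Heine's theorem by contradiction: the base points of a bad sequence subconverge, and continuity
    at their limit excludes a jump of size [d]. *)
Lemma continuous_uniform (f : R -> R) (B d : R) : continuous f -> 0 < d -> exists2 r, 0 < r &
  forall s t, `|s| <= B -> `|t| <= r -> `|f (s + t) - f s| <= d.
Proof.
move=> fc d0; apply: contrapT => nH.
have /choice[w wP] : forall k : nat, exists w : R * R,
    [/\ `|w.1| <= B, `|w.2| <= harmonic k & d < `|f (w.1 + w.2) - f w.1|].
  move=> k; apply: contrapT => nw; apply: nH; exists (harmonic k : R).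
    by rewrite /harmonic/= invr_gt0.
  move=> s t sB tk; rewrite leNgt; apply/negP => H; apply: nw.
  by exists (s, t).
have [|phi phik Hphi] := @diagonal_subsequence R (fun _ k => (w k).1).
  by move=> _; exists B => k; have [] := wP k.
have [l Hl] := Hphi 0%N.
have t0 : (fun k => (w (phi k)).2) @ \oo --> (0 : R).
  have h := cvg_subseq phik (@cvg_harmonic R).
  apply/cvgrPdist_le => e e0; have := h => /cvgrPdist_le /(_ e e0); apply: filterS => k.
  rewrite !sub0r !normrN => hk; have [_ h2 _] := wP (phi k); apply: le_trans h2 _.
  exact: le_trans (ler_norm _) hk.
have h1 : (fun k => f ((w (phi k)).1 + (w (phi k)).2)) @ \oo --> f l.
  apply: (@continuous_cvg _ _ _ _ _ _ f); first exact: fc.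
  by rewrite -[X in _ --> X]addr0; apply: cvgD.
have h2 : (fun k => f (w (phi k)).1) @ \oo --> f l.
  by apply: (@continuous_cvg _ _ _ _ _ _ f); [exact: fc|exact: Hl].
have h3 : (fun k => `|f ((w (phi k)).1 + (w (phi k)).2) - f (w (phi k)).1|) @ \oo --> (0 : R).
  by rewrite -(normr0 R) -(subrr (f l)); apply: cvg_norm; exact: cvgB.
have : d <= 0.
  by apply: (ler_cvg_to (cvg_cst d) h3); apply: nearW => k; have [_ _ /ltW] := wP (phi k).
by rewrite leNgt d0.
Qed.

Lemma G_pos_taylor (B d : R) : 0 < d -> exists2 r, 0 < r &
  forall s t, `|s| <= B -> `|t| <= r -> `|G_pos (s + t) - G_pos s - g_pos s * t| <= d * `|t|.
Proof.
move=> d0; have [r r0 H] := continuous_uniform B g_pos_cont d0; exists r => // s t sB tr.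
pose F (x : R) := G_pos (s + x) - g_pos s * x.
have DF (x : R) : is_derive x (1 : R) F (g_pos (s + x) - g_pos s).
  have h1 : is_derive x (1 : R) (fun x => s + x) 1.
    have D : is_derive x (1 : R) (cst s + (id : R -> R)) (0 + 1) by exact: is_deriveD.
    by rewrite add0r in D.
  have h2 := @is_derive1_comp R G_pos (fun x => s + x) x _ _ (is_derive_G_pos (s + x)) h1.
  have h3 : is_derive x (1 : R) (fun x => g_pos s * x) (g_pos s * 1) by exact: is_deriveZ.
  by rewrite !mulr1 in h2 h3; exact: (is_deriveB h2 h3).
have cF : continuous F.
  by move=> x; apply: differentiable_continuous; apply/derivable1_diffP; have [] := DF x.
have key b c : b <= c -> (forall x, b <= x -> x <= c -> `|x| <= r) -> `|F c - F b| <= d * (c - b).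
  move=> bc hx; have [|x] := @MVT_segment R F _ b c bc (fun x _ => DF x).
    exact: continuous_subspaceT.
  rewrite in_itv/= => /andP[bx xc] ->; rewrite normrM [X in _ * X]ger0_norm ?subr_ge0//.
  by apply: ler_wpM2r; [rewrite subr_ge0|apply: H => //; exact: hx].
have E : G_pos (s + t) - G_pos s - g_pos s * t = F t - F 0.
  by rewrite /F addr0 mulr0 subr0 addrAC.
rewrite E; move: tr; have [t0|t0] := leP 0 t.
  rewrite (ger0_norm t0) => tr; have := key 0 t t0; rewrite subr0; apply => x x0 xt.
  by rewrite ger0_norm// (le_trans xt).
rewrite (ltr0_norm t0) distrC => tr; have := key t 0 (ltW t0); rewrite sub0r; apply => x tx x0.
by rewrite ler0_norm// (le_trans _ tr)// lerN2.
Qed.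

Lemma G_pos_small e : 0 < e -> exists2 r, 0 < r & forall s, `|s| <= r -> G_pos s <= e * `|s| `^ p.
Proof.
move=> e0; have := G_at0 => /cvgrPdist_le /(_ e e0) [r /= r0 Hr].
exists (r / 2); first by rewrite divr_gt0.
move=> s sr; rewrite /G_pos; have [s0|s0] := leP s 0.
  rewrite /primitive (_ : \int[_]_(_ in _) _ = 0) ?mulr_ge0 ?powR_ge0 ?(ltW e0)//.
  by rewrite set_itv1 /Rintegral integral_set1.
have : `|0 - primitive g s / s `^ p| <= e.
  apply: Hr; last exact: s0.
  by rewrite /= sub0r normrN (le_lt_trans sr)// ltr_pdivrMr// ltr_pMr// ltr1n.
rewrite sub0r normrN => /(le_trans (ler_norm _)).
by rewrite ler_pdivrMr ?powR_gt0// gtr0_norm.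
Qed.

Lemma G_pos_growth e : 0 < e -> exists2 C, 0 <= C & forall s, G_pos s <= e * `|s| `^ p + C.
Proof.
move=> e0; have := G_atoo => /cvgrPdist_le /(_ e e0) [T [_ HT]].
have [C C0 HC] := continuous_bounded `|T| G_pos_cont.
exists C => // s; have [sT|sT] := leP `|s| `|T|.
  apply: le_trans (le_trans (ler_norm _) (HC s sT)) _.
  by rewrite lerDr mulr_ge0 ?powR_ge0// ltW.
rewrite /G_pos; have [s0|s0] := leP s 0.
  rewrite /primitive (_ : \int[_]_(_ in _) _ = 0); first by rewrite addr_ge0// mulr_ge0 ?powR_ge0 ?(ltW e0).
  by rewrite set_itv1 /Rintegral integral_set1.
have Ts : T < s by apply: le_lt_trans (ler_norm T) _; rewrite -(gtr0_norm s0).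
have := HT s Ts; rewrite sub0r normrN => /(le_trans (ler_norm _)).
by rewrite ler_pdivrMr ?powR_gt0// gtr0_norm// => h; apply: le_trans h _; rewrite lerDl.
Qed.

End nonlinearity.

(** The product is only known to be nonnegative, hence the [+ 1] in the denominator here and in the
    radii below. *)
Lemma load_constant (R : realFieldType) (l m k d v : R) : 0 <= l * m * k -> 0 <= d -> 0 <= v ->
  l * (d / (l * m * k + 1) * m * (k * v)) <= d * v.
Proof.
move=> b0 d0 v0; have c0 : 0 < l * m * k + 1 by rewrite ltr_wpDl.
have -> : l * (d / (l * m * k + 1) * m * (k * v)) = (d * v) * (l * m * k / (l * m * k + 1)) by ring.
by rewrite ler_piMr ?mulr_ge0// ler_pdivrMr// mul1r lerDl.
Qed.

Lemma load_constant1 (R : realFieldType) (l k d v : R) : 0 <= l * k -> 0 <= d -> 0 <= v ->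
  l * (d / (l * k + 1) * (k * v)) <= d * v.
Proof.
move=> b0 d0 v0; have := @load_constant R l 1 k d v.
by rewrite !mulr1; apply.
Qed.

(** * The functionals of the variational problem *)

Section functionals.
Variables (R : realType) (n : nat) (p : R) (p_gt1 : 1 < p).
Notation mu := (lebesgue_rV R n).
Hypothesis p_gtn : n%:R < p.
Variables (a h : 'rV[R]_n -> R) (a0 A : R) (g : R -> R) (lam : R).
Hypotheses (a_meas : measurable_fun [set: 'rV[R]_n] a) (a0_gt0 : 0 < a0).
Hypothesis a_bounds : forall x, a0 <= a x <= A.
Hypothesis h_itg : itg mu h.
Hypothesis h_ge0 : forall x, 0 <= h x.
Hypothesis g_cont : continuous g.
Hypothesis g_ge0 : forall t : R, 0 <= t -> 0 <= g t.
Hypothesis G_at0 : primitive g t / t `^ p @[t --> 0^'+] --> (0 : R).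
Hypothesis G_atoo : primitive g t / t `^ p @[t --> +oo] --> (0 : R).
Hypothesis lam_gt0 : 0 < lam.
Local Notation X := (sobolev_space n p_gt1).
Local Notation N := (@sob_norm R n p p_gt1 a).
Local Notation K := (sup_norm_const n p a0).
Implicit Types (u v w : X) (f : 'rV[R]_n -> R).

Let p_gt0 : 0 < p. Proof. exact: lt_trans p_gt1. Qed.
Let K_ge0 : 0 <= K. Proof. exact: sup_norm_const_ge0. Qed.
Let N_ge0 u : 0 <= N u. Proof. exact: sob_norm_ge0. Qed.
Let KN_ge0 u : 0 <= K * N u. Proof. by rewrite mulr_ge0. Qed.
Let fn_sup u : {ae mu, forall x, `|fn u x| <= K * N u}.
Proof. exact: (sob_sup a_meas a0_gt0 a_bounds u p_gtn). Qed.
Let fn_meas u : measurable_fun [set: 'rV[R]_n] (fn u). Proof. by have [] := fn_Lp u. Qed.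

Definition mass : R := \int[mu]_x h x.
Let mass_ge0 : 0 <= mass. Proof. by apply: Rintegral_ge0. Qed.

Let lmK_ge0 : 0 <= lam * mass * K.
Proof. exact: (mulr_ge0 (mulr_ge0 (ltW lam_gt0) mass_ge0) K_ge0). Qed.
Let lK_ge0 : 0 <= lam * K. Proof. exact: (mulr_ge0 (ltW lam_gt0) K_ge0). Qed.

Lemma weighted_itg f (M : R) : measurable_fun [set: 'rV[R]_n] f ->
  {ae mu, forall x, `|f x| <= M} -> itg mu (fun x => h x * f x).
Proof.
move=> mf fM; apply: (itg_le_ae _ (itgZ M h_itg)).
  by apply: measurable_funM => //; exact: itgM h_itg.
apply: filterS fM => x fx; rewrite normrM ger0_norm// mulrC.
exact: ler_wpM2r.
Qed.

Lemma weighted_Int_le f (M : R) : measurable_fun [set: 'rV[R]_n] f ->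
  {ae mu, forall x, `|f x| <= M} -> `|\int[mu]_x (h x * f x)| <= M * mass.
Proof.
move=> mf fM; rewrite /mass -(IntZ M h_itg); apply: Int_norm_le.
- exact: weighted_itg fM.
- exact: itgZ.
apply: filterS fM => x fx; rewrite normrM ger0_norm// mulrC.
exact: ler_wpM2r.
Qed.

Lemma g_pos_fn_meas u : measurable_fun [set: 'rV[R]_n] (fun x => g_pos g (fn u x)).
Proof.
apply: (measurableT_comp _ (fn_meas u)).
by apply: continuous_measurable_fun; exact: g_pos_cont.
Qed.

Lemma G_pos_fn_meas u : measurable_fun [set: 'rV[R]_n] (fun x => G_pos g (fn u x)).
Proof.
apply: (measurableT_comp _ (fn_meas u)).
by apply: continuous_measurable_fun; exact: (G_pos_cont p_gt1 g_cont G_at0).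
Qed.

Lemma g_pos_fn_bounded B : exists2 M, 0 <= M & forall u, N u <= B ->
  {ae mu, forall x, `|g_pos g (fn u x)| <= M}.
Proof.
have [M M0 HM] := continuous_bounded (K * B) (g_pos_cont g_cont).
exists M => // u uB; apply: filterS (fn_sup u) => x hx; apply: HM.
by apply: le_trans hx _; exact: ler_wpM2l.
Qed.

Lemma G_pos_fn_bounded u : exists2 M, 0 <= M & {ae mu, forall x, `|G_pos g (fn u x)| <= M}.
Proof.
have [M M0 HM] := continuous_bounded (K * N u) (G_pos_cont p_gt1 g_cont G_at0).
by exists M => //; apply: filterS (fn_sup u) => x hx; exact: HM.
Qed.

Lemma product_bounded (f1 f2 : 'rV[R]_n -> R) (M1 M2 : R) : 0 <= M1 ->
  {ae mu, forall x, `|f1 x| <= M1} -> {ae mu, forall x, `|f2 x| <= M2} ->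
  {ae mu, forall x, `|f1 x * f2 x| <= M1 * M2}.
Proof. by move=> M10; apply: filterS2 => x h1 h2; rewrite normrM; exact: ler_pM. Qed.

Definition load u v : R := lam * \int[mu]_x (h x * (g_pos g (fn u x) * fn v x)).
Definition potential u : R := lam * \int[mu]_x (h x * G_pos g (fn u x)).

Lemma load_meas u v : measurable_fun [set: 'rV[R]_n] (fun x => g_pos g (fn u x) * fn v x).
Proof. by apply: measurable_funM; [exact: g_pos_fn_meas|exact: fn_meas]. Qed.

Lemma load_itg u v : itg mu (fun x => h x * (g_pos g (fn u x) * fn v x)).
Proof.
have [M M0 HM] := g_pos_fn_bounded (N u).
apply: (weighted_itg (load_meas u v)); exact: (product_bounded M0 (HM u (lexx _)) (fn_sup v)).
Qed.

Lemma potential_itg u : itg mu (fun x => h x * G_pos g (fn u x)).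
Proof. by have [M M0 HM] := G_pos_fn_bounded u; exact: (weighted_itg (G_pos_fn_meas u) HM). Qed.

Lemma load_linear u : linear_functional (load u).
Proof.
move=> c x y; rewrite /load mulrCA -mulrDr; congr (_ * _).
rewrite -(IntZ c (load_itg u x)) -(IntD (itgZ c (load_itg u x)) (load_itg u y)).
by apply: eq_Rintegral => t _; rewrite fnD fnZ; ring.
Qed.

Lemma load_bounded B : exists2 M, 0 < M & forall u, N u <= B -> bounded_functional N M (load u).
Proof.
have [M M0 HM] := g_pos_fn_bounded B.
exists (lam * (M * K * mass) + 1).
  by rewrite ltr_wpDl//; exact: (mulr_ge0 (ltW lam_gt0) (mulr_ge0 (mulr_ge0 M0 K_ge0) mass_ge0)).
move=> u uB v; rewrite /load normrM (gtr0_norm lam_gt0).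
have h1 := weighted_Int_le (load_meas u v) (product_bounded M0 (HM u uB) (fn_sup v)).
apply: le_trans (ler_wpM2l (ltW lam_gt0) h1) _; rewrite mulrDl mul1r.
by apply: (@le_trans _ _ (lam * (M * K * mass) * N v)); [rewrite le_eqVlt; apply/orP; left; apply/eqP; move: mass K (N v) => m k z; ring|rewrite lerDl].
Qed.

(** Since [h] is merely integrable, [v] is estimated by its supremum; the nonlinear terms then need
    to be close only in $L^1$ with weight [h]. *)
Lemma load_distance u w v (d : R) : 0 <= d ->
  \int[mu]_x (h x * `|g_pos g (fn u x) - g_pos g (fn w x)|) <= d ->
  `|load u v - load w v| <= lam * (d * (K * N v)).
Proof.
move=> d0 hd; rewrite /load -mulrBr normrM (gtr0_norm lam_gt0); apply: ler_wpM2l; first exact: ltW.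
have [M1 M10 H1] := g_pos_fn_bounded (N u); have [M2 M20 H2] := g_pos_fn_bounded (N w).
have md : measurable_fun [set: 'rV[R]_n] (fun x => `|g_pos g (fn u x) - g_pos g (fn w x)|).
  by apply: measurableT_comp => //; apply: measurable_funB; exact: g_pos_fn_meas.
have id_ : itg mu (fun x => h x * `|g_pos g (fn u x) - g_pos g (fn w x)|).
  apply: (@weighted_itg _ (M1 + M2) md).
  apply: filterS2 (H1 u (lexx _)) (H2 w (lexx _)) => x h1 h2; rewrite normr_id.
  exact: le_trans (ler_normB _ _) (lerD h1 h2).
rewrite -(IntB (load_itg u v) (load_itg w v)).
apply: le_trans (Int_norm_le (itgB (load_itg u v) (load_itg w v)) (itgZ (K * N v) id_) _) _.
  apply: filterS (fn_sup v) => x hx.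
  have -> : h x * (g_pos g (fn u x) * fn v x) - h x * (g_pos g (fn w x) * fn v x) =
    (h x * (g_pos g (fn u x) - g_pos g (fn w x))) * fn v x by ring.
  rewrite normrM mulrC normrM (ger0_norm (h_ge0 x)).
  by apply: ler_wpM2r => //; apply: mulr_ge0.
by rewrite (IntZ _ id_) mulrC; apply: ler_wpM2r.
Qed.

Lemma load_near u w v (d : R) : 0 <= d ->
  {ae mu, forall x, `|g_pos g (fn u x) - g_pos g (fn w x)| <= d} ->
  `|load u v - load w v| <= lam * (d * mass * (K * N v)).
Proof.
move=> d0 hd; apply: load_distance; first by rewrite mulr_ge0.
have md : measurable_fun [set: 'rV[R]_n] (fun x => `|g_pos g (fn u x) - g_pos g (fn w x)|).
  by apply: measurableT_comp => //; apply: measurable_funB; exact: g_pos_fn_meas.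
apply: le_trans (ler_norm _) (weighted_Int_le md _).
by apply: filterS hd => x; rewrite normr_id.
Qed.

Lemma load_continuous (w : nat -> X) u : seq_cvg N w u ->
  forall d, 0 < d -> \forall k \near \oo, bounded_functional N d (fun v => load (w k) v - load u v).
Proof.
move=> wu d d0; pose c := lam * mass * K + 1.
have c0 : 0 < c by rewrite ltr_wpDl.
have dc : 0 < d / c by rewrite divr_gt0.
have [r r0 Hr] := continuous_uniform (K * N u) (g_pos_cont g_cont) dc.
have rK : 0 < r / (K + 1) by rewrite divr_gt0// ltr_wpDl.
have := wu => /(cvg0_leP (fun k => N_ge0 _)) /(_ _ rK); apply: filterS => k hk v.
apply: (@le_trans _ _ (lam * (d / c * mass * (K * N v)))).
  apply: load_near; first exact: ltW.
  apply: filterS2 (fn_sup u) (fn_sup (w k - u)) => x h1 h2.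
  have -> : fn (w k) x = fn u x + fn (w k - u) x by rewrite fnB addrC subrK.
  apply: (Hr _ _ h1); apply: le_trans h2 _; apply: le_trans (ler_wpM2l K_ge0 hk) _.
  by rewrite mulrCA ler_piMr ?(ltW r0)// ler_pdivrMr ?ltr_wpDl// mul1r lerDl.
exact: (load_constant lmK_ge0 (ltW d0) (N_ge0 v)).
Qed.

Lemma load_compact (w : nat -> X) B : (forall k, N (w k) <= B) ->
  exists2 phi : nat -> nat, (forall k, (k <= phi k)%N) &
  forall d, 0 < d -> exists n0, forall k m, (n0 <= k)%N -> (n0 <= m)%N ->
    bounded_functional N d (fun v => load (w (phi k)) v - load (w (phi m)) v).
Proof.
move=> wB.
have B' k : norm_p p (fn (w k)) + grad_norm p (gr (w k)) <= (a0^-1 `^ p^-1 + n%:R) * B.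
  apply: le_trans (sob_sup_parts a_meas a0_gt0 a_bounds (w k)) _.
  by apply: ler_wpM2l => //; rewrite addr_ge0 ?powR_ge0.
have [phi phik Hphi] := sobolev_ae_compact p_gt1 p_gtn (fun k => sobolevP (w k)) B'.
exists phi => // d d0.
pose F x := fine (limn_esup (fun k => (fn (w (phi k)) x)%:E)).
have mF : measurable_fun [set: 'rV[R]_n] F.
  apply: measurableT_comp => //; apply: measurable_fun_limn_esup => k.
  by apply/measurable_EFinP; exact: fn_meas.
have fF : {ae mu, forall x, (fun k => fn (w (phi k)) x) @ \oo --> F x}.
  apply: filterS Hphi => x /cvg_ex[l fl].
  rewrite /F is_cvg_limn_esupE; last by apply/cvg_ex; exists l%:E; exact: cvg_comp fl _.
  have -> : limn (fun k => (fn (w (phi k)) x)%:E) = l%:E.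
    by apply/cvg_lim => //; exact: cvg_comp fl _.
  by [].
have [M M0 HM] := g_pos_fn_bounded B.
have mh : measurable_fun [set: 'rV[R]_n] h by exact: itgM h_itg.
have mgF : measurable_fun [set: 'rV[R]_n] (fun x => g_pos g (F x)).
  apply: (measurableT_comp _ mF); apply: continuous_measurable_fun; exact: g_pos_cont.
have [|||||iF _ Hl] := @dct _ _ _ mu (fun k x => h x * g_pos g (fn (w (phi k)) x))
  (fun x => h x * g_pos g (F x)) (fun x => M * h x).
- by move=> k; apply: measurable_funM => //; exact: g_pos_fn_meas.
- exact: measurable_funM.
- apply: filterS fF => x hx; apply: cvgM; first exact: cvg_cst.
  by apply: (@continuous_cvg _ _ _ _ _ _ (g_pos g)); [exact: g_pos_cont|exact: hx].
- exact: itgZ.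
- apply: ae_foralln => k; apply: filterS (HM (w (phi k)) (wB _)) => x hx.
  by rewrite normrM ger0_norm// mulrC; exact: ler_wpM2r.
pose c := lam * K + 1.
have c0 : 0 < c by rewrite ltr_wpDl.
have dc : 0 < d / c / 2 by rewrite !divr_gt0.
have In_ge0 k : 0 <= \int[mu]_x `|h x * g_pos g (fn (w (phi k)) x) - h x * g_pos g (F x)|.
  by apply: Rintegral_ge0 => x _; exact: normr_ge0.
have := Hl => /(cvg0_leP In_ge0) /(_ _ dc) [n0 _ Hn0].
exists n0 => k m kn mn v.
have ik j : itg mu (fun x => h x * g_pos g (fn (w (phi j)) x)).
  exact: (weighted_itg (g_pos_fn_meas _) (HM (w (phi j)) (wB _))).
have id_ j : itg mu (fun x => `|h x * g_pos g (fn (w (phi j)) x) - h x * g_pos g (F x)|).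
  exact: (itg_norm (itgB (ik j) iF)).
apply: (@le_trans _ _ (lam * (d / c * (K * N v)))).
  apply: load_distance; first by rewrite divr_ge0 ?ltW.
  have -> : d / c = d / c / 2 + d / c / 2 by rewrite -splitr.
  apply: le_trans (lerD (Hn0 k kn) (Hn0 m mn)); rewrite -(IntD (id_ k) (id_ m)).
  apply: Int_le => [||x]; last 1 first.
  - have -> : h x * `|g_pos g (fn (w (phi k)) x) - g_pos g (fn (w (phi m)) x)| =
      `|(h x * g_pos g (fn (w (phi k)) x) - h x * g_pos g (F x)) -
        (h x * g_pos g (fn (w (phi m)) x) - h x * g_pos g (F x))|.
      rewrite -[X in X * _](ger0_norm (h_ge0 x)) -normrM; congr `|_|; ring.
    exact: ler_normB.
  - apply: (itg_le _ (itgD (itg_norm (ik k)) (itg_norm (ik m)))) => [|x].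
      by apply: measurable_funM => //; apply: measurableT_comp => //; apply: measurable_funB; exact: g_pos_fn_meas.
    rewrite normrM normr_id -normrM mulrBr; exact: ler_normB.
  - exact: (itgD (id_ k) (id_ m)).
exact: (load_constant1 lK_ge0 (ltW d0) (N_ge0 v)).
Qed.

Lemma load0 v : load 0 v = 0.
Proof.
rewrite /load (_ : \int[mu]_x _ = 0) ?mulr0//.
transitivity (\int[mu]_x (cst 0 x : R)); last by rewrite /Rintegral integral0.
apply: eq_Rintegral => x _; rewrite fn0 /g_pos max_l//.
by rewrite (g0 p_gt1 g_cont G_at0) mul0r mulr0.
Qed.

Lemma potential_ge0 u : 0 <= potential u.
Proof.
rewrite mulr_ge0 ?(ltW lam_gt0)//; apply: Rintegral_ge0 => x _.
by rewrite mulr_ge0//; exact: G_pos_ge0.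
Qed.

Lemma potential_derivable B d : 0 < d -> exists2 r, 0 < r &
  forall u v, N u <= B -> N v <= r -> `|potential (u + v) - potential u - load u v| <= d * N v.
Proof.
move=> d0; pose c := lam * mass * K + 1.
have c0 : 0 < c by rewrite ltr_wpDl.
have dc : 0 < d / c by rewrite divr_gt0.
have [r r0 Hr] := G_pos_taylor p_gt1 g_cont G_at0 (K * B) dc.
have rK : 0 < r / (K + 1) by rewrite divr_gt0// ltr_wpDl.
exists (r / (K + 1)) => // u v uB vr.
have E : potential (u + v) - potential u - load u v =
    lam * \int[mu]_x (h x * (G_pos g (fn (u + v) x) - G_pos g (fn u x) - g_pos g (fn u x) * fn v x)).
  rewrite /potential /load -!mulrBr; congr (_ * _).
  rewrite -(IntB (potential_itg (u + v)) (potential_itg u)).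
  rewrite -(IntB (itgB (potential_itg (u + v)) (potential_itg u)) (load_itg u v)).
  by apply: eq_Rintegral => x _; ring.
rewrite E normrM (gtr0_norm lam_gt0).
apply: (@le_trans _ _ (lam * (d / c * (K * N v) * mass))).
  apply: ler_wpM2l; first exact: ltW.
  apply: weighted_Int_le.
    apply: measurable_funB; last exact: load_meas.
    by apply: measurable_funB; exact: G_pos_fn_meas.
  apply: filterS2 (fn_sup u) (fn_sup v) => x h1 h2; rewrite fnD.
  have vr' : `|fn v x| <= r.
    apply: le_trans h2 _; apply: le_trans (ler_wpM2l K_ge0 vr) _.
    by rewrite mulrCA ler_piMr ?(ltW r0)// ler_pdivrMr ?ltr_wpDl// mul1r lerDl.
  have uB' : `|fn u x| <= K * B by apply: le_trans h1 _; exact: ler_wpM2l.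
  apply: le_trans (Hr _ _ uB' vr') _; apply: ler_wpM2l h2; exact: ltW.
rewrite [_ / c * _ * _]mulrAC; exact: (load_constant lmK_ge0 (ltW d0) (N_ge0 v)).
Qed.

Lemma potential_le u (e C : R) : 0 <= e -> 0 <= C ->
  {ae mu, forall x, G_pos g (fn u x) <= e * `|fn u x| `^ p + C} ->
  potential u <= lam * mass * K `^ p * e * N u `^ p + lam * mass * C.
Proof.
move=> e0 C0 H.
have -> : lam * mass * K `^ p * e * N u `^ p + lam * mass * C =
    lam * ((e * (K * N u) `^ p + C) * mass).
  rewrite powRM//; move: (K `^ p) (N u `^ p) mass => k v m; ring.
apply: ler_wpM2l; first exact: ltW.
apply: le_trans (ler_norm _) (weighted_Int_le (G_pos_fn_meas u) _).
apply: filterS2 H (fn_sup u) => x h1 h2; rewrite ger0_norm; last exact: G_pos_ge0.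
apply: le_trans h1 _; rewrite lerD2r; apply: ler_wpM2l => //.
exact: powR_le_mono.
Qed.

(** Chosen so that, after the embedding constant and the mass of [h] are taken into account, the
    potential uses at most half of the term $N^p/p$. *)
Let small_coeff : R := (2 * p * (lam * mass * K `^ p + 1))^-1.
Let coeff_gt0 : 0 < lam * mass * K `^ p + 1.
Proof. by rewrite ltr_wpDl// !mulr_ge0 ?powR_ge0// ltW. Qed.
Let small_coeff_gt0 : 0 < small_coeff.
Proof. by rewrite invr_gt0 !mulr_gt0. Qed.
Let small_coeffP u : lam * mass * K `^ p * small_coeff * N u `^ p <= N u `^ p / (2 * p).
Proof.
rewrite mulrC; apply: ler_wpM2l; first exact: powR_ge0.
have p2 : 0 < 2 * p by rewrite mulr_gt0.
rewrite /small_coeff invfM mulrCA ler_piMr ?invr_ge0 ?(ltW p2)//.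
by rewrite ler_pdivrMr// mul1r lerDl.
Qed.

Lemma potential_growth : exists C, forall u, potential u <= N u `^ p / (2 * p) + C.
Proof.
have [C C0 HC] := G_pos_growth p_gt1 g_cont G_at0 G_atoo small_coeff_gt0.
exists (lam * mass * C) => u.
apply: le_trans (potential_le (ltW small_coeff_gt0) C0 _) _; last by rewrite lerD2r small_coeffP.
by apply: aeW => x; exact: HC.
Qed.

Lemma potential_small : exists2 r, 0 < r & forall u, N u <= r -> potential u <= N u `^ p / (2 * p).
Proof.
have [r r0 Hr] := G_pos_small G_at0 small_coeff_gt0.
have rK : 0 < r / (K + 1) by rewrite divr_gt0// ltr_wpDl.
exists (r / (K + 1)) => // u ur.
apply: le_trans (potential_le (ltW small_coeff_gt0) (lexx 0) _) _; last by rewrite mulr0 addr0 small_coeffP.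
apply: filterS (fn_sup u) => x hx; rewrite addr0; apply: Hr.
apply: le_trans hx _; apply: le_trans (ler_wpM2l K_ge0 ur) _.
by rewrite mulrCA ler_piMr ?(ltW r0)// ler_pdivrMr ?ltr_wpDl// mul1r lerDl.
Qed.

Definition is_critical u := forall v, tilted N p (load u) u <= tilted N p (load u) v.
Definition total_energy u : R := N u `^ p / p - potential u.

Theorem two_critical_points e : total_energy e < 0 ->
  exists u v, [/\ is_critical u, total_energy u < 0, is_critical v & 0 < total_energy v].
Proof.
move=> e0.
have NT u v : N (u + v) <= N u + N v by exact: (sob_norm_triangle a_meas a0_gt0 a_bounds).
have NZ c u : N (c *: u) = `|c| * N u by exact: (sob_normZ a_meas a0_gt0 a_bounds).
have UC := sob_uniformly_convex p_gt1 a_meas a0_gt0 a_bounds.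
have CO := @sob_complete R n p p_gt1 a a0 A a_meas a0_gt0 a_bounds.
have [u uc ue] := negative_critical_point p_gt1 N_ge0 NT NZ UC CO load_linear load_bounded
  load_continuous load_compact potential_derivable potential_growth e0.
have [v vc ve] := positive_critical_point p_gt1 N_ge0 NT NZ UC CO load_linear load_bounded
  load_continuous load_compact load0 potential_ge0 potential_derivable potential_growth potential_small e0.
by exists u, v.
Qed.

End functionals.

(** At a positive limit the exponent may have any sign, as is needed for [p - 2]. *)
Lemma cvg_powR_pos (R : realType) (r : R) (f : nat -> R) (l : R) : 0 < l -> f @ \oo --> l ->
  (fun k => f k `^ r) @ \oo --> l `^ r.
Proof.
move=> l0 fl; apply: (@continuous_cvg _ _ _ _ _ _ (fun x => x `^ r)) => //.
have : derivable (fun x : R => x `^ r) l 1 by apply: derivable_powR; rewrite in_itv/= l0.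
by move/derivable1_diffP/differentiable_continuous.
Qed.

(** * Critical points are weak solutions *)

Section flux.
Variables (R : realType) (p : R).
Hypothesis p_gt1 : 1 < p.
Implicit Types s t : R.

Let p_gt0 : 0 < p. Proof. exact: lt_trans p_gt1. Qed.

Section vectors.
Variable n : nat.
Implicit Types y z : 'rV[R]_n.

Lemma flux_self y : enorm y `^ (p - 2) * dotp y y = enorm y `^ p.
Proof.
rewrite -sqr_enorm -powR_mulrn ?enorm_ge0//; have := enorm_ge0 y; rewrite le_eqVlt => /predU1P[<-|y0].
  by rewrite [in X in _ * X]powR0 ?mulr0 ?powR0 ?gt_eqF.
by rewrite -powRD ?subrK// (gt_eqF y0) implybT.
Qed.

Lemma flux_le y z : `|enorm y `^ (p - 2) * dotp y z| <= enorm y `^ (p - 1) * enorm z.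
Proof.
rewrite normrM (ger0_norm (powR_ge0 _ _)).
have := enorm_ge0 y; rewrite le_eqVlt => /predU1P[y0|y0].
  suff -> : dotp y z = 0 by rewrite normr0 mulr0 mulr_ge0 ?powR_ge0 ?enorm_ge0.
  exact: dotp_enorm0 (esym y0).
apply: le_trans (ler_wpM2l (powR_ge0 _ _) (cauchy_schwarz y z)) _.
rewrite mulrA le_eqVlt; apply/orP; left; apply/eqP; congr (_ * _).
rewrite -[X in _ * X](@powRr1 _ (enorm y)) ?(ltW y0)// -powRD; last by rewrite (gt_eqF y0) implybT.
by congr (_ `^ _); lra.
Qed.

Lemma young_crude s t : 0 <= s -> 0 <= t -> s `^ (p - 1) * t <= s `^ p + t `^ p.
Proof.
move=> s0 t0; have p1 : 0 < p - 1 by rewrite subr_gt0.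
have [st|/ltW ts] := leP s t.
  apply: (@le_trans _ _ (t `^ (p - 1) * t)); first by apply: ler_wpM2r => //; exact: powR_le_mono.
  by rewrite (powR_predE p_gt1 t0) lerDr powR_ge0.
apply: (@le_trans _ _ (s `^ (p - 1) * s)); first by apply: ler_wpM2l => //; exact: powR_ge0.
by rewrite (powR_predE p_gt1 s0) lerDl powR_ge0.
Qed.

Lemma flux_bound y z : `|enorm y `^ (p - 2) * dotp y z| <= enorm y `^ p + enorm z `^ p.
Proof. by apply: le_trans (flux_le y z) (young_crude _ _); exact: enorm_ge0. Qed.

(** At [y = 0] with $p<2$ the first factor alone is singular; the product is then controlled by
    $|y+tz|^{p-1}|z|$, which tends to 0. *)
Lemma flux_cvg y z (t : nat -> R) : t @ \oo --> (0 : R) ->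
  (fun k => enorm (y + t k *: z) `^ (p - 2) * dotp (y + t k *: z) z) @ \oo -->
  enorm y `^ (p - 2) * dotp y z.
Proof.
move=> t0.
have ce : (fun k => enorm (y + t k *: z)) @ \oo --> enorm y.
  have h : (fun k => `|t k| * enorm z) @ \oo --> (0 : R).
    rewrite -[X in _ --> X](mul0r (enorm z)); apply: cvgM; last exact: cvg_cst.
    by rewrite -(normr0 R); exact: cvg_norm.
  apply/cvgrPdist_le => e e0; have := h => /cvgrPdist_le /(_ e e0); apply: filterS => k.
  rewrite sub0r normrN => /(le_trans (ler_norm _)); apply: le_trans.
  rewrite -enormZ ler_norml; apply/andP; split.
    by have := enormD y (t k *: z); lra.
  by have := enormD (y + t k *: z) (- (t k *: z)); rewrite addrK enormN; lra.
have := enorm_ge0 y; rewrite le_eqVlt => /predU1P[y0|y0]; last first.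
  apply: cvgM; first exact: cvg_powR_pos.
  have -> : (fun k => dotp (y + t k *: z) z) = (fun k => dotp y z + t k * dotp z z).
    by apply/funext => k; rewrite dotpDl dotpZl.
  rewrite -[X in _ --> X]addr0 -[X in _ --> _ + X](mul0r (dotp z z)).
  by apply: cvgD; [exact: cvg_cst|apply: cvgM => //; exact: cvg_cst].
have -> : dotp y z = 0.
  exact: dotp_enorm0 (esym y0).
have p1 : 0 < p - 1 by rewrite subr_gt0.
have h : (fun k => enorm (y + t k *: z) `^ (p - 1) * enorm z) @ \oo --> (0 : R).
  rewrite -[X in _ --> X](mul0r (enorm z)); apply: cvgM; last exact: cvg_cst.
  rewrite -[X in _ --> X](@powR0 _ (p - 1)) ?gt_eqF//; rewrite -y0 in ce.
  by apply: cvg_powR => // k; exact: enorm_ge0.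
rewrite mulr0; apply/cvgrPdist_le => e e0; have := h => /cvgrPdist_le /(_ e e0); apply: filterS => k.
by rewrite !sub0r !normrN => hk; apply: le_trans (flux_le _ _) (le_trans (ler_norm _) hk).
Qed.

End vectors.

(** Scalars are read as row vectors of length 1, so that the facts on the gradient term also yield
    those on the zero-order term. *)
Lemma enorm1 s : enorm (const_mx s : 'rV[R]_1) = `|s|.
Proof. by rewrite /enorm /dotp big_ord1 !mxE -expr2 sqrtr_sqr. Qed.

Lemma dotp1 s t : dotp (const_mx s : 'rV[R]_1) (const_mx t) = s * t.
Proof. by rewrite /dotp big_ord1 !mxE. Qed.

Lemma const_mxD1 s t c : const_mx s + c *: const_mx t = const_mx (s + c * t) :> 'rV[R]_1.
Proof. by apply/rowP => i; rewrite !mxE. Qed.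

Lemma abs_flux_self s : `|s| `^ (p - 2) * s * s = `|s| `^ p.
Proof. by have := flux_self (const_mx s : 'rV[R]_1); rewrite enorm1 dotp1 mulrA. Qed.

Lemma abs_flux_bound s t : `| `|s| `^ (p - 2) * s * t| <= `|s| `^ p + `|t| `^ p.
Proof. by have := flux_bound (const_mx s : 'rV[R]_1) (const_mx t); rewrite !enorm1 dotp1 mulrA. Qed.

Lemma abs_flux_cvg s t (c : nat -> R) : c @ \oo --> (0 : R) ->
  (fun k => `|s + c k * t| `^ (p - 2) * (s + c k * t) * t) @ \oo --> `|s| `^ (p - 2) * s * t.
Proof.
move=> /(@flux_cvg 1 (const_mx s) (const_mx t)); rewrite enorm1 dotp1 mulrA.
by under eq_fun do rewrite const_mxD1 enorm1 dotp1 mulrA.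
Qed.

Lemma abs_tangent s t : `|t| `^ p + p * (`|t| `^ (p - 2) * t * (s - t)) <= `|s| `^ p.
Proof.
have := @enorm_tangent R 1 p p_gt1 (const_mx s) (const_mx t).
have -> : const_mx s - const_mx t = const_mx (s - t) :> 'rV[R]_1.
  by apply/rowP => i; rewrite !mxE.
by rewrite !enorm1 dotp1 [_ `^ (p - 2) * (_ * _)]mulrA.
Qed.

End flux.

Lemma gap_nonpos (R : realFieldType) (p t1 t2 t3 c : R) : 0 < p -> t2 <= t1 -> t1 <= t3 ->
  (t1 + t2) / 2 - t3 = c / p -> c <= 0.
Proof.
move=> p0 H1 H2 H3; have : c / p <= 0 by rewrite -H3; lra.
by rewrite ler_pdivrMr// mul0r.
Qed.

Section critical_points.
Variables (R : realType) (n : nat) (p : R) (p_gt1 : 1 < p).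
Notation mu := (lebesgue_rV R n).
Hypothesis p_gtn : n%:R < p.
Variables (a h : 'rV[R]_n -> R) (a0 A : R) (g : R -> R) (lam : R).
Hypotheses (a_meas : measurable_fun [set: 'rV[R]_n] a) (a0_gt0 : 0 < a0).
Hypothesis a_bounds : forall x, a0 <= a x <= A.
Hypothesis h_itg : itg mu h.
Hypothesis h_ge0 : forall x, 0 <= h x.
Hypothesis g_cont : continuous g.
Hypothesis g_ge0 : forall t : R, 0 <= t -> 0 <= g t.
Hypothesis lam_gt0 : 0 < lam.
Local Notation X := (sobolev_space n p_gt1).
Local Notation N := (@sob_norm R n p p_gt1 a).
Local Notation load := (@load R n p p_gt1 h g lam).
Local Notation potential := (@potential R n p p_gt1 h g lam).
Implicit Types (u v w : X).

Let p_gt0 : 0 < p. Proof. exact: lt_trans p_gt1. Qed.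
Let a_ge0 x : 0 <= a x. Proof. by have /andP[q _] := a_bounds x; exact: le_trans (ltW a0_gt0) q. Qed.
Let NpE u : N u `^ p = dirichlet a u. Proof. exact: (sob_norm_powR a0_gt0 a_bounds). Qed.
Let density_itg u : itg mu (energy_density a u). Proof. exact: (itg_energy a_meas a0_gt0 a_bounds). Qed.
Let load_lin u : linear_functional (load u).
Proof. exact: (load_linear p_gtn lam a_meas a0_gt0 a_bounds h_itg h_ge0 g_cont). Qed.

Definition flux u v x : R := enorm (gr u x) `^ (p - 2) * dotp (gr u x) (gr v x)
  + a x * `|fn u x| `^ (p - 2) * fn u x * fn v x.

Lemma flux_meas u v : measurable_fun [set: 'rV[R]_n] (flux u v).
Proof.
have mu_ : measurable_fun [set: 'rV[R]_n] (fn u) by have [] := fn_Lp u.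
have mv_ : measurable_fun [set: 'rV[R]_n] (fn v) by have [] := fn_Lp v.
have mgu i : measurable_fun [set: 'rV[R]_n] (fun x => gr u x ord0 i) by have [] := gr_Lp u i.
have mgv i : measurable_fun [set: 'rV[R]_n] (fun x => gr v x ord0 i) by have [] := gr_Lp v i.
apply: measurable_funD.
  apply: measurable_funM; last exact: measurable_dotp.
  by apply: measurable_powR_comp; exact: measurable_enorm.
apply: measurable_funM => //; apply: measurable_funM => //; apply: measurable_funM => //.
exact: measurable_norm_powR.
Qed.

Lemma flux_density u v x : `|flux u v x| <= energy_density a u x + energy_density a v x.
Proof.
apply: le_trans (ler_normD _ _) _; rewrite /energy_density addrACA; apply: lerD.
  exact: flux_bound.
rewrite -!mulrA normrM (ger0_norm (a_ge0 x)) -mulrDr; apply: ler_wpM2l => //.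
by rewrite mulrA; exact: abs_flux_bound.
Qed.

Lemma flux_itg u v : itg mu (flux u v).
Proof.
apply: (itg_le (flux_meas u v) (itgD (density_itg u) (density_itg v))) => x.
exact: flux_density.
Qed.

Lemma flux_selfE u x : flux u u x = energy_density a u x.
Proof. by rewrite /flux (flux_self p_gt1) /energy_density -!mulrA [`|_| `^ _ * _]mulrA abs_flux_self. Qed.

Lemma flux_opp u v x : flux u (- v) x = - flux u v x.
Proof. by rewrite /flux fnN grN -(scaleN1r (gr v x)) dotpZr; ring. Qed.

Lemma density_tangent u w x :
  energy_density a w x + p * flux w (u - w) x <= energy_density a u x.
Proof.
rewrite /flux /energy_density grB fnB.
have h1 := enorm_tangent p_gt1 (gr u x) (gr w x).
have h2 := ler_wpM2l (a_ge0 x) (abs_tangent p_gt1 (fn u x) (fn w x)).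
apply: le_trans (lerD h1 h2); rewrite le_eqVlt; apply/orP; left; apply/eqP; ring.
Qed.

(** The domination comes from convexity: $u+tv$ lies between $u$ and $u+v$ for $0\le t\le 1$, so its
    energy density is at most the sum of theirs. *)
Lemma flux_limit u v : (fun k => \int[mu]_x flux (u + harmonic k *: v) v x) @ \oo --> \int[mu]_x flux u v x.
Proof.
have [|||||_ H _] := @dct _ _ _ mu (fun k => flux (u + harmonic k *: v) v) (flux u v)
  (fun x => (energy_density a u x + energy_density a (u + v) x) + energy_density a v x).
- by move=> k; exact: flux_meas.
- exact: flux_meas.
- apply: aeW => x.
  have -> : (fun k => flux (u + harmonic k *: v) v x) = (fun k =>
      enorm (gr u x + (harmonic k : R) *: gr v x) `^ (p - 2) * dotp (gr u x + (harmonic k : R) *: gr v x) (gr v x) +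
      a x * (`|fn u x + harmonic k * fn v x| `^ (p - 2) * (fn u x + harmonic k * fn v x) * fn v x)).
    by apply/funext => k; rewrite /flux grD grZ fnD fnZ !mulrA.
  have -> : flux u v x = enorm (gr u x) `^ (p - 2) * dotp (gr u x) (gr v x) +
      a x * (`|fn u x| `^ (p - 2) * fn u x * fn v x) by rewrite /flux !mulrA.
  have H1 := @flux_cvg R p p_gt1 n (gr u x) (gr v x) _ (@cvg_harmonic R).
  have H2 := @abs_flux_cvg R p p_gt1 (fn u x) (fn v x) _ (@cvg_harmonic R).
  exact: (cvgD H1 (cvgM (cvg_cst _) H2)).
- by apply: itgD; [apply: itgD|]; exact: density_itg.
- apply: aeW => x k; apply: le_trans (flux_density _ _ _) _; rewrite lerD2r.
  have k0 : 0 <= harmonic k :> R by rewrite /harmonic/= invr_ge0.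
  have k1 : harmonic k <= 1 :> R by rewrite /harmonic/= invf_le1// ler1n.
  have -> : u + harmonic k *: v = (1 - harmonic k) *: u + harmonic k *: (u + v).
    by rewrite scalerBl scale1r scalerDr addrA subrK.
  apply: le_trans (energy_density_convex a0_gt0 a_bounds u (u + v) x k0 k1) _.
  apply: lerD; rewrite ler_piMl ?(energy_density_ge0 a0_gt0 a_bounds)//.
  by rewrite gerBl.
by [].
Qed.

Lemma tiltedE u w : tilted N p (load u) w = dirichlet a w / p - load u w.
Proof. by rewrite /tilted NpE. Qed.

(** Minimality bounds $t\,L_u(v)$ by the increase of the energy term from $u$ to $w=u+tv$. The
    tangent taken at $w$, not at $u$, bounds this increase from above by a flux at $w$, and then $t$
    tends to 0. *)
Lemma critical_flux_ge u v : is_critical a h g lam u -> load u v <= \int[mu]_x flux u v x.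
Proof.
move=> uc; have H0 : (fun _ : nat => load u v) @ \oo --> load u v by exact: cvg_cst.
have H1 := @flux_limit u v; apply: (ler_cvg_to H0 H1); apply: nearW => k.
have k0 : 0 < harmonic k :> R by rewrite /harmonic/= invr_gt0.
have := uc (u + harmonic k *: v); rewrite !tiltedE (lfD (load_lin u)) (lfZ (load_lin u)).
set w := u + harmonic k *: v.
have D : dirichlet a w - dirichlet a u <= p * harmonic k * \int[mu]_x flux w v x.
  rewrite /dirichlet -(IntB (density_itg w) (density_itg u)) -(IntZ (p * harmonic k) (flux_itg w v)).
  apply: Int_le => [||x]; [exact: (itgB (density_itg w) (density_itg u))|exact: (itgZ _ (flux_itg w v))|].
  have := density_tangent u w x.
  have -> : flux w (u - w) x = - (harmonic k * flux w v x).
    rewrite /flux grB fnB /w grD fnD grZ fnZ.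
    have -> : gr u x - (gr u x + (harmonic k : R) *: gr v x) = - (harmonic k : R) *: gr v x.
      by rewrite opprD addrA subrr sub0r scaleNr.
    rewrite dotpZr.
    have -> : fn u x - (fn u x + harmonic k * fn v x) = - (harmonic k * fn v x) by ring.
    ring.
  by rewrite mulrN mulrA; move: (energy_density a w x) (energy_density a u x) => *; lra.
move: D; move: (dirichlet a w) (dirichlet a u) (load u u) (load u v) (\int[mu]_x flux w v x) (harmonic k : R) k0.
move=> dw du luu luv I t t0 D H.
have : t * luv <= (dw - du) / p by rewrite mulrBl; lra.
rewrite ler_pdivlMr// => H2; have : p * t * luv <= p * t * I by apply: le_trans D; lra.
by rewrite ler_pM2l// mulr_gt0.
Qed.

Lemma critical_flux u v : is_critical a h g lam u -> \int[mu]_x flux u v x = load u v.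
Proof.
move=> uc; apply/eqP; rewrite eq_le (critical_flux_ge v uc) andbT.
have := critical_flux_ge (- v) uc; rewrite (lfN (load_lin u)).
have -> : \int[mu]_x flux u (- v) x = \int[mu]_x (-1 * flux u v x).
  by apply: eq_Rintegral => x _; rewrite flux_opp mulN1r.
by rewrite (IntZ _ (flux_itg u v)) mulN1r lerN2.
Qed.

Lemma critical_dirichlet u : is_critical a h g lam u -> dirichlet a u = load u u.
Proof.
move=> uc; rewrite -(critical_flux u uc); apply: eq_Rintegral => x _.
by rewrite flux_selfE.
Qed.

Lemma load_ae u w : {ae mu, forall x, fn u x = fn w x} -> load u u = load w w.
Proof.
move=> uw; congr (_ * _); apply: Int_ae.
- exact: itgM (load_itg p_gtn a_meas a0_gt0 a_bounds h_itg h_ge0 g_cont u u).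
- exact: itgM (load_itg p_gtn a_meas a0_gt0 a_bounds h_itg h_ge0 g_cont w w).
- by apply: filterS uw => x ->.
Qed.

(** At a critical point the Dirichlet integral equals [load u u], which sees the function only up to
    null sets. So different energies give different solutions, whatever gradients represent them. *)
Lemma critical_energy_ae u w :
  continuous (G_pos g) -> is_critical a h g lam u -> is_critical a h g lam w ->
  {ae mu, forall x, fn u x = fn w x} -> total_energy a h g lam u = total_energy a h g lam w.
Proof.
move=> Gc uc wc uw.
have E v : is_critical a h g lam v -> total_energy a h g lam v = load v v / p - potential v.
  by move=> vc; rewrite /total_energy (NpE v) (critical_dirichlet vc).
have mG v : measurable_fun [set: 'rV[R]_n] (fun x => h x * G_pos g (fn v x)).
  apply: measurable_funM; first exact: itgM h_itg.
  apply: (measurableT_comp _ (fn_Lp v).1).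
  exact: continuous_measurable_fun.
have P : potential u = potential w.
  have I : \int[mu]_x (h x * G_pos g (fn u x)) = \int[mu]_x (h x * G_pos g (fn w x)).
    by apply: (Int_ae (mG u) (mG w)); apply: filterS uw => x ->.
  exact: (congr1 (fun t : R => lam * t) I).
by rewrite (E u uc) (E w wc) (load_ae uw) P.
Qed.

(** Passing to the positive part [w] does not raise the Dirichlet integral and, as [g_pos] is
    nonnegative, does not lower the load. So [w] minimizes the same tilted functional; uniform
    convexity makes the distance of [u] and [w] zero, and the sup bound turns this into equality
    almost everywhere. *)
Lemma critical_nonneg u : is_critical a h g lam u -> {ae mu, forall x, 0 <= fn u x}.
Proof.
move=> uc.
have [w [fnw grw]] : exists w, (forall x, fn w x = Num.max (fn u x) 0) /\
    (forall x, gr w x = \1_(pos_set (fn u)) x *: gr u x).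
  by exists (mk_sobolev p_gt1 (sobolev_pos p_gt1 (sobolevP u))).
have Dw : dirichlet a w <= dirichlet a u.
  apply: Int_le => [||x]; [exact: density_itg|exact: density_itg|].
  rewrite /energy_density; apply: lerD.
    apply: powR_le_mono => //; first exact: enorm_ge0.
    rewrite grw enormZ ler_piMl ?enorm_ge0// indicE.
    by case: (_ \in _); rewrite ?normr1 ?normr0.
  apply: ler_wpM2l => //; apply: powR_le_mono => //; rewrite fnw.
  by have [_|_] := leP (fn u x) 0; rewrite ?normr0.
have Lw : load u u <= load u w.
  apply: ler_wpM2l; first exact: ltW.
  apply: Int_le => [||x].
  - exact: (load_itg p_gtn a_meas a0_gt0 a_bounds h_itg h_ge0 g_cont).
  - exact: (load_itg p_gtn a_meas a0_gt0 a_bounds h_itg h_ge0 g_cont).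
  - apply: ler_wpM2l => //; apply: ler_wpM2l; first exact: g_pos_ge0.
    by rewrite fnw le_max lexx.
have Tw : tilted N p (load u) w <= tilted N p (load u) u.
  have pV : 0 <= p^-1 by rewrite invr_ge0 ltW.
  by rewrite (tiltedE u w) (tiltedE u u); exact: (lerB (ler_wpM2r pV Dw) Lw).
have G0 : convexity_gap N p u w <= 0.
  exact: (gap_nonpos p_gt0 Tw (uc (2^-1 *: (u + w))) (tilted_gap N p_gt1 u w (load_lin u))).
have N0 e : 0 < e -> N (u - w) <= e.
  move=> e0; have UC := sob_uniformly_convex p_gt1 a_meas a0_gt0 a_bounds.
  have [d d0 Hd] := small_gap p_gt1 (fun v => sob_norm_ge0 a v) UC (N u + N w) e0.
  have Bu : N u <= N u + N w by rewrite lerDl sob_norm_ge0.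
  have Bw : N w <= N u + N w by rewrite lerDr sob_norm_ge0.
  exact: (Hd u w Bu Bw (le_trans G0 (ltW d0))).
have Nuw : N (u - w) = 0.
  apply/eqP; rewrite eq_le sob_norm_ge0 andbT; apply/ler_addgt0Pr => e e0; rewrite add0r.
  exact: N0.
have := sob_sup a_meas a0_gt0 a_bounds (u - w) p_gtn; apply: filterS => x.
rewrite Nuw mulr0 fnB => h0; have : fn u x - fn w x = 0.
  by apply/eqP; rewrite -normr_eq0 eq_le h0 normr_ge0.
by move=> /subr0_eq ->; rewrite fnw le_max lexx orbT.
Qed.

End critical_points.

(** * The threshold *)

Section tent_energy.
Variables (R : realType) (n : nat) (p : R) (p_gt1 : 1 < p).
Notation mu := (lebesgue_rV R n).
Variables (a h : 'rV[R]_n -> R) (a0 A : R) (g : R -> R) (lam : R).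
Hypotheses (a_meas : measurable_fun [set: 'rV[R]_n] a) (a0_gt0 : 0 < a0).
Hypothesis a_bounds : forall x, a0 <= a x <= A.
Variables (x0 : 'rV[R]_n) (r d : R).
Hypotheses (r_gt0 : 0 < r) (d_gt0 : 0 < d).
Variable e : sobolev_space n p_gt1.
Hypotheses (fn_e : fn e = tent x0 r d) (gr_e : gr e = tent_gradient x0 r d).

Let p_gt0 : 0 < p. Proof. exact: lt_trans p_gt1. Qed.

Lemma itg_eball (s : R) : 0 < s -> itg mu \1_(eball x0 s).
Proof.
move=> s0; have mB : measurable (eball x0 s) by exact: measurable_eball.
apply/integrableP; split; first by apply/measurable_EFinP; exact: measurable_indic.
under eq_integral => x _ do rewrite /= ger0_norm//.
rewrite integral_indic// setIT.
exact: (eq_ind_r (fun t => t < +oo)%E (ltry _) (measure_eballE x0 s0)).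
Qed.

Lemma Int_eball (s : R) : 0 < s -> \int[mu]_x \1_(eball x0 s) x = s ^+ n / @gamma_pi R n.
Proof.
move=> s0; have mB : measurable (eball x0 s) by exact: measurable_eball.
rewrite /Rintegral integral_indic// setIT.
exact: (congr1 fine (measure_eballE x0 s0)).
Qed.

Lemma indic_eball (s : R) (x : 'rV[R]_n) : \1_(eball x0 s) x = (enorm (x - x0) < s)%R%:R :> R.
Proof.
rewrite indicE; congr (_%:R); congr nat_of_bool; apply/idP/idP; first by rewrite inE.
by move=> xs; rewrite inE.
Qed.

Lemma tent_density_le x : energy_density a e x <=
  (2 * d / r) `^ p * (\1_(eball x0 r) x - \1_(eball x0 (r / 2)) x)
  + A * d `^ p * \1_(eball x0 r) x.
Proof.
have /andP[h1 axA] := a_bounds x.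
have ax0 : 0 <= a x by exact: le_trans (ltW a0_gt0) h1.
have A0 : 0 <= A by exact: le_trans axA.
have rr : r / 2 < r by have := r_gt0; lra.
have H1 : enorm (gr e x) `^ p <= (2 * d / r) `^ p * (\1_(eball x0 r) x - \1_(eball x0 (r / 2)) x).
  rewrite gr_e (enorm_tent_gradient x0 r_gt0 d_gt0) !indic_eball indicE.
  have -> : (x \in [set y | (r / 2 < enorm (y - x0)) && (enorm (y - x0) < r)]) =
      (r / 2 < enorm (x - x0)) && (enorm (x - x0) < r) by apply/idP/idP; rewrite inE.
  move: (enorm (x - x0)) => q.
  have [qr|qr] := ltP (r / 2) q.
    rewrite (ltNge q (r / 2)) (ltW qr)/= subr0.
    by case: (_ < _) => /=; rewrite ?mulr1// !mulr0 powR0// gt_eqF.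
  rewrite (le_lt_trans qr rr)/= mulr0 powR0 ?gt_eqF//.
  apply: mulr_ge0; first exact: powR_ge0.
  by case: (q < r / 2)%R; rewrite /= ?subrr ?subr0 ?ler01.
have H2 : a x * `|fn e x| `^ p <= A * d `^ p * \1_(eball x0 r) x.
  rewrite -mulrA; apply: (ler_pM ax0 (powR_ge0 _ _) axA).
  rewrite fn_e indic_eball; have [qr|qr] := ltP (enorm (x - x0)) r; last first.
    by rewrite tent_outer// normr0 powR0 ?gt_eqF// mulr0.
  have /andP[t0 td] := tent_bounds x0 r d_gt0 x.
  by rewrite mulr1; apply: powR_le_mono => //; rewrite ger0_norm.
exact: (lerD H1 H2).
Qed.

(** The gradient has length $2d/r$ on an annulus whose volume is $1-2^{-n}$ times that of the ball
    of radius $r$; this is the origin of $2^p-2^{p-n}$. The zero-order term contributes $A\,d^p$ on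
    the whole ball. *)
Lemma tent_dirichlet_le : dirichlet a e <=
  d `^ p * ((2 `^ p - 2 `^ (p - n%:R) + r `^ p * A) / (@gamma_pi R n * r `^ (p - n%:R))).
Proof.
have r2 : 0 < r / 2 by rewrite divr_gt0.
have I1 := itg_eball r_gt0; have I2 := itg_eball r2.
have I3 := itgZ ((2 * d / r) `^ p) (itgB I1 I2); have I4 := itgZ (A * d `^ p) I1.
apply: le_trans (Int_le (itg_energy a_meas a0_gt0 a_bounds e) (itgD I3 I4) tent_density_le) _.
rewrite (IntD I3 I4) (IntZ _ (itgB I1 I2)) (IntZ _ I1) (IntB I1 I2) (Int_eball r_gt0) (Int_eball r2).
have g0 := @gamma_pi_gt0 R n.
have q0 : 0 <= r^-1 by rewrite invr_ge0 ltW.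
have E1 : (2 * d / r) `^ p = 2 `^ p * d `^ p / r `^ p.
  by rewrite !powRM ?mulr_ge0 ?(ltW d_gt0)// -powR_inv1 ?(ltW r_gt0)// -powRrM mulN1r powRN.
have E2 : r `^ (p - n%:R) = r `^ p / r ^+ n.
  by rewrite powRD ?(gt_eqF r_gt0) ?implybT// powRN powR_mulrn// ltW.
have E3 : (2 : R) `^ (p - n%:R) = 2 `^ p / 2 ^+ n.
  by rewrite powRD ?pnatr_eq0 ?implybT// powRN powR_mulrn.
rewrite E1 E2 E3 expr_div_n.
have rp0 := powR_gt0 p r_gt0; have rn0 := exprn_gt0 n r_gt0.
have tn0 : 0 < (2 : R) ^+ n by rewrite exprn_gt0.
move: (2 `^ p) (d `^ p) (r `^ p) (r ^+ n) (2 ^+ n) (gamma_pi) rp0 rn0 tn0 g0 => x1 x2 x3 x4 x5 x6 h3 h4 h5 h6.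
rewrite le_eqVlt; apply/orP; left; apply/eqP; field.
by rewrite !gt_eqF.
Qed.

Hypothesis p_gtn : n%:R < p.
Hypothesis h_itg : itg mu h.
Hypothesis h_ge0 : forall x, 0 <= h x.
Hypothesis g_cont : continuous g.
Hypothesis g_ge0 : forall t : R, 0 <= t -> 0 <= g t.
Hypothesis G_at0 : primitive g t / t `^ p @[t --> 0^'+] --> (0 : R).
Hypothesis lam_gt0 : 0 < lam.

(** Only the inner ball, where the tent equals [d], is counted; elsewhere the integrand is
    nonnegative. *)
Lemma tent_potential_ge :
  lam * (primitive g d * \int[mu]_(x in eball x0 (r / 2)) h x) <= potential h g lam e.
Proof.
have mB : measurable (eball x0 (r / 2)) by apply: measurable_eball.
rewrite /potential; apply: ler_wpM2l; first exact: ltW.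
rewrite Rintegral_mkcond.
have hI : itg mu (h \_ (eball x0 (r / 2))).
  apply: (@itg_le _ _ _ _ _ h) => [||x].
  - by apply/(measurable_restrictT _ mB); apply: measurable_funS (itgM h_itg).
  - exact: h_itg.
  - by rewrite patchE; case: ifPn => _; rewrite ?normr0 ?ger0_norm.
rewrite -(IntZ _ hI); apply: Int_le => [||x].
- exact: itgZ.
- exact: (potential_itg p_gtn a_meas a0_gt0 a_bounds h_itg h_ge0 g_cont G_at0).
rewrite patchE; case: ifPn => [|_]; last first.
  by rewrite mulr0; apply: mulr_ge0 => //; exact: G_pos_ge0.
rewrite inE => xB; rewrite fn_e tent_inner//; last exact: ltW.
by rewrite /G_pos max_l ?(ltW d_gt0)// mulrC.
Qed.

End tent_energy.

(** * Weak solutions for the original coefficients *)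

Section solutions.
Variables (R : realType) (n : nat) (p : R) (p_gt1 : 1 < p).
Notation mu := (lebesgue_rV R n).
Hypothesis p_gtn : n%:R < p.
(** [b] and [k] are versions of [a] and [h] that satisfy everywhere the bounds that the originals
    satisfy almost everywhere; the variational theory is applied to them. *)
Variables (a b h k : 'rV[R]_n -> R) (a0 A : R) (g : R -> R) (lam : R).
Hypotheses (a_meas : measurable_fun [set: 'rV[R]_n] a) (h_meas : measurable_fun [set: 'rV[R]_n] h).
Hypotheses (b_meas : measurable_fun [set: 'rV[R]_n] b) (a0_gt0 : 0 < a0).
Hypothesis b_bounds : forall x, a0 <= b x <= A.
Hypothesis k_itg : itg mu k.
Hypothesis k_ge0 : forall x, 0 <= k x.
Hypothesis g_cont : continuous g.
Hypothesis g_ge0 : forall t : R, 0 <= t -> 0 <= g t.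
Hypothesis lam_gt0 : 0 < lam.
Hypotheses (ab : {ae mu, forall x, a x = b x}) (hk : {ae mu, forall x, h x = k x}).
Local Notation X := (sobolev_space n p_gt1).

Lemma sobolev_gradP (u : 'rV[R]_n -> R) (Du : 'rV[R]_n -> 'rV[R]_n) : sobolev_grad p u Du <-> sobolev p u Du.
Proof.
have p1 := ltW p_gt1.
split=> -[h1 h2 h3]; split => //.
- exact/(Lfun_LpP _ _ p1).
- by move=> i; apply/(Lfun_LpP _ _ p1); exact: h2.
- exact/(Lfun_LpP _ _ p1).
- by move=> i; apply/(Lfun_LpP _ _ p1); exact: h2.
Qed.

(** Nonnegativity is established before the equation, since it turns [g_pos] back into [g]; the
    return to [a] and [h] changes the integrands on null sets only. *)
Lemma critical_weak_solution (u : X) : is_critical b k g lam u -> weak_solution p a h g lam (fn u).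
Proof.
move=> uc.
have u0 := critical_nonneg p_gtn b_meas a0_gt0 b_bounds k_itg k_ge0 g_cont g_ge0 lam_gt0 uc.
split; first exact: u0.
exists (gr u); first by apply/sobolev_gradP; exact: sobolevP.
move=> v0 Dv0 /sobolev_gradP sv.
have [v [<- <-]] : exists v : X, fn v = v0 /\ gr v = Dv0 by exists (mk_sobolev p_gt1 sv).
have E := critical_flux p_gtn b_meas a0_gt0 b_bounds k_itg k_ge0 g_cont v uc.
have L : \int[mu]_x (enorm (gr u x) `^ (p - 2) * dotp (gr u x) (gr v x)
    + a x * `|fn u x| `^ (p - 2) * fn u x * fn v x) = \int[mu]_x flux b u v x.
  apply: (Int_ae (flux_meas a_meas u v) (flux_meas b_meas u v)).
  by apply: filterS ab => x; rewrite /flux => ->.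
have M1 : measurable_fun [set: 'rV[R]_n] (fun x => h x * g (fn u x) * fn v x).
  apply: measurable_funM; last by have [] := fn_Lp v.
  apply: measurable_funM => //; apply: measurableT_comp; last by have [] := fn_Lp u.
  exact: continuous_measurable_fun.
have M2 : measurable_fun [set: 'rV[R]_n] (fun x => k x * (g_pos g (fn u x) * fn v x)).
  exact: itgM (load_itg p_gtn b_meas a0_gt0 b_bounds k_itg k_ge0 g_cont u v).
have Rr : \int[mu]_x (h x * g (fn u x) * fn v x) = \int[mu]_x (k x * (g_pos g (fn u x) * fn v x)).
  apply: (Int_ae M1 M2); apply: filterS2 hk u0 => x -> ux.
  by rewrite /g_pos max_l// mulrA.
by rewrite L Rr E.
Qed.

Hypothesis G_at0 : primitive g t / t `^ p @[t --> 0^'+] --> (0 : R).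
Hypothesis G_atoo : primitive g t / t `^ p @[t --> +oo] --> (0 : R).

Lemma critical_0 : is_critical b k g lam (0 : X) /\ total_energy b k g lam (0 : X) = 0.
Proof.
have N0 : sob_norm b (0 : X) = 0.
  by have := sob_normZ b_meas a0_gt0 b_bounds 0 (0 : X); rewrite scale0r normr0 mul0r.
have p0 : p != 0 by rewrite gt_eqF// (lt_trans _ p_gt1).
split.
  move=> v; have L w := load0 k lam g_cont G_at0 (w : X).
  rewrite /tilted (L v) (L 0) N0 (powR0 p0) mul0r !subr0.
  by apply: divr_ge0; [exact: powR_ge0|exact: (le_trans ler01 (ltW p_gt1))].
rewrite /total_energy N0 powR0// mul0r sub0r /potential.
have -> : \int[mu]_x (k x * G_pos g (fn (0 : X) x)) = 0.
  transitivity (\int[mu]_x (cst 0 x : R)); last by rewrite /Rintegral integral0.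
  by apply: eq_Rintegral => x _; rewrite fn0 /G_pos maxxx /primitive set_itv1 Rintegral_set1 mulr0.
by rewrite mulr0 oppr0.
Qed.

Lemma three_weak_solutions (e : X) : total_energy b k g lam e < 0 ->
  exists u1 u2 u3 : 'rV[R]_n -> R,
    [/\ weak_solution p a h g lam u1, weak_solution p a h g lam u2 & weak_solution p a h g lam u3] /\
    [/\ ~ {ae mu, forall x, u1 x = u2 x}, ~ {ae mu, forall x, u1 x = u3 x} &
        ~ {ae mu, forall x, u2 x = u3 x}].
Proof.
move=> e0.
have [u [v [uc uE vc vE]]] := two_critical_points p_gtn b_meas a0_gt0 b_bounds k_itg k_ge0
  g_cont g_ge0 G_at0 G_atoo lam_gt0 e0.
have [zc zE] := critical_0.
have Gc := G_pos_cont p_gt1 g_cont G_at0.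
have same (w1 w2 : X) : is_critical b k g lam w1 -> is_critical b k g lam w2 ->
    total_energy b k g lam w1 != total_energy b k g lam w2 -> ~ {ae mu, forall x, fn w1 x = fn w2 x}.
  move=> c1 c2 + w12.
  rewrite (critical_energy_ae p_gtn b_meas a0_gt0 b_bounds k_itg k_ge0 g_cont Gc c1 c2 w12).
  by rewrite eqxx.
exists (fn (0 : X)), (fn u), (fn v); split.
  by split; exact: critical_weak_solution.
split; [apply: same zc uc _|apply: same zc vc _|apply: same uc vc _].
- by rewrite zE gt_eqF.
- by rewrite zE lt_eqF.
- by rewrite lt_eqF// (lt_trans uE).
Qed.

End solutions.

(* The left factor of the hypothesis is the constant of [lambda_star], in which
   [k_a ^ p] and the norm of [h] cancel; the conclusion says that the energy of
   the tent of height [d] is negative, and the factor 3/2 only leaves room. *)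
Lemma threshold_level (R : realFieldType) (p kp m1 gam s D H G dp lam : R) :
  0 < p -> 0 < kp -> 0 < m1 -> 0 < gam -> 0 < s -> 0 < D -> 0 < H -> 0 < G -> 0 < dp ->
  3 / 2 * (1 / (p * kp * m1 * (1 / kp * gam * (s / D) * (H / m1)))) * (dp / G) < lam ->
  dp * (D / (gam * s)) / p < lam * (G * H).
Proof.
move=> p0 kp0 m0 ga0 s0 D0 H0 G0 d0.
have -> : 3 / 2 * (1 / (p * kp * m1 * (1 / kp * gam * (s / D) * (H / m1)))) * (dp / G) =
    3 / 2 * (dp * (D / (gam * s)) / p / (G * H)) by field; rewrite !gt_eqF.
have GH0 : 0 < G * H by exact: mulr_gt0.
have V0 : 0 < dp * (D / (gam * s)) / p / (G * H)
  by apply: (divr_gt0 _ GH0); apply: (divr_gt0 _ p0); apply: (mulr_gt0 d0); rewrite divr_gt0// mulr_gt0.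
move=> h; rewrite -ltr_pdivrMr//; move: (_ / (G * H)) V0 h => t; lra.
Qed.

(** * Positivity of the constants and the height of the tent *)

Section constants.
Variables (R : realType) (n : nat) (p : R).
Notation mu := (lebesgue_rV R n).
Hypotheses (n_ge1 : (1 <= n)%N) (p_gtn : n%:R < p).
Variables (a h : 'rV[R]_n -> R) (g : R -> R) (x0 : 'rV[R]_n) (r lam : R).
Hypothesis a_Linfty : a \in Lfun mu +oo%E.
Hypothesis a_minus_gt0 : (0 < ess_inf mu (EFin \o a))%E.
Hypothesis h_L1 : h \in Lfun mu 1%E.
Hypothesis h_neq0 : ~ {ae mu, forall x, h x = 0}.
Hypothesis r_gt0 : 0 < r.
Hypothesis h_ball : 0 < \int[mu]_(x in eball x0 (r / 2)) h x.

Let p_gt0 : 0 < p. Proof. by apply: le_lt_trans p_gtn; exact: ler0n. Qed.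

Lemma p_gt1_of_dim : 1 < p.
Proof. by apply: le_lt_trans p_gtn; rewrite ler1n. Qed.

(** Guards against degenerate values of essential bounds: a statement that fails at every point
    cannot hold almost everywhere. *)
Lemma nonnull : ~ {ae mu, forall x, False}.
Proof. by move=> F; apply: h_neq0; apply: filterS F. Qed.

Lemma lebesgue_rV_gt0 : (0 < mu [set: 'rV[R]_n])%E.
Proof.
rewrite lt0e measure_ge0 andbT; apply/eqP => m0; apply: nonnull.
by exists setT; split => //= x _.
Qed.

Lemma Linfty_meas : measurable_fun [set: 'rV[R]_n] a.
Proof. by move: a_Linfty; rewrite inE => /andP[/[!inE]]. Qed.

Lemma norm_infty_bound : {ae mu, forall x, `|a x| <= norm_infty a}.
Proof.
move: a_Linfty; rewrite inE => /andP[_ /[!inE]/=].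
rewrite /finite_norm /norm_infty => L.
have L0 := Lnorm_ge0 mu +oo%E (EFin \o a).
have LE : Lnorm mu +oo%E (EFin \o a) = ess_sup mu (abse \o (EFin \o a)).
  by rewrite unlock /Lnorm lebesgue_rV_gt0.
have := ess_sup_ge mu (abse \o (EFin \o a)); rewrite -LE.
apply: filterS => x /=.
move: L L0; case: (Lnorm _ _ _) => [t| |]//= _ _.
Qed.

Lemma a_minus_bound : {ae mu, forall x, a_minus a <= a x} /\ 0 < a_minus a.
Proof.
have := ess_inf_le mu (EFin \o a); rewrite /a_minus.
move: a_minus_gt0; case: (ess_inf _ _) => [t| |]//=.
(* The remaining case is an infinite essential infimum, impossible for a real-valued function;
   without it [fine] returns the true value. *)
by move=> _ F; exfalso; apply: nonnull; apply: filterS F => x.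
Qed.

Lemma a_minus_le_norm : a_minus a <= norm_infty a.
Proof.
rewrite leNgt; apply/negP => lt; apply: nonnull.
have [h1 _] := a_minus_bound; apply: filterS2 h1 norm_infty_bound => x h1 h2.
have := lt_le_trans lt (le_trans h1 (ler_norm _)); rewrite ltNge => /negP; exact.
Qed.

Lemma k_a_gt0 : 0 < k_a p a.
Proof.
have [_ a0] := a_minus_bound; have p1 := p_gt1_of_dim.
have n0 : 0 < n%:R :> R by rewrite ltr0n.
rewrite /k_a; apply: mulr_gt0; last by apply: powR_gt0; rewrite divr_gt0 ?subr_gt0.
apply: mulr_gt0; last by rewrite divr_gt0// powR_gt0.
apply: mulr_gt0; last by rewrite powR_gt0// gamma_pi_gt0.
by apply: mulr_gt0; rewrite powR_gt0// divr_gt0.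
Qed.

Lemma norm1_gt0 : 0 < norm1 h.
Proof.
have hI : itg mu h by apply/Lfun1_integrable.
have mhE : measurable_fun [set: 'rV[R]_n] (EFin \o h) by apply/measurable_EFinP; exact: itgM hI.
have NE : Lnorm mu 1%E (EFin \o h) <> 0%E.
  by move=> E; apply: h_neq0; have := Lnorm_eq0_eq0 mhE lte01 E; apply: filterS => x /(_ I) [].
rewrite /norm1 fine_gt0// lt0e Lnorm_ge0 andbT; apply/andP; split; first exact/eqP.
by rewrite Lnorm1; have /integrableP[] := hI.
Qed.

(** Since [lam / c] exceeds the infimum, some height [d] has its ratio below [lam / c]; this [d] is
    the height of the tent. *)
Lemma threshold_test_height : (forall t, 0 <= t -> 0 <= primitive g t) ->
  (lambda_star p a h g x0 r < lam%:E)%E -> exists d : R, [/\ 0 < d, 0 < lam &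
   d `^ p * ((2 `^ p - 2 `^ (p - n%:R) + r `^ p * norm_infty a) /
     (@gamma_pi R n * r `^ (p - n%:R))) / p <
   lam * (primitive g d * \int[mu]_(x in eball x0 (r / 2)) h x)].
Proof.
move=> G0; rewrite /lambda_star; set c := 3 / 2 * _; set m := ereal_inf _ => L.
have k0 : 0 < k_a p a `^ p by rewrite powR_gt0// k_a_gt0.
have n0 := norm1_gt0; have g0 := @gamma_pi_gt0 R n.
have s0 : 0 < r `^ (p - n%:R) by rewrite powR_gt0.
have [_ am0] := a_minus_bound; have A0 := lt_le_trans am0 a_minus_le_norm.
have D0 : 0 < 2 `^ p - 2 `^ (p - n%:R) + r `^ p * norm_infty a.
  apply: ltr_wpDl; last by rewrite mulr_gt0// powR_gt0.
  by rewrite subr_ge0 ler_powR ?ler1n// gerBl.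
have c0 : 0 < c.
  apply: mulr_gt0; first by rewrite divr_gt0.
  apply: divr_gt0 => //; apply: mulr_gt0; first by rewrite !mulr_gt0.
  apply: mulr_gt0; last exact: divr_gt0.
  by apply: mulr_gt0; [apply: mulr_gt0 => //; exact: divr_gt0|exact: divr_gt0].
have [y [d d0 <-] dl] : exists2 y, [set pow_ratio p g d | d in [set d : R | 0 < d]] y &
    (y < (lam / c)%:E)%E.
  by apply: ereal_inf_lt; rewrite EFinM muleC lte_pdivlMl.
(* A vanishing primitive would give the ratio [+oo], which is not below a real number; so [G(d)] is
   positive. *)
exists d; move: dl; rewrite /pow_ratio; have [|Gn] := eqVneq (primitive g d) 0; first by [].
rewrite lte_fin ltr_pdivlMr// mulrC => dl.
have Gd : 0 < primitive g d by rewrite lt_neqAle eq_sym Gn G0// ltW.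
have dp0 : 0 < d `^ p by rewrite powR_gt0.
split => //; first by apply: lt_trans dl; rewrite mulr_gt0// divr_gt0.
exact: (threshold_level p_gt0 k0 n0 g0 s0 D0 h_ball Gd dp0 dl).
Qed.

End constants.

Theorem theorem3p3 (R : realType) (N : nat) (p : R)
    (a h : 'rV[R]_N -> R) (g : R -> R) (x0 : 'rV[R]_N) (r lambda : R)
    (N_ge1 : (1 <= N)%N) (ltNp : N%:R < p)
    (a_Linfty : a \in Lfun (lebesgue_rV R N) +oo%E)
    (a_minus_gt0 : (0 < ess_inf (lebesgue_rV R N) (EFin \o a))%E)
    (h_L1 : h \in Lfun (lebesgue_rV R N) 1%E)
    (h_ge0 : {ae lebesgue_rV R N, forall x, 0 <= h x})
    (h_neq0 : ~ {ae lebesgue_rV R N, forall x, h x = 0})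
    (g_cont : continuous g)
    (g_ge0 : forall t : R, 0 <= t -> 0 <= g t)
    (g_neq0 : exists2 t : R, 0 <= t & g t != 0)
    (r_gt0 : 0 < r)
    (h_ball : 0 < \int[lebesgue_rV R N]_(x in eball x0 (r / 2)) h x)
    (G_at0 : primitive g t / t `^ p @[t --> 0^'+] --> (0 : R))
    (G_atoo : primitive g t / t `^ p @[t --> +oo] --> (0 : R))
    (lambda_gt : (lambda_star p a h g x0 r < lambda%:E)%E) :
  exists u1 u2 u3 : 'rV[R]_N -> R,
    [/\ weak_solution p a h g lambda u1,
        weak_solution p a h g lambda u2 &
        weak_solution p a h g lambda u3] /\
    [/\ ~ {ae lebesgue_rV R N, forall x, u1 x = u2 x},
        ~ {ae lebesgue_rV R N, forall x, u1 x = u3 x} &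
        ~ {ae lebesgue_rV R N, forall x, u2 x = u3 x}].
Proof.
have p_gt1 := p_gt1_of_dim N_ge1 ltNp.
have [a_ge a0] := a_minus_bound a_minus_gt0 h_neq0.
have a_le := norm_infty_bound a_Linfty h_neq0.
have aA := a_minus_le_norm a_Linfty a_minus_gt0 h_neq0.
have G_ge0 t : 0 <= t -> 0 <= primitive g t.
  by move=> t0; have := G_pos_ge0 g_ge0 t; rewrite /G_pos max_l.
have [d [d0 lam0 dl]] := threshold_test_height N_ge1 ltNp a_Linfty a_minus_gt0 h_L1 h_neq0
  r_gt0 h_ball G_ge0 lambda_gt.
have ma := Linfty_meas a_Linfty.
have h_itg : itg (lebesgue_rV R N) h by apply/Lfun1_integrable.
have [b [b_meas b_bounds ab]] : exists b : 'rV[R]_N -> R, [/\ measurable_fun setT b,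
    forall x, a_minus a <= b x <= norm_infty a & {ae lebesgue_rV R N, forall x, a x = b x}].
  (* Clamping between the two essential bounds changes [a] on a null set only. *)
  exists (fun x => Num.max (a_minus a) (Num.min (norm_infty a) (a x))); split.
  - by apply: measurable_maxr => //; exact: measurable_minr.
  - by move=> x; rewrite le_max lexx/= ge_max aA ge_min lexx.
  - apply: filterS2 a_ge a_le => x h1 h2.
    by rewrite min_r ?max_r//; exact: le_trans (ler_norm _) h2.
have [k [k_itg k_ge0 hk]] : exists k : 'rV[R]_N -> R, [/\ itg (lebesgue_rV R N) k,
    forall x, 0 <= k x & {ae lebesgue_rV R N, forall x, h x = k x}].
  (* The positive part changes [h] on a null set only, so its integral over the inner ball is the
     same. *)
  exists (fun x => Num.max (h x) 0); split.
  - apply: (itg_le _ (itg_norm h_itg)) => [|x]; first by apply: measurable_maxr => //; exact: itgM h_itg.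
    by have [_|hx] := leP (h x) 0; rewrite ?normr0.
  - by move=> x; rewrite le_max lexx orbT.
  - by apply: filterS h_ge0 => x hx; rewrite max_l.
have mB : measurable (eball x0 (r / 2)) by exact: measurable_eball.
have hkB : \int[lebesgue_rV R N]_(x in eball x0 (r / 2)) h x =
    \int[lebesgue_rV R N]_(x in eball x0 (r / 2)) k x.
  rewrite !(Rintegral_mkcond _ (eball x0 (r / 2))); apply: Int_ae.
  - by apply/(measurable_restrictT _ mB); apply: measurable_funS (itgM h_itg).
  - by apply/(measurable_restrictT _ mB); apply: measurable_funS (itgM k_itg).
  - by apply: filterS hk => x hx; rewrite !patchE hx.
have [e [fe ge]] : exists e : sobolev_space N p_gt1, fn e = tent x0 r d /\ gr e = tent_gradient x0 r d.
  by exists (mk_sobolev p_gt1 (sobolev_tent x0 r_gt0 d0 p_gt1)).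
have De := tent_dirichlet_le b_meas a0 b_bounds r_gt0 d0 fe ge.
have Pe := tent_potential_ge b_meas a0 b_bounds r_gt0 d0 fe ltNp k_itg k_ge0 g_cont g_ge0 G_at0 lam0.
apply: (three_weak_solutions ltNp ma (itgM h_itg) b_meas a0 b_bounds k_itg k_ge0 g_cont g_ge0 lam0
  ab hk G_at0 G_atoo (e := e)).
rewrite /total_energy (sob_norm_powR a0 b_bounds) subr_lt0.
have pV : 0 <= p^-1 by rewrite invr_ge0 ltW// (lt_trans ltr01).
rewrite hkB in dl.
exact: (le_lt_trans (ler_wpM2r pV De) (lt_le_trans dl Pe)).
Qed.
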